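(* There exists $\Theta_0\in(0,+\infty)$ such that: (1) for all $\Theta\in(0,\Theta_0)$ one has $m_\Theta<2\pi\,\widehat{m}_{\Theta/\sqrt{2\pi}}$, and every minimizer $(u_\Theta,v_\Theta)$ of $m_\Theta$ (i.e. $(u_\Theta,v_\Theta)\in V_\Theta$ with $I(u_\Theta,v_\Theta)=m_\Theta$) satisfies $(\partial_y u_\Theta,\partial_y v_\Theta)\neq(0,0)$; (2) for all $\Theta\in(\Theta_0,+\infty)$ one has $m_\Theta=2\pi\,\widehat{m}_{\Theta/\sqrt{2\pi}}$, and every minimizer $(u_\Theta,v_\Theta)$ of $m_\Theta$ satisfies $\partial_y u_\Theta=\partial_y v_\Theta=0$.
   Context: $\mathbb{T}=\mathbb{R}/2\pi\mathbb{Z}$; points of $\mathbb{R}^3\times\mathbb{T}$ are $(x,y)$; $\nabla_x$ is the gradient in $x$, $\nabla_{x,y}$ the full gradient, $\partial_y$ the $y$-derivative. Functions are real-valued, $H^1=H^1(\mathbb{R}^3\times\mathbb{T})$ and $\|\cdot\|_2$ is the $L^2(\mathbb{R}^3\times\mathbb{T})$ norm. For $\Theta>0$ let $S_\Theta=\{u\in H^1:\|u\|_2=\Theta\}$. For $(u,v)\in H^1\times H^1$ set $I(u,v)=\frac12\int_{\mathbb{R}^3\times\mathbb{T}}(|\nabla_{x,y}u|^2+|\nabla_{x,y}v|^2)\,dx\,dy-\frac14\int_{\mathbb{R}^3\times\mathbb{T}}(|u|^4+2|u|^2|v|^2+|v|^4)\,dx\,dy$, $Q(u,v)=\int_{\mathbb{R}^3\times\mathbb{T}}(|\nabla_xu|^2+|\nabla_xv|^2)\,dx\,dy-\frac34\int_{\mathbb{R}^3\times\mathbb{T}}(|u|^4+2|u|^2|v|^2+|v|^4)\,dx\,dy$,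 $V_\Theta=\{(u,v)\in S_\Theta\times S_\Theta: Q(u,v)=0\}$ and $m_\Theta=\inf_{V_\Theta}I$. On $\mathbb{R}^3$: for $(u,v)\in H^1(\mathbb{R}^3)\times H^1(\mathbb{R}^3)$ let $\widehat I(u,v)=\frac12\int_{\mathbb{R}^3}(|\nabla u|^2+|\nabla v|^2)dx-\frac14\int_{\mathbb{R}^3}(|u|^4+2|u|^2|v|^2+|v|^4)dx$ and $\widehat Q(u,v)=\int_{\mathbb{R}^3}(|\nabla u|^2+|\nabla v|^2)dx-\frac34\int_{\mathbb{R}^3}(|u|^4+2|u|^2|v|^2+|v|^4)dx$; for $\rho>0$, $\widehat m_\rho=\inf\{\widehat I(u,v): u,v\in H^1(\mathbb{R}^3),\ \|u\|_{L^2(\mathbb{R}^3)}=\|v\|_{L^2(\mathbb{R}^3)}=\rho,\ \widehat Q(u,v)=0\}$. *)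

(* Defs.v *)
From HB Require Import structures.
From mathcomp Require Import all_boot all_order all_algebra.
From mathcomp Require Import all_classical all_reals all_analysis.
Set Implicit Arguments. Unset Strict Implicit. Unset Printing Implicit Defensive.
Import Order.TTheory GRing.Theory Num.Theory.
Import numFieldNormedType.Exports.
Local Open Scope classical_set_scope.
Local Open Scope ring_scope.

Section Defs.
Variable R : realType.

Definition R3 := ((R * R) * R)%type.
Definition R3R := (R3 * R)%type.

Definition leb3 : set R3 -> \bar R :=
  ((@lebesgue_measure R \x @lebesgue_measure R) \x @lebesgue_measure R)%E.
Definition leb4 : set R3R -> \bar R := (leb3 \x @lebesgue_measure R)%E.

Definition shift3 (i : 'I_3) (t : R) (x : R3) : R3 :=
  let: ((a, b), c) := x in
  if nat_of_ord i == 0%N then ((a + t, b), c)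
  else if nat_of_ord i == 1%N then ((a, b + t), c)
  else ((a, b), c + t).
Definition shift4 (i : 'I_4) (t : R) (p : R3R) : R3R :=
  let: (x, y) := p in
  if (nat_of_ord i < 3)%N then (shift3 (inord i) t x, y) else (x, y + t).

Definition pderiv {T : Type} (sh : R -> T -> T) (phi : T -> R) (p : T) : R :=
  derive1 (fun t => phi (sh t p)) 0.

Definition test_fun {T : topologicalType} n (sh : 'I_n -> R -> T -> T)
  (phi : T -> R) : Prop :=
  continuous phi /\
  (exists K : set T, compact K /\ forall p, ~ K p -> phi p = 0) /\
  forall i, (forall p, derivable (fun t => phi (sh i t p)) 0 1) /\
            continuous (pderiv (sh i) phi).

Definition weak_grad {d} {T : measurableType d} n (mu : set T -> \bar R)
  (test : (T -> R) -> Prop) (sh : 'I_n -> R -> T -> T)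
  (u : T -> R) (g : 'I_n -> T -> R) : Prop :=
  forall i, measurable_fun setT (g i) /\
    forall phi, test phi ->
      (\int[mu]_p (u p * pderiv (sh i) phi p)%:E =
       - \int[mu]_p (g i p * phi p)%:E)%E.

(** Functions on R^3 x T are 2pi-periodic functions on R^3 x R; integrals
    over R^3 x T are integrals over the fundamental domain R^3 x [0, 2pi[. *)
Definition periodic_y (u : R3R -> R) : Prop :=
  forall x y, u (x, y + 2 * pi) = u (x, y).
Definition FD : set R3R := [set p | 0 <= p.2 < 2 * pi].
Definition intT (f : R3R -> R) : \bar R := (\int[leb4]_(p in FD) (f p)%:E)%E.

Definition test4 (phi : R3R -> R) : Prop := @test_fun R3R 4 shift4 phi.

Definition H1T (u : R3R -> R) (g : 'I_4 -> R3R -> R) : Prop :=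
  measurable_fun setT u /\ periodic_y u /\
  (intT (fun p => (u p ^+ 2)%R) < +oo)%E /\
  weak_grad leb4 test4 shift4 u g /\
  forall i, (intT (fun p => (g i p ^+ 2)%R) < +oo)%E.

Definition quartic (a b : R) : R := a ^+ 4 + 2 * a ^+ 2 * b ^+ 2 + b ^+ 4.

Definition I_T (u v : R3R -> R) (gu gv : 'I_4 -> R3R -> R) : \bar R :=
  ((2^-1)%:E * intT (fun p => \sum_(i < 4) (gu i p ^+ 2 + gv i p ^+ 2))%R
   - (4^-1)%:E * intT (fun p => (quartic (u p) (v p))%R))%E.

Definition Q_T (u v : R3R -> R) (gu gv : 'I_4 -> R3R -> R) : \bar R :=
  (intT (fun p => \sum_(i < 4 | (nat_of_ord i < 3)%N) (gu i p ^+ 2 + gv i p ^+ 2))%R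
   - (3 / 4)%:E * intT (fun p => (quartic (u p) (v p))%R))%E.

(** (u,v) in V_Theta (with weak gradients gu gv); ||u||_2 = Theta is
    written as ||u||_2^2 = Theta^2 (Theta > 0). *)
Definition in_V (Th : R) (u v : R3R -> R) (gu gv : 'I_4 -> R3R -> R) : Prop :=
  H1T u gu /\ H1T v gv /\
  intT (fun p => (u p ^+ 2)%R) = (Th ^+ 2)%:E /\
  intT (fun p => (v p ^+ 2)%R) = (Th ^+ 2)%:E /\
  Q_T u v gu gv = 0%E.

Definition m_T (Th : R) : \bar R :=
  ereal_inf [set r | exists u v gu gv, in_V Th u v gu gv /\ r = I_T u v gu gv].

Definition minimizer (Th : R) u v gu gv : Prop :=
  in_V Th u v gu gv /\ I_T u v gu gv = m_T Th.

Definition int3 (f : R3 -> R) : \bar R := (\int[leb3]_p (f p)%:E)%E.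
Definition test3 (phi : R3 -> R) : Prop := @test_fun R3 3 shift3 phi.

Definition H1R3 (u : R3 -> R) (g : 'I_3 -> R3 -> R) : Prop :=
  measurable_fun setT u /\
  (int3 (fun p => (u p ^+ 2)%R) < +oo)%E /\
  weak_grad leb3 test3 shift3 u g /\
  forall i, (int3 (fun p => (g i p ^+ 2)%R) < +oo)%E.

Definition I_R3 (u v : R3 -> R) (gu gv : 'I_3 -> R3 -> R) : \bar R :=
  ((2^-1)%:E * int3 (fun p => \sum_(i < 3) (gu i p ^+ 2 + gv i p ^+ 2))%R
   - (4^-1)%:E * int3 (fun p => (quartic (u p) (v p))%R))%E.

Definition Q_R3 (u v : R3 -> R) (gu gv : 'I_3 -> R3 -> R) : \bar R :=
  (int3 (fun p => \sum_(i < 3) (gu i p ^+ 2 + gv i p ^+ 2))%R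
   - (3 / 4)%:E * int3 (fun p => (quartic (u p) (v p))%R))%E.

Definition mhat (rho : R) : \bar R :=
  ereal_inf [set r | exists u v gu gv,
    H1R3 u gu /\ H1R3 v gv /\
    int3 (fun p => (u p ^+ 2)%R) = (rho ^+ 2)%:E /\
    int3 (fun p => (v p ^+ 2)%R) = (rho ^+ 2)%:E /\
    Q_R3 u v gu gv = 0%E /\ r = I_R3 u v gu gv].

Definition iy : 'I_4 := @Ordinal 4 3 isT.

End Defs.

(* Main.v *)
Require Import Defs.
From HB Require Import structures.
From mathcomp Require Import all_boot all_order all_algebra.
From mathcomp Require Import all_classical all_reals all_analysis.
From mathcomp Require Import measurable_realfun.
From mathcomp Require Import ring lra.
Set Implicit Arguments. Unset Strict Implicit. Unset Printing Implicit Defensive.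
Import Order.TTheory GRing.Theory Num.Theory.
Import numFieldNormedType.Exports.
Local Open Scope classical_set_scope.
Local Open Scope ring_scope.

(** Write A and B for the x- and y-parts of the Dirichlet energy of a pair and N for its quartic
    term. On the constraint N = 4A/3, so I = A/6 + B/2; rescaling u -> s u(s x, y) identifies the
    admissible (A, B) at mass Theta with those at mass 1, and
    6 Theta^2 m_Theta = inf (A + 3 Theta^4 B) over mass 1. The y-independent pairs give the value
    alpha = inf A, which corresponds to the problem on R^3. Hence Theta_0^4 is the supremum of the
    lambda for which some admissible (A, B) has A + 3 lambda B < alpha, and above it a minimizer
    must have B = 0, since otherwise a slightly smaller lambda would give a value below alpha.

    The supremum is positive because pairs concentrated in y make A arbitrarily small. It is finite
    by splitting a pair into its y-average and the fluctuation: the average obeys the sharp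
    Gagliardo-Nirenberg inequality with constant given by alpha, while Gagliardo-Nirenberg on
    R^3 x T (through Loomis-Whitney) and Poincare's inequality in y bound the quartic term of the
    fluctuation by a small multiple of A plus a large multiple of B, so A + 3 lambda B >= alpha for
    large lambda. *)

(** * Measure-preserving maps and product measures *)

(** No minimizer is constructed; only the set of attainable pairs (A, B) at mass one matters, and
    each of them contributes an affine function of lambda. The dilation acts on x alone because the
    circle has a fixed length, so passing from mass 1 to mass Theta divides A by Theta^2 and
    multiplies B by Theta^2: this is the origin of Theta^4.

    The analytic obstacle is that functions are known only through weak derivatives. Rather than
    approximating by smooth functions, the weak identity is tested on products, which gives an
    absolutely continuous representative on almost every coordinate line. Gagliardo-Nirenberg and
    Poincare then become one-dimensional estimates integrated over lines.

    In the comparison with alpha the sharp constant is needed only for the y-average: the cross term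
    linear in the fluctuation has mean zero in y, and every remaining term is controlled by a
    positive power of B, hence absorbed by the penalty. Pairs whose average carries little energy
    escape this argument; for them a crude lower bound on A (1 + B) forces B to be large. *)

Section mpres.
Local Open Scope ereal_scope.
Context (d d' : measure_display) (X : measurableType d) (Y : measurableType d').
Context (R : realType).

Definition mpres (m : {measure set X -> \bar R}) (m' : {measure set Y -> \bar R})
    (phi : X -> Y) :=
  measurable_fun setT phi /\
  forall A, measurable A -> m (phi @^-1` A) = m' A.

Variables (m : {measure set X -> \bar R}) (m' : {measure set Y -> \bar R}).
Variable phi : X -> Y.

Lemma ge0_integral_mpres : mpres m m' phi -> forall f : Y -> \bar R,
  measurable_fun setT f -> (forall y, 0 <= f y) ->
  \int[m']_y f y = \int[m]_x f (phi x).
Proof.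
move=> [mphi mE] f mf f0.
rewrite (eq_measure_integral (pushforward m phi)); last first.
  by move=> A mA _; rewrite /pushforward -mE.
by rewrite ge0_integral_pushforward//= preimage_setT.
Qed.

Lemma integral_mpres : mpres m m' phi -> forall f : Y -> \bar R,
  measurable_fun setT f -> \int[m']_y f y = \int[m]_x f (phi x).
Proof.
move=> H f mf; rewrite integralE [RHS]integralE; congr (_ - _).
  rewrite (ge0_integral_mpres H (measurable_funepos mf) (funepos_ge0 f)).
  by apply: eq_integral => x _; rewrite !funeposE.
rewrite (ge0_integral_mpres H (measurable_funeneg mf) (funeneg_ge0 f)).
by apply: eq_integral => x _; rewrite !funenegE.
Qed.

Lemma ae_mpres : mpres m m' phi -> forall P : Y -> Prop,
  {ae m', forall y, P y} -> {ae m, forall x, P (phi x)}.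
Proof.
move=> [mphi mE] P [N [mN N0 PN]]; exists (phi @^-1` N); split.
- by rewrite -[_ @^-1` _]setTI; exact: mphi.
- by rewrite mE.
- by move=> x /= Px; apply: PN.
Qed.

Lemma integrable_mpres : mpres m m' phi -> forall f : Y -> \bar R,
  m'.-integrable setT f -> m.-integrable setT (f \o phi).
Proof.
move=> H f /integrableP[mf fi]; apply/integrableP; split.
  by apply: measurableT_comp => //; case: H.
rewrite -(ge0_integral_mpres H (f := fun y => `|f y|))//.
exact: measurableT_comp.
Qed.
End mpres.

Lemma mpres_comp (R : realType) (d1 d2 d3 : measure_display)
  (X : measurableType d1) (Y : measurableType d2) (Z : measurableType d3)
  (m1 : {measure set X -> \bar R}) (m2 : {measure set Y -> \bar R})
  (m3 : {measure set Z -> \bar R}) (f : X -> Y) (g : Y -> Z) :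
  mpres m1 m2 f -> mpres m2 m3 g -> mpres m1 m3 (g \o f).
Proof.
move=> [mf fE] [mg gE]; split; first exact: measurableT_comp.
move=> A mA; rewrite comp_preimage fE ?gE//.
by rewrite -[_ @^-1` _]setTI; exact: mg.
Qed.

Section prodm.
Local Open Scope ereal_scope.
Context (R : realType) (d1 d2 : measure_display).
Context (X : measurableType d1) (Y : measurableType d2).
Variables (m1 : {sigma_finite_measure set X -> \bar R}).
Variables (m2 : {sigma_finite_measure set Y -> \bar R}).

Let sigma_finite_prod : sigma_finite setT (m1 \x m2).
Proof.
have /sigma_finiteP[F [TF ndF Foo]] := sigma_finiteT m1.
have /sigma_finiteP[G [TG ndG Goo]] := sigma_finiteT m2.
exists (fun n => F n `*` G n).
  rewrite -setXTT TF TG predeqE => -[x y]; split.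
    move=> [/= [n _ Fnx] [k _ Gky]]; exists (maxn n k) => //; split.
    - by move: x Fnx; exact/subsetPset/ndF/leq_maxl.
    - by move: y Gky; exact/subsetPset/ndG/leq_maxr.
  by move=> [n _ []/= ? ?]; split; exists n.
move=> k; have [? ?] := Foo k; have [? ?] := Goo k.
split; first exact: measurableX.
by rewrite product_measure1E// lte_mul_pinfty// ge0_fin_numE.
Qed.

Definition prodm0 : set (X * Y)%type -> \bar R := m1 \x m2.
HB.instance Definition _ := Measure.on prodm0.
HB.instance Definition _ :=
  Measure_isSigmaFinite.Build _ _ _ prodm0 sigma_finite_prod.

(* The rigid head symbol keeps unification of iterated product measures cheap. *)
Definition prodm : {sigma_finite_measure set (X * Y)%type -> \bar R} := prodm0.

Lemma tonelli1 (f : X * Y -> \bar R) : measurable_fun setT f ->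
  (forall p, 0 <= f p) -> \int[prodm]_p f p = \int[m1]_x \int[m2]_y f (x, y).
Proof. exact: fubini_tonelli1. Qed.

Lemma tonelli2 (f : X * Y -> \bar R) : measurable_fun setT f ->
  (forall p, 0 <= f p) -> \int[prodm]_p f p = \int[m2]_y \int[m1]_x f (x, y).
Proof. exact: fubini_tonelli2. Qed.

Lemma measurable_int1 (f : X * Y -> \bar R) : measurable_fun setT f ->
  (forall p, 0 <= f p) -> measurable_fun setT (fun x => \int[m2]_y f (x, y)).
Proof. exact: measurable_fun_fubini_tonelli_F. Qed.

Lemma measurable_int2 (f : X * Y -> \bar R) : measurable_fun setT f ->
  (forall p, 0 <= f p) -> measurable_fun setT (fun y => \int[m1]_x f (x, y)).
Proof. exact: measurable_fun_fubini_tonelli_G. Qed.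

Lemma fubini1_li (f : X * Y -> \bar R) : prodm.-integrable setT f ->
  \int[prodm]_p f p = \int[m1]_x \int[m2]_y f (x, y).
Proof. by move=> h; rewrite -[LHS](integral12_prod_meas1 h). Qed.

Lemma ae_int1 (f : X * Y -> \bar R) : prodm.-integrable setT f ->
  {ae m1, forall x, m2.-integrable setT (fun y => f (x, y))}.
Proof. exact: ae_integrable1. Qed.

Lemma integrable_int1 (f : X * Y -> \bar R) : prodm.-integrable setT f ->
  m1.-integrable setT (fun x => \int[m2]_y f (x, y)).
Proof. exact: integrable_fubini_F. Qed.

Lemma prodmE (A : set X) (B : set Y) : measurable A -> measurable B ->
  prodm (A `*` B) = m1 A * m2 B.
Proof. exact: product_measure1E. Qed.

(** The exceptional set is measurable and almost all of its sections are null, so its product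
    measure, which is the integral of the measures of the sections, vanishes. *)
Lemma ae_prod_intro (P : X * Y -> Prop) : measurable [set p | P p] ->
  {ae m1, forall x, {ae m2, forall y, P (x, y)}} ->
  {ae prodm, forall p, P p}.
Proof.
move=> mP H; exists (~` [set p | P p]); split => //; first exact: measurableC.
have mC : measurable (~` [set p | P p]) by exact: measurableC.
have : ae_eq m1 setT (m2 \o xsection (~` [set p | P p])) (cst 0).
  move: H; apply: filterS => x [N [mN N0 PN]] _ /=.
  apply/eqP; rewrite eq_le measure_ge0 andbT -N0.
  apply: le_measure; rewrite ?inE//; first exact: measurable_xsection.
  by move=> y; rewrite /xsection /= inE => /PN.
move/ae_eq_integral_abs => /(_ measurableT (measurable_fun_xsection m2 mC)) <-.
by apply: eq_integral => x _; rewrite gee0_abs.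
Qed.
End prodm.

Lemma measure_integral1 (R : realType) (d : measure_display)
  (X : measurableType d) (m : {measure set X -> \bar R}) (A : set X) :
  measurable A -> m A = (\int[m]_x (\1_A x)%:E)%E.
Proof. by move=> mA; rewrite integral_indic// setIT. Qed.

Lemma measurable_funE1 (R : realType) (d : measure_display)
  (X : measurableType d) (A : set X) : measurable A ->
  measurable_fun setT (fun x => (\1_A x : R)%:E).
Proof. by move=> mA; apply/measurable_EFinP; exact: measurable_indic. Qed.

Lemma mpres_ge0 (R : realType) (d d' : measure_display)
  (X : measurableType d) (Y : measurableType d')
  (m : {measure set X -> \bar R}) (m' : {measure set Y -> \bar R}) (phi : X -> Y) :
  measurable_fun setT phi ->
  (forall f : Y -> \bar R, measurable_fun setT f -> (forall y, 0 <= f y)%E ->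
     (\int[m]_x f (phi x) = \int[m']_y f y)%E) -> mpres m m' phi.
Proof.
move=> mphi H; split => // A mA.
have mA' : measurable (phi @^-1` A) by rewrite -[_ @^-1` _]setTI; exact: mphi.
by rewrite !measure_integral1// -H//; exact: measurable_funE1.
Qed.

Section mpres_prod.
Local Open Scope ereal_scope.
Context (R : realType) (d1 d2 d3 : measure_display).
Context (X : measurableType d1) (Y : measurableType d2) (Z : measurableType d3).
Variables (m1 : {sigma_finite_measure set X -> \bar R}).
Variables (m2 : {sigma_finite_measure set Y -> \bar R}).
Variables (m3 : {sigma_finite_measure set Z -> \bar R}).

Lemma mpres_swap : mpres (prodm m1 m2) (prodm m2 m1) (fun p => (p.2, p.1)).
Proof.
have mg : measurable_fun setT (fun p : X * Y => (p.2, p.1)).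
  exact: measurable_fun_pair.
apply: mpres_ge0 => // f mf f0.
by rewrite tonelli2//; [rewrite tonelli1|exact: measurableT_comp mf mg].
Qed.

Lemma mpres_map1 (f : X -> Y) : mpres m1 m2 f ->
  mpres (prodm m1 m3) (prodm m2 m3) (fun p => (f p.1, p.2)).
Proof.
move=> Hf; have [mf _] := Hf.
have mg : measurable_fun setT (fun p : X * Z => (f p.1, p.2)).
  by apply: measurable_fun_pair => //; exact: measurableT_comp.
apply: mpres_ge0 => // g mg' g0.
rewrite tonelli2//; last exact: measurableT_comp mg' mg.
rewrite tonelli2//; apply: eq_integral => z _.
rewrite (ge0_integral_mpres Hf (f := fun y => g (y, z)))//.
by apply: measurableT_comp => //; exact: measurable_fun_pair.
Qed.

Lemma mpres_map2 (f : X -> Y) : mpres m1 m2 f ->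
  mpres (prodm m3 m1) (prodm m3 m2) (fun p => (p.1, f p.2)).
Proof.
move=> Hf; have [mf _] := Hf.
have mg : measurable_fun setT (fun p : Z * X => (p.1, f p.2)).
  by apply: measurable_fun_pair => //; exact: measurableT_comp.
apply: mpres_ge0 => // g mg' g0.
rewrite tonelli1//; last exact: measurableT_comp mg' mg.
rewrite tonelli1//; apply: eq_integral => z _.
rewrite (ge0_integral_mpres Hf (f := fun y => g (z, y)))//.
by apply: measurableT_comp => //; exact: measurable_fun_pair.
Qed.

(** Together with [mpres_swap] and the maps on single factors, this exchange generates all the
    permutations of coordinates used to bring a given direction to the last place. *)
Lemma mpres_swap23 : mpres (prodm (prodm m1 m2) m3) (prodm (prodm m1 m3) m2)
  (fun p => ((p.1.1, p.2), p.1.2)).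
Proof.
have mg : measurable_fun setT (fun p : X * Y * Z => ((p.1.1, p.2), p.1.2)).
  apply: measurable_fun_pair; last exact: measurableT_comp.
  by apply: measurable_fun_pair => //; exact: measurableT_comp.
apply: mpres_ge0 => // f mf f0.
have mfg := measurableT_comp mf mg.
rewrite tonelli1// [RHS]tonelli1//.
have m12 := measurable_int1 m3 mfg (fun p => f0 _).
have m13 := measurable_int1 m2 mf f0.
rewrite tonelli1//; last by move=> p; exact: integral_ge0.
rewrite tonelli1//; last by move=> p; exact: integral_ge0.
apply: eq_integral => x _ /=.
have mf' : measurable_fun setT (fun q : Y * Z => f ((x, q.2), q.1)).
  apply: measurableT_comp => //; apply: measurable_fun_pair => //.
  exact: measurable_fun_pair.
by rewrite -(tonelli1 m2 m3 mf')// -(tonelli2 m2 m3 mf').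
Qed.
End mpres_prod.

Section eq_integral_fun.
Local Open Scope ereal_scope.
Context (d : measure_display) (T : measurableType d) (R : realType).
Import HBNNSimple.

(** An integral is a supremum over simple functions and evaluates its set function on measurable
    sets only. This moves integrals from [leb3] and [leb4], which are bare set functions, to genuine
    measures. *)
Lemma eq_setfun_integral (m1 m2 : set T -> \bar R) (D : set T) (f : T -> \bar R) :
  (forall A, measurable A -> m1 A = m2 A) ->
  \int[m1]_(x in D) f x = \int[m2]_(x in D) f x.
Proof.
move=> m12; rewrite /integral; congr (_ - _); congr ereal_sup;
  apply/seteqP; split=> _ [h hf <-]; exists h => //;
  by apply: eq_fsbigr => r _; rewrite m12.
Qed.
End eq_integral_fun.

(** * Lebesgue measure on R^3 and R^4 *)

Section lebesgue_measures.
Variable R : realType.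

Definition lebR : set R -> \bar R := @lebesgue_measure R.

Let lebR0 : lebR set0 = 0%E.
Proof. exact: (measure0 (@lebesgue_measure R)). Qed.

Let lebR_ge0 A : (0 <= lebR A)%E.
Proof. exact: (measure_ge0 (@lebesgue_measure R)). Qed.

Let lebR_sadd : semi_sigma_additive lebR.
Proof.
by move=> F mF tF mUF; apply: (@measure_semi_sigma_additive _ _ _ (@lebesgue_measure R)).
Qed.

HB.instance Definition _ := isMeasure.Build _ _ _ lebR lebR0 lebR_ge0 lebR_sadd.

Let lebR_sf : sigma_finite setT lebR.
Proof. exact: (sigma_finiteT (@lebesgue_measure R)). Qed.

HB.instance Definition _ := Measure_isSigmaFinite.Build _ _ _ lebR lebR_sf.

(* [lebesgue_measure] lives on a copy of [R] with its own measurable structure;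
   [L1] .. [L4] are the Lebesgue measures for the canonical structures. *)
Definition L1 : {sigma_finite_measure set R -> \bar R} := lebR.
Definition L2 := prodm L1 L1.
Definition L3 : {sigma_finite_measure set (R3 R) -> \bar R} := prodm L2 L1.
Definition L4 : {sigma_finite_measure set (R3R R) -> \bar R} := prodm L3 L1.

Let K1 : {sigma_finite_measure set (measurableTypeR R) -> \bar R} :=
  @lebesgue_measure R.
Let K2 := prodm K1 K1.
Let K3 := prodm K2 K1.

Lemma mpres_leb : mpres K1 L1 (@idfun R).
Proof. by split => // _ A mA; rewrite setTI. Qed.

Lemma mpres_leb2 : mpres K2 L2 (@idfun (R * R)).
Proof.
have := mpres_comp (mpres_map1 K1 mpres_leb) (mpres_map2 L1 mpres_leb).
by congr mpres; apply/funext => -[].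
Qed.

Lemma mpres_leb3 : mpres K3 L3 (@idfun (R * R * R)).
Proof.
have := mpres_comp (mpres_map1 K1 mpres_leb2) (mpres_map2 L2 mpres_leb).
by congr mpres; apply/funext => -[].
Qed.

Lemma leb3E (A : set (R3 R)) : measurable A -> leb3 A = L3 A.
Proof. by move=> mA; rewrite -(mpres_leb3.2 _ mA). Qed.

Lemma leb4E (A : set (R3R R)) : measurable A -> leb4 A = L4 A.
Proof.
move=> mA; rewrite /leb4 /product_measure1.
transitivity (\int[L3]_x (L1 \o xsection A) x)%E => //.
by apply: eq_setfun_integral => B mB; exact: leb3E.
Qed.

Lemma int3E (D : set (R3 R)) (f : R3 R -> \bar R) :
  (\int[@leb3 R]_(x in D) f x = \int[L3]_(x in D) f x)%E.
Proof. by apply: eq_setfun_integral => A mA; exact: leb3E. Qed.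

Lemma int4E (D : set (R3R R)) (f : R3R R -> \bar R) :
  (\int[@leb4 R]_(x in D) f x = \int[L4]_(x in D) f x)%E.
Proof. by apply: eq_setfun_integral => A mA; exact: leb4E. Qed.

Lemma ae4E (P : R3R R -> Prop) :
  {ae (@leb4 R), forall p, P p} <-> {ae L4, forall p, P p}.
Proof.
split=> -[N [mN N0 PN]]; exists N; split => //.
  by rewrite -leb4E.
by rewrite leb4E.
Qed.

Lemma ae1E (P : R -> Prop) :
  {ae (@lebesgue_measure R), forall p, P p} <-> {ae L1, forall p, P p}.
Proof. by split=> -[N [mN N0 PN]]; exists N; split. Qed.

Lemma L1_itv (a b : R) (x y : bool) : a <= b ->
  L1 [set` Interval (BSide x a) (BSide y b)] = (b - a)%:E.
Proof.
move=> ab; transitivity (@lebesgue_measure R [set` Interval (BSide x a) (BSide y b)]) => //.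
rewrite lebesgue_measure_itv/= lte_fin.
by move: ab; rewrite le_eqVlt => /orP[/eqP ->|->//]; rewrite ltxx subrr.
Qed.

Lemma L1_set1 (a : R) : L1 [set a] = 0%E.
Proof. exact: (lebesgue_measure_set1 a). Qed.

(** Uniqueness of Lebesgue measure: the right-hand side is a measure in [A] that has the correct
    value on half-open intervals. *)
Lemma L1_affine (t s : R) (A : set R) : 0 < t -> measurable A ->
  (L1 A = t%:E * L1 ((fun x => t * x + s)%R @^-1` A))%E.
Proof.
move=> t0 mA.
have mphi : measurable_fun setT (fun x : measurableTypeR R => (t * x + s : measurableTypeR R)).
  by apply: measurable_funD => //; apply: measurable_funM.
pose pm := measure_function_pushforward__canonical__measure_function_Measure K1 mphi.
pose m : {measure set (measurableTypeR R) -> \bar R} := mscale (NngNum (ltW t0)) pm.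
suff : @lebesgue_measure R A = m A by [].
apply: (lebesgue_measure_unique (mu := m)) => // X; rewrite ocitvP => -[->|[[a b] /= ab ->]].
  by rewrite !measure0.
rewrite /m /= /mscale /= /pushforward.
have -> : (fun x : measurableTypeR R => (t * x + s : measurableTypeR R)) @^-1` `]a, b] = `](a - s) / t, (b - s) / t]%classic.
  apply/seteqP; split=> x /=; rewrite !in_itv/= ltr_pdivrMr// ler_pdivlMr//.
    by rewrite mulrC => /andP[h1 h2]; apply/andP; split; lra.
  by rewrite mulrC => /andP[h1 h2]; apply/andP; split; lra.
rewrite !lebesgue_measure_itv/= !lte_fin ab ltr_pM2r ?invr_gt0//.
rewrite ltrD2r ab -EFinM; congr EFin.
by rewrite -mulrBl mulrCA mulfV ?gt_eqF// mulr1; ring.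
Qed.

Lemma ge0_int_affine (t s : R) (f : R -> \bar R) : 0 < t ->
  measurable_fun setT f -> (forall x, 0 <= f x)%E ->
  (\int[L1]_x f (t * x + s)%R = (t^-1)%:E * \int[L1]_x f x)%E.
Proof.
move=> t0 mf f0.
have mphi : measurable_fun setT (fun x : R => t * x + s).
  by apply: measurable_funD => //; apply: measurable_funM.
have tn : (0 <= t^-1)%R by rewrite invr_ge0 ltW.
pose m : {measure set R -> \bar R} := mscale (NngNum tn) L1.
rewrite -(ge0_integral_mscale _ _ (NngNum tn))//.
rewrite [RHS](@ge0_integral_mpres _ _ _ _ _ L1 m (fun x => t * x + s))//.
split => // A mA.
change (L1 ((fun x : R => (t * x + s)%R) @^-1` A) = (t^-1)%:E * L1 A)%E.
by rewrite [in RHS](@L1_affine t s)// muleA -EFinM mulVf ?gt_eqF// mul1e.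
Qed.
End lebesgue_measures.

(** * Loomis-Whitney and Cauchy-Schwarz inequalities *)

Section hoelder3.
Local Open Scope ereal_scope.
Context (R : realType).

(** The exponent 1/3 is that of the Loomis-Whitney inequality in dimension four. Infinite values are
    kept because the line integrals to which it is applied may be infinite. *)
Definition cbrt (x : \bar R) : \bar R := x `^ (3^-1).

Lemma cbrt_ge0 x : 0 <= cbrt x. Proof. exact: poweR_ge0. Qed.

Lemma cbrt_fin (x : R) : (0 <= x)%R ->
  cbrt x%:E = (x `^ (3^-1))%:E /\ ((x `^ (3^-1)) ^+ 3 = x)%R.
Proof.
move=> x0; split; first by rewrite /cbrt poweR_EFin.
by rewrite -powR_mulrn ?powR_ge0// -powRrM mulVf// powRr1.
Qed.

Lemma cbrt_y : cbrt +oo = +oo.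
Proof. by rewrite /cbrt poweRyr// invr_eq0. Qed.

Lemma cbrt0 : cbrt 0 = 0.
Proof. by rewrite /cbrt poweR0r// invr_eq0. Qed.

Lemma amgm3 (x y z : R) : (0 <= x -> 0 <= y -> 0 <= z ->
  x * y * z <= (x ^+ 3 + y ^+ 3 + z ^+ 3) / 3)%R.
Proof.
move=> x0 y0 z0.
have H : (0 <= (x + y + z) * ((x - y) ^+ 2 + (y - z) ^+ 2 + (x - z) ^+ 2))%R.
  by rewrite mulr_ge0 ?addr_ge0 ?sqr_ge0.
rewrite ler_pdivlMr//.
have -> : (x * y * z * 3 = x ^+ 3 + y ^+ 3 + z ^+ 3 -
  (x + y + z) * ((x - y) ^+ 2 + (y - z) ^+ 2 + (x - z) ^+ 2) / 2)%R by field.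
by rewrite gerBl divr_ge0.
Qed.

(** The arithmetic-geometric mean inequality after each factor is normalised by a positive number.
    In [hoelder3] these numbers are the three integrals. *)
Lemma cbrt_amgm (a b c A B C : \bar R) (A' B' C' : R) :
  0 <= a -> 0 <= b -> 0 <= c -> (0 < A')%R -> (0 < B')%R -> (0 < C')%R ->
  A = A'%:E -> B = B'%:E -> C = C'%:E ->
  cbrt a * cbrt b * cbrt c <= (cbrt A * cbrt B * cbrt C) *
    (((A'^-1 / 3)%R)%:E * a + (((B'^-1 / 3)%R)%:E * b + ((C'^-1 / 3)%R)%:E * c)).
Proof.
move=> a0 b0 c0 A0 B0 C0 -> -> ->.
have [-> A3] := cbrt_fin (ltW A0).
have [-> B3] := cbrt_fin (ltW B0).
have [-> C3] := cbrt_fin (ltW C0).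
set p := (A' `^ _)%R in A3 *; set q := (B' `^ _)%R in B3 *.
set s := (C' `^ _)%R in C3 *.
have p0 : (0 < p)%R by rewrite powR_gt0.
have q0 : (0 < q)%R by rewrite powR_gt0.
have s0 : (0 < s)%R by rewrite powR_gt0.
have gt0 D : (0 < D -> 0 < D^-1 / 3 :> R)%R by move=> D0; rewrite divr_gt0 ?invr_gt0.
have K0 : 0 < p%:E * q%:E * s%:E by rewrite -!EFinM lte_fin !mulr_gt0.
have top X Y : 0 <= Y -> X = +oo -> p%:E * q%:E * s%:E * (X + Y) = +oo.
  move=> Y0 ->; rewrite addye; last by rewrite gt_eqF// (lt_le_trans _ Y0).
  by rewrite gt0_muley.
have nn D (z : \bar R) : (0 < D)%R -> 0 <= z -> 0 <= (D^-1 / 3)%:E * z.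
  by move=> D0 z0; rewrite mule_ge0// lee_fin ltW// gt0.
case: a a0 => [a a0| _|//]; last first.
  by rewrite top ?leey ?adde_ge0 ?nn// gt0_muley// lte_fin gt0.
case: b b0 => [b b0| _|//]; last first.
  by rewrite addeCA top ?leey ?adde_ge0 ?nn// gt0_muley// lte_fin gt0.
case: c c0 => [c c0| _|//]; last first.
  rewrite addeA addeC top ?leey ?adde_ge0 ?nn// gt0_muley// lte_fin gt0//.
rewrite !lee_fin in a0 b0 c0.
have [-> a3] := cbrt_fin a0; have [-> b3] := cbrt_fin b0; have [-> c3] := cbrt_fin c0.
set x := (a `^ _)%R in a3 *; set y := (b `^ _)%R in b3 *; set z := (c `^ _)%R in c3 *.
rewrite -[leLHS]/((x * y * z)%:E) -[leRHS]/((p * q * s *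
  (A'^-1 / 3 * a + (B'^-1 / 3 * b + C'^-1 / 3 * c)))%R%:E) lee_fin.
have := @amgm3 (x / p) (y / q) (z / s).
move=> /(_ (divr_ge0 (powR_ge0 _ _) (ltW p0)) (divr_ge0 (powR_ge0 _ _) (ltW q0))
  (divr_ge0 (powR_ge0 _ _) (ltW s0))).
rewrite !expr_div_n a3 b3 c3 A3 B3 C3 => H.
have -> : (x * y * z = p * q * s * (x / p * (y / q) * (z / s)))%R.
  by field; rewrite !gt_eqF.
rewrite ler_pM2l ?mulr_gt0//; apply: le_trans H _.
by rewrite le_eqVlt; apply/orP; left; apply/eqP; field; rewrite !gt_eqF.
Qed.

Context (d : measure_display) (T : measurableType d).
Variable m : {measure set T -> \bar R}.

Lemma measurable_cbrt (f : T -> \bar R) : measurable_fun setT f ->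
  measurable_fun setT (cbrt \o f).
Proof. by move=> mf; apply: measurableT_comp => //; exact: measurable_poweR. Qed.

(** When the three integrals are positive and finite, integrate [cbrt_amgm] normalised by them. A
    zero integral makes the left-hand side vanish; these cases are settled first, so that an
    infinite integral then meets only positive factors and makes the right-hand side infinite. *)
Lemma hoelder3 (a b c : T -> \bar R) :
  measurable_fun setT a -> measurable_fun setT b -> measurable_fun setT c ->
  (forall x, 0 <= a x) -> (forall x, 0 <= b x) -> (forall x, 0 <= c x) ->
  \int[m]_x (cbrt (a x) * cbrt (b x) * cbrt (c x)) <=
    cbrt (\int[m]_x a x) * cbrt (\int[m]_x b x) * cbrt (\int[m]_x c x).
Proof.
move=> ma mb mc a0 b0 c0.
have mr (f : T -> \bar R) : measurable_fun setT f -> measurable_fun setT (fun x => cbrt (f x)).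
  exact: measurable_cbrt.
have mabc : measurable_fun setT (fun x => cbrt (a x) * cbrt (b x) * cbrt (c x)).
  by apply: emeasurable_funM; [apply: emeasurable_funM|]; exact: mr.
have abc0 x : 0 <= cbrt (a x) * cbrt (b x) * cbrt (c x).
  by rewrite !mule_ge0 ?cbrt_ge0.
have zero (f : T -> \bar R) : measurable_fun setT f -> (forall x, 0 <= f x) ->
    \int[m]_x f x = 0 ->
    (forall x, f x = 0 -> cbrt (a x) * cbrt (b x) * cbrt (c x) = 0) ->
    \int[m]_x (cbrt (a x) * cbrt (b x) * cbrt (c x)) = 0.
  move=> mf f0 If0 H; rewrite (@ae_eq_integral _ _ _ m setT (cst 0))//.
    by rewrite integral0.
  have : ae_eq m setT f (cst 0).
    apply/ae_eq_integral_abs => //; rewrite -If0.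
    by apply: eq_integral => x _; rewrite gee0_abs.
  by apply: filterS => x /= h _; rewrite H// h.
have Ia0 : 0 <= \int[m]_x a x by exact: integral_ge0.
have Ib0 : 0 <= \int[m]_x b x by exact: integral_ge0.
have Ic0 : 0 <= \int[m]_x c x by exact: integral_ge0.
have [Ia|Ia] := eqVneq (\int[m]_x a x) 0.
  rewrite (zero a)// => [|x ->]; last by rewrite cbrt0 !mul0e.
  by rewrite !mule_ge0 ?cbrt_ge0.
have [Ib|Ib] := eqVneq (\int[m]_x b x) 0.
  rewrite (zero b)// => [|x ->]; last by rewrite cbrt0 mule0 mul0e.
  by rewrite !mule_ge0 ?cbrt_ge0.
have [Ic|Ic] := eqVneq (\int[m]_x c x) 0.
  rewrite (zero c)// => [|x ->]; last by rewrite cbrt0 mule0.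
  by rewrite !mule_ge0 ?cbrt_ge0.
have rpos x : 0 <= x -> x != 0 -> 0 < cbrt x.
  by move=> x0 xn; rewrite poweR_gt0// lt0e xn.
have pa := rpos _ Ia0 Ia; have pb := rpos _ Ib0 Ib; have pc := rpos _ Ic0 Ic.
have [fa|ia] := ltP (\int[m]_x a x) +oo; last first.
  move: ia; rewrite leye_eq => /eqP ->.
  by rewrite cbrt_y gt0_mulye// gt0_mulye// leey.
have [fb|ib] := ltP (\int[m]_x b x) +oo; last first.
  move: ib; rewrite leye_eq => /eqP ->.
  by rewrite cbrt_y gt0_muley// gt0_mulye// leey.
have [fc|ic] := ltP (\int[m]_x c x) +oo; last first.
  move: ic; rewrite leye_eq => /eqP ->.
  by rewrite cbrt_y gt0_muley ?leey// mule_gt0.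
have fin (x : \bar R) : 0 <= x -> x < +oo -> x != 0 -> exists2 A', (0 < A')%R & x = A'%:E.
  move=> x0 xoo xn; exists (fine x); first by rewrite fine_gt0// lt0e xn x0.
  by rewrite fineK// ge0_fin_numE.
have [A' A0 AE] := fin _ Ia0 fa Ia.
have [B' B0 BE] := fin _ Ib0 fb Ib.
have [C' C0 CE] := fin _ Ic0 fc Ic.
set K := (X in _ <= X).
have K0 : 0 <= K by rewrite /K !mule_ge0 ?cbrt_ge0.
have q0 D : (0 < D -> 0 <= D^-1 / 3 :> R)%R by move=> D0; rewrite divr_ge0 ?invr_ge0 ?ltW.
(* The integral of [F] is one: each of the three normalised terms contributes 1/3. *)
pose F x := ((A'^-1 / 3)%R)%:E * a x + (((B'^-1 / 3)%R)%:E * b x + ((C'^-1 / 3)%R)%:E * c x).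
have mF1 D (f : T -> \bar R) : measurable_fun setT f ->
  measurable_fun setT (fun x => ((D^-1 / 3)%R)%:E * f x).
  by move=> mf; apply: emeasurable_funM.
have F10 D (f : T -> \bar R) x : (0 < D)%R -> (forall x, 0 <= f x) ->
  0 <= ((D^-1 / 3)%R)%:E * f x by move=> D0 f0; rewrite mule_ge0// lee_fin q0.
have mF : measurable_fun setT F.
  by apply: emeasurable_funD; [|apply: emeasurable_funD]; exact: mF1.
have F0 x : 0 <= F x by rewrite /F !adde_ge0 ?F10.
apply: (@le_trans _ _ (\int[m]_x (K * F x))).
  apply: ge0_le_integral => //.
  - exact: emeasurable_funM.
  - by move=> x _; exact: (@cbrt_amgm _ _ _ _ _ _ A' B' C').
rewrite ge0_integralZl//.
suff -> : \int[m]_x F x = 1 by rewrite mule1.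
rewrite /F ge0_integralD//; last 4 first.
  by move=> x _; exact: F10.
  exact: mF1.
  by move=> x _; rewrite adde_ge0 ?F10.
  by apply: emeasurable_funD; exact: mF1.
rewrite ge0_integralD//; last 4 first.
  by move=> x _; exact: F10.
  exact: mF1.
  by move=> x _; exact: F10.
  exact: mF1.
rewrite !ge0_integralZl//; try by rewrite lee_fin q0.
rewrite AE BE CE -!EFinM -!EFinD; congr EFin.
by field; rewrite !gt_eqF.
Qed.
End hoelder3.

Section loomis_whitney.
Let mule_rot (R : realType) (x y z w : \bar R) : (x * y * z * w = w * x * y * z)%E.
Proof. by rewrite muleC !muleA. Qed.

Let mule_rot_le (R : realType) (x y z w : \bar R) : (x * y * z * w <= w * x * y * z)%E.
Proof. by rewrite mule_rot. Qed.

Let mule_rot_le2 (R : realType) (x y z w : \bar R) : (x * y * z * w <= w * z * x * y)%E.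
Proof. by rewrite mule_rot -!muleA; rewrite [(z * _)%E]muleC !muleA. Qed.

Local Open Scope ereal_scope.
Context (R : realType) (d1 d2 d3 d4 : measure_display).
Context (T1 : measurableType d1) (T2 : measurableType d2).
Context (T3 : measurableType d3) (T4 : measurableType d4).
Variables (m1 : {sigma_finite_measure set T1 -> \bar R}).
Variables (m2 : {sigma_finite_measure set T2 -> \bar R}).
Variables (m3 : {sigma_finite_measure set T3 -> \bar R}).
Variables (m4 : {sigma_finite_measure set T4 -> \bar R}).
Variables (f1 : T2 * T3 * T4 -> \bar R) (f2 : T1 * T3 * T4 -> \bar R).
Variables (f3 : T1 * T2 * T4 -> \bar R) (f4 : T1 * T2 * T3 -> \bar R).
Hypotheses (mf1 : measurable_fun setT f1) (mf2 : measurable_fun setT f2).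
Hypotheses (mf3 : measurable_fun setT f3) (mf4 : measurable_fun setT f4).
Hypotheses (f10 : forall p, 0 <= f1 p) (f20 : forall p, 0 <= f2 p).
Hypotheses (f30 : forall p, 0 <= f3 p) (f40 : forall p, 0 <= f4 p).

(** The variables are integrated one at a time, the last one first. At each stage exactly one of the
    four factors does not depend on the current variable and comes out of the integral, while the
    other three are handled by [hoelder3]. *)
Lemma loomis_whitney :
  \int[prodm (prodm (prodm m1 m2) m3) m4]_p
    (cbrt (f1 ((p.1.1.2, p.1.2), p.2)) * cbrt (f2 ((p.1.1.1, p.1.2), p.2)) *
     cbrt (f3 (p.1.1, p.2)) * cbrt (f4 p.1)) <=
  cbrt (\int[prodm (prodm m2 m3) m4]_q f1 q) *
  cbrt (\int[prodm (prodm m1 m3) m4]_q f2 q) *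
  cbrt (\int[prodm (prodm m1 m2) m4]_q f3 q) *
  cbrt (\int[prodm (prodm m1 m2) m3]_q f4 q).
Proof.
have mp1 : measurable_fun setT (fun p : T1 * T2 * T3 * T4 => ((p.1.1.2, p.1.2), p.2)).
  apply: measurable_fun_pair => //; apply: measurable_fun_pair.
    exact: (measurableT_comp measurable_snd (measurableT_comp measurable_fst measurable_fst)).
  exact: (measurableT_comp measurable_snd measurable_fst).
have mp2 : measurable_fun setT (fun p : T1 * T2 * T3 * T4 => ((p.1.1.1, p.1.2), p.2)).
  apply: measurable_fun_pair => //; apply: measurable_fun_pair.
    exact: (measurableT_comp measurable_fst (measurableT_comp measurable_fst measurable_fst)).
  exact: (measurableT_comp measurable_snd measurable_fst).
have mp3 : measurable_fun setT (fun p : T1 * T2 * T3 * T4 => (p.1.1, p.2)).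
  apply: measurable_fun_pair => //.
  exact: (measurableT_comp measurable_fst measurable_fst).
have mF : measurable_fun setT (fun p : T1 * T2 * T3 * T4 =>
    cbrt (f1 ((p.1.1.2, p.1.2), p.2)) * cbrt (f2 ((p.1.1.1, p.1.2), p.2)) *
     cbrt (f3 (p.1.1, p.2)) * cbrt (f4 p.1)).
  apply: emeasurable_funM; [apply: emeasurable_funM; [apply: emeasurable_funM|]|].
  - exact: (measurable_cbrt (measurableT_comp mf1 mp1)).
  - exact: (measurable_cbrt (measurableT_comp mf2 mp2)).
  - exact: (measurable_cbrt (measurableT_comp mf3 mp3)).
  - exact: (measurable_cbrt (measurableT_comp mf4 measurable_fst)).
rewrite tonelli1//; last by move=> p; rewrite !mule_ge0 ?cbrt_ge0.
pose F1 q := \int[m4]_y f1 (q, y).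
pose F2 q := \int[m4]_y f2 (q, y).
pose F3 q := \int[m4]_y f3 (q, y).
have mF1 : measurable_fun setT F1 by exact: measurable_int1.
have mF2 : measurable_fun setT F2 by exact: measurable_int1.
have mF3 : measurable_fun setT F3 by exact: measurable_int1.
have F10 q : 0 <= F1 q by exact: integral_ge0.
have F20 q : 0 <= F2 q by exact: integral_ge0.
have F30 q : 0 <= F3 q by exact: integral_ge0.
have mq1 : measurable_fun setT (fun p : T1 * T2 * T3 => (p.1.2, p.2)).
  apply: measurable_fun_pair => //; exact: (measurableT_comp measurable_snd measurable_fst).
have mq2 : measurable_fun setT (fun p : T1 * T2 * T3 => (p.1.1, p.2)).
  apply: measurable_fun_pair => //; exact: (measurableT_comp measurable_fst measurable_fst).
have m1F : measurable_fun setT (fun p : T1 * T2 * T3 =>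
    cbrt (F1 (p.1.2, p.2)) * cbrt (F2 (p.1.1, p.2)) * cbrt (f4 p) * cbrt (F3 p.1)).
  apply: emeasurable_funM; [apply: emeasurable_funM; [apply: emeasurable_funM|]|].
  - exact: (measurable_cbrt (measurableT_comp mF1 mq1)).
  - exact: (measurable_cbrt (measurableT_comp mF2 mq2)).
  - exact: (measurable_cbrt mf4).
  - exact: (measurable_cbrt (measurableT_comp mF3 measurable_fst)).
apply: (@le_trans _ _ (\int[prodm (prodm m1 m2) m3]_p
    (cbrt (F1 (p.1.2, p.2)) * cbrt (F2 (p.1.1, p.2)) * cbrt (f4 p) * cbrt (F3 p.1)))).
  apply: ge0_le_integral => //.
  - by move=> p _; apply: integral_ge0 => y _; rewrite !mule_ge0 ?cbrt_ge0.
  - by apply: (measurable_int1 m4 mF) => p; rewrite !mule_ge0 ?cbrt_ge0.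
  - move=> [[a b] c] _ /=.
    have m1' : measurable_fun setT (fun y => f1 (b, c, y)) by apply: measurableT_comp.
    have m2' : measurable_fun setT (fun y => f2 (a, c, y)) by apply: measurableT_comp.
    have m3' : measurable_fun setT (fun y => f3 (a, b, y)) by apply: measurableT_comp.
    rewrite ge0_integralZr ?cbrt_ge0//; last 2 first.
      by apply: emeasurable_funM; [apply: emeasurable_funM|]; exact: measurable_cbrt.
      by move=> y _; rewrite !mule_ge0 ?cbrt_ge0.
    apply: (@le_trans _ _ (cbrt (F1 (b, c)) * cbrt (F2 (a, c)) * cbrt (F3 (a, b)) * cbrt (f4 (a, b, c)))).
      by apply: lee_wpmul2r; [exact: cbrt_ge0|exact: hoelder3].
    by rewrite muleAC.
rewrite tonelli1//; last by move=> p; rewrite !mule_ge0 ?cbrt_ge0.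
pose G1 b := \int[m3]_c F1 (b, c).
pose G2 a := \int[m3]_c F2 (a, c).
pose G4 q := \int[m3]_c f4 (q, c).
have mG1 : measurable_fun setT G1 by exact: measurable_int1.
have mG2 : measurable_fun setT G2 by exact: measurable_int1.
have mG4 : measurable_fun setT G4 by exact: measurable_int1.
have G10 q : 0 <= G1 q by exact: integral_ge0.
have G20 q : 0 <= G2 q by exact: integral_ge0.
have G40 q : 0 <= G4 q by exact: integral_ge0.
have m2F : measurable_fun setT (fun p : T1 * T2 =>
    cbrt (F3 p) * cbrt (G4 p) * cbrt (G1 p.2) * cbrt (G2 p.1)).
  apply: emeasurable_funM; [apply: emeasurable_funM; [apply: emeasurable_funM|]|].
  - exact: (measurable_cbrt mF3).
  - exact: (measurable_cbrt mG4).
  - exact: (measurable_cbrt (measurableT_comp mG1 measurable_snd)).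
  - exact: (measurable_cbrt (measurableT_comp mG2 measurable_fst)).
apply: (@le_trans _ _ (\int[prodm m1 m2]_p
    (cbrt (F3 p) * cbrt (G4 p) * cbrt (G1 p.2) * cbrt (G2 p.1)))).
  apply: ge0_le_integral => //.
  - by move=> p _; apply: integral_ge0 => y _; rewrite !mule_ge0 ?cbrt_ge0.
  - by apply: (measurable_int1 m3 m1F) => p; rewrite !mule_ge0 ?cbrt_ge0.
  - move=> [a b] _ /=.
    have m1' : measurable_fun setT (fun y => F1 (b, y)) by apply: measurableT_comp.
    have m2' : measurable_fun setT (fun y => F2 (a, y)) by apply: measurableT_comp.
    have m3' : measurable_fun setT (fun y => f4 (a, b, y)) by apply: measurableT_comp.
    rewrite ge0_integralZr ?cbrt_ge0//; last 2 first.
      by apply: emeasurable_funM; [apply: emeasurable_funM|]; exact: measurable_cbrt.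
      by move=> y _; rewrite !mule_ge0 ?cbrt_ge0.
    apply: (@le_trans _ _ (cbrt (G1 b) * cbrt (G2 a) * cbrt (G4 (a, b)) * cbrt (F3 (a, b)))).
      by apply: lee_wpmul2r; [exact: cbrt_ge0|exact: hoelder3].
    exact: mule_rot_le2.
rewrite tonelli1//; last by move=> p; rewrite !mule_ge0 ?cbrt_ge0.
pose H3 a := \int[m2]_b F3 (a, b).
pose H4 a := \int[m2]_b G4 (a, b).
have mH3 : measurable_fun setT H3 by exact: measurable_int1.
have mH4 : measurable_fun setT H4 by exact: measurable_int1.
have H30 q : 0 <= H3 q by exact: integral_ge0.
have H40 q : 0 <= H4 q by exact: integral_ge0.
have E1 : \int[prodm (prodm m2 m3) m4]_q f1 q = \int[m2]_b G1 b.
  by rewrite (tonelli1 _ _ mf1 f10); exact: (tonelli1 m2 m3 mF1 F10).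
have E2 : \int[prodm (prodm m1 m3) m4]_q f2 q = \int[m1]_a G2 a.
  by rewrite (tonelli1 _ _ mf2 f20); exact: (tonelli1 m1 m3 mF2 F20).
have E3 : \int[prodm (prodm m1 m2) m4]_q f3 q = \int[m1]_a H3 a.
  by rewrite (tonelli1 _ _ mf3 f30); exact: (tonelli1 m1 m2 mF3 F30).
have E4 : \int[prodm (prodm m1 m2) m3]_q f4 q = \int[m1]_a H4 a.
  by rewrite (tonelli1 _ _ mf4 f40); exact: (tonelli1 m1 m2 mG4 G40).
rewrite E1 E2 E3 E4.
apply: (@le_trans _ _ (\int[m1]_a
    (cbrt (G2 a) * cbrt (H3 a) * cbrt (H4 a) * cbrt (\int[m2]_b G1 b)))).
  apply: ge0_le_integral => //.
  - by move=> p _; apply: integral_ge0 => y _; rewrite !mule_ge0 ?cbrt_ge0.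
  - by apply: (measurable_int1 m2 m2F) => p; rewrite !mule_ge0 ?cbrt_ge0.
  - apply: emeasurable_funM => //.
    by apply: emeasurable_funM; [apply: emeasurable_funM|]; exact: measurable_cbrt.
  - move=> a _ /=.
    have m1' : measurable_fun setT (fun y => F3 (a, y)) by apply: measurableT_comp.
    have m2' : measurable_fun setT (fun y => G4 (a, y)) by apply: measurableT_comp.
    rewrite ge0_integralZr ?cbrt_ge0//; last 2 first.
      by apply: emeasurable_funM; [apply: emeasurable_funM|]; exact: measurable_cbrt.
      by move=> y _; rewrite !mule_ge0 ?cbrt_ge0.
    apply: (@le_trans _ _ (cbrt (H3 a) * cbrt (H4 a) * cbrt (\int[m2]_b G1 b) * cbrt (G2 a))).
      by apply: lee_wpmul2r; [exact: cbrt_ge0|exact: hoelder3].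
    exact: mule_rot_le.
rewrite ge0_integralZr ?cbrt_ge0//; last 2 first.
  by apply: emeasurable_funM; [apply: emeasurable_funM|]; exact: measurable_cbrt.
  by move=> y _; rewrite !mule_ge0 ?cbrt_ge0.
apply: (@le_trans _ _ (cbrt (\int[m1]_a G2 a) * cbrt (\int[m1]_a H3 a) * cbrt (\int[m1]_a H4 a) *
  cbrt (\int[m2]_b G1 b))).
  by apply: lee_wpmul2r; [exact: cbrt_ge0|exact: hoelder3].
exact: mule_rot_le.
Qed.
End loomis_whitney.

Section cauchy_schwarz.
Local Open Scope ereal_scope.
Context (R : realType) (d : measure_display) (T : measurableType d).
Variable m : {measure set T -> \bar R}.

(** Optimisation of the parameter: [s = B / I] gives the inequality when [B] is positive. *)
Lemma sqr_le_of_am (I A B : R) : (0 <= I -> 0 <= A -> 0 <= B ->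
  (forall s, 0 < s -> 2 * I <= s * A + B / s) -> I ^+ 2 <= A * B)%R.
Proof.
move=> I0 A0 B0 H.
have [->|In] := eqVneq I 0%R; first by rewrite expr0n mulr_ge0.
have Ip : (0 < I)%R by rewrite lt_neqAle eq_sym In.
have [Bz|Bn] := eqVneq B 0%R.
  have A1 : (0 < A + 1)%R by rewrite ltr_wpDl.
  (* With [B = 0] this choice gives [2 I <= I A / (A + 1) < I], which is absurd for positive [I]. *)
  have := H (I / (A + 1))%R (divr_gt0 Ip A1).
  rewrite Bz mul0r addr0 => h; exfalso; move: h; apply/negP; rewrite -ltNge.
  rewrite mulrAC ltr_pdivrMr//; nra.
have Bp : (0 < B)%R by rewrite lt_neqAle eq_sym Bn.
have := H (B / I)%R (divr_gt0 Bp Ip).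
have -> : (B / (B / I) = I)%R by field; rewrite In Bn.
move=> h; have {h} : (I <= B / I * A)%R by lra.
by rewrite mulrAC ler_pdivlMr// -expr2 mulrC.
Qed.

(** Weighted Young inequalities for all weights, then [sqr_le_of_am]. Finite values of the two
    square integrals are the input, so that the finiteness of the mixed integral is part of the
    conclusion. *)
Lemma cauchy_schwarz (f g : T -> R) (A B : R) :
  measurable_fun setT f -> measurable_fun setT g ->
  \int[m]_x ((f x) ^+ 2)%:E = A%:E -> \int[m]_x ((g x) ^+ 2)%:E = B%:E ->
  exists2 I, \int[m]_x (`|f x * g x|%R)%:E = I%:E & (0 <= I)%R /\ (I ^+ 2 <= A * B)%R.
Proof.
move=> mf mg fA gB.
have A0 : (0 <= A)%R.
  by rewrite -lee_fin -fA; apply: integral_ge0 => x _; rewrite lee_fin sqr_ge0.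
have B0 : (0 <= B)%R.
  by rewrite -lee_fin -gB; apply: integral_ge0 => x _; rewrite lee_fin sqr_ge0.
have I0 : 0 <= \int[m]_x (`|f x * g x|%R)%:E by apply: integral_ge0 => x _; rewrite lee_fin.
have mfg : measurable_fun setT (fun x => (`|f x * g x|%R)%:E).
  by apply/measurable_EFinP; apply: measurableT_comp => //; exact: measurable_funM.
have H s : (0 < s)%R -> \int[m]_x (`|f x * g x|%R)%:E <= ((s * A + B / s) / 2)%:E.
  move=> s0.
  have -> : ((s * A + B / s) / 2)%:E = \int[m]_x ((s / 2)%:E * ((f x) ^+ 2)%:E + (s^-1 / 2)%:E * ((g x) ^+ 2)%:E).
    rewrite ge0_integralD//; last 4 first.
    - by move=> x _; rewrite -EFinM lee_fin mulr_ge0 ?sqr_ge0// divr_ge0 ?ltW.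
    - by apply: emeasurable_funM => //; apply/measurable_EFinP; exact: measurable_funX.
    - by move=> x _; rewrite -EFinM lee_fin mulr_ge0 ?sqr_ge0// divr_ge0 ?invr_ge0 ?ltW.
    - by apply: emeasurable_funM => //; apply/measurable_EFinP; exact: measurable_funX.
    rewrite !ge0_integralZl//.
    - by rewrite fA gB -!EFinM -EFinD; congr EFin; field; rewrite gt_eqF.
    - by apply/measurable_EFinP; exact: measurable_funX.
    - by move=> x _; rewrite lee_fin sqr_ge0.
    - by rewrite lee_fin divr_ge0 ?invr_ge0 ?ltW.
    - by apply/measurable_EFinP; exact: measurable_funX.
    - by move=> x _; rewrite lee_fin sqr_ge0.
    - by rewrite lee_fin divr_ge0 ?ltW.
  apply: ge0_le_integral => //.
  - by apply: emeasurable_funD; apply: emeasurable_funM => //; apply/measurable_EFinP; exact: measurable_funX.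
  - move=> x _; rewrite -!EFinM -EFinD lee_fin normrM.
    rewrite -(real_normK (num_real (f x))) -(real_normK (num_real (g x))).
    set a := `|f x|%R; set b := `|g x|%R.
    have -> : (s / 2 * a ^+ 2 + s^-1 / 2 * b ^+ 2 = a * b + s^-1 / 2 * (s * a - b) ^+ 2)%R.
      by field; rewrite gt_eqF.
    by rewrite lerDl mulr_ge0 ?sqr_ge0// divr_ge0 ?invr_ge0 ?ltW.
have Ifin : \int[m]_x (`|f x * g x|%R)%:E \is a fin_num.
  by rewrite ge0_fin_numE// (le_lt_trans (H 1%R ltr01))// ltry.
exists (fine (\int[m]_x (`|f x * g x|%R)%:E)); first by rewrite fineK.
split; first exact: fine_ge0.
apply: sqr_le_of_am => //; first exact: fine_ge0.
by move=> s /H; rewrite -{1}(fineK Ifin) lee_fin ler_pdivlMr// mulrC.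
Qed.
End cauchy_schwarz.

Notation li m f := (m.-integrable setT (EFin \o f)).

(** * Real-valued integrals and absolute continuity *)

Section li.
Context (R : realType) (d : measure_display) (T : measurableType d).
Variable m : {measure set T -> \bar R}.
Implicit Types f g h : T -> R.

Lemma li_meas f : li m f -> measurable_fun setT f.
Proof. by move=> /measurable_int /measurable_EFinP. Qed.

Lemma li_le f g : measurable_fun setT f -> (forall x, `|f x| <= g x) ->
  li m g -> li m f.
Proof.
move=> mf fg; apply: le_integrable => //; first exact/measurable_EFinP.
by move=> x _ /=; rewrite lee_fin (le_trans (fg x))// ler_norm.
Qed.

Lemma li_abs f : li m f -> li m (fun x => `|f x|).
Proof. exact: integrable_norm. Qed.

Lemma liD f g : li m f -> li m g -> li m (fun x => f x + g x).
Proof. by move=> fi gi; exact: (integrableD measurableT fi gi). Qed.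

Lemma liB f g : li m f -> li m g -> li m (fun x => f x - g x).
Proof. by move=> fi gi; exact: (integrableB measurableT fi gi). Qed.

Lemma liZ k f : li m f -> li m (fun x => k * f x).
Proof. by move=> fi; exact: (integrableZl measurableT k fi). Qed.

Lemma liZr k f : li m f -> li m (fun x => f x * k).
Proof. by move=> /(liZ k); apply: eq_integrable => // x _ /=; rewrite mulrC. Qed.

Lemma li0 : li m (fun=> 0).
Proof. exact: integrable0. Qed.

Lemma li_bdd f h C : li m f -> measurable_fun setT h ->
  (forall x, `|h x| <= C) -> li m (fun x => f x * h x).
Proof.
move=> fi mh hC.
apply: (li_le (g := fun x => `|f x| * C)).
- by apply: measurable_funM => //; exact: li_meas.
- by move=> x; rewrite normrM ler_wpM2l.
- exact: liZr (li_abs fi).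
Qed.

Lemma RintE f : li m f -> (\int[m]_x (f x)%:E = (\int[m]_x f x)%R%:E)%E.
Proof. by move=> fi; rewrite /Rintegral fineK// integrable_fin_num. Qed.

Lemma Rint_ae f g : measurable_fun setT f -> measurable_fun setT g ->
  {ae m, forall x, f x = g x} -> \int[m]_x f x = \int[m]_x g x.
Proof.
move=> mf mg fg; rewrite /Rintegral; congr fine; apply: ae_eq_integral => //.
- exact/measurable_EFinP.
- exact/measurable_EFinP.
- by apply: filterS fg => x /= ->.
Qed.

Lemma Rint_le f g : li m f -> li m g -> (forall x, f x <= g x) ->
  \int[m]_x f x <= \int[m]_x g x.
Proof. by move=> fi gi fg; apply: le_Rintegral. Qed.

Lemma li_ge0P f : measurable_fun setT f -> (forall x, 0 <= f x) ->
  li m f <-> (\int[m]_x (f x)%:E < +oo)%E.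
Proof.
move=> mf f0; split=> [/integrableP[_]|H].
  by under eq_integral do rewrite /= ger0_norm//.
apply/integrableP; split; first exact/measurable_EFinP.
by under eq_integral do rewrite /= ger0_norm//.
Qed.

Lemma li_absP f : measurable_fun setT f ->
  li m f <-> (\int[m]_x (`|f x|)%:E < +oo)%E.
Proof.
move=> mf; split=> [/integrableP[_]//|H].
by apply/integrableP; split => //; exact/measurable_EFinP.
Qed.

End li.

Section prod_li.
Context (R : realType) (d1 d2 : measure_display).
Context (X : measurableType d1) (Y : measurableType d2).
Variables (m1 : {sigma_finite_measure set X -> \bar R}).
Variables (m2 : {sigma_finite_measure set Y -> \bar R}).

Lemma prod_li (f : X -> R) (g : Y -> R) : li m1 f -> li m2 g ->
  li (prodm m1 m2) (fun p => f p.1 * g p.2).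
Proof.
move=> fi gi.
have mf := li_meas fi; have mg := li_meas gi.
have mfg : measurable_fun setT (fun p : X * Y => f p.1 * g p.2).
  apply: measurable_funM; first exact: (measurableT_comp mf measurable_fst).
  exact: (measurableT_comp mg measurable_snd).
apply/li_absP => //; rewrite tonelli1//; last first.
  by apply/measurable_EFinP; apply: measurableT_comp.
under eq_integral => x _.
  under eq_integral do rewrite normrM EFinM /=.
  rewrite ge0_integralZl//; last first.
    by apply/measurable_EFinP; apply: measurableT_comp.
  over.
rewrite ge0_integralZr//; last 2 first.
  by apply/measurable_EFinP; apply: measurableT_comp.
  exact: integral_ge0.
apply: lte_mul_pinfty; first exact: integral_ge0.
  by rewrite ge0_fin_numE ?integral_ge0//; exact/li_absP.
exact/li_absP.
Qed.

Lemma Rint_fubini1 (f : X * Y -> R) : li (prodm m1 m2) f ->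
  \int[prodm m1 m2]_p f p = \int[m1]_x \int[m2]_y f (x, y).
Proof.
move=> fi; rewrite [LHS]/Rintegral fubini1_li//.
rewrite [RHS]/Rintegral; congr fine.
apply: ae_eq_integral => //.
- by have /integrableP[] := integrable_int1 fi.
- apply/measurable_EFinP; apply: measurableT_comp => //.
  by have /integrableP[] := integrable_int1 fi.
- by apply: filterS (ae_int1 fi) => x h _; rewrite [LHS]RintE.
Qed.

Lemma li_int1 (f : X * Y -> R) : li (prodm m1 m2) f ->
  li m1 (fun x => \int[m2]_y f (x, y)).
Proof.
move=> fi; have h := integrable_int1 fi.
apply: le_integrable h => //.
- apply/measurable_EFinP; apply: measurableT_comp => //.
  by have /integrableP[] := integrable_int1 fi.
- move=> x _; rewrite /= /Rintegral.
  by move: (integral m2 _ _) => [r| |] //=; rewrite normr0 leey.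
Qed.

Lemma Rint_prod (f : X -> R) (g : Y -> R) : li m1 f -> li m2 g ->
  \int[prodm m1 m2]_p (f p.1 * g p.2) = (\int[m1]_x f x) * \int[m2]_y g y.
Proof.
move=> fi gi; rewrite Rint_fubini1/=; last exact: prod_li.
rewrite -RintegralZr//; apply: eq_Rintegral => x _.
by rewrite RintegralZl.
Qed.
End prod_li.

Lemma li_mpres (R : realType) (d d' : measure_display)
  (X : measurableType d) (Y : measurableType d')
  (m : {measure set X -> \bar R}) (m' : {measure set Y -> \bar R}) (phi : X -> Y) (f : Y -> R) :
  mpres m m' phi -> li m' f -> li m (fun x => f (phi x)).
Proof. by move=> H fi; exact: (integrable_mpres H fi). Qed.

Lemma Rint_mpres (R : realType) (d d' : measure_display)
  (X : measurableType d) (Y : measurableType d')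
  (m : {measure set X -> \bar R}) (m' : {measure set Y -> \bar R}) (phi : X -> Y) (f : Y -> R) :
  mpres m m' phi -> measurable_fun setT f -> \int[m']_y f y = \int[m]_x f (phi x).
Proof.
move=> H mf; rewrite /Rintegral (integral_mpres H (f := EFin \o f))//.
exact/measurable_EFinP.
Qed.

Lemma Rint_fubini2 (R : realType) (d1 d2 : measure_display)
  (X : measurableType d1) (Y : measurableType d2)
  (m1 : {sigma_finite_measure set X -> \bar R})
  (m2 : {sigma_finite_measure set Y -> \bar R}) (f : X * Y -> R) :
  li (prodm m1 m2) f -> \int[prodm m1 m2]_p f p = \int[m2]_y \int[m1]_x f (x, y).
Proof.
move=> fi; rewrite (Rint_mpres (mpres_swap m2 m1) (li_meas fi)).
by rewrite Rint_fubini1//; exact: (li_mpres (mpres_swap m2 m1) fi).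
Qed.

Section cumulative_integral.
Variable R : realType.
Local Notation mu := (L1 R).
Implicit Types (f h U V G H : R -> R) (s t : R).

Definition bR (b : bool) : R := b%:R.

(** The primitive vanishing at minus infinity. The indicator replaces a varying domain of
    integration, so that products of primitives become double integrals over triangles. *)
Definition cum (f : R -> R) (t : R) : R := \int[mu]_(s in [set: R]) (f s * bR (s <= t)).

Lemma ind_le1 (b : bool) : `|bR b| <= 1.
Proof. by case: b; rewrite /bR ?normr1 ?normr0. Qed.

Lemma measurable_natb (d : measure_display) (T : measurableType d) (f : T -> bool) :
  measurable_fun setT f -> measurable_fun setT (fun x => bR (f x)).
Proof. by move=> mf; apply: (measurableT_comp (f := bR)) mf. Qed.

Lemma measurable_indle t : measurable_fun setT (fun s : R => bR (s <= t)).
Proof. by apply: measurable_natb; exact: measurable_fun_ler. Qed.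

Lemma measurable_indlt t : measurable_fun setT (fun s : R => bR (s < t)).
Proof. by apply: measurable_natb; exact: measurable_fun_ltr. Qed.

Lemma li_cut f t : li mu f -> li mu (fun s => f s * bR (s <= t)).
Proof. by move=> fi; apply: li_bdd fi (measurable_indle t) (fun s => ind_le1 _). Qed.

Lemma li_tri (f h : R -> R) : li mu f -> li mu h ->
  li (prodm mu mu) (fun p => f p.1 * h p.2 * bR (p.1 <= p.2)).
Proof.
move=> fi hi; apply: (li_bdd (C := 1) (prod_li fi hi)) => [|s]; last exact: ind_le1.
by apply: measurable_natb; exact: measurable_fun_ler.
Qed.

Lemma measurable_cum f : li mu f -> measurable_fun setT (cum f).
Proof.
move=> fi.
have mg : measurable_fun setT (fun p : R * R => (f p.1 * bR (p.1 <= p.2))%:E).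
  apply/measurable_EFinP; apply: measurable_funM.
    exact: (measurableT_comp (li_meas fi) measurable_fst).
  by apply: measurable_natb; exact: measurable_fun_ler.
apply: measurableT_comp => //.
rewrite [X in measurable_fun _ X](_ : _ = fun t =>
  (\int[mu]_s ((fun p : R * R => (f p.1 * bR (p.1 <= p.2))%:E)^\+ (s, t)) -
   \int[mu]_s ((fun p : R * R => (f p.1 * bR (p.1 <= p.2))%:E)^\- (s, t)))%E); last first.
  by apply/funext => t; rewrite integralE; congr (_ - _)%E;
    apply: eq_integral => s _; rewrite ?funeposE ?funenegE.
apply: emeasurable_funB.
- by apply: (measurable_int2 mu (measurable_funepos mg)).
- by apply: (measurable_int2 mu (measurable_funeneg mg)).
Qed.

Lemma cum_bound f t : li mu f -> `|cum f t| <= \int[mu]_s `|f s|.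
Proof.
move=> fi; have ci := li_cut t fi.
apply: le_trans (le_normr_Rintegral measurableT ci) _.
apply: Rint_le; [exact: li_abs|exact: li_abs|].
by move=> s; rewrite normrM ler_piMr// ind_le1.
Qed.

Lemma cum_lt f t : li mu f -> cum f t = \int[mu]_s (f s * bR (s < t)).
Proof.
move=> fi; apply: Rint_ae.
- exact: li_meas (li_cut t fi).
- by apply: measurable_funM; [exact: li_meas fi|exact: measurable_indlt].
- exists [set t]; split => //; first exact: L1_set1.
  move=> s /= h; apply: contra_notP h => /eqP st.
  by rewrite le_eqVlt (negbTE st).
Qed.

(** Integration by parts without pointwise differentiation: the product of the two integrals is an
    integral over the plane, which is split along the diagonal. *)
Lemma cum_mul0 f h : li mu f -> li mu h ->
  (\int[mu]_s f s) * (\int[mu]_s h s) =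
  \int[mu]_t (h t * cum f t) + \int[mu]_s (f s * cum h s).
Proof.
move=> fi hi; rewrite -Rint_prod//.
have i1 := li_tri fi hi.
have i2 : li (prodm mu mu) (fun p => f p.1 * h p.2 * bR (p.2 < p.1)).
  apply: (li_bdd (C := 1) (prod_li fi hi)) => [|s]; last exact: ind_le1.
  by apply: measurable_natb; exact: measurable_fun_ltr.
transitivity (\int[prodm mu mu]_p (f p.1 * h p.2 * bR (p.1 <= p.2) + f p.1 * h p.2 * bR (p.2 < p.1))).
  apply: eq_Rintegral => p _; rewrite -mulrDr ltNge.
  by case: (p.1 <= p.2); rewrite /bR ?addr0 ?add0r mulr1.
rewrite RintegralD//; congr (_ + _).
  rewrite Rint_fubini2//=; apply: eq_Rintegral => t _.
  rewrite /cum -RintegralZl//; last exact: li_cut.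
  by apply: eq_Rintegral => s _; ring.
rewrite Rint_fubini1//=; apply: eq_Rintegral => s _.
rewrite cum_lt// -RintegralZl//; last first.
  exact: li_bdd hi (measurable_indlt s) (fun s => ind_le1 _).
by apply: eq_Rintegral => t _; ring.
Qed.

Lemma li_mulcum f h : li mu f -> li mu h -> li mu (fun t => h t * cum f t).
Proof.
move=> fi hi; apply: li_bdd hi (measurable_cum fi) (fun t => cum_bound t fi).
Qed.

Lemma cumM f h t : li mu f -> li mu h ->
  cum f t * cum h t = cum (fun s => h s * cum f s + f s * cum h s) t.
Proof.
move=> fi hi; have f' := li_cut t fi; have h' := li_cut t hi.
rewrite [LHS]cum_mul0// /cum -RintegralD//; last 2 first.
- exact: li_mulcum.
- exact: li_mulcum.
apply: eq_Rintegral => s _.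
(* Below [t] the primitive does not see the truncation at [t], so [cum_mul0] for the truncated
   functions is the identity up to time [t]. *)
have E g : cum (fun s => g s * bR (s <= t)) s * bR (s <= t) = cum g s * bR (s <= t).
  case: (leP s t) => st; last by rewrite /bR !mulr0.
  rewrite /bR !mulr1; apply: eq_Rintegral => x _.
  by case: (leP x s) => xs; rewrite ?mulr0// (le_trans xs st) !mulr1.
by rewrite mulrDl -!mulrA; congr (_ * _ + _ * _); rewrite mulrC E mulrC.
Qed.

Lemma cumD f h t : li mu f -> li mu h -> cum (fun s => f s + h s) t = cum f t + cum h t.
Proof.
move=> fi hi; rewrite /cum -RintegralD//; [|exact: li_cut|exact: li_cut].
by apply: eq_Rintegral => s _; rewrite mulrDl.
Qed.

Lemma cumZ k f t : li mu f -> cum (fun s => k * f s) t = k * cum f t.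
Proof.
move=> fi; rewrite /cum -RintegralZl//; last exact: li_cut.
by apply: eq_Rintegral => s _; rewrite mulrA.
Qed.

(* [U] is absolutely continuous with derivative [G], in integrated form. *)
Definition ac (U G : R -> R) := li mu G /\ exists c, forall t, U t = c + cum G t.

Lemma ac_meas U G : ac U G -> measurable_fun setT U.
Proof.
move=> [Gi [c UE]]; rewrite (_ : U = fun t => c + cum G t); last exact/funext.
by apply: measurable_funD => //; exact: measurable_cum.
Qed.

Lemma ac_bdd U G : ac U G -> exists C, forall t, `|U t| <= C.
Proof.
move=> [Gi [c UE]]; exists (`|c| + \int[mu]_s `|G s|) => t.
by rewrite UE (le_trans (ler_normD _ _))// lerD2l cum_bound.
Qed.

Lemma acM U G V H : ac U G -> ac V H ->
  ac (fun t => U t * V t) (fun t => U t * H t + V t * G t).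
Proof.
move=> aU aV; have [C UC] := ac_bdd aU; have [D VD] := ac_bdd aV.
have mU := ac_meas aU; have mV := ac_meas aV.
move: aU aV => [Gi [c UE]] [Hi [e VE]].
split.
  apply: liD.
    by have := li_bdd Hi mU UC; apply: eq_integrable => // t _ /=; rewrite mulrC.
  by have := li_bdd Gi mV VD; apply: eq_integrable => // t _ /=; rewrite mulrC.
exists (c * e) => t.
transitivity (c * e + (c * cum H t + e * cum G t + cum G t * cum H t)).
  by rewrite UE VE; ring.
congr (_ + _); rewrite cumM// -!cumZ// -cumD//; try exact: liZ.
rewrite -cumD//; last 2 first.
- by apply: liD; exact: liZ.
- by apply: liD; exact: li_mulcum.
by apply: eq_Rintegral => s _; congr (_ * _); rewrite UE VE; ring.
Qed.

(** Two applications of the product rule give [U^3] the derivative [3 U^2 G], and an increment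
    integrates this against a difference of two indicators, which is at most one in absolute value.
    This is the one-dimensional core of the Gagliardo-Nirenberg inequality. *)
Lemma ac_cube_bound U G s t : ac U G ->
  `|U t ^+ 3 - U s ^+ 3| <= 3 * \int[mu]_x (U x ^+ 2 * `|G x|).
Proof.
move=> aU; have [C UC] := ac_bdd aU; have mU := ac_meas aU.
have Gi := aU.1.
have [_ [c UE]] := acM (acM aU aU) aU.
pose W x := U x * U x * G x + U x * (U x * G x + U x * G x).
have i2 : li mu (fun x => U x ^+ 2 * `|G x|).
  have := li_bdd (li_abs Gi) (measurable_funX 2 mU) (C := C ^+ 2).
  have h x : `|U x ^+ 2| <= C ^+ 2 by rewrite normrX lerXn2r// ?nnegrE// (le_trans _ (UC x)).
  by move=> /(_ h); apply: eq_integrable => // x _ /=; rewrite mulrC.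
have Wi : li mu W.
  apply: (li_le (g := fun x => 3 * (U x ^+ 2 * `|G x|))); last exact: liZ.
  - have mG := li_meas Gi.
    by apply: measurable_funD; apply: measurable_funM => //;
      [apply: measurable_funM|apply: measurable_funD; apply: measurable_funM].
  - move=> x; rewrite /W (_ : _ + _ = 3 * (U x ^+ 2 * G x)); last by ring.
    by rewrite (normrM 3) (normrM (U x ^+ 2)) [`|3|]ger0_norm// [`|U x ^+ 2|]ger0_norm ?sqr_ge0.
have -> : U t ^+ 3 - U s ^+ 3 = cum W t - cum W s.
  rewrite (_ : U t ^+ 3 = U t * U t * U t); last by ring.
  rewrite (_ : U s ^+ 3 = U s * U s * U s); last by ring.
  by rewrite !UE; ring.
rewrite /cum -RintegralB//; [|exact: li_cut|exact: li_cut].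
apply: le_trans (le_normr_Rintegral measurableT _) _.
  by apply: liB; exact: li_cut.
rewrite -RintegralZl//; apply: Rint_le.
- by apply: li_abs; apply: liB; exact: li_cut.
- exact: liZ.
- move=> x; rewrite -mulrBr normrM /W (_ : _ + _ = 3 * (U x ^+ 2 * G x)); last by ring.
  rewrite (normrM 3) (normrM (U x ^+ 2)) [`|3|]ger0_norm// [`|U x ^+ 2|]ger0_norm ?sqr_ge0//.
  apply: ler_piMr.
    by apply: mulr_ge0 => //; apply: mulr_ge0 => //; exact: sqr_ge0.
  by case: (x <= t); case: (x <= s); rewrite /bR ?subrr ?subr0 ?sub0r ?normrN ?normr1 ?normr0.
Qed.
End cumulative_integral.

(** * Product test functions and restriction to lines *)

Section C1.
Variable R : realType.
Implicit Types (f g : R -> R).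

Definition C1 f f' := continuous f' /\ forall x, is_derive x (1 : R) f (f' x).

Lemma C1_cont f f' : C1 f f' -> continuous f.
Proof.
move=> [_ df] x; apply: differentiable_continuous.
by apply/derivable1_diffP; case: (df x).
Qed.

(** A quadratic remainder treats the square of the positive part at its corner without one-sided
    limits. *)
Lemma is_derive_quad f (x d C : R) :
  (forall h, `|f (h + x) - f x - h * d| <= C * h ^+ 2) -> is_derive x (1 : R) f d.
Proof.
move=> H.
have cv : h^-1 *: ((f \o shift x) (h *: 1) - f x) @[h --> (0 : R)^'] --> d.
  apply/cvgrPdist_le => e e0.
  have C0 : 0 < `|C| + 1 by rewrite ltr_wpDl.
  near=> h.
  have hn : h != 0 by near: h; exact: nbhs_dnbhs_neq.
  have h0 : 0 < `|h| by rewrite normr_gt0.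
  rewrite /= /shift [h *: 1]mulr1.
  have -> : d - h^-1 *: (f (h + x) - f x) = - h^-1 * (f (h + x) - f x - h * d).
    by rewrite /GRing.scale /=; field.
  rewrite normrM normrN normfV mulrC ler_pdivrMr//.
  apply: le_trans (H h) _; rewrite -(real_normK (num_real h)) expr2 mulrA ler_pM2r//.
  apply: (@le_trans _ _ ((`|C| + 1) * `|h|)).
    by rewrite ler_wpM2r// (le_trans (ler_norm C))// lerDl.
  rewrite mulrC -ler_pdivlMr// ltW//.
  near: h; apply: dnbhs0_lt; exact: divr_gt0.
apply: DeriveDef; first by apply/cvg_ex; exists d.
exact: cvg_lim cv.
Unshelve. all: by end_near. Qed.

(** Test functions are only required to be of class C^1, so squares of positive parts are smooth
    enough to build all the bumps and cutoffs below. *)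
Definition pos (x : R) : R := (x + `|x|) / 2.

Lemma pos_ge0 x : 0 <= pos x.
Proof. by rewrite /pos divr_ge0//; have := ler_norm (- x); rewrite normrN => h; lra. Qed.

Lemma pos_id x : 0 <= x -> pos x = x.
Proof. by move=> x0; rewrite /pos ger0_norm//; field. Qed.

Lemma pos_0 x : x <= 0 -> pos x = 0.
Proof. by move=> x0; rewrite /pos ler0_norm// subrr mul0r. Qed.

Lemma pos_cont : continuous pos.
Proof.
move=> x; apply: cvgM; last exact: cvg_cst.
by apply: cvgD; [exact: cvg_id|exact: norm_continuous].
Qed.

Lemma C1_pos2 : C1 (fun x => pos x ^+ 2) (fun x => 2 * pos x).
Proof.
split=> [x|x]; first by apply: cvgM; [exact: cvg_cst|exact: pos_cont].
apply: (@is_derive_quad _ _ _ 1) => h; rewrite mul1r.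
case: (leP 0 x) => x0; case: (leP 0 (h + x)) => hx.
- rewrite !pos_id// (_ : _ - _ = h ^+ 2); last by ring.
  by rewrite ger0_norm ?sqr_ge0.
- rewrite (pos_id x0) (pos_0 (ltW hx)) ler_norml; apply/andP; split; nra.
- rewrite (pos_id hx) (pos_0 (ltW x0)) ler_norml; apply/andP; split; nra.
- rewrite (pos_0 (ltW hx)) (pos_0 (ltW x0)) (_ : _ - _ = 0) ?normr0 ?sqr_ge0//; ring.
Qed.

Lemma C1M f f' g g' : C1 f f' -> C1 g g' ->
  C1 (fun x => f x * g x) (fun x => f x * g' x + f' x * g x).
Proof.
move=> Hf Hg; have cf := C1_cont Hf; have cg := C1_cont Hg.
move: Hf Hg => [cf' df] [cg' dg]; split=> x.
  by apply: cvgD; apply: cvgM; [exact: cf|exact: cg'|exact: cf'|exact: cg].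
have := is_deriveM (df x) (dg x).
by congr (is_derive _ _ _ _); rewrite /GRing.scale /= [g x * _]mulrC.
Qed.

Lemma C1_comp f f' g g' : C1 f f' -> C1 g g' ->
  C1 (fun x => f (g x)) (fun x => f' (g x) * g' x).
Proof.
move=> Hf Hg; have cg := C1_cont Hg.
move: Hf Hg => [cf' df] [cg' dg]; split=> x.
  by apply: cvgM; [apply: (@continuous_comp _ _ _ g f'); [exact: cg|exact: cf']|exact: cg'].
by have := is_derive1_comp (df (g x)) (dg x).
Qed.

Lemma C1_affine (a b : R) : C1 (fun x => a * x + b) (fun=> a).
Proof.
split=> x; first exact: cvg_cst.
apply: (@is_derive_quad _ _ _ 0) => h.
by rewrite mul0r (_ : _ - _ - _ = 0) ?normr0//; ring.
Qed.

Definition tst (a b : R) f f' :=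
  C1 f f' /\ forall t, ~~ (a < t < b) -> f t = 0 /\ f' t = 0.

Definition bmp a b t : R := pos (t - a) ^+ 2 * pos (b - t) ^+ 2.
Definition dbmp a b t : R :=
  pos (t - a) ^+ 2 * (- (2 * pos (b - t))) + 2 * pos (t - a) * pos (b - t) ^+ 2.

Lemma C1_bmp a b : C1 (bmp a b) (dbmp a b).
Proof.
have h1 : C1 (fun t => pos (t - a) ^+ 2) (fun t => 2 * pos (t - a)).
  have := C1_comp C1_pos2 (C1_affine 1 (- a)); congr (C1 _ _).
    by apply/funext => t; rewrite mul1r.
  by apply/funext => t; rewrite mul1r mulr1.
have h2 : C1 (fun t => pos (b - t) ^+ 2) (fun t => - (2 * pos (b - t))).
  have := C1_comp C1_pos2 (C1_affine (- 1) b); congr (C1 _ _).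
    by apply/funext => t; rewrite mulN1r addrC.
  by apply/funext => t; rewrite mulN1r mulrN1 addrC.
exact: C1M h1 h2.
Qed.

Lemma bmp_ge0 a b t : 0 <= bmp a b t.
Proof. by rewrite mulr_ge0 ?sqr_ge0. Qed.

Lemma bmp_out a b t : ~~ (a < t < b) -> bmp a b t = 0 /\ dbmp a b t = 0.
Proof.
rewrite negb_and -!leNgt => /orP[h|h].
  by rewrite /bmp /dbmp (@pos_0 (t - a)) ?subr_le0//; split; ring.
by rewrite /bmp /dbmp (@pos_0 (b - t)) ?subr_le0//; split; ring.
Qed.

Lemma bmp_gt0 a b t : a < t < b -> 0 < bmp a b t.
Proof.
move=> /andP[h1 h2]; rewrite /bmp !pos_id ?subr_ge0 ?ltW//.
by rewrite mulr_gt0// exprn_gt0// subr_gt0.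
Qed.

(* A C^1 approximation of the indicator of ]a, b[, supported in [a, b]. *)
Definition sig a b (n : nat) t : R := 1 - pos (1 - n%:R * bmp a b t) ^+ 2.
Definition dsig a b (n : nat) t : R :=
  2 * pos (1 - n%:R * bmp a b t) * (n%:R * dbmp a b t).

Lemma tst_sig a b n : tst a b (sig a b n) (dsig a b n).
Proof.
split.
  have h0 := C1_comp (C1_affine (- n%:R) 1) (C1_bmp a b).
  have h1 := C1_comp C1_pos2 h0.
  have := C1_comp (C1_affine (- 1) 1) h1; congr (C1 _ _).
    by apply/funext => t; rewrite /sig /= mulN1r addrC; congr (_ - pos _ ^+ 2); ring.
  apply/funext => t; rewrite /dsig /= (_ : - n%:R * _ + 1 = 1 - n%:R * bmp a b t); last by ring.
  by ring.
move=> t /bmp_out[h1 h2]; rewrite /sig /dsig h1 h2 !mulr0 subr0 pos_id//.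
by rewrite expr1n subrr.
Qed.

Lemma sig_bound a b n t : 0 <= sig a b n t <= 1.
Proof.
rewrite /sig; have p0 := pos_ge0 (1 - n%:R * bmp a b t).
have p1 : pos (1 - n%:R * bmp a b t) <= 1.
  case: (leP 0 (1 - n%:R * bmp a b t)) => h; last by rewrite pos_0// ltW.
  by rewrite pos_id// gerBl mulr_ge0// bmp_ge0.
by rewrite subr_ge0 gerBl sqr_ge0 andbT; rewrite expr_le1.
Qed.

Lemma sig_norm a b n t : `|sig a b n t| <= 1.
Proof. by have /andP[h1 h2] := sig_bound a b n t; rewrite ger0_norm. Qed.

Lemma sig_cvg a b t : sig a b n t @[n --> \oo] --> bR R (a < t < b).
Proof.
case: (boolP (a < t < b)) => ab; last first.
  rewrite (_ : (fun n => _) = fun=> 0); first exact: cvg_cst.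
  by apply/funext => n; have [] := (tst_sig a b n).2 _ ab.
have b0 := bmp_gt0 ab.
apply: cvg_near_cst; exists (Num.bound (bmp a b t)^-1) => //= n /= hn.
have h : 1 <= n%:R * bmp a b t.
  rewrite -ler_pdivrMr// div1r; apply: ltW.
  have h' : 0 <= (bmp a b t)^-1 by rewrite invr_ge0 ltW.
  by apply: (lt_le_trans (archi_boundP h')); rewrite ler_nat.
by rewrite /sig pos_0 ?subr_le0// expr0n subr0.
Qed.

Lemma tst_meas a b f f' : tst a b f f' -> measurable_fun setT f /\ measurable_fun setT f'.
Proof.
move=> [Hf _]; split; apply: continuous_measurable_fun; first exact: C1_cont Hf.
exact: Hf.1.
Qed.

Lemma tst0 a b : tst a b (fun=> 0) (fun=> 0).
Proof.
split=> //; split=> x; first exact: cvg_cst.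
by apply: (@is_derive_quad _ _ _ 0) => h; rewrite mul0r mulr0 !subr0 normr0.
Qed.

Lemma cont_bdd_itv a b f : continuous f -> (forall t, ~~ (a < t < b) -> f t = 0) ->
  exists2 C, 0 <= C & forall t, `|f t| <= C.
Proof.
move=> cf f0; case: (leP a b) => ab; last first.
  exists 0 => // t; rewrite f0 ?normr0//; apply/negP => /andP[/lt_trans h /h].
  by rewrite ltNge ltW.
have cf' : {within `[a, b], continuous (fun t => `|f t|)}.
  by apply: continuous_subspaceT => t; apply: continuous_comp; [exact: cf|exact: norm_continuous].
have [c _ Hc] := EVT_max ab cf'.
exists `|f c| => // t; case: (boolP (a < t < b)) => [/andP[h1 h2]|/f0 ->]; last by rewrite normr0.
by apply: Hc; rewrite in_itv/= !ltW.
Qed.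

Lemma tst_bdd a b f f' : tst a b f f' ->
  exists2 C, 0 <= C & forall t, `|f t| <= C /\ `|f' t| <= C.
Proof.
move=> [Hf H0].
have [C C0 HC] := cont_bdd_itv (C1_cont Hf) (fun t h => (H0 t h).1).
have [D D0 HD] := cont_bdd_itv Hf.1 (fun t h => (H0 t h).2).
exists (C + D) => [|t]; first exact: addr_ge0.
by split; [apply: le_trans (HC t) _|apply: le_trans (HD t) _]; rewrite ?lerDl ?lerDr.
Qed.

Lemma li_bdd_itv a b f C : measurable_fun setT f -> (forall t, `|f t| <= C) ->
  (forall t, ~~ (a < t < b) -> f t = 0) -> li (L1 R) f.
Proof.
move=> mf fC f0.
have C0 : 0 <= C by rewrite (le_trans _ (fC 0)).
case: (leP a b) => ab; last first.
  rewrite (_ : f = fun=> 0); first exact: li0.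
  apply/funext => t; apply: f0; apply/negP => /andP[/lt_trans h /h].
  by rewrite ltNge ltW.
have mi : measurable_fun setT (fun t : R => bR R (a < t < b)).
  apply: measurable_natb; apply: measurable_and; exact: measurable_fun_ltr.
apply: (li_le (g := fun t => C * bR R (a < t < b))) => //.
  move=> t; case: (boolP (a < t < b)) => h; first by rewrite /bR mulr1.
  by rewrite f0// normr0 /bR mulr0.
apply: liZ; apply/li_ge0P => //.
rewrite [X in (X < _)%E](_ : _ = L1 R `]a, b[%classic).
  by rewrite L1_itv// ltry.
rewrite measure_integral1//; apply: eq_integral => t _; rewrite indicE /bR.
by congr ((nat_of_bool _)%:R%:E); apply/idP/idP; rewrite ?inE/= ?in_itv.
Qed.

Lemma tst_li a b f f' : tst a b f f' -> li (L1 R) f /\ li (L1 R) f'.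
Proof.
move=> Hf; have [C _ HC] := tst_bdd Hf; have [m1 m2] := tst_meas Hf.
by split; [apply: (@li_bdd_itv a b _ C) => // t|apply: (@li_bdd_itv a b _ C) => // t];
  [have [] := HC t|move=> /Hf.2[]|have [] := HC t|move=> /Hf.2[]].
Qed.
End C1.

Lemma ae_countable (R : realType) (d : measure_display) (T : measurableType d)
  (m : {measure set T -> \bar R}) (I : countType) (P : I -> T -> Prop) :
  (forall i, {ae m, forall x, P i x}) -> {ae m, forall x, forall i, P i x}.
Proof.
move=> H.
have : {ae m, forall x, forall n, (if unpickle n is Some i then P i x else True)}.
  apply: ae_foralln => n; case: unpickle => [i|]; first exact: H.
  exact: aeW.
by apply: filterS => x h i; have := h (pickle i); rewrite pickleK.
Qed.

(** * Separating families of test functions and absolutely continuous representatives *)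

Section sep.
Variable R : realType.

(* The functions [chi i] detect a.e. vanishing on [X]; this turns a weak identity tested on
   products into one holding on almost every line. *)
Definition sep (d : measure_display) (T : measurableType d)
    (m : {sigma_finite_measure set T -> \bar R}) (X : set T) (I : countType)
    (chi : I -> T -> R) :=
  [/\ measurable X,
      forall i, measurable_fun setT (chi i) /\ forall x, `|chi i x| <= 1 &
      forall F : T -> R, li m F -> (forall i, \int[m]_x (F x * chi i x) = 0) ->
        {ae m, forall x, X x -> F x = 0}].

(** For each second index the partial integral over [m2] vanishes almost everywhere on [X1], by the
    first family. Countability of the second index set provides one null set for all indices, and
    off it the second family applies to the slice. *)
Lemma sep_prod (d1 d2 : measure_display) (T1 : measurableType d1) (T2 : measurableType d2)
  (m1 : {sigma_finite_measure set T1 -> \bar R})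
  (m2 : {sigma_finite_measure set T2 -> \bar R}) X1 X2 (I1 I2 : countType)
  (chi1 : I1 -> T1 -> R) (chi2 : I2 -> T2 -> R) :
  sep m1 X1 chi1 -> sep m2 X2 chi2 ->
  sep (prodm m1 m2) (X1 `*` X2) (fun (i : I1 * I2) p => chi1 i.1 p.1 * chi2 i.2 p.2).
Proof.
move=> [mX1 c1 s1] [mX2 c2 s2]; split; first exact: measurableX.
  move=> [i j] /=; have [mi ib] := c1 i; have [mj jb] := c2 j; split.
    apply: measurable_funM; first exact: (measurableT_comp mi measurable_fst).
    exact: (measurableT_comp mj measurable_snd).
  by move=> p; rewrite normrM -[leRHS]mulr1 ler_pM.
move=> F Fi HF.
have mF := li_meas Fi.
have Fj j : li (prodm m1 m2) (fun p => F p * chi2 j p.2).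
  have [mj jb] := c2 j.
  exact: (li_bdd Fi (measurableT_comp mj measurable_snd) (fun p => jb p.2)).
have Z j : {ae m1, forall x, X1 x -> \int[m2]_y (F (x, y) * chi2 j y) = 0}.
  apply: s1; first exact: (li_int1 (Fj j)).
  move=> i; have [mi ib] := c1 i; have [mj jb] := c2 j.
  rewrite -(HF (i, j)) /= Rint_fubini1; last first.
    have := li_bdd (Fj j) (measurableT_comp mi measurable_fst) (fun p => ib p.1).
    by apply: eq_integrable => // p _ /=; congr EFin; ring.
  apply: Rint_ae.
  - by apply: measurable_funM => //; exact: li_meas (li_int1 (Fj j)).
  - apply: li_meas; apply: (@li_int1 _ _ _ _ _ m1 m2 (fun p => F p * (chi1 i p.1 * chi2 j p.2))).
    have := li_bdd (Fj j) (measurableT_comp mi measurable_fst) (fun p => ib p.1).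
    by apply: eq_integrable => // p _ /=; congr EFin; ring.
  - apply: filterS (ae_int1 (Fj j)) => x hx /=.
    rewrite -RintegralZr//; apply: eq_Rintegral => y _; ring.
apply: ae_prod_intro.
  rewrite [X in measurable X](_ : _ = ~` (X1 `*` X2) `|` (F @^-1` [set 0])).
    apply: measurableU; first by apply: measurableC; exact: measurableX.
    by rewrite -[_ @^-1` _]setTI; exact: mF.
  apply/seteqP; split=> p /=.
    by move=> h; case: (pselect ((X1 `*` X2) p)) => hp; [right; exact: h|left].
  by move=> [h1 h2//|//].
have := ae_countable Z.
apply: filterS2 (ae_int1 Fi) => x Fx Zx /=.
have [X1x|nX1] := pselect (X1 x); last by apply: aeW => y [].
have : {ae m2, forall y, X2 y -> F (x, y) = 0}.
  by apply: s2 => // j; exact: Zx.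
by apply: filterS => y h [_ /h].
Qed.

(** Approximate indicators of the rational subintervals of ]a, b[, hence a countable family. Indices
    whose endpoints are badly placed are sent to the zero function instead of being excluded. *)
Definition fam (a b : R) (i : rat * rat * nat) (t : R) : R :=
  bR R [&& a < ratr i.1.1, ratr i.1.1 < ratr i.1.2 :> R & ratr i.1.2 < b] *
  sig (ratr i.1.1) (ratr i.1.2) i.2 t.

Definition dfam (a b : R) (i : rat * rat * nat) (t : R) : R :=
  bR R [&& a < ratr i.1.1, ratr i.1.1 < ratr i.1.2 :> R & ratr i.1.2 < b] *
  dsig (ratr i.1.1) (ratr i.1.2) i.2 t.

Lemma tst_fam a b i : tst a b (fam a b i) (dfam a b i).
Proof.
case: i => -[q r] n; rewrite /fam /dfam /=.
case: (boolP [&& a < ratr q, ratr q < ratr r :> R & ratr r < b]) => h; last first.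
  rewrite /bR.
  have -> : (fun t : R => 0 * sig (ratr q) (ratr r) n t) = fun=> 0 by apply/funext => t; rewrite mul0r.
  have -> : (fun t : R => 0 * dsig (ratr q) (ratr r) n t) = fun=> 0 by apply/funext => t; rewrite mul0r.
  exact: tst0.
have [hC h0] := tst_sig (ratr q : R) (ratr r) n.
have /and3P[aq qr rb] := h.
rewrite /bR.
have -> : (fun t : R => 1 * sig (ratr q) (ratr r) n t) = sig (ratr q) (ratr r) n by apply/funext => t; rewrite mul1r.
have -> : (fun t : R => 1 * dsig (ratr q) (ratr r) n t) = dsig (ratr q) (ratr r) n by apply/funext => t; rewrite mul1r.
split=> // t ht; apply: h0; apply: contra ht => /andP[h1 h2].
by rewrite (lt_trans aq h1) (lt_trans h2 rb).
Qed.

Lemma fam_le1 a b i t : `|fam a b i t| <= 1.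
Proof. by rewrite /fam normrM -[leRHS]mulr1 ler_pM ?ind_le1 ?sig_norm. Qed.

Lemma cumE (f : R -> R) t : li (L1 R) f ->
  cum f t = \int[@lebesgue_measure R]_(s in `]-oo, t]) f s.
Proof.
move=> fi; rewrite /cum (Rint_mpres (mpres_leb R)); last exact: li_meas (li_cut t fi).
rewrite [RHS]Rintegral_mkcond; apply: eq_Rintegral => s _.
rewrite patchE.
have -> : (s \in [set` `]-oo, t]]) = (s <= t) by apply/idP/idP; rewrite inE /= in_itv.
by rewrite /=; case: (s <= t); rewrite /bR ?mulr1 ?mulr0.
Qed.

Lemma li_leb (f : R -> R) : li (L1 R) f -> (@lebesgue_measure R).-integrable setT (EFin \o f).
Proof. by move=> fi; exact: (integrable_mpres (mpres_leb R) fi). Qed.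

Lemma C1_cum (f : R -> R) : li (L1 R) f -> continuous f -> C1 (cum f) f.
Proof.
move=> fi cf; split=> // x.
have fK := li_leb fi.
pose P (x : R) := \int[@lebesgue_measure R]_(t in [set` `]-oo, x]]) f t.
have H : derivable P x 1 /\ (P^`())%classic x = f x.
  apply: (@continuous_FTC1 _ f -oo%O x (x + 1)); rewrite ?ltrDl//.
  - by apply: integrableS fK.
  - by rewrite ltNyr.
  - exact: cf.
have -> : cum f = P by apply/funext => t; exact: cumE.
apply: DeriveDef; first exact: H.1.
by rewrite -derive1E H.2.
Qed.

(** The cutoffs are bounded by one and converge to the indicator of ]a, b[; dominated convergence
    gives a vanishing integral over the interval. *)
Lemma cum_itv0 (F : R -> R) (a b : R) : a < b -> li (L1 R) F ->
  (forall n, \int[L1 R]_t (F t * sig a b n t) = 0) -> cum F b = cum F a.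
Proof.
move=> ab Fi H.
have mi : measurable_fun setT (fun t : R => bR R (a < t < b)).
  by apply: measurable_natb; apply: measurable_and; exact: measurable_fun_ltr.
have ms n : measurable_fun setT (sig a b n) by have [] := tst_meas (tst_sig a b n).
have mF := li_meas Fi.
have E : \int[L1 R]_t (F t * bR R (a < t < b)) = 0.
  have := @dominated_cvg _ _ _ (L1 R) setT measurableT
    (fun n t => (F t * sig a b n t)%:E) (fun t => (F t * bR R (a < t < b))%:E)
    (fun t => (`|F t|)%:E).
  have h1 n : measurable_fun setT (fun t : R => (F t * sig a b n t)%:E).
    by apply/measurable_EFinP; exact: measurable_funM.
  have h2 t : setT t -> (F t * sig a b n t)%:E @[n --> \oo] --> (F t * bR R (a < t < b))%:E.
    by move=> _; apply: cvg_EFin; [exact: nearW|apply: cvgM; [exact: cvg_cst|exact: sig_cvg]].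
  have h3 n t : setT t -> (`|(F t * sig a b n t)%:E| <= (`|F t|)%:E)%E.
    by move=> _; rewrite lee_fin normrM ler_piMr// sig_norm.
  move=> /(_ h1 h2 (fun _ _ => isT) (li_abs Fi) h3).
  rewrite (_ : (fun n => _) = cst 0%E); last first.
    apply/funext => n; rewrite RintE ?H//.
    exact: li_bdd Fi (ms n) (fun t => sig_norm _ _ _ _).
  move=> /cvg_lim => /(_ (@ereal_hausdorff R)); rewrite lim_cst; last exact: ereal_hausdorff.
  by rewrite /Rintegral => <-.
rewrite -[LHS]addr0 -E /cum.
have ca := li_cut a Fi; have cb := li_cut b Fi.
have ci : li (L1 R) (fun t => F t * bR R (a < t < b)).
  exact: li_bdd Fi mi (fun s => ind_le1 _ _).
apply/eqP; rewrite -subr_eq0 E addr0 -RintegralB//; apply/eqP; rewrite -E.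
apply: Rint_ae; first exact: li_meas (liB cb ca).
  exact: li_meas ci.
exists [set b]; split => //; first exact: L1_set1.
move=> t /= h; apply: contra_notP h => /eqP tb; rewrite -mulrBr; congr (_ * _).
rewrite /bR; case: (leP t b) => tb'; case: (leP t a) => ta /=.
- by rewrite subrr.
- by rewrite lt_neqAle tb tb' subr0.
- by move: (le_lt_trans ta ab); rewrite ltNge (ltW tb').
- by rewrite subrr ltNge (ltW tb').
Qed.

(** Orthogonality to the family makes the primitive of [F] constant on the rational points of ]a,
    b[, while at almost every point the primitive has derivative [F x]. These two facts are
    compatible only if [F x = 0]. *)
Lemma sep1 a b : a < b -> sep (L1 R) `]a, b[%classic (fam a b).
Proof.
move=> ab; split => //.
  move=> i; split; last exact: fam_le1.
  by have [] := tst_meas (tst_fam a b i).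
move=> F Fi HF.
have FK := li_leb Fi.
have cst (q r : rat) : a < ratr q -> ratr q < ratr r :> R -> ratr r < b ->
    cum F (ratr r) = cum F (ratr q).
  move=> aq qr rb; apply: cum_itv0 => // n.
  by rewrite -(HF (q, r, n)); apply: eq_Rintegral => t _; rewrite /fam /= aq qr rb mul1r.
have := @FTC1Ny R F.
have h1 y : (@lebesgue_measure R).-integrable `]-oo, y] (EFin \o F) by exact: integrableS FK.
have h2 : locally_integrable [set: R] F by exact: (open_integrable_locally openT FK).
move=> /(_ h1 h2) /ae1E; apply: filterS => x [dF Fx]; rewrite /= in_itv /= => /andP[ax xb].
have : is_derive x 1 (cum F) (F x).
  rewrite (_ : cum F = fun x : R => \int[@lebesgue_measure R]_(t in [set` `]-oo, x]]) F t); last first.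
    by apply/funext => t; exact: cumE.
  by apply: DeriveDef; [exact: dF|rewrite -derive1E].
rewrite is_derive1_caratheodory => -[g [gE gc gx]].
apply/eqP/negP => /negP Fn0.
have e0 : 0 < `|F x| by rewrite normr_gt0.
set e := `|F x| in e0.
have : \forall z \near x, `|g x - g z| < e / 2.
  by move/cvgrPdist_lt : gc; apply; rewrite divr_gt0.
rewrite gx => /nbhs_ballP[dl /= dl0 Hdl].
pose D := Num.min dl (b - x).
have D0 : 0 < D by rewrite lt_min dl0 subr_gt0.
have Ddl : D <= dl by rewrite ge_min lexx.
have Db : D <= b - x by rewrite ge_min lexx orbT.
(* Both rational points lie to the right of [x], one within [D / 8] and the other beyond [D / 2].
   The increments of the primitive from [x] agree, yet the first is below [3/16 e D] and the second
   above [1/4 e D]. *)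
have [q1] : exists q : rat, ratr q \in `]x, x + D / 8[ by apply: rat_in_itvoo; lra.
have [q2] : exists q : rat, ratr q \in `]x + D / 2, x + D[ by apply: rat_in_itvoo; lra.
rewrite !in_itv /= => /andP[h21 h22] /andP[h11 h12].
set z1 : R := ratr q1 in h11 h12; set z2 : R := ratr q2 in h21 h22.
have E : cum F z2 = cum F z1 by apply: cst; lra.
have B1 : `|F x - g z1| < e / 2.
  by apply: Hdl; rewrite /ball /= ltr_norml; apply/andP; split; lra.
have B2 : `|F x - g z2| < e / 2.
  by apply: Hdl; rewrite /ball /= ltr_norml; apply/andP; split; lra.
have G1 := gE z1; have G2 := gE z2.
have K : g z1 * (z1 - x) = g z2 * (z2 - x) by rewrite -G1 -G2 E.
have N1 : `|g z1| < 3 / 2 * e.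
  have := ler_normB (F x) (F x - g z1); rewrite (_ : F x - (F x - g z1) = g z1); last by ring.
  by rewrite -/e; lra.
have N2 : e / 2 < `|g z2|.
  have := ler_normD (g z2) (F x - g z2); rewrite (_ : g z2 + (F x - g z2) = F x); last by ring.
  by rewrite -/e; lra.
have K' : `|g z1| * (z1 - x) = `|g z2| * (z2 - x).
  rewrite -[z1 - x]ger0_norm; last by lra.
  rewrite -[z2 - x]ger0_norm; last by lra.
  by rewrite -!normrM K.
nra.
Qed.

(* Primitive of [fam a b i] minus its mean times a fixed bmp, so that it
   vanishes at both ends. *)
Definition dth (a b : R) i t : R := fam a b i t -
  (\int[L1 R]_s fam a b i s) / (\int[L1 R]_s sig a b 1 s) * sig a b 1 t.
Definition th (a b : R) i : R -> R := cum (dth a b i).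

Lemma int_sig_gt0 a b : a < b -> 0 < \int[L1 R]_s sig a b 1 s.
Proof.
move=> ab; have [si _] := tst_li (tst_sig a b 1).
have s0 t : 0 <= sig a b 1 t by have /andP[] := sig_bound a b 1 t.
rewrite lt_neqAle; apply/andP; split; last by apply: Rintegral_ge0.
apply/eqP => I0.
have : ae_eq (L1 R) setT (EFin \o sig a b 1) (cst 0%E).
  have mE : measurable_fun setT (EFin \o sig a b 1) by apply/measurable_EFinP; exact: li_meas si.
  apply/(ae_eq_integral_abs (L1 R) measurableT mE).
  transitivity (\int[L1 R]_s (sig a b 1 s)%:E)%E; last by rewrite RintE// -I0.
  by apply: eq_integral => t _; rewrite /= ger0_norm.
move=> [N [mN N0 PN]].
have : (L1 R `]a, b[%classic <= L1 R N)%E.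
  apply: le_measure; rewrite ?inE// => t; rewrite /= in_itv /= => tab.
  apply: PN => /= /(_ I) [] /eqP; apply/negP.
  have b0 := bmp_gt0 tab.
  rewrite gt_eqF// /sig mul1r subr_gt0.
  have p0 := pos_ge0 (1 - bmp a b t).
  have p1 : pos (1 - bmp a b t) < 1.
    case: (leP 0 (1 - bmp a b t)) => h; last by rewrite pos_0// ltW.
    by rewrite pos_id// gtrBl.
  by rewrite expr_lt1.
by rewrite N0 (L1_itv _ _ (ltW ab)) lee_fin subr_le0 leNgt ab.
Qed.

Lemma tst_th a b i : a < b -> tst a b (th a b i) (dth a b i).
Proof.
move=> ab.
have tf := tst_fam a b i; have ts := tst_sig a b 1.
have [fi _] := tst_li tf; have [si _] := tst_li ts.
have ti : li (L1 R) (dth a b i) by apply: liB => //; exact: liZ.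
have t0 t : ~~ (a < t < b) -> dth a b i t = 0.
  by move=> h; rewrite /dth (tf.2 _ h).1 (ts.2 _ h).1 mulr0 subr0.
split.
  apply: C1_cum => // t; apply: cvgB; first exact: (C1_cont tf.1).
  by apply: cvgM; [exact: cvg_cst|exact: (C1_cont ts.1)].
move=> t h; split; last exact: t0.
move: h; rewrite negb_and -!leNgt => /orP[ta|bt].
  rewrite /th /cum (_ : (fun s => _) = fun=> 0).
    by rewrite Rintegral_cst// mul0r.
  apply/funext => s; case: (leP s t) => st; last by rewrite /bR mulr0.
  by rewrite t0 ?mul0r// negb_and -!leNgt (le_trans st ta).
have -> : th a b i t = \int[L1 R]_s dth a b i s.
  apply: eq_Rintegral => s _; case: (leP s t) => st; first by rewrite /bR mulr1.
  by rewrite t0 ?mul0r// negb_and -!leNgt (le_trans bt (ltW st)) orbT.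
rewrite /dth RintegralB//; last exact: liZ.
by rewrite (RintegralZl _ measurableT si) divfK ?subrr// gt_eqF// int_sig_gt0.
Qed.

(** The lemma of du Bois-Reymond. After integration by parts, [U - cum G] is orthogonal to every
    [dth], that is, to every member of the separating family corrected to have mean zero; so it
    equals its weighted mean almost everywhere on ]a, b[. *)
Lemma ac_rep a b (U G : R -> R) : a < b -> li (L1 R) U -> li (L1 R) G ->
  (forall i, \int[L1 R]_t (U t * dth a b i t + G t * th a b i t) = 0) ->
  exists c, {ae (L1 R), forall t, a < t < b -> U t = c + cum G t}.
Proof.
move=> ab Ui Gi H.
pose W t := U t - cum G t.
pose K := \int[L1 R]_s sig a b 1 s.
have K0 : 0 < K by exact: int_sig_gt0.
have [si _] := tst_li (tst_sig a b 1).
have mcG := measurable_cum Gi.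
have ms := li_meas si.
have Wf f C : li (L1 R) f -> (forall t, `|f t| <= C) -> li (L1 R) (fun t => W t * f t).
  move=> fi fC; have h1 := li_bdd Ui (li_meas fi) fC.
  have h2 := li_bdd fi mcG (fun t => cum_bound t Gi).
  have := liB h1 h2; apply: eq_integrable => // t _ /=; congr EFin; rewrite /W; ring.
have Wsi := Wf _ _ si (fun t => sig_norm a b 1 t).
pose C := (\int[L1 R]_t (W t * sig a b 1 t)) / K.
exists C.
pose F t := (W t - C) * bR R (a < t < b).
have mi : measurable_fun setT (fun t : R => bR R (a < t < b)).
  by apply: measurable_natb; apply: measurable_and; exact: measurable_fun_ltr.
have ii : li (L1 R) (fun t : R => bR R (a < t < b)).
  apply: (@li_bdd_itv _ a b _ 1) => // [t|t /negbTE ->]; first exact: ind_le1.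
  by rewrite /bR.
have Fi : li (L1 R) F.
  have h1 := Wf _ 1 ii (fun t => ind_le1 _ _).
  have := liB h1 (liZ C ii); apply: eq_integrable => // t _ /=; congr EFin; rewrite /F; ring.
have [_ _ s1] := sep1 ab.
have : {ae (L1 R), forall t, `]a, b[%classic t -> F t = 0}.
  apply: s1 => // i.
  have tf := tst_fam a b i; have [fi _] := tst_li tf.
  have Wfi := Wf _ _ fi (fun t => fam_le1 a b i t).
  have ti : li (L1 R) (dth a b i) by apply: liB => //; exact: liZ.
  pose mm := (\int[L1 R]_s fam a b i s) / K.
  have [thi _] := tst_li (tst_th i ab).
  have [B _ HB] := tst_bdd (tst_th i ab).
  have E1 : \int[L1 R]_t (W t * dth a b i t) = 0.
    rewrite -(H i).
    (* The integral of [dth] is zero, so integrating by parts against [G] leaves no boundary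
       term. *)
    have := cum_mul0 ti Gi.
    have [[_ _] t0] := tst_th i ab.
    have -> : \int[L1 R]_s dth a b i s = 0.
      rewrite /dth RintegralB//; last exact: liZ.
      by rewrite (RintegralZl _ measurableT si) divfK ?subrr// gt_eqF.
    rewrite mul0r => /esym/eqP; rewrite addr_eq0 => /eqP E2.
    have u1 := li_bdd Ui (li_meas ti) (fun t => (HB t).2).
    have u2 := li_bdd Gi (li_meas thi) (fun t => (HB t).1).
    have u3 := li_mulcum Gi ti.
    rewrite RintegralD// [X in _ + X]E2 -RintegralB//.
    by apply: eq_Rintegral => t _; rewrite /W; ring.
  have E3 : \int[L1 R]_t (W t * fam a b i t) = mm * \int[L1 R]_t (W t * sig a b 1 t).
    apply/eqP; rewrite -subr_eq0 -RintegralZl// -RintegralB//; last exact: liZ.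
    apply/eqP; rewrite -[RHS]E1; apply: eq_Rintegral => t _; rewrite /dth -/K -/mm; ring.
  transitivity (\int[L1 R]_t (W t * fam a b i t - C * fam a b i t)).
    apply: eq_Rintegral => t _; rewrite /F.
    case: (boolP (a < t < b)) => h; first by rewrite /bR mulr1 mulrBl.
    by rewrite (tf.2 _ h).1 !mulr0 subrr.
  rewrite RintegralB//; last exact: liZ.
  by rewrite RintegralZl// E3 /C /mm; field; rewrite gt_eqF.
apply: filterS => t /= h tab; have := h _; rewrite in_itv /= tab => /(_ isT).
rewrite /F tab /bR mulr1 /W => /eqP; rewrite subr_eq0 => /eqP <-; ring.
Qed.

(** The variables separate: for each of the countably many functions [dth] and [th], the slice
    identity holds for almost every [z] in [X] by the separating family of the base. Off a common
    null set [ac_rep] applies to the slice. *)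
Lemma line_rep (d : measure_display) (T : measurableType d)
  (m : {sigma_finite_measure set T -> \bar R}) X (I : countType) (chi : I -> T -> R)
  (a b : R) (u g : T * R -> R) : a < b -> sep m X chi ->
  li (prodm m (L1 R)) u -> li (prodm m (L1 R)) g ->
  (forall i f f', tst a b f f' ->
    \int[prodm m (L1 R)]_p ((u p * f' p.2 + g p * f p.2) * chi i p.1) = 0) ->
  {ae m, forall z, X z -> li (L1 R) (fun t => g (z, t)) /\
    exists c, {ae (L1 R), forall t, a < t < b -> u (z, t) = c + cum (fun t => g (z, t)) t}}.
Proof.
move=> ab [mX c1 s1] ui gi H.
have Zi j : li (prodm m (L1 R)) (fun p => u p * dth a b j p.2 + g p * th a b j p.2).
  have [B _ HB] := tst_bdd (tst_th j ab); have [mt mt'] := tst_meas (tst_th j ab).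
  apply: liD.
    exact: (li_bdd ui (measurableT_comp mt' measurable_snd) (fun p => (HB p.2).2)).
  exact: (li_bdd gi (measurableT_comp mt measurable_snd) (fun p => (HB p.2).1)).
have Z j : {ae m, forall z, X z ->
    \int[L1 R]_t (u (z, t) * dth a b j t + g (z, t) * th a b j t) = 0}.
  apply: s1; first exact: (li_int1 (Zi j)).
  move=> i; rewrite -(H i _ _ (tst_th j ab)).
  have [mi ib] := c1 i.
  have Ci := li_bdd (Zi j) (measurableT_comp mi measurable_fst) (fun p => ib p.1).
  rewrite Rint_fubini1//.
  apply: Rint_ae.
  - by apply: measurable_funM => //; exact: li_meas (li_int1 (Zi j)).
  - exact: li_meas (li_int1 Ci).
  - by apply: filterS (ae_int1 (Zi j)) => x hx /=; rewrite -RintegralZr.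
have := ae_countable Z.
apply: filterS3 (ae_int1 ui) (ae_int1 gi) => z uz gz Zz Xz; split => //.
by apply: ac_rep => // i; exact: Zz.
Qed.
End sep.

(** * Weak gradients tested on products, and their restriction to coordinate lines *)

Section pw.
Variable R : realType.
Local Notation mu := (L1 R).
Local Notation L4 := (L4 R).
Local Notation L3 := (L3 R).
Local Notation R4 := (R3R R).

(** The open period cell, which differs from that of [FD] by a null set and is where test functions
    with support in the cell live. *)
Definition iT (y : R) : R := bR R (0 < y < 2 * pi).
Definition iB (n : nat) (x : R) : R := bR R (- n%:R < x < n%:R).
Definition tprod (f1 f2 f3 f4 : R -> R) (p : R4) : R :=
  f1 p.1.1.1 * f2 p.1.1.2 * f3 p.1.2 * f4 p.2.
Definition ibox n : R4 -> R := tprod (iB n) (iB n) (iB n) iT.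

Definition dprod (i : nat) (f1 f1' f2 f2' f3 f3' f4 f4' : R -> R) : R4 -> R :=
  if i == 0 then tprod f1' f2 f3 f4 else if i == 1 then tprod f1 f2' f3 f4
  else if i == 2 then tprod f1 f2 f3' f4 else tprod f1 f2 f3 f4'.

(* Weak gradient on R^3 x ]0, 2pi[ tested against product functions. *)
Definition PW (u : R4 -> R) (g : 'I_4 -> R4 -> R) :=
  [/\ measurable_fun setT u, forall i, measurable_fun setT (g i),
      li L4 (fun p => u p ^+ 2 * iT p.2), forall i, li L4 (fun p => g i p ^+ 2 * iT p.2) &
      forall (i : 'I_4) (n : nat) f1 f1' f2 f2' f3 f3' f4 f4',
        tst (- n%:R) n%:R f1 f1' -> tst (- n%:R) n%:R f2 f2' ->
        tst (- n%:R) n%:R f3 f3' -> tst 0 (2 * pi) f4 f4' ->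
        \int[L4]_p (u p * dprod i f1 f1' f2 f2' f3 f3' f4 f4' p +
                    g i p * tprod f1 f2 f3 f4 p) = 0].

Lemma pi2_gt0 : 0 < 2 * pi :> R.
Proof. by rewrite mulr_gt0// pi_gt0. Qed.

Lemma measurable_bitv (a b : R) : measurable_fun setT (fun t : R => bR R (a < t < b)).
Proof. by apply: measurable_natb; apply: measurable_and; exact: measurable_fun_ltr. Qed.

Lemma measurable_iT : measurable_fun setT iT. Proof. exact: measurable_bitv. Qed.

Lemma li_bitv (a b : R) : li mu (fun t : R => bR R (a < t < b)).
Proof.
apply: (@li_bdd_itv _ a b _ 1); first exact: measurable_bitv.
  by move=> t; exact: ind_le1.
by move=> t /negbTE ->; rewrite /bR.
Qed.

Lemma bR01 b : 0 <= bR R b <= 1.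
Proof. by case: b; rewrite /bR/= ler01 lexx. Qed.

Lemma bR_sq b : bR R b * bR R b = bR R b.
Proof. by case: b; rewrite /bR ?mulr1 ?mulr0. Qed.

Lemma m_x1 : measurable_fun setT (fun p : R4 => p.1.1.1).
Proof. exact: (measurableT_comp measurable_fst (measurableT_comp measurable_fst measurable_fst)). Qed.

Lemma m_x2 : measurable_fun setT (fun p : R4 => p.1.1.2).
Proof. exact: (measurableT_comp measurable_snd (measurableT_comp measurable_fst measurable_fst)). Qed.

Lemma m_x3 : measurable_fun setT (fun p : R4 => p.1.2).
Proof. exact: (measurableT_comp measurable_snd measurable_fst). Qed.

Lemma measurable_tprod f1 f2 f3 f4 : measurable_fun setT f1 -> measurable_fun setT f2 ->
  measurable_fun setT f3 -> measurable_fun setT f4 -> measurable_fun setT (tprod f1 f2 f3 f4).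
Proof.
move=> h1 h2 h3 h4; rewrite /tprod.
apply: measurable_funM; [apply: measurable_funM; [apply: measurable_funM|]|].
- exact: (measurableT_comp h1 m_x1).
- exact: (measurableT_comp h2 m_x2).
- exact: (measurableT_comp h3 m_x3).
- exact: (measurableT_comp h4 measurable_snd).
Qed.

Lemma li_tprod f1 f2 f3 f4 : li mu f1 -> li mu f2 -> li mu f3 -> li mu f4 ->
  li L4 (tprod f1 f2 f3 f4).
Proof. by move=> h1 h2 h3 h4; exact: (prod_li (prod_li (prod_li h1 h2) h3) h4). Qed.

Lemma li_ibox n : li L4 (ibox n).
Proof. by apply: li_tprod; exact: li_bitv. Qed.

Lemma ibox01 n p : 0 <= ibox n p <= 1.
Proof.
rewrite /ibox /tprod /iB /iT.
move: (_ < _ < _) (_ < _ < _) (_ < _ < _) (_ < _ < _) => [] [] [] [];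
  by rewrite /bR ?(mulr0, mul0r, mulr1) ?lexx ?ler01.
Qed.

Lemma ibox_iT n p : ibox n p * iT p.2 = ibox n p.
Proof. by rewrite /ibox /tprod /iT -!mulrA bR_sq. Qed.

(** On a box of finite measure, [|u| <= u^2 + 1]. *)
Lemma li_boxed n (u : R4 -> R) : measurable_fun setT u ->
  li L4 (fun p => u p ^+ 2 * iT p.2) -> li L4 (fun p => u p * ibox n p).
Proof.
move=> mu' ui; have bi := li_ibox n.
apply: (li_le (g := fun p => u p ^+ 2 * iT p.2 + ibox n p)); last exact: liD.
  by apply: measurable_funM => //; exact: li_meas bi.
move=> p; have /andP[b0 b1] := ibox01 n p.
rewrite -(ibox_iT n p) mulrA normrM [`|iT _|]ger0_norm; last by have /andP[] := bR01 (0 < p.2 < 2 * pi).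
have /andP[t0 t1] : 0 <= iT p.2 <= 1 by exact: bR01.
rewrite normrM [`|ibox _ _|]ger0_norm//.
have h : `|u p| <= u p ^+ 2 + 1.
  rewrite -(real_normK (num_real (u p))); move: (`|u p|) (normr_ge0 (u p)) => x x0; nra.
have bt := mulr_ge0 b0 t0.
apply: (@le_trans _ _ ((u p ^+ 2 + 1) * (ibox n p * iT p.2))).
  by rewrite -mulrA ler_wpM2r// mulr_ge0.
rewrite mulrDl mul1r lerD2r mulrCA mulrC.
by rewrite ler_piMr// mulr_ge0// sqr_ge0.
Qed.

(** The involutions [sw1], [sw2], [sw3] exchange one x-coordinate with y, so that every direction
    can be moved to the last factor, where [line_rep] operates. *)
Definition sw1 (p : R4) : R4 := (((p.2, p.1.1.2), p.1.2), p.1.1.1).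
Definition sw2 (p : R4) : R4 := (((p.1.1.1, p.2), p.1.2), p.1.1.2).
Definition sw3 (p : R4) : R4 := ((p.1.1, p.2), p.1.2).

Lemma mpres_sw3 : mpres L4 L4 sw3.
Proof. exact: (mpres_swap23 (L2 R) mu mu). Qed.

Lemma mpres_sw2 : mpres L4 L4 sw2.
Proof.
have h := mpres_map1 mu (mpres_swap23 mu mu mu).
exact: (mpres_comp (mpres_comp h mpres_sw3) h).
Qed.

Lemma mpres_sw1 : mpres L4 L4 sw1.
Proof.
have h := mpres_map1 mu (mpres_map1 mu (mpres_swap mu mu)).
exact: (mpres_comp (mpres_comp h mpres_sw2) h).
Qed.

Lemma sep_box a1 b1 a2 b2 a3 b3 : a1 < b1 -> a2 < b2 -> a3 < b3 ->
  sep L3 (`]a1, b1[%classic `*` `]a2, b2[%classic `*` `]a3, b3[%classic)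
    (fun (i : (rat * rat * nat) * (rat * rat * nat) * (rat * rat * nat)) (z : R3 R) =>
       fam a1 b1 i.1.1 z.1.1 * fam a2 b2 i.1.2 z.1.2 * fam a3 b3 i.2 z.2).
Proof. by move=> h1 h2 h3; exact: (sep_prod (sep_prod (sep1 h1) (sep1 h2)) (sep1 h3)). Qed.

Lemma iB_fam n (f f' : R -> R) : tst (- n%:R) n%:R f f' -> forall t, iB n t * f t = f t /\ iB n t * f' t = f' t.
Proof.
move=> tf t; rewrite /iB; case: (boolP (- n%:R < t < n%:R)) => h; first by rewrite /bR !mul1r.
by have [-> ->] := tf.2 _ h; rewrite !mulr0.
Qed.

Lemma iT_fam (f f' : R -> R) : tst 0 (2 * pi) f f' -> forall t, iT t * f t = f t /\ iT t * f' t = f' t.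
Proof.
move=> tf t; rewrite /iT; case: (boolP (0 < t < 2 * pi)) => h; first by rewrite /bR !mul1r.
by have [-> ->] := tf.2 _ h; rewrite !mulr0.
Qed.

(** Truncation to the box is invisible to products of functions that are supported in the box. *)
Lemma box_alg (U G i1 i2 i3 i4 F1 F2 F3 f f' j P X Y : R) :
  i1 * F1 = F1 -> i2 * F2 = F2 -> i3 * F3 = F3 -> i4 * f = f -> i4 * f' = f' ->
  j = i1 * i2 * i3 * i4 -> P = F1 * F2 * F3 -> X = F1 * F2 * F3 * f' ->
  Y = F1 * F2 * F3 * f -> (U * j * f' + G * j * f) * P = U * X + G * Y.
Proof.
move=> e1 e2 e3 e4 e5 -> -> -> ->.
transitivity (U * ((i1 * F1) * (i2 * F2) * (i3 * F3) * (i4 * f')) +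
              G * ((i1 * F1) * (i2 * F2) * (i3 * F3) * (i4 * f))); first by ring.
by rewrite e1 e2 e3 e4 e5.
Qed.

(** Square integrability gives integrability only locally, hence the truncation to a box: the
    truncated functions are integrable, and product tests supported in the box do not notice it. *)
Lemma line_y u g n : PW u g -> (0 < n)%N ->
  {ae L3, forall z : R3 R, (`](- n%:R), n%:R[%classic `*` `](- n%:R), n%:R[%classic `*` `](- n%:R), n%:R[%classic) z ->
    li mu (fun t => g iy (z, t) * ibox n (z, t)) /\
    exists c, {ae mu, forall t, 0 < t < 2 * pi ->
      u (z, t) * ibox n (z, t) = c + cum (fun t => g iy (z, t) * ibox n (z, t)) t}}.
Proof.
move=> [mu' mg ui gi W] n0.
have nn : - n%:R < n%:R :> R by rewrite gtrN// ltr0n.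
have bu := li_boxed n mu' ui; have bg := li_boxed n (mg iy) (gi iy).
apply: (line_rep pi2_gt0 (sep_box nn nn nn) bu bg) => i f f' tf.
rewrite -(W iy n _ _ _ _ _ _ _ _ (tst_fam _ _ i.1.1) (tst_fam _ _ i.1.2) (tst_fam _ _ i.2) tf).
apply: eq_Rintegral => p _; rewrite /dprod /= /ibox /tprod.
have [e1 _] := iB_fam (tst_fam (- n%:R) n%:R i.1.1) p.1.1.1.
have [e2 _] := iB_fam (tst_fam (- n%:R) n%:R i.1.2) p.1.1.2.
have [e3 _] := iB_fam (tst_fam (- n%:R) n%:R i.2) p.1.2.
have [e4 e4'] := iT_fam tf p.2.
by refine (@box_alg _ _ _ _ _ _ _ _ _ _ _ _ _ _ _ e1 e2 e3 e4 e4' _ _ _ _); ring.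
Qed.

(** As for [line_y] after the exchange [sw1]: the direction of differentiation becomes the last
    factor, and the period cell becomes a side of the base. The other two x-directions follow the
    same pattern. *)
Lemma line_x1 u g n : PW u g -> (0 < n)%N ->
  {ae L3, forall z : R3 R, (`]0, (2 * pi)[%classic `*` `](- n%:R), n%:R[%classic `*` `](- n%:R), n%:R[%classic) z ->
    li mu (fun t => g (@Ordinal 4 0 isT) (sw1 (z, t)) * ibox n (sw1 (z, t))) /\
    exists c, {ae mu, forall t, - n%:R < t < n%:R ->
      u (sw1 (z, t)) * ibox n (sw1 (z, t)) =
      c + cum (fun t => g (@Ordinal 4 0 isT) (sw1 (z, t)) * ibox n (sw1 (z, t))) t}}.
Proof.
move=> [mu' mg ui gi W] n0.
have nn : - n%:R < n%:R :> R by rewrite gtrN// ltr0n.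
have bu := li_boxed n mu' ui; have bg := li_boxed n (mg (@Ordinal 4 0 isT)) (gi (@Ordinal 4 0 isT)).
apply: (line_rep nn (sep_box pi2_gt0 nn nn) (li_mpres mpres_sw1 bu) (li_mpres mpres_sw1 bg)) => i f f' tf.
have H := W (@Ordinal 4 0 isT) n _ _ _ _ _ _ _ _ tf (tst_fam _ _ i.1.2) (tst_fam _ _ i.2) (tst_fam _ _ i.1.1).
rewrite -[RHS]H (Rint_mpres mpres_sw1); last first.
  have [mf mf'] := tst_meas tf.
  have mfam a b j : measurable_fun setT (@fam R a b j) by have [] := tst_meas (tst_fam a b j).
  by apply: measurable_funD; apply: measurable_funM => //; exact: measurable_tprod.
apply: eq_Rintegral => p _; rewrite /dprod /= /ibox /tprod /sw1 /=.
have [e1 e1'] := iB_fam tf p.2.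
have [e2 _] := iB_fam (tst_fam (- n%:R) n%:R i.1.2) p.1.1.2.
have [e3 _] := iB_fam (tst_fam (- n%:R) n%:R i.2) p.1.2.
have [e4 _] := iT_fam (tst_fam 0 (2 * pi) i.1.1) p.1.1.1.
by refine (@box_alg _ _ _ _ _ _ _ _ _ _ _ _ _ _ _ e4 e2 e3 e1 e1' _ _ _ _); ring.
Qed.

Lemma line_x2 u g n : PW u g -> (0 < n)%N ->
  {ae L3, forall z : R3 R, (`](- n%:R), n%:R[%classic `*` `]0, (2 * pi)[%classic `*` `](- n%:R), n%:R[%classic) z ->
    li mu (fun t => g (@Ordinal 4 1 isT) (sw2 (z, t)) * ibox n (sw2 (z, t))) /\
    exists c, {ae mu, forall t, - n%:R < t < n%:R ->
      u (sw2 (z, t)) * ibox n (sw2 (z, t)) =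
      c + cum (fun t => g (@Ordinal 4 1 isT) (sw2 (z, t)) * ibox n (sw2 (z, t))) t}}.
Proof.
move=> [mu' mg ui gi W] n0.
have nn : - n%:R < n%:R :> R by rewrite gtrN// ltr0n.
have bu := li_boxed n mu' ui; have bg := li_boxed n (mg (@Ordinal 4 1 isT)) (gi (@Ordinal 4 1 isT)).
apply: (line_rep nn (sep_box nn pi2_gt0 nn) (li_mpres mpres_sw2 bu) (li_mpres mpres_sw2 bg)) => i f f' tf.
have H := W (@Ordinal 4 1 isT) n _ _ _ _ _ _ _ _ (tst_fam _ _ i.1.1) tf (tst_fam _ _ i.2) (tst_fam _ _ i.1.2).
rewrite -[RHS]H (Rint_mpres mpres_sw2); last first.
  have [mf mf'] := tst_meas tf.
  have mfam a b j : measurable_fun setT (@fam R a b j) by have [] := tst_meas (tst_fam a b j).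
  by apply: measurable_funD; apply: measurable_funM => //; exact: measurable_tprod.
apply: eq_Rintegral => p _; rewrite /dprod /= /ibox /tprod /sw2 /=.
have [e1 e1'] := iB_fam tf p.2.
have [e2 _] := iB_fam (tst_fam (- n%:R) n%:R i.1.1) p.1.1.1.
have [e3 _] := iB_fam (tst_fam (- n%:R) n%:R i.2) p.1.2.
have [e4 _] := iT_fam (tst_fam 0 (2 * pi) i.1.2) p.1.1.2.
by refine (@box_alg _ _ _ _ _ _ _ _ _ _ _ _ _ _ _ e4 e2 e3 e1 e1' _ _ _ _); ring.
Qed.

Lemma line_x3 u g n : PW u g -> (0 < n)%N ->
  {ae L3, forall z : R3 R, (`](- n%:R), n%:R[%classic `*` `](- n%:R), n%:R[%classic `*` `]0, (2 * pi)[%classic) z ->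
    li mu (fun t => g (@Ordinal 4 2 isT) (sw3 (z, t)) * ibox n (sw3 (z, t))) /\
    exists c, {ae mu, forall t, - n%:R < t < n%:R ->
      u (sw3 (z, t)) * ibox n (sw3 (z, t)) =
      c + cum (fun t => g (@Ordinal 4 2 isT) (sw3 (z, t)) * ibox n (sw3 (z, t))) t}}.
Proof.
move=> [mu' mg ui gi W] n0.
have nn : - n%:R < n%:R :> R by rewrite gtrN// ltr0n.
have bu := li_boxed n mu' ui; have bg := li_boxed n (mg (@Ordinal 4 2 isT)) (gi (@Ordinal 4 2 isT)).
apply: (line_rep nn (sep_box nn nn pi2_gt0) (li_mpres mpres_sw3 bu) (li_mpres mpres_sw3 bg)) => i f f' tf.
have H := W (@Ordinal 4 2 isT) n _ _ _ _ _ _ _ _ (tst_fam _ _ i.1.1) (tst_fam _ _ i.1.2) tf (tst_fam _ _ i.2).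
rewrite -[RHS]H (Rint_mpres mpres_sw3); last first.
  have [mf mf'] := tst_meas tf.
  have mfam a b j : measurable_fun setT (@fam R a b j) by have [] := tst_meas (tst_fam a b j).
  by apply: measurable_funD; apply: measurable_funM => //; exact: measurable_tprod.
apply: eq_Rintegral => p _; rewrite /dprod /= /ibox /tprod /sw3 /=.
have [e1 e1'] := iB_fam tf p.2.
have [e2 _] := iB_fam (tst_fam (- n%:R) n%:R i.1.1) p.1.1.1.
have [e3 _] := iB_fam (tst_fam (- n%:R) n%:R i.1.2) p.1.1.2.
have [e4 _] := iT_fam (tst_fam 0 (2 * pi) i.2) p.1.2.
by refine (@box_alg _ _ _ _ _ _ _ _ _ _ _ _ _ _ _ e4 e2 e3 e1 e1' _ _ _ _); ring.
Qed.
End pw.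

(** * Gagliardo-Nirenberg and Poincare inequalities *)

Section lines.
Variable R : realType.
Local Notation mu := (L1 R).

Lemma Rint_le_ae (d : measure_display) (T : measurableType d)
  (m : {measure set T -> \bar R}) (f g : T -> R) : li m f -> li m g ->
  {ae m, forall x, f x <= g x} -> \int[m]_x f x <= \int[m]_x g x.
Proof.
move=> fi gi fg; have mf := li_meas fi; have mg := li_meas gi.
have mM : measurable_fun setT (fun x => Num.max (f x) (g x)) by exact: measurable_maxr.
have Mi : li m (fun x => Num.max (f x) (g x)).
  apply: (li_le (g := fun x => `|f x| + `|g x|)) => //; last by apply: liD; exact: li_abs.
  by move=> x; case: (leP (f x) (g x)) => _; rewrite ?lerDr ?lerDl.
apply: (@le_trans _ _ (\int[m]_x Num.max (f x) (g x))).
  by apply: Rint_le => // x; rewrite le_max lexx.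
rewrite (Rint_ae mM mg)//; move: fg; apply: filterS => x h; exact: max_r.
Qed.

Lemma int_bitv (a b : R) : a <= b -> \int[mu]_t bR R (a < t < b) = b - a.
Proof.
move=> ab; rewrite /Rintegral.
have -> : (\int[mu]_t (bR R (a < t < b))%:E = \int[mu]_t (\1_(`]a, b[%classic) t)%:E)%E.
  apply: eq_integral => t _; rewrite indicE /bR; congr (_ %:R)%:E.
  have [h|h] := boolP (a < t < b).
    by rewrite mem_set//= in_itv.
  by rewrite memNset//= in_itv /= (negbTE h).
rewrite integral_indic// setIT; exact: (congr1 fine (@L1_itv _ a b false true ab)).
Qed.

(** Decay at infinity is extracted from square integrability. If [|u t|^3] exceeded the integral [k]
    on the right, then by [ac_cube_bound] the function [u^2] would be bounded below by a fixed
    positive number almost everywhere on arbitrarily long intervals. *)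
Lemma cube_line (n0 : nat) (u g : R -> R) : measurable_fun setT u -> measurable_fun setT g ->
  li mu (fun t => u t ^+ 2) ->
  (forall n, (n0 <= n)%N -> li mu (fun t => g t * iB n t) /\
     exists c, {ae mu, forall t, - n%:R < t < n%:R ->
       u t * iB n t = c + cum (fun t => g t * iB n t) t}) ->
  {ae mu, forall t, ((`|u t| ^+ 3)%:E <= \int[mu]_s (3 * (u s ^+ 2 * `|g s|))%:E)%E}.
Proof.
move=> mu' mg u2 H.
have mug : measurable_fun setT (fun s => 3 * (u s ^+ 2 * `|g s|)).
  apply: measurable_funM => //; apply: measurable_funM; first exact: measurable_funX.
  exact: measurableT_comp.
have ug0 s : 0 <= 3 * (u s ^+ 2 * `|g s|) by rewrite mulr_ge0// mulr_ge0// sqr_ge0.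
case: (boolP (\int[mu]_s (3 * (u s ^+ 2 * `|g s|))%:E == +oo)%E) => [/eqP ->|Kfin].
  by apply: aeW => t; rewrite leey.
have Ki : li mu (fun s => 3 * (u s ^+ 2 * `|g s|)).
  by apply/(li_ge0P mu mug ug0); rewrite ltey.
rewrite RintE//; set k := \int[mu]_s _.
(* The minimum with 1 bounds [u s ^+ 2] from below in both cases: where [|u s| >= 1] the square is
   at least 1, and where [|u s| < 1] it is at least the cube. *)
have : {ae mu, forall t, forall n, (n0 <= n)%N -> - n%:R < t < n%:R ->
    \int[mu]_s (u s ^+ 2) >= (2 * n%:R) * Num.min 1 (`|u t| ^+ 3 - k)}.
  apply: ae_countable => n.
  case: (leqP n0 n) => n0n; last by apply: aeW.
  have [Gi [c Hc]] := H n n0n.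
  pose G t := g t * iB n t; pose U t := c + cum G t.
  have aU : ac U G by split => //; exists c.
  have mU := ac_meas aU; have [C UC] := ac_bdd aU.
  have UG2 : li mu (fun x => U x ^+ 2 * `|G x|).
    have := li_bdd (C := C ^+ 2) (li_abs Gi) (measurable_funX 2 mU) _.
    move=> /(_ _)/= h; rewrite (_ : (fun x => _) = fun x => `|G x| * U x ^+ 2); last first.
      by apply/funext => x; rewrite mulrC.
    apply: h => x; rewrite normrX lerXn2r// ?nnegrE//; first exact: le_trans (normr_ge0 _) (UC 0).
  have Uk : 3 * \int[mu]_x (U x ^+ 2 * `|G x|) <= k.
    rewrite /k -RintegralZl//; apply: Rint_le_ae => //; first exact: liZ.
    move: Hc; apply: filterS => t Hc; rewrite ler_pM2l// /G.
    case: (boolP (- n%:R < t < n%:R)) => tn; last by rewrite /iB (negbTE tn) /bR mulr0 normr0 mulr0 mulr_ge0// sqr_ge0.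
    by rewrite /U -(Hc tn) /iB tn /bR !mulr1.
  have bn0 : 0 <= n%:R :> R by [].
  move: (Hc); apply: filterS => t Ht _ tn.
  have ut : u t = U t by rewrite /U -(Ht tn) /iB tn /bR mulr1.
  set m := Num.min 1 _.
  have -> : 2 * n%:R * m = \int[mu]_s (m * iB n s).
    rewrite RintegralZl//; last exact: li_bitv.
    by rewrite int_bitv; [rewrite opprK; ring|lra].
  apply: Rint_le_ae => //; first by apply: liZ; exact: li_bitv.
  move: Hc; apply: filterS => s Hs.
  case: (boolP (- n%:R < s < n%:R)) => sn; last first.
    by rewrite /iB (negbTE sn) /bR mulr0 sqr_ge0.
  have us : u s = U s by rewrite /U -(Hs sn) /iB sn /bR mulr1.
  rewrite /iB sn /bR mulr1.
  have := ac_cube_bound s t aU; rewrite -ut -us => h.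
  have h1 : `|u t| ^+ 3 <= `|u s| ^+ 3 + k.
    have := lerD (lexx (`|u s ^+ 3|)) (le_trans h Uk).
    by rewrite -!normrX => /(le_trans _); apply; rewrite -lerBlDl; exact: lerB_dist.
  have h2 : m <= `|u s| ^+ 3 by rewrite /m ge_min lerBlDr h1 orbT.
  have h3 : m <= 1 by rewrite /m ge_min lexx.
  rewrite -(real_normK (num_real (u s))); case: (leP 1 (`|u s|)) => us1.
    by apply: le_trans h3 _; rewrite exprn_ege1.
  by apply: le_trans h2 _; rewrite exprS ler_piMl ?sqr_ge0// ltW.
apply: filterS => t Ht; rewrite lee_fin leNgt; apply/negP => kt.
set m := Num.min 1 (`|u t| ^+ 3 - k) in Ht.
have m0 : 0 < m by rewrite /m lt_min ltr01 subr_gt0.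
pose I := \int[mu]_s (u s ^+ 2).
(* The interval of half-length [N] contains [t], and [N m] already exceeds the integral of [u^2]. *)
have [N HN] : exists N : nat, `|t| + I / m < N%:R.
  by exists (Num.truncn (`|t| + I / m)).+1; exact: truncnS_gt.
have I0 : 0 <= I by apply: Rintegral_ge0 => s _; exact: sqr_ge0.
have Im : 0 <= I / m by rewrite divr_ge0// ltW.
pose M := maxn n0 N.
have NM : N%:R <= M%:R :> R by rewrite ler_nat leq_maxr.
have tM : - M%:R < t < M%:R by rewrite -ltr_norml; lra.
have := Ht M (leq_maxl _ _) tM.
have : I < M%:R * m by rewrite -ltr_pdivrMr//; have := normr_ge0 t; lra.
have : 0 <= M%:R * m by rewrite mulr_ge0// ltW.
rewrite -/I; lra.
Qed.

(** On a bounded interval there is no decay, so [|u t|^3] is compared with its mean over the period.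
    The mean term is the reason why the mass joins the y-energy in the final inequality on R^3 x
    T. *)
Lemma cube_seg (c : R) (u g : R -> R) : measurable_fun setT u -> measurable_fun setT g ->
  li mu (fun t => g t * iT t) ->
  {ae mu, forall t, 0 < t < 2 * pi -> u t = c + cum (fun t => g t * iT t) t} ->
  {ae mu, forall t, ((`|u t| ^+ 3 * iT t)%:E <=
    \int[mu]_s ((2 * pi)^-1 * (`|u s| ^+ 3 * iT s) + 3 * (u s ^+ 2 * `|g s| * iT s))%:E)%E}.
Proof.
move=> mu' mg Gi Hc.
have p0 := pi2_gt0 R; have miT := @measurable_iT R.
have iT0 (s : R) : 0 <= iT s by have /andP[] := bR01 R (0 < s < 2 * pi).
have m1 : measurable_fun setT (fun s => (2 * pi)^-1 * (`|u s| ^+ 3 * iT s)).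
  apply: measurable_funM => //; apply: measurable_funM => //.
  by apply: measurable_funX; exact: measurableT_comp.
have m2 : measurable_fun setT (fun s => 3 * (u s ^+ 2 * `|g s| * iT s)).
  apply: measurable_funM => //; apply: measurable_funM => //.
  apply: measurable_funM; first exact: measurable_funX.
  exact: measurableT_comp.
have p1 s : 0 <= (2 * pi)^-1 * (`|u s| ^+ 3 * iT s).
  by rewrite mulr_ge0 ?invr_ge0 ?(ltW p0)// mulr_ge0// exprn_ge0.
have p2 s : 0 <= 3 * (u s ^+ 2 * `|g s| * iT s) by rewrite mulr_ge0// mulr_ge0// mulr_ge0// sqr_ge0.
have m12 := measurable_funD m1 m2.
have p12 s := addr_ge0 (p1 s) (p2 s).
set K := (\int[mu]_s _)%E.
case: (boolP (K == +oo)%E) => [/eqP ->|Kfin]; first by apply: aeW => t; rewrite leey.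
have Ki : li mu (fun s => (2 * pi)^-1 * (`|u s| ^+ 3 * iT s) + 3 * (u s ^+ 2 * `|g s| * iT s)).
  by apply/(li_ge0P mu m12 p12); rewrite ltey.
have i1 : li mu (fun s => (2 * pi)^-1 * (`|u s| ^+ 3 * iT s)).
  by apply: li_le Ki => // s; rewrite ger0_norm// lerDl.
have i2 : li mu (fun s => 3 * (u s ^+ 2 * `|g s| * iT s)).
  by apply: li_le Ki => // s; rewrite ger0_norm// lerDr.
rewrite /K RintE// RintegralD//.
set k1 := \int[mu]_s _; set k2 := \int[mu]_s _.
pose G t := g t * iT t; pose U t := c + cum G t.
have aU : ac U G by split => //; exists c.
have mU := ac_meas aU; have [C UC] := ac_bdd aU.
have UG2 : li mu (fun x => U x ^+ 2 * `|G x|).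
  have := li_bdd (C := C ^+ 2) (li_abs Gi) (measurable_funX 2 mU) _.
  move=> /(_ _)/= h; rewrite (_ : (fun x => _) = fun x => `|G x| * U x ^+ 2); last first.
    by apply/funext => x; rewrite mulrC.
  apply: h => x; rewrite normrX lerXn2r// ?nnegrE//; first exact: le_trans (normr_ge0 _) (UC 0).
have Uk : 3 * \int[mu]_x (U x ^+ 2 * `|G x|) <= k2.
  rewrite /k2 -RintegralZl//; apply: Rint_le_ae => //; first exact: liZ.
  move: Hc; apply: filterS => t Ht; rewrite ler_pM2l// /G normrM (ger0_norm (iT0 t)) mulrA.
  case: (boolP (0 < t < 2 * pi)) => tn; last by rewrite /iT (negbTE tn) /bR !mulr0.
  by rewrite /U -(Ht tn).
move: (Hc); apply: filterS => t Ht; rewrite lee_fin.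
case: (boolP (0 < t < 2 * pi)) => tn; last first.
  rewrite {1}/iT (negbTE tn) /bR mulr0 addr_ge0//; exact: Rintegral_ge0.
rewrite {1}/iT tn /bR mulr1 -lerBlDr.
have -> : `|u t| ^+ 3 - k2 = \int[mu]_s ((2 * pi)^-1 * (`|u t| ^+ 3 - k2) * iT s).
  rewrite RintegralZl//; last exact: li_bitv.
  by rewrite int_bitv ?subr0 ?ltW// mulrAC mulVf ?mul1r// gt_eqF.
apply: Rint_le_ae => //; first by apply: liZ; exact: li_bitv.
move: Hc; apply: filterS => s Hs.
case: (boolP (0 < s < 2 * pi)) => sn; last by rewrite /iT (negbTE sn) /bR !mulr0.
rewrite /iT sn /bR !mulr1 ler_pM2l ?invr_gt0//.
have := ac_cube_bound s t aU; rewrite /U -(Ht tn) -(Hs sn) -/(U _) => h.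
have := lerD (lexx (`|u s ^+ 3|)) (le_trans h Uk).
rewrite lerBlDr -!normrX => /(le_trans _); apply; rewrite -lerBlDl; exact: lerB_dist.
Qed.

Lemma cum_dist (G : R -> R) s t : li mu G -> `|cum G t - cum G s| <= \int[mu]_x `|G x|.
Proof.
move=> Gi; rewrite /cum -RintegralB//; [|exact: li_cut|exact: li_cut].
have mD : measurable_fun setT (fun x : R => bR R (x <= t) - bR R (x <= s)).
  by apply: measurable_funB; exact: measurable_indle.
have D1 x : `|bR R (x <= t) - bR R (x <= s)| <= 1.
  by case: (x <= t); case: (x <= s); rewrite /bR ?subrr ?sub0r ?subr0 ?normrN ?normr0 ?normr1.
have Di := li_bdd Gi mD D1.
have -> : \int[mu]_x (G x * bR R (x <= t) - G x * bR R (x <= s)) =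
          \int[mu]_x (G x * (bR R (x <= t) - bR R (x <= s))).
  by apply: eq_Rintegral => x _; rewrite mulrBr.
apply: le_trans (le_normr_Rintegral measurableT Di) _.
apply: Rint_le; [exact: li_abs|exact: li_abs|].
by move=> x; rewrite normrM ler_piMr.
Qed.

(** Since [u] has mean zero, [2 pi u(t)] is the integral of [u(t) - u(s)] over [s], and so [|u(t)|]
    is at most the L^1 norm of [g] on the cell. Cauchy-Schwarz and an integration over the cell give
    the constant [(2 pi)^2], which makes no claim to sharpness. *)
Lemma poincare_seg (c : R) (u g : R -> R) : measurable_fun setT u -> measurable_fun setT g ->
  li mu (fun t => g t * iT t) -> li mu (fun t => u t * iT t) -> li mu (fun t => g t ^+ 2 * iT t) ->
  {ae mu, forall t, 0 < t < 2 * pi -> u t = c + cum (fun t => g t * iT t) t} ->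
  \int[mu]_t (u t * iT t) = 0 -> li mu (fun t => u t ^+ 2 * iT t) ->
  \int[mu]_t (u t ^+ 2 * iT t) <= (2 * pi) ^+ 2 * \int[mu]_t (g t ^+ 2 * iT t).
Proof.
move=> mu' mg Gi ui g2 Hc u0 u2.
have p0 := pi2_gt0 R; have miT := @measurable_iT R.
have iT0 (s : R) : 0 <= iT s by have /andP[] := bR01 R (0 < s < 2 * pi).
pose G t := g t * iT t.
have [M ME [M0 M2]] : exists2 I, (\int[mu]_x (`|G x * iT x|)%:E = I%:E)%E &
    0 <= I /\ I ^+ 2 <= (\int[mu]_t (g t ^+ 2 * iT t)) * (2 * pi).
  apply: cauchy_schwarz => //; first exact: measurable_funM.
    rewrite -RintE//; apply: eq_integral => t _; congr EFin.
    by rewrite /G exprMn (expr2 (iT _)) bR_sq.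
  rewrite -[2 * pi]subr0 -(int_bitv (ltW p0)) -RintE; last exact: li_bitv.
  by apply: eq_integral => t _; rewrite expr2 bR_sq.
have MI : \int[mu]_x `|G x| = M.
  rewrite /Rintegral -[RHS]/(fine M%:E) -ME; congr fine; apply: eq_integral => x _.
  by rewrite /G -mulrA bR_sq.
have ub : {ae mu, forall t, u t ^+ 2 * iT t <= M ^+ 2 * iT t}.
  move: (Hc); apply: filterS => t Ht.
  case: (boolP (0 < t < 2 * pi)) => tn; last by rewrite /iT (negbTE tn) /bR !mulr0.
  rewrite ler_wpM2r// -(real_normK (num_real (u t))) lerXn2r ?nnegrE//.
  suff : `|u t * (2 * pi)| <= M * (2 * pi).
    by rewrite normrM (gtr0_norm p0) ler_pM2r.
  have iTE : 2 * pi = \int[mu]_s iT s by rewrite /iT int_bitv ?subr0 ?ltW.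
  have biT : li mu (@iT R) by exact: li_bitv.
  have di : li mu (fun s => u t * iT s - u s * iT s) by apply: liB => //; exact: liZ.
  have -> : u t * (2 * pi) = \int[mu]_s (u t * iT s - u s * iT s).
    by rewrite RintegralB//; [rewrite u0 subr0 RintegralZl// -iTE|exact: liZ].
  apply: le_trans (le_normr_Rintegral measurableT di) _.
  rewrite {1}iTE -RintegralZl//; apply: Rint_le_ae; [exact: li_abs|exact: liZ|].
  move: Hc; apply: filterS => s Hs.
  case: (boolP (0 < s < 2 * pi)) => sn; last by rewrite /iT (negbTE sn) /bR !mulr0 subrr normr0.
  rewrite -mulrBl normrM (ger0_norm (iT0 s)) ler_wpM2r// (Ht tn) (Hs sn) -MI.
  have := @cum_dist G s t Gi; rewrite (_ : c + _ - _ = cum G t - cum G s)//.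
  by rewrite /G; ring.
have biT : li mu (@iT R) by exact: li_bitv.
have := Rint_le_ae u2 (liZ (M ^+ 2) biT) ub.
rewrite RintegralZl// int_bitv ?subr0 ?(ltW p0)// => h.
apply: le_trans h _; apply: le_trans (ler_wpM2r (ltW p0) M2) _.
by rewrite le_eqVlt; apply/orP; left; apply/eqP; ring.
Qed.
End lines.

Section gn.
Variable R : realType.
Local Notation mu := (L1 R).
Local Notation L4 := (L4 R).
Local Notation L3 := (L3 R).
Local Notation R4 := (R3R R).
Variables (u : R4 -> R) (g : 'I_4 -> R4 -> R).
Hypothesis ug : PW u g.

Let mu' : measurable_fun setT u. Proof. by case: ug. Qed.
Let mg i : measurable_fun setT (g i). Proof. by case: ug. Qed.

Lemma ae_and (d : measure_display) (T : measurableType d) (m : {measure set T -> \bar R})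
  (P Q : T -> Prop) : {ae m, forall x, P x} -> {ae m, forall x, Q x} ->
  {ae m, forall x, P x /\ Q x}.
Proof. by move=> hP hQ; apply: filterS2 hP hQ. Qed.

Lemma iT_ge0 (t : R) : 0 <= iT t.
Proof. by have /andP[] := bR01 R (0 < t < 2 * pi). Qed.

Lemma m_iT2 : measurable_fun setT (fun p : R4 => iT p.2).
Proof. exact: measurableT_comp (@measurable_iT R) measurable_snd. Qed.

Let kf i (p : R4) : R := 3 * (u p ^+ 2 * `|g i p| * iT p.2).

Let mkf i : measurable_fun setT (kf i).
Proof.
apply: measurable_funM => //; apply: measurable_funM; last exact: m_iT2.
apply: measurable_funM; first exact: measurable_funX.
exact: measurableT_comp.
Qed.

Let kf0 i p : 0 <= kf i p.
Proof. by rewrite mulr_ge0// mulr_ge0 ?iT_ge0// mulr_ge0// sqr_ge0. Qed.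

(** The common pattern of the x-directions. [S] moves the direction to the last place, [J] tells
    whether the line lies over the period cell, and the boxes [X n] exhaust such lines. There are
    countably many boxes, so almost every line has a representation on all large ones, and
    [cube_line] applies to it. *)
Lemma cube_dir (i : 'I_4) (S : R4 -> R4) (J : R3 R -> bool) (X : nat -> set (R3 R)) :
  mpres L4 L4 S -> (forall p, S (S p) = p) ->
  (forall z t, (0 < (S (z, t)).2 < 2 * pi) = J z) ->
  (forall z, J z -> exists n0, forall n, (n0 <= n)%N -> (0 < n)%N /\ X n z) ->
  (forall n z t, X n z -> ibox n (S (z, t)) = iB n t) ->
  (forall n, (0 < n)%N -> {ae L3, forall z, X n z ->
    li mu (fun t => g i (S (z, t)) * ibox n (S (z, t))) /\
    exists c, {ae mu, forall t, - n%:R < t < n%:R ->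
      u (S (z, t)) * ibox n (S (z, t)) =
      c + cum (fun t => g i (S (z, t)) * ibox n (S (z, t))) t}}) ->
  {ae L4, forall p, ((`|u p| ^+ 3 * iT p.2)%:E <= \int[mu]_s (kf i (S ((S p).1, s)))%:E)%E}.
Proof.
move=> pS SS SJ JX Xb H.
have mS := pS.1.
have sl (z : R3 R) : measurable_fun setT (fun t : R => S (z, t)).
  by apply: (measurableT_comp mS); exact: measurable_fun_pair.
have mR : measurable_fun setT (fun z => \int[mu]_s (kf i (S (z, s)))%:E)%E.
  apply: (@measurable_int1 _ _ _ (R3 R) _ mu (fun p => (kf i (S p))%:E)).
    by apply/measurable_EFinP; exact: measurableT_comp (@mkf i) mS.
  by move=> p; rewrite lee_fin.
have mL : measurable_fun setT (fun p => (`|u (S p)| ^+ 3 * iT (S p).2)%:E).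
  apply/measurable_EFinP; apply: (measurableT_comp (f := fun p => `|u p| ^+ 3 * iT p.2)) mS.
  by apply: measurable_funM; [apply: measurable_funX; exact: measurableT_comp|exact: m_iT2].
have : {ae L4, forall p, ((`|u (S p)| ^+ 3 * iT (S p).2)%:E <= \int[mu]_s (kf i (S (p.1, s)))%:E)%E}.
  apply: ae_prod_intro.
    rewrite -[X in measurable X]setTI; apply: emeasurable_fun_le => //.
    exact: (measurableT_comp mR measurable_fst).
  have u2 : {ae L3, forall z, li mu (fun t => u (S (z, t)) ^+ 2 * iT (S (z, t)).2)}.
    have [_ _ ui _ _] := ug.
    exact: (ae_int1 (li_mpres pS ui)).
  have Hn : {ae L3, forall z, forall n, (0 < n)%N -> X n z ->
      li mu (fun t => g i (S (z, t)) * ibox n (S (z, t))) /\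
      exists c, {ae mu, forall t, - n%:R < t < n%:R ->
        u (S (z, t)) * ibox n (S (z, t)) =
        c + cum (fun t => g i (S (z, t)) * ibox n (S (z, t))) t}}.
    apply: ae_countable => n; case: (ltnP 0 n) => n0; last by apply: aeW.
    by move: (H n n0); apply: filterS => z h _; exact: h.
  apply: filterS2 u2 Hn => z u2 Hn.
  have iTS t : iT (S (z, t)).2 = bR R (J z) by rewrite /iT SJ.
  case: (boolP (J z)) => Jz; last first.
    apply: aeW => t; rewrite iTS (negbTE Jz) /bR mulr0.
    by apply: integral_ge0 => s _; rewrite lee_fin.
  have [n0 Hn0] := JX z Jz.
  have kE : (\int[mu]_s (kf i (S (z, s)))%:E =
     \int[mu]_s (3 * (u (S (z, s)) ^+ 2 * `|g i (S (z, s))|))%:E)%E.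
    by apply: eq_integral => s _; rewrite /kf iTS Jz /bR mulr1.
  have : {ae mu, forall t, ((`|u (S (z, t))| ^+ 3)%:E <=
     \int[mu]_s (3 * (u (S (z, s)) ^+ 2 * `|g i (S (z, s))|))%:E)%E}.
    apply: (@cube_line _ n0).
    - exact: measurableT_comp mu' (sl z).
    - exact: measurableT_comp (mg i) (sl z).
    - move: u2; congr (li mu _); apply/funext => t.
      by rewrite iTS Jz /bR mulr1.
    - move=> n /Hn0[n00 Xz]; move: (Hn n n00 Xz).
      have -> : (fun t => g i (S (z, t)) * ibox n (S (z, t))) = fun t => g i (S (z, t)) * iB n t.
        by apply/funext => t; rewrite Xb.
      move=> [h1 [c h2]]; split => //; exists c; move: h2; apply: filterS => t h /h.
      by rewrite Xb.
  by apply: filterS => t; rewrite iTS Jz /bR mulr1 /= kE.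
move=> /(ae_mpres pS); apply: filterS => p; by rewrite SS.
Qed.

Lemma nat_gt_norm3 (a b c : R) : exists n0 : nat, forall n, (n0 <= n)%N ->
  [/\ (0 < n)%N, - n%:R < a < n%:R, - n%:R < b < n%:R & - n%:R < c < n%:R].
Proof.
exists (Num.truncn (`|a| + `|b| + `|c|)).+1 => n hn.
have h : `|a| + `|b| + `|c| < n%:R by apply: lt_le_trans (truncnS_gt _) _; rewrite ler_nat.
split; first (by case: n hn {h}); rewrite -ltr_norml;
  have := normr_ge0 a; have := normr_ge0 b; have := normr_ge0 c; lra.
Qed.

Lemma iB1 n (t : R) : - n%:R < t < n%:R -> iB n t = 1.
Proof. by move=> h; rewrite /iB h. Qed.

Lemma iT1 (t : R) : 0 < t < 2 * pi -> iT t = 1.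
Proof. by move=> h; rewrite /iT h. Qed.

Let i0 : 'I_4 := @Ordinal 4 0 isT.
Let i1 : 'I_4 := @Ordinal 4 1 isT.
Let i2 : 'I_4 := @Ordinal 4 2 isT.

Lemma cube_x1 : {ae L4, forall p, ((`|u p| ^+ 3 * iT p.2)%:E <=
  \int[mu]_s (kf i0 (sw1 ((sw1 p).1, s)))%:E)%E}.
Proof.
apply: (@cube_dir i0 (@sw1 R) (fun z => 0 < z.1.1 < 2 * pi)
  (fun n => `]0, (2 * pi)[%classic `*` `](- n%:R), n%:R[%classic `*` `](- n%:R), n%:R[%classic)).
- exact: mpres_sw1.
- by move=> [[[a b] c] d].
- by move=> [[a b] c] d.
- move=> [[a b] c] /= h; have [n0 Hn] := nat_gt_norm3 b c 0; exists n0 => n /Hn[n0' hb hc _].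
  by split => //; rewrite /= !in_itv /=.
- move=> n [[a b] c] t; rewrite /= !in_itv /= => -[[h1 h2] h3].
  by rewrite /ibox /tprod /sw1 /= (iB1 h2) (iB1 h3) (iT1 h1) !mulr1.
- by move=> n n0; exact: line_x1.
Qed.

Lemma cube_x2 : {ae L4, forall p, ((`|u p| ^+ 3 * iT p.2)%:E <=
  \int[mu]_s (kf i1 (sw2 ((sw2 p).1, s)))%:E)%E}.
Proof.
apply: (@cube_dir i1 (@sw2 R) (fun z => 0 < z.1.2 < 2 * pi)
  (fun n => `](- n%:R), n%:R[%classic `*` `]0, (2 * pi)[%classic `*` `](- n%:R), n%:R[%classic)).
- exact: mpres_sw2.
- by move=> [[[a b] c] d].
- by move=> [[a b] c] d.
- move=> [[a b] c] /= h; have [n0 Hn] := nat_gt_norm3 a c 0; exists n0 => n /Hn[n0' hb hc _].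
  by split => //; rewrite /= !in_itv /=.
- move=> n [[a b] c] t; rewrite /= !in_itv /= => -[[h1 h2] h3].
  by rewrite /ibox /tprod /sw2 /= (iB1 h1) (iB1 h3) (iT1 h2) !mulr1 mul1r.
- by move=> n n0; exact: line_x2.
Qed.

Lemma cube_x3 : {ae L4, forall p, ((`|u p| ^+ 3 * iT p.2)%:E <=
  \int[mu]_s (kf i2 (sw3 ((sw3 p).1, s)))%:E)%E}.
Proof.
apply: (@cube_dir i2 (@sw3 R) (fun z => 0 < z.2 < 2 * pi)
  (fun n => `](- n%:R), n%:R[%classic `*` `](- n%:R), n%:R[%classic `*` `]0, (2 * pi)[%classic)).
- exact: mpres_sw3.
- by move=> [[[a b] c] d].
- by move=> [[a b] c] d.
- move=> [[a b] c] /= h; have [n0 Hn] := nat_gt_norm3 a b 0; exists n0 => n /Hn[n0' hb hc _].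
  by split => //; rewrite /= !in_itv /=.
- move=> n [[a b] c] t; rewrite /= !in_itv /= => -[[h1 h2] h3].
  by rewrite /ibox /tprod /sw3 /= (iB1 h1) (iB1 h2) (iT1 h3) !mulr1 !mul1r.
- by move=> n n0; exact: line_x3.
Qed.

(** In the y-direction a single box is enough: once its base contains [z], its trace on the line is
    the whole period cell. *)
Lemma seg_rep : {ae L3, forall z, li mu (fun t => g iy (z, t) * iT t) /\
  exists c, {ae mu, forall t, 0 < t < 2 * pi ->
    u (z, t) = c + cum (fun t => g iy (z, t) * iT t) t}}.
Proof.
have : {ae L3, forall z, forall n, (0 < n)%N ->
    (`](- n%:R), n%:R[%classic `*` `](- n%:R), n%:R[%classic `*` `](- n%:R), n%:R[%classic) z ->
    li mu (fun t => g iy (z, t) * ibox n (z, t)) /\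
    exists c, {ae mu, forall t, 0 < t < 2 * pi ->
      u (z, t) * ibox n (z, t) = c + cum (fun t => g iy (z, t) * ibox n (z, t)) t}}.
  apply: ae_countable => n; case: (ltnP 0 n) => n0; last by apply: aeW.
  by move: (line_y ug n0); apply: filterS => z h _; exact: h.
apply: filterS => -[[a b] c] H.
have [n0 Hn] := nat_gt_norm3 a b c.
have [n00 h1 h2 h3] := Hn n0 (leqnn _).
have := H n0 n00; rewrite /= !in_itv /= => /(_ (conj (conj h1 h2) h3)).
have E t : ibox n0 ((a, b, c), t) = iT t.
  by rewrite /ibox /tprod /= (iB1 h1) (iB1 h2) (iB1 h3) !mul1r.
have -> : (fun t => g iy (a, b, c, t) * ibox n0 (a, b, c, t)) = fun t => g iy (a, b, c, t) * iT t.
  by apply/funext => t; rewrite E.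
move=> [k1 [e k2]]; split => //; exists e; move: k2; apply: filterS => t h ht.
by rewrite -(h ht) E (iT1 ht) mulr1.
Qed.

Let ky (p : R4) : R := (2 * pi)^-1 * (`|u p| ^+ 3 * iT p.2) + kf iy p.

Let mky1 : measurable_fun setT (fun p => (2 * pi)^-1 * (`|u p| ^+ 3 * iT p.2)).
Proof.
apply: measurable_funM => //; apply: measurable_funM; last exact: m_iT2.
by apply: measurable_funX; exact: measurableT_comp.
Qed.

Let mky : measurable_fun setT ky. Proof. exact: measurable_funD. Qed.

Let ky0 p : 0 <= ky p.
Proof.
rewrite addr_ge0// mulr_ge0 ?invr_ge0 ?(ltW (pi2_gt0 R))//.
by rewrite mulr_ge0 ?iT_ge0// exprn_ge0.
Qed.

Lemma cube_y : {ae L4, forall p, ((`|u p| ^+ 3 * iT p.2)%:E <= \int[mu]_s (ky (p.1, s))%:E)%E}.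
Proof.
have mR : measurable_fun setT (fun z => \int[mu]_s (ky (z, s))%:E)%E.
  apply: (@measurable_int1 _ _ _ (R3 R) _ mu (fun p => (ky p)%:E)).
    exact/measurable_EFinP.
  by move=> p; rewrite lee_fin.
apply: ae_prod_intro.
  rewrite -[X in measurable X]setTI; apply: emeasurable_fun_le => //.
    apply/measurable_EFinP; apply: measurable_funM; last exact: m_iT2.
    by apply: measurable_funX; exact: measurableT_comp.
  exact: (measurableT_comp mR measurable_fst).
apply: filterS seg_rep => z [h [c hc]].
have sl : measurable_fun setT (fun t : R => (z, t)) by exact: measurable_fun_pair.
exact: (cube_seg (measurableT_comp mu' sl) (measurableT_comp (mg iy) sl) h hc).
Qed.

Lemma cbrt_mono (x y : \bar R) : (0 <= x -> x <= y -> cbrt x <= cbrt y)%E.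
Proof.
move=> x0 xy; apply: gt0_ler_poweR => //; rewrite ?invr_ge0// in_itv/= leey andbT//.
exact: le_trans xy.
Qed.

Lemma cbrt_cube (x : R) : 0 <= x -> cbrt (x ^+ 3)%:E = x%:E.
Proof.
move=> x0; have [-> h] := cbrt_fin (exprn_ge0 3 x0); congr EFin.
by apply/eqP; rewrite -(@eqrXn2 _ 3)// ?powR_ge0// h.
Qed.

Lemma pi2V_le1 : (2 * pi)^-1 <= 1 :> R.
Proof. by rewrite invf_le1 ?pi2_gt0//; have := pi_ge2 R; lra. Qed.

(** The square of the sum is at most [2 X + 18 Y]; the first coefficient is enlarged to 18 to
    combine mass and y-energy into one factor. *)
Lemma sum_sqr_bound (J I5 I4 X Y : R) : 0 <= J -> J <= I5 -> I5 ^+ 2 <= X ->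
  I4 ^+ 2 <= 9 * Y -> 0 <= X -> (J + I4) ^+ 2 <= 18 * (X + Y).
Proof.
move=> J0 JI h5 h4 X0; have := sqr_ge0 (J - I4).
have : J ^+ 2 <= I5 ^+ 2 by rewrite lerXn2r// nnegrE (le_trans J0).
rewrite sqrrB sqrrD; lra.
Qed.

(** Squaring the bound on [N^3] and inserting the four Cauchy-Schwarz bounds produces
    [N^6 <= c N^4 B1 B2 B3 (a + B4)]; division by [N^4] remains. The factors are 9 for each
    x-direction and 18 for the y-direction. *)
Lemma gagliardo_nirenberg_alg (N a B1 B2 B3 B4 J1 J2 J3 J4 : R) : 0 <= N -> 0 <= a ->
  0 <= B1 -> 0 <= B2 -> 0 <= B3 -> 0 <= B4 ->
  0 <= J1 -> 0 <= J2 -> 0 <= J3 -> 0 <= J4 -> N ^+ 3 <= J1 * J2 * J3 * J4 ->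
  J1 ^+ 2 <= 9 * (N * B1) -> J2 ^+ 2 <= 9 * (N * B2) -> J3 ^+ 2 <= 9 * (N * B3) ->
  J4 ^+ 2 <= 18 * (N * (a + B4)) -> N ^+ 2 <= (9 ^+ 3 * 18) * (B1 * B2 * B3 * (a + B4)).
Proof.
move=> N0 a0 b1 b2 b3 b4 p1 p2 p3 p4 N3 q1 q2 q3 q4.
have P0 : 0 <= B1 * B2 * B3 * (a + B4).
  by apply: mulr_ge0; [apply: mulr_ge0 => //; exact: mulr_ge0|exact: addr_ge0].
have [->|Nn] := eqVneq N 0.
  by rewrite expr0n/=; apply: mulr_ge0 => //; apply: mulr_ge0 => //; exact: exprn_ge0.
have Np : 0 < N by rewrite lt_neqAle eq_sym Nn.
rewrite -(ler_pM2r (exprn_gt0 4 Np)) -exprD.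
have -> : N ^+ (2 + 4) = (N ^+ 3) ^+ 2 by rewrite -exprM.
have h12 : 0 <= J1 * J2 by exact: mulr_ge0.
have h123 : 0 <= J1 * J2 * J3 by exact: mulr_ge0.
apply: (@le_trans _ _ ((J1 * J2 * J3 * J4) ^+ 2)).
  by rewrite lerXn2r ?nnegrE ?exprn_ge0 ?(mulr_ge0 h123).
rewrite (exprMn _ (J1 * J2 * J3)) (exprMn _ (J1 * J2)) (exprMn _ J1).
apply: (@le_trans _ _ (9 * (N * B1) * (9 * (N * B2)) * (9 * (N * B3)) * (18 * (N * (a + B4))))).
  have s1 := sqr_ge0 J1; have s2 := sqr_ge0 J2; have s3 := sqr_ge0 J3; have s4 := sqr_ge0 J4.
  have s12 := mulr_ge0 s1 s2; have s123 := mulr_ge0 s12 s3.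
  exact: (ler_pM s123 s4 (ler_pM s12 s3 (ler_pM s1 s2 q1 q2) q3) q4).
rewrite le_eqVlt; apply/orP; left; apply/eqP.
move: (9 : R) (18 : R) => c9 c18; ring.
Qed.

(* [|u|^3] is bounded by its integral along each of the four coordinate directions; multiply the
   four bounds, apply Loomis-Whitney, and absorb the resulting power of the L^4 norm. *)
Lemma gagliardo_nirenberg : li L4 (fun p => u p ^+ 4 * iT p.2) ->
  (\int[L4]_p (u p ^+ 4 * iT p.2)) ^+ 2 <= (9 ^+ 3 * 18) *
  ((\int[L4]_p (g i0 p ^+ 2 * iT p.2)) * (\int[L4]_p (g i1 p ^+ 2 * iT p.2)) *
   (\int[L4]_p (g i2 p ^+ 2 * iT p.2)) *
   (\int[L4]_p (u p ^+ 2 * iT p.2) + \int[L4]_p (g iy p ^+ 2 * iT p.2))).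
Proof.
move=> u4; have [_ _ u2 g2 _] := ug.
set N := \int[L4]_p (u p ^+ 4 * iT p.2).
pose A i := \int[L4]_p (g i p ^+ 2 * iT p.2).
have N0 : 0 <= N.
  by apply: Rintegral_ge0 => p _; rewrite mulr_ge0 ?iT_ge0// (exprM _ 2 2) sqr_ge0.
have iTX k (p : R4) : iT p.2 ^+ k.+1 = iT p.2.
  by elim: k => [|k IH]; [rewrite expr1|rewrite exprS IH bR_sq].
have mi := m_iT2.
have u4' : (\int[L4]_p ((u p ^+ 2 * iT p.2) ^+ 2)%:E = N%:E)%E.
  rewrite -RintE//; apply: eq_integral => p _; congr EFin.
  by rewrite exprMn iTX -exprM.
have mi2 (f : R4 -> R) k : measurable_fun setT f -> measurable_fun setT (fun p : R4 => f p ^+ k * iT p.2).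
  by move=> mf; apply: measurable_funM => //; exact: measurable_funX.
have mi1 (f : R4 -> R) : measurable_fun setT f -> measurable_fun setT (fun p : R4 => f p * iT p.2).
  by move=> mf; apply: measurable_funM.
(* Cauchy-Schwarz splits [u^2 |g i|] into the quartic norm and the i-th energy, which is how [N]
   reappears on the right-hand side. *)
have CS i : exists I, [/\ (\int[L4]_p (kf i p)%:E = I%:E)%E, 0 <= I & I ^+ 2 <= 9 * (N * A i)].
  have gA : (\int[L4]_p ((g i p * iT p.2) ^+ 2)%:E = (A i)%:E)%E.
    by rewrite -RintE//; apply: eq_integral => p _; rewrite exprMn iTX.
  have [I IE [I0 I2]] := cauchy_schwarz (mi2 u 2 mu') (mi1 _ (mg i)) u4' gA.
  exists (3 * I); split; [|by rewrite mulr_ge0|by rewrite exprMn; lra].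
  have m3 : measurable_fun setT (fun p => (`|u p ^+ 2 * iT p.2 * (g i p * iT p.2)|)%:E).
    apply/measurable_EFinP; apply: measurableT_comp => //.
    by apply: measurable_funM; [exact: mi2|exact: mi1].
  rewrite EFinM -IE -(ge0_integralZl L4 measurableT m3)//.
  apply: eq_integral => p _; rewrite -EFinM; congr EFin.
  rewrite /kf; congr (3 * _); rewrite [RHS]normrM (ger0_norm (mulr_ge0 (sqr_ge0 _) (iT_ge0 _))).
  rewrite normrM (ger0_norm (iT_ge0 _)) mulrACA; congr (_ * _).
  exact: esym (bR_sq R _).
have [I1 [E1 p1 q1]] := CS i0; have [I2 [E2 p2 q2]] := CS i1; have [I3 [E3 p3 q3]] := CS i2.
have [I4 [E4 p4 q4]] := CS iy.
have uA : (\int[L4]_p ((u p * iT p.2) ^+ 2)%:E = (\int[L4]_p (u p ^+ 2 * iT p.2))%R%:E)%E.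
  by rewrite -RintE//; apply: eq_integral => p _; rewrite exprMn iTX.
set a := \int[L4]_p (u p ^+ 2 * iT p.2) in uA *.
have [I5 E5 [p5 q5]] := cauchy_schwarz (mi2 u 2 mu') (mi1 _ mu') u4' uA.
have E6 : (\int[L4]_p (ky p)%:E = ((2 * pi)^-1 * I5 + I4)%:E)%E.
  have m3 : measurable_fun setT (fun p => (`|u p ^+ 2 * iT p.2 * (u p * iT p.2)|)%:E).
    apply/measurable_EFinP; apply: measurableT_comp => //.
    by apply: measurable_funM; [exact: mi2|exact: mi1].
  have pn : (0 <= ((2 * pi)^-1 : R)%:E)%E by rewrite lee_fin invr_ge0 (ltW (pi2_gt0 R)).
  rewrite EFinD -E4 EFinM -E5 -(ge0_integralZl L4 measurableT m3)//.
  rewrite -(ge0_integralD L4 measurableT)//.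
  - apply: eq_integral => p _; rewrite -EFinM -EFinD /ky; congr (_ * _ + _)%:E.
    rewrite [RHS]normrM (ger0_norm (mulr_ge0 (sqr_ge0 _) (iT_ge0 _))).
    rewrite normrM (ger0_norm (iT_ge0 _)) -(real_normK (num_real (u p))) mulrACA -exprSr; congr (_ * _).
    exact: esym (bR_sq R _).
  - by move=> p _; rewrite -EFinM lee_fin mulr_ge0 ?invr_ge0 ?(ltW (pi2_gt0 R)).
  - exact: measurable_funeM.
  - by move=> p _; rewrite lee_fin.
  - exact/measurable_EFinP.
(* The line integrals as functions of the three remaining coordinates, in the order required by
   [loomis_whitney]; the first two need a permutation of their arguments. *)
pose F1 (q : R3 R) := (\int[mu]_s (kf i0 (sw1 ((q.2, q.1.1, q.1.2), s)))%:E)%E.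
pose F2 (q : R3 R) := (\int[mu]_s (kf i1 (sw2 ((q.1.1, q.2, q.1.2), s)))%:E)%E.
pose F3 (q : R3 R) := (\int[mu]_s (kf i2 (sw3 (q, s)))%:E)%E.
pose F4 (q : R3 R) := (\int[mu]_s (ky (q, s))%:E)%E.
have rot : mpres L3 L3 (fun q : R3 R => ((q.2, q.1.1, q.1.2) : R3 R)).
  exact: (mpres_comp (mpres_swap23 mu mu mu) (mpres_map1 mu (mpres_swap mu mu))).
have sw : mpres L3 L3 (fun q : R3 R => ((q.1.1, q.2, q.1.2) : R3 R)).
  exact: (mpres_swap23 mu mu mu).
have mG (S : R4 -> R4) i : measurable_fun setT S ->
    measurable_fun setT (fun z => \int[mu]_s (kf i (S (z, s)))%:E)%E.
  move=> mS; apply: (@measurable_int1 _ _ _ (R3 R) _ mu (fun p => (kf i (S p))%:E)).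
    by apply/measurable_EFinP; exact: measurableT_comp (@mkf i) mS.
  by move=> p; rewrite lee_fin.
have G0 (S : R4 -> R4) i z : (0 <= \int[mu]_s (kf i (S (z, s)))%:E)%E.
  by apply: integral_ge0 => s _; rewrite lee_fin.
have EG (S : R4 -> R4) i : mpres L4 L4 S ->
    (\int[L3]_z \int[mu]_s (kf i (S (z, s)))%:E = \int[L4]_p (kf i p)%:E)%E.
  move=> pS; rewrite (ge0_integral_mpres pS (f := fun p => (kf i p)%:E)); last 2 first.
  - exact/measurable_EFinP.
  - by move=> p; rewrite lee_fin.
  apply: esym; apply: (@tonelli1 _ _ _ _ _ L3 mu (fun p => (kf i (S p))%:E)).
    by apply/measurable_EFinP; exact: measurableT_comp (@mkf i) pS.1.
  by move=> p; rewrite lee_fin.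
have mF1 : measurable_fun setT F1 by exact: (measurableT_comp (mG _ i0 (mpres_sw1 R).1) rot.1).
have mF2 : measurable_fun setT F2 by exact: (measurableT_comp (mG _ i1 (mpres_sw2 R).1) sw.1).
have mF3 : measurable_fun setT F3 by exact: (mG _ i2 (mpres_sw3 R).1).
have mF4 : measurable_fun setT F4.
  apply: (@measurable_int1 _ _ _ (R3 R) _ mu (fun p => (ky p)%:E)); first exact/measurable_EFinP.
  by move=> p; rewrite lee_fin.
have EF1 : (\int[L3]_z F1 z = I1%:E)%E.
  rewrite -E1 -(EG _ i0 (mpres_sw1 R)).
  exact: (esym (ge0_integral_mpres rot (mG _ i0 (mpres_sw1 R).1) (G0 _ _))).
have EF2 : (\int[L3]_z F2 z = I2%:E)%E.
  rewrite -E2 -(EG _ i1 (mpres_sw2 R)).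
  exact: (esym (ge0_integral_mpres sw (mG _ i1 (mpres_sw2 R).1) (G0 _ _))).
have EF3 : (\int[L3]_z F3 z = I3%:E)%E by rewrite -E3 -(EG _ i2 (mpres_sw3 R)).
have EF4 : (\int[L3]_z F4 z = ((2 * pi)^-1 * I5 + I4)%:E)%E.
  rewrite -E6; apply: esym; apply: (@tonelli1 _ _ _ _ _ L3 mu (fun p => (ky p)%:E)); first exact/measurable_EFinP.
  by move=> p; rewrite lee_fin.
have F10 z : (0 <= F1 z)%E by exact: G0.
have F20 z : (0 <= F2 z)%E by exact: G0.
have F30 z : (0 <= F3 z)%E by exact: G0.
have F40 z : (0 <= F4 z)%E by apply: integral_ge0 => s _; rewrite lee_fin.
have LW := @loomis_whitney R _ _ _ _ R R R R mu mu mu mu F1 F2 F3 F4 mF1 mF2 mF3 mF4 F10 F20 F30 F40.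
have x1 := measurableT_comp mF1 (measurable_fun_pair (measurable_fun_pair (@m_x2 R) (@m_x3 R)) measurable_snd).
have x2 := measurableT_comp mF2 (measurable_fun_pair (measurable_fun_pair (@m_x1 R) (@m_x3 R)) measurable_snd).
have x3 := measurableT_comp mF3 (measurable_fun_pair (measurableT_comp measurable_fst measurable_fst : measurable_fun setT (fun p : R4 => p.1.1)) measurable_snd).
have x4 := measurableT_comp mF4 (measurable_fst : measurable_fun setT (fun p : R4 => p.1)).
have mc (F : R4 -> \bar R) : measurable_fun setT F -> measurable_fun setT (fun p => cbrt (F p)).
  by move=> h; exact: measurable_cbrt h.
have NE : (N%:E <= cbrt I1%:E * cbrt I2%:E * cbrt I3%:E * cbrt ((2 * pi)^-1 * I5 + I4)%:E)%E.
  rewrite -EF1 -EF2 -EF3 -EF4; apply: le_trans LW; rewrite -RintE//.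
  apply: ae_ge0_le_integral => //.
  - by move=> p _; rewrite lee_fin mulr_ge0 ?iT_ge0// (exprM _ 2 2) sqr_ge0.
  - by apply/measurable_EFinP; exact: li_meas u4.
  - by move=> p _; rewrite !mule_ge0 ?cbrt_ge0.
  - apply: emeasurable_funM; [apply: emeasurable_funM; [apply: emeasurable_funM|]|].
    + exact: mc x1.
    + exact: mc x2.
    + exact: mc x3.
    + exact: mc x4.
  have h12 := ae_and cube_x1 cube_x2; have h34 := ae_and cube_x3 cube_y.
  apply: filterS2 h12 h34 => p [h1 h2] [h3 h4] _.
  (* The fourth power is read as a product of four copies of [x], each of them below the cube root
     of the line integral in one direction. *)
  pose x := `|u p| * iT p.2.
  have x0 : 0 <= x by rewrite mulr_ge0 ?iT_ge0.
  have xE : `|u p| ^+ 3 * iT p.2 = x ^+ 3 by rewrite exprMn iTX.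
  have cb (F : \bar R) : ((`|u p| ^+ 3 * iT p.2)%:E <= F -> x%:E <= cbrt F)%E.
    rewrite xE => h; rewrite -(cbrt_cube x0); apply: cbrt_mono h.
    by rewrite lee_fin exprn_ge0.
  have -> : u p ^+ 4 * iT p.2 = x * x * x * x.
    rewrite -(iTX 3 p) (exprM _ 2 2) -(real_normK (num_real (u p))) /x; ring.
  rewrite !EFinM; apply: lee_pmul.
  - by rewrite -!EFinM lee_fin !mulr_ge0.
  - by rewrite lee_fin.
  - apply: lee_pmul; [by rewrite -!EFinM lee_fin !mulr_ge0|by rewrite lee_fin| |exact: (cb _ h3)].
    by apply: lee_pmul; [by rewrite lee_fin|by rewrite lee_fin|exact: (cb _ h1)|exact: (cb _ h2)].
  - exact: (cb _ h4).
have p6 : 0 <= (2 * pi)^-1 * I5 + I4.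
  by rewrite addr_ge0// mulr_ge0// invr_ge0 (ltW (pi2_gt0 R)).
have q6 : ((2 * pi)^-1 * I5 + I4) ^+ 2 <= 18 * (N * (a + A iy)).
  have : (2 * pi)^-1 * I5 <= I5 by rewrite ler_piMl// pi2V_le1.
  have : 0 <= (2 * pi)^-1 * I5 by rewrite mulr_ge0// invr_ge0 (ltW (pi2_gt0 R)).
  have : 0 <= N * a.
    by rewrite mulr_ge0//; apply: Rintegral_ge0 => p _; rewrite mulr_ge0 ?sqr_ge0 ?iT_ge0.
  by move=> h J0 JI; have := sum_sqr_bound J0 JI q5 q4 h; rewrite -mulrDr.
move: p6 q6 NE; set I6 := _ + I4 => p6 q6.
have [-> r1] := cbrt_fin p1; have [-> r2] := cbrt_fin p2; have [-> r3] := cbrt_fin p3.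
have [-> r4] := cbrt_fin p6.
rewrite -!EFinM lee_fin => NE.
have N3 : N ^+ 3 <= I1 * I2 * I3 * I6.
  rewrite -r1 -r2 -r3 -r4 -!exprMn lerXn2r// nnegrE ?(le_trans N0 NE)//.
change (N ^+ 2 <= (9 ^+ 3 * 18) * (A i0 * A i1 * A i2 * (a + A iy))).
have A0 i : 0 <= A i by apply: Rintegral_ge0 => p _; exact: mulr_ge0 (sqr_ge0 _) (iT_ge0 _).
have a0 : 0 <= a by apply: Rintegral_ge0 => p _; exact: mulr_ge0 (sqr_ge0 _) (iT_ge0 _).
move: (A i0) (A i1) (A i2) (A iy) (A0 i0) (A0 i1) (A0 i2) (A0 iy) q1 q2 q3 q6.
move=> B1 B2 B3 B4 B10 B20 B30 B40 q1 q2 q3 q6.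
exact: (gagliardo_nirenberg_alg N0 a0 B10 B20 B30 B40 p1 p2 p3 p6 N3 q1 q2 q3 q6).
Qed.

Lemma poincare : {ae L3, forall z, \int[mu]_t (u (z, t) * iT t) = 0} ->
  \int[L4]_p (u p ^+ 2 * iT p.2) <= (2 * pi) ^+ 2 * \int[L4]_p (g iy p ^+ 2 * iT p.2).
Proof.
move=> z0; have [_ _ u2 g2 _] := ug.
rewrite (Rint_fubini1 (m1 := L3) (m2 := mu) u2) (Rint_fubini1 (m1 := L3) (m2 := mu) (g2 iy)).
have U := li_int1 (m1 := L3) (m2 := mu) u2; have G := li_int1 (m1 := L3) (m2 := mu) (g2 iy).
rewrite -RintegralZl//; apply: Rint_le_ae => //; first exact: liZ.
have hu := ae_int1 (m1 := L3) (m2 := mu) u2; have hg := ae_int1 (m1 := L3) (m2 := mu) (g2 iy).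
have h1 := ae_and hu hg; have h2 := ae_and z0 seg_rep.
apply: filterS2 h1 h2 => z [uz gz] [z0z [Gz [c hc]]].
have sl : measurable_fun setT (fun t : R => (z, t)) by exact: measurable_fun_pair.
have muz := measurableT_comp mu' sl; have mgz := measurableT_comp (mg iy) sl.
apply: (poincare_seg muz mgz Gz _ gz hc z0z uz).
apply: (li_le (g := fun t => u (z, t) ^+ 2 * iT t + iT t)).
- by apply: measurable_funM => //; exact: measurable_iT.
- move=> t; rewrite normrM (ger0_norm (iT_ge0 t)) -[X in _ + X]mul1r -mulrDl ler_wpM2r ?iT_ge0//.
  rewrite -(real_normK (num_real (u (z, t)))); move: (`|u (z, t)|) (normr_ge0 (u (z, t))) => x x0; nra.
- by apply: liD => //; exact: li_bitv.
Qed.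
End gn.

(** * Test functions and Sobolev spaces *)

Section carath.
Variable R : realType.

(** A Caratheodory function is the pointwise limit of its values at [t] rounded down to the grid of
    step 1/(n+1), and each approximation is measurable because only countably many grid points
    occur. Iterated over the coordinates, this makes continuous functions measurable for the product
    sigma-algebras. *)
Lemma carath (d : measure_display) (X : measurableType d) (f : X * R -> R) :
  (forall t, measurable_fun setT (fun x => f (x, t))) ->
  (forall x, continuous (fun t => f (x, t))) -> measurable_fun setT f.
Proof.
move=> mf cf.
pose q (n : nat) (t : R) : R := (Num.floor (n.+1%:R * t))%:~R / n.+1%:R.
apply: (@measurable_fun_cvg _ _ _ _ (fun n p => f (p.1, q n p.2))); last first.
  move=> [x t] _ /=.
  have qt : q n t @[n --> \oo] --> t.
    apply: (@squeeze_cvgr _ _ _ _ (fun n : nat => t - n.+1%:R^-1) (fun=> t)).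
    - near=> n; have n0 : 0 < n.+1%:R :> R by [].
      have /andP[h1 h2] := floor_itv (n.+1%:R * t).
      apply/andP; split; last by rewrite /q ler_pdivrMr// [t * _]mulrC.
      rewrite lerBlDr /q -[X in _ + X]mul1r -mulrDl ler_pdivlMr// [t * _]mulrC.
      by move: h2; rewrite intrD => /ltW.
    - rewrite -[X in _ --> X]subr0; apply: cvgB; first exact: cvg_cst.
      exact: cvg_harmonic.
    - exact: cvg_cst.
  exact: (cvg_comp _ _ qt (cf x t)).
move=> n _ B mB; rewrite setTI.
pose A (k : int) := [set x | B (f (x, k%:~R / n.+1%:R))].
pose C (k : int) := [set t : R | Num.floor (n.+1%:R * t) = k].
have n0 : 0 < n.+1%:R :> R by [].
have mA k : measurable (A k) by rewrite -[A k]setTI; exact: mf.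
have mC k : measurable (C k).
  rewrite (_ : C k = `[k%:~R / n.+1%:R, (k + 1)%:~R / n.+1%:R[%classic)//.
  apply/seteqP; split=> t /=; rewrite in_itv/= ler_pdivrMr// ltr_pdivlMr// mulrC.
    by move=> <-; exact: floor_itv.
  by move=> /floor_def.
rewrite (_ : _ @^-1` _ = \bigcup_m (if unpickle m is Some k then A k `*` C k else set0)).
  by apply: bigcupT_measurable => m; case: unpickle => // k; exact: measurableX.
apply/seteqP; split=> [[x t] /= h|[x t] [m _]].
  exists (pickle (Num.floor (n.+1%:R * t))); [exact: I|rewrite pickleK; split; [exact: h|exact: erefl]].
by case: unpickle => // k [/= h e]; rewrite /q /= e.
Unshelve. all: by end_near.
Qed.

Lemma cont_pairl (X Y : topologicalType) (y : Y) : continuous (fun x : X => (x, y)).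
Proof. by move=> x; apply: cvg_pair; [exact: cvg_id|exact: cvg_cst]. Qed.

Lemma cont_pairr (X Y : topologicalType) (x : X) : continuous (fun y : Y => (x, y)).
Proof. by move=> y; apply: cvg_pair; [exact: cvg_cst|exact: cvg_id]. Qed.

Lemma cont_compT (X Y Z : topologicalType) (f : X -> Y) (g : Y -> Z) :
  continuous f -> continuous g -> continuous (fun x => g (f x)).
Proof. by move=> cf cg x; apply: continuous_comp; [exact: cf|exact: cg]. Qed.

Lemma cont2_meas (f : R * R -> R) : continuous f -> measurable_fun setT f.
Proof.
move=> cf; apply: carath => [t|x].
  by apply: continuous_measurable_fun; exact: cont_compT (@cont_pairl R R t) cf.
exact: cont_compT (@cont_pairr R R x) cf.
Qed.

Lemma cont3_meas (f : R3 R -> R) : continuous f -> measurable_fun setT f.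
Proof.
move=> cf; apply: carath => [t|x].
  by apply: cont2_meas; exact: cont_compT (@cont_pairl (R * R)%type R t) cf.
exact: cont_compT (@cont_pairr (R * R)%type R x) cf.
Qed.

Lemma cont4_meas (f : R3R R -> R) : continuous f -> measurable_fun setT f.
Proof.
move=> cf; apply: carath => [t|x].
  by apply: cont3_meas; exact: cont_compT (@cont_pairl (R3 R) R t) cf.
exact: cont_compT (@cont_pairr (R3 R) R x) cf.
Qed.

Lemma compact_bdd (T : topologicalType) (K : set T) (f : T -> R) : compact K ->
  continuous f -> exists2 C, 0 <= C & forall p, K p -> `|f p| <= C.
Proof.
move=> cK cf.
have : compact (f @` K) by apply: continuous_compact => //; exact: continuous_subspaceT.
move=> /compact_bounded[M [_ HM]]; exists (`|M| + 1); first by rewrite addr_ge0.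
move=> p Kp; apply: (HM (`|M| + 1)); last by exists p.
by rewrite (le_lt_trans (ler_norm M))// ltrDl.
Qed.

Lemma compact_bdd0 (T : topologicalType) (K : set T) (f : T -> R) : compact K ->
  continuous f -> (forall p, ~ K p -> f p = 0) ->
  exists2 C, 0 <= C & forall p, `|f p| <= C.
Proof.
move=> cK cf f0; have [C C0 HC] := compact_bdd cK cf; exists C => // p.
by have [/HC//|/f0 ->] := pselect (K p); rewrite normr0.
Qed.

Lemma pderiv_out (T : topologicalType) (sh : R -> T -> T) (phi : T -> R) (K : set T) p :
  hausdorff_space T -> compact K -> (forall p, ~ K p -> phi p = 0) ->
  continuous (fun t => sh t p) -> sh 0 p = p -> ~ K p -> pderiv sh phi p = 0.
Proof.
move=> hT cK phi0 csh sh0 nK; rewrite /pderiv derive1E.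
have oK : open (~` K) by rewrite openC; exact: compact_closed.
have : nbhs p (~` K) by exact: open_nbhs_nbhs.
rewrite -[in X in nbhs X _]sh0 => /(csh 0) h.
rewrite (near_eq_derive (g := cst 0)); first by rewrite derive_cst.
by near=> t; rewrite phi0//; near: t; exact: h.
Unshelve. all: by end_near.
Qed.

Lemma is_derive_pderiv (T : Type) (sh : R -> T -> T) (phi : T -> R) p :
  derivable (fun t => phi (sh t p)) 0 1 ->
  is_derive (0 : R) (1 : R) (fun t => phi (sh t p)) (pderiv sh phi p).
Proof. by move=> h; apply: DeriveDef => //; rewrite /pderiv derive1E. Qed.

(* The translates [F t] pull the difference quotients at [t] back to those at 0. *)
Lemma C1_line (T : topologicalType) (sh : R -> T -> T) (phi : T -> R) (F : R -> T) :
  (forall s t, sh s (F t) = F (t + s)) -> continuous F ->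
  (forall p, derivable (fun t => phi (sh t p)) 0 1) -> continuous (pderiv sh phi) ->
  C1 (fun t => phi (F t)) (fun t => pderiv sh phi (F t)).
Proof.
move=> shF cF dphi cd; split; first exact: cont_compT cF cd.
move=> t.
have E : (fun h : R => h^-1 *: ((fun t => phi (F t)) \o shift t) (h *: 1) - h^-1 *: phi (F t)) =
   (fun h : R => h^-1 *: ((fun s => phi (sh s (F t))) \o shift 0) (h *: 1) - h^-1 *: phi (sh 0 (F t))).
  by apply/funext => h /=; rewrite !shF !addr0 [t + _]addrC.
have E' : (fun h : R => h^-1 *: (((fun t => phi (F t)) \o shift t) (h *: 1) - phi (F t))) =
   (fun h : R => h^-1 *: (((fun s => phi (sh s (F t))) \o shift 0) (h *: 1) - phi (sh 0 (F t)))).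
  by apply/funext => h; have := congr1 (fun f => f h) E; rewrite !scalerBr.
have [dd de] := @is_derive_pderiv T sh phi (F t) (dphi (F t)); apply: DeriveDef.
  by move: dd; rewrite /derivable E'.
by rewrite -de /derive E'.
Qed.

Lemma is_derive_mulr (f : R -> R) (t d k : R) : is_derive t (1 : R) f d ->
  is_derive t (1 : R) (fun s => f s * k) (d * k).
Proof.
move=> h; have := @is_deriveZ _ _ _ f k t 1 d h.
rewrite (_ : k \*: f = (fun s => f s * k)); last by apply/funext => s /=; rewrite mulrC.
by rewrite (_ : k *: d = d * k)// mulrC.
Qed.

Lemma pderivE (T : Type) (sh : R -> T -> T) (phi : T -> R) p d :
  is_derive (0 : R) (1 : R) (fun t => phi (sh t p)) d -> pderiv sh phi p = d.
Proof. by move=> [_ <-]; rewrite /pderiv derive1E. Qed.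

Lemma Rint_eq0 (d : measure_display) (T : measurableType d) (m : {measure set T -> \bar R})
  (f : T -> R) : (forall x, f x = 0) -> \int[m]_x f x = 0.
Proof.
move=> f0; rewrite /Rintegral (eq_integral (cst 0%E)) ?integral0// => x _.
by rewrite /= f0.
Qed.

Lemma int_tst_deriv a b f f' : tst a b f f' -> \int[L1 R]_t f' t = 0.
Proof.
move=> tf; have [fi f'i] := tst_li tf; have [[cf' df] f0] := tf.
have [_ dc] := C1_cum f'i cf'.
have cs x y : f x - cum f' x = f y - cum f' y.
  apply: (@is_derive_0_is_cst _ (fun x => f x - cum f' x)) => z.
  by have := is_deriveB (df z) (dc z); rewrite subrr.
have a0 : cum f' a = 0.
  apply: Rint_eq0 => s.
  case: (leP s a) => sa; last by rewrite /bR mulr0.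
  by rewrite (f0 s _).2 ?mul0r// ltNge sa.
have := cs b a; rewrite a0 (f0 a _).1 ?ltxx// (f0 b _).1 ?ltxx ?andbF// !sub0r oppr0.
move=> /eqP; rewrite oppr_eq0 => /eqP <-; apply: eq_Rintegral => s _.
case: (leP s b) => sb; first by rewrite /bR mulr1.
by rewrite (f0 s _).2 ?mul0r// [s < b]ltNge (ltW sb) andbF.
Qed.
End carath.

(** * Test functions on R^3 and R^4, and integration by parts along lines *)

Section tests.
Variable R : realType.
Local Notation mu := (L1 R).
Local Notation L4 := (L4 R).
Local Notation L3 := (L3 R).
Local Notation R3 := (R3 R).
Local Notation R4 := (R3R R).

Definition ib3 n (x : R3) : R := iB n x.1.1 * iB n x.1.2 * iB n x.2.
Definition ib4 n (p : R4) : R := ib3 n p.1 * iB n p.2.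

Lemma shift3E (i : 'I_3) t (a b c : R) : shift3 i t ((a, b), c) =
  match nat_of_ord i with 0 => ((a + t, b), c) | 1 => ((a, b + t), c) | _ => ((a, b), c + t) end.
Proof. by case: i => [[|[|[|m]]] im]. Qed.

Lemma shift4E (i : 'I_4) t (a b c e : R) : shift4 i t (((a, b), c), e) =
  match nat_of_ord i with 0 => (((a + t, b), c), e) | 1 => (((a, b + t), c), e)
  | 2 => (((a, b), c + t), e) | _ => (((a, b), c), e + t) end.
Proof. by case: i => [[|[|[|[|m]]]] im] //=; rewrite /shift4 /= !inordK. Qed.

Lemma contD (a : R) : continuous (fun t : R => a + t).
Proof. by move=> t; apply: cvgD; [exact: cvg_cst|exact: cvg_id]. Qed.

Lemma cont_pair (X Y Z : topologicalType) (f : X -> Y) (g : X -> Z) :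
  continuous f -> continuous g -> continuous (fun x => (f x, g x)).
Proof. by move=> cf cg x; apply: cvg_pair; [exact: cf|exact: cg]. Qed.

Lemma cont_cst (X Y : topologicalType) (y : Y) : continuous (fun _ : X => y).
Proof. by move=> x; exact: cvg_cst. Qed.

Lemma shift3_cont i (x : R3) : continuous (fun t => shift3 i t x).
Proof.
case: x => [[a b] c].
have h0 : continuous (fun t : R => ((a + t, b), c)).
  by apply: cont_pair; [apply: cont_pair; [exact: contD|exact: cont_cst]|exact: cont_cst].
have h1 : continuous (fun t : R => ((a, b + t), c)).
  by apply: cont_pair; [apply: cont_pair; [exact: cont_cst|exact: contD]|exact: cont_cst].
have h2 : continuous (fun t : R => ((a, b), c + t)).
  by apply: cont_pair; [exact: cont_cst|exact: contD].
by case: i => [[|[|[|m]]] im].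
Qed.

Lemma shift4_cont i (p : R4) : continuous (fun t => shift4 i t p).
Proof.
case: p => [x y].
have h0 : continuous (fun t : R => (shift3 (inord i) t x, y)).
  by apply: cont_pair; [exact: shift3_cont|exact: cont_cst].
have h1 : continuous (fun t : R => (x, y + t)).
  by apply: cont_pair; [exact: cont_cst|exact: contD].
have E : (fun t => shift4 i t (x, y)) =
    if (i < 3)%N then (fun t : R => (shift3 (inord i) t x, y)) else (fun t : R => (x, y + t)).
  by apply/funext => t; rewrite /shift4; case: ifP.
by rewrite E; case: ifP.
Qed.

Lemma shift3_0 i (x : R3) : shift3 i 0 x = x.
Proof. by case: x => [[a b] c]; rewrite shift3E !addr0; case: i => [[|[|[|m]]] im]. Qed.

Lemma shift4_0 i (p : R4) : shift4 i 0 p = p.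
Proof. by case: p => [x y]; rewrite /shift4 shift3_0 addr0; case: ifP. Qed.

Lemma fst_cont (X Y : topologicalType) : continuous (@fst X Y).
Proof. by move=> x; exact: cvg_fst. Qed.

Lemma snd_cont (X Y : topologicalType) : continuous (@snd X Y).
Proof. by move=> x; exact: cvg_snd. Qed.

Lemma nat_bound (a M : R) n : `|a| <= M -> (Num.truncn M < n)%N -> iB n a = 1.
Proof.
move=> h hn; apply: iB1; rewrite -ltr_norml (le_lt_trans h)//.
by apply: lt_le_trans (truncnS_gt _) _; rewrite ler_nat.
Qed.

(** The form in which compact support is used: one box and one constant serve the function and all
    its partial derivatives. *)
Lemma test3_supp (phi : R3 -> R) : test3 phi -> exists (n : nat) (C : R), 0 <= C /\ forall x,
  [/\ phi x * ib3 n x = phi x, `|phi x| <= C &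
      forall i, pderiv (shift3 i) phi x * ib3 n x = pderiv (shift3 i) phi x /\
                `|pderiv (shift3 i) phi x| <= C].
Proof.
move=> [cp [[K [cK K0]] dp]].
have hT : hausdorff_space R3 by exact: (@norm_hausdorff _ (R * R * R)%type).
have out i x : ~ K x -> pderiv (shift3 i) phi x = 0.
  by apply: pderiv_out hT cK K0 (@shift3_cont i x) (shift3_0 i x).
have [C C0 HC] := compact_bdd0 cK cp K0.
have [D0 D00 HD0] := compact_bdd0 cK (dp ord0).2 (out ord0).
have [D1 D10 HD1] := compact_bdd0 cK (dp (inord 1)).2 (out (inord 1)).
have [D2 D20 HD2] := compact_bdd0 cK (dp (inord 2)).2 (out (inord 2)).
have c11 : continuous (fun x : R3 => x.1.1) := cont_compT (@fst_cont (R * R)%type R) (@fst_cont R R).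
have c12 : continuous (fun x : R3 => x.1.2) := cont_compT (@fst_cont (R * R)%type R) (@snd_cont R R).
have [M1 M10 HM1] := compact_bdd cK c11.
have [M2 M20 HM2] := compact_bdd cK c12.
have [M3 M30 HM3] := compact_bdd cK (@snd_cont (R * R)%type R).
exists (Num.truncn (M1 + M2 + M3)).+1, (C + D0 + D1 + D2); split; first by rewrite !addr_ge0.
move=> x.
have ib1 : K x -> ib3 (Num.truncn (M1 + M2 + M3)).+1 x = 1.
  move=> Kx; rewrite /ib3 !(@nat_bound _ (M1 + M2 + M3)) ?mulr1//.
  - by have := HM3 _ Kx; lra.
  - by have := HM2 _ Kx; lra.
  - by have := HM1 _ Kx; lra.
split.
- by have [/ib1 ->|/K0 ->] := pselect (K x); rewrite ?mulr1// mul0r.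
- by have := HC x; lra.
move=> i; split.
  by have [/ib1 ->|/out ->] := pselect (K x); rewrite ?mulr1// mul0r.
have [e|[e|e]] : i = ord0 \/ i = inord 1 \/ i = inord 2.
  case: i => [[|[|[|m]]] im] //; [left|right; left|right; right]; apply/val_inj => //=; by rewrite inordK.
- by rewrite e; have := HD0 x; lra.
- by rewrite e; have := HD1 x; lra.
- by rewrite e; have := HD2 x; lra.
Qed.

Lemma test4_supp (phi : R4 -> R) : test4 phi -> exists (n : nat) (C : R), 0 <= C /\ forall x,
  [/\ phi x * ib4 n x = phi x, `|phi x| <= C &
      forall i, pderiv (shift4 i) phi x * ib4 n x = pderiv (shift4 i) phi x /\
                `|pderiv (shift4 i) phi x| <= C].
Proof.
move=> [cp [[K [cK K0]] dp]].
have hT : hausdorff_space R4 by exact: (@norm_hausdorff _ (R * R * R * R)%type).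
have out i x : ~ K x -> pderiv (shift4 i) phi x = 0.
  by apply: pderiv_out hT cK K0 (@shift4_cont i x) (shift4_0 i x).
have [C C0 HC] := compact_bdd0 cK cp K0.
have [D0 D00 HD0] := compact_bdd0 cK (dp ord0).2 (out ord0).
have [D1 D10 HD1] := compact_bdd0 cK (dp (inord 1)).2 (out (inord 1)).
have [D2 D20 HD2] := compact_bdd0 cK (dp (inord 2)).2 (out (inord 2)).
have [D3 D30 HD3] := compact_bdd0 cK (dp (inord 3)).2 (out (inord 3)).
have c1 : continuous (fun x : R4 => x.1.1) := cont_compT (@fst_cont R3 R) (@fst_cont (R * R)%type R).
have c11 : continuous (fun x : R4 => x.1.1.1) := cont_compT c1 (@fst_cont R R).
have c12 : continuous (fun x : R4 => x.1.1.2) := cont_compT c1 (@snd_cont R R).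
have c13 : continuous (fun x : R4 => x.1.2) := cont_compT (@fst_cont R3 R) (@snd_cont (R * R)%type R).
have [M1 M10 HM1] := compact_bdd cK c11.
have [M2 M20 HM2] := compact_bdd cK c12.
have [M3 M30 HM3] := compact_bdd cK c13.
have [M4 M40 HM4] := compact_bdd cK (@snd_cont R3 R).
exists (Num.truncn (M1 + M2 + M3 + M4)).+1, (C + D0 + D1 + D2 + D3); split; first by rewrite !addr_ge0.
move=> x.
have ib1 : K x -> ib4 (Num.truncn (M1 + M2 + M3 + M4)).+1 x = 1.
  move=> Kx; rewrite /ib4 /ib3 !(@nat_bound _ (M1 + M2 + M3 + M4)) ?mulr1//.
  - by have := HM4 _ Kx; lra.
  - by have := HM3 _ Kx; lra.
  - by have := HM2 _ Kx; lra.
  - by have := HM1 _ Kx; lra.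
split.
- by have [/ib1 ->|/K0 ->] := pselect (K x); rewrite ?mulr1// mul0r.
- by have := HC x; lra.
move=> i; split.
  by have [/ib1 ->|/out ->] := pselect (K x); rewrite ?mulr1// mul0r.
have [e|[e|[e|e]]] : i = ord0 \/ i = inord 1 \/ i = inord 2 \/ i = inord 3.
  case: i => [[|[|[|[|m]]]] im] //; [left|right; left|right; right; left|right; right; right];
    apply/val_inj => //=; by rewrite inordK.
- by rewrite e; have := HD0 x; lra.
- by rewrite e; have := HD1 x; lra.
- by rewrite e; have := HD2 x; lra.
- by rewrite e; have := HD3 x; lra.
Qed.

Lemma li_ib3 n : li L3 (ib3 n).
Proof. exact: (prod_li (prod_li (li_bitv _ _) (li_bitv _ _)) (li_bitv _ _)). Qed.

Lemma li_ib4 n : li L4 (ib4 n).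
Proof. exact: (prod_li (li_ib3 n) (li_bitv _ _)). Qed.

Lemma ib3_01 n x : 0 <= ib3 n x <= 1.
Proof.
rewrite /ib3 /iB; move: (_ < _ < _) (_ < _ < _) (_ < _ < _) => [] [] [];
  by rewrite /bR ?(mulr0, mul0r, mulr1) ?lexx ?ler01.
Qed.

Lemma ib4_01 n x : 0 <= ib4 n x <= 1.
Proof.
rewrite /ib4 /iB; have := ib3_01 n x.1; move: (_ < _ < _) => [];
  by rewrite /bR ?(mulr0, mul0r, mulr1) ?lexx ?ler01.
Qed.

Lemma li_supp (d : measure_display) (T : measurableType d) (m : {measure set T -> \bar R})
  (u h ib : T -> R) C : measurable_fun setT u -> measurable_fun setT h ->
  li m (fun x => u x ^+ 2) -> li m ib -> (forall x, 0 <= ib x <= 1) ->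
  (forall x, h x * ib x = h x) -> (forall x, `|h x| <= C) -> li m (fun x => u x * h x).
Proof.
move=> mu' mh u2 bi b01 hb hC.
apply: (li_le (g := fun x => C * (u x ^+ 2 + ib x))).
- exact: measurable_funM.
- move=> x; rewrite -(hb x) !normrM mulrCA.
  have /andP[b0 b1] := b01 x; rewrite (ger0_norm b0).
  apply: ler_pM => //; first by rewrite mulr_ge0.
  have : `|u x| ^+ 2 = u x ^+ 2 by exact: real_normK (num_real _).
  move: (`|u x|) (normr_ge0 (u x)) => y y0 <-; nra.
- by apply: liZ; exact: liD.
Qed.

Lemma is_derive_shift f f' (x : R) : C1 f f' ->
  is_derive (0 : R) (1 : R) (fun t => f (x + t)) (f' x).
Proof.
move=> Hf; have [_ /(_ 0)] := C1_comp Hf (C1_affine 1 x).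
rewrite mulr0 add0r mulr1; congr (is_derive _ _ _ _).
by apply/funext => t; rewrite mul1r addrC.
Qed.

Lemma contM (X : topologicalType) (f g : X -> R) : continuous f -> continuous g ->
  continuous (fun x => f x * g x).
Proof. by move=> cf cg x; apply: cvgM; [exact: cf|exact: cg]. Qed.

Lemma tens_test (phi : R3 -> R) a b f f' : test3 phi -> tst a b f f' ->
  test4 (fun p => phi p.1 * f p.2) /\
  forall i : 'I_4, pderiv (shift4 i) (fun p => phi p.1 * f p.2) =
    if (i < 3)%N then (fun p => pderiv (shift3 (inord i)) phi p.1 * f p.2)
    else (fun p => phi p.1 * f' p.2).
Proof.
move=> [cp [[K [cK K0]] dp]] [Cf f0].
have cf := C1_cont Cf; have cf' := Cf.1.
have D (i : 'I_4) p : is_derive (0 : R) (1 : R) (fun t => phi (shift4 i t p).1 * f (shift4 i t p).2)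
    (if (i < 3)%N then pderiv (shift3 (inord i)) phi p.1 * f p.2 else phi p.1 * f' p.2).
  case: p => [x y]; rewrite /shift4; case: ifP => h /=.
    apply: is_derive_mulr; exact: is_derive_pderiv ((dp (inord i)).1 x).
  have := is_derive_mulr (phi x) (is_derive_shift y Cf).
  rewrite mulrC; congr (is_derive _ _ _ _).
  by apply/funext => t; rewrite mulrC.
have E (i : 'I_4) : pderiv (shift4 i) (fun p => phi p.1 * f p.2) =
    if (i < 3)%N then (fun p => pderiv (shift3 (inord i)) phi p.1 * f p.2)
    else (fun p => phi p.1 * f' p.2).
  by apply/funext => p; rewrite (pderivE (D i p)); case: ifP.
split=> //; split; [|split].
- exact: contM (cont_compT (@fst_cont R3 R) cp) (cont_compT (@snd_cont R3 R) cf).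
- exists (K `*` `[a, b]%classic); split; first by apply: compact_setX => //; exact: segment_compact.
  move=> [x y] /= h; have [Kx|/K0 ->] := pselect (K x); last by rewrite mul0r.
  rewrite (f0 y _).1 ?mulr0//; apply/negP => /andP[h1 h2]; apply: h; split => //.
  by rewrite /= in_itv/= !ltW.
move=> i; split; first by move=> p; case: (D i p).
rewrite E; case: ifP => _.
  exact: contM (cont_compT (@fst_cont R3 R) (dp (inord i)).2) (cont_compT (@snd_cont R3 R) cf).
exact: contM (cont_compT (@fst_cont R3 R) cp) (cont_compT (@snd_cont R3 R) cf').
Qed.

Lemma prod_test3 a1 b1 f1 f1' a2 b2 f2 f2' a3 b3 f3 f3' :
  tst a1 b1 f1 f1' -> tst a2 b2 f2 f2' -> tst a3 b3 f3 f3' ->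
  test3 (fun x : R3 => f1 x.1.1 * f2 x.1.2 * f3 x.2) /\
  forall i : 'I_3, pderiv (shift3 i) (fun x : R3 => f1 x.1.1 * f2 x.1.2 * f3 x.2) =
    match nat_of_ord i with 0 => (fun x => f1' x.1.1 * f2 x.1.2 * f3 x.2)
    | 1 => (fun x => f1 x.1.1 * f2' x.1.2 * f3 x.2)
    | _ => (fun x => f1 x.1.1 * f2 x.1.2 * f3' x.2) end.
Proof.
move=> [C1f z1] [C2f z2] [C3f z3].
have c1 := C1_cont C1f; have c2 := C1_cont C2f; have c3 := C1_cont C3f.
have c1' := C1f.1; have c2' := C2f.1; have c3' := C3f.1.
pose P (i : 'I_3) : R3 -> R := match nat_of_ord i with 0 => (fun x => f1' x.1.1 * f2 x.1.2 * f3 x.2)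
    | 1 => (fun x => f1 x.1.1 * f2' x.1.2 * f3 x.2)
    | _ => (fun x => f1 x.1.1 * f2 x.1.2 * f3' x.2) end.
have D (i : 'I_3) x : is_derive (0 : R) (1 : R)
    (fun t => f1 (shift3 i t x).1.1 * f2 (shift3 i t x).1.2 * f3 (shift3 i t x).2) (P i x).
  case: x => [[a b] c]; case: i => [[|[|[|m]]] im] //; rewrite /P /shift3 /=.
  - by apply: is_derive_mulr; apply: is_derive_mulr; exact: is_derive_shift.
  - apply: is_derive_mulr; have := is_derive_mulr (f1 a) (is_derive_shift b C2f).
    by rewrite mulrC; congr (is_derive _ _ _ _); apply/funext => t; rewrite mulrC.
  - have := is_derive_mulr (f1 a * f2 b) (is_derive_shift c C3f).
    by rewrite [f3' c * _]mulrC; congr (is_derive _ _ _ _); apply/funext => t; rewrite mulrC.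
have E i : pderiv (shift3 i) (fun x : R3 => f1 x.1.1 * f2 x.1.2 * f3 x.2) = P i.
  by apply/funext => x; exact: pderivE (D i x).
have c11 : continuous (fun x : R3 => x.1.1) := cont_compT (@fst_cont (R * R)%type R) (@fst_cont R R).
have c12 : continuous (fun x : R3 => x.1.2) := cont_compT (@fst_cont (R * R)%type R) (@snd_cont R R).
have c13 := @snd_cont (R * R)%type R.
split=> //; split; [|split].
- exact: contM (contM (cont_compT c11 c1) (cont_compT c12 c2)) (cont_compT c13 c3).
- exists (`[a1, b1]%classic `*` `[a2, b2]%classic `*` `[a3, b3]%classic); split.
    by apply: compact_setX; [apply: compact_setX|]; exact: segment_compact.
  move=> [[x y] z] /= h.
  case: (boolP (a1 < x < b1)) => hx; last by rewrite (z1 x hx).1 !mul0r.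
  case: (boolP (a2 < y < b2)) => hy; last by rewrite (z2 y hy).1 mulr0 mul0r.
  case: (boolP (a3 < z < b3)) => hz; last by rewrite (z3 z hz).1 mulr0.
  exfalso; apply: h; rewrite !in_itv/=.
  by move: hx hy hz => /andP[/ltW-> /ltW->] /andP[/ltW-> /ltW->] /andP[/ltW-> /ltW->].
move=> i; split; first by move=> x; case: (D i x).
rewrite E; case: i => [[|[|[|m]]] im] //; rewrite /P /=.
- exact: contM (contM (cont_compT c11 c1') (cont_compT c12 c2)) (cont_compT c13 c3).
- exact: contM (contM (cont_compT c11 c1) (cont_compT c12 c2')) (cont_compT c13 c3).
- exact: contM (contM (cont_compT c11 c1) (cont_compT c12 c2)) (cont_compT c13 c3').
Qed.

Lemma slice_test (phi : R4 -> R) y : test4 phi -> test3 (fun x => phi (x, y)) /\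
  forall (i : 'I_4), (i < 3)%N -> forall x, pderiv (shift3 (inord i)) (fun x => phi (x, y)) x =
    pderiv (shift4 i) phi (x, y).
Proof.
move=> [cp [[K [cK K0]] dp]].
have E (i : 'I_4) : (i < 3)%N -> forall x, pderiv (shift3 (inord i)) (fun x => phi (x, y)) x =
    pderiv (shift4 i) phi (x, y).
  by move=> h x; rewrite /pderiv /shift4 h.
split=> //; split; [|split].
- exact: cont_compT (@cont_pairl R3 R y) cp.
- exists (fst @` K); split.
    apply: continuous_compact => //; apply: continuous_subspaceT; exact: fst_cont.
  move=> x h; apply: K0 => Kxy; apply: h; by exists (x, y).
move=> j.
pose i : 'I_4 := widen_ord (leqnSn 3) j.
have i3 : (i < 3)%N by exact: (ltn_ord j).
have ij : inord i = j by exact: inord_val.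
have [d1 d2] := dp i; split.
  by move=> x; have := d1 (x, y); rewrite /shift4 i3 ij.
have -> : pderiv (shift3 j) (fun x => phi (x, y)) = (fun x => pderiv (shift4 i) phi (x, y)).
  by apply/funext => x; rewrite -E// ij.
exact: cont_compT (@cont_pairl R3 R y) d2.
Qed.

Definition swl (i : 'I_4) : R4 -> R4 :=
  match nat_of_ord i with 0 => @sw1 R | 1 => @sw2 R | 2 => @sw3 R | _ => id end.

Lemma mpres_swl i : mpres L4 L4 (swl i).
Proof.
case: i => [[|[|[|[|m]]]] im] //; rewrite /swl/=.
- exact: mpres_sw1.
- exact: mpres_sw2.
- exact: mpres_sw3.
- by split => [|A mA]; [exact: measurable_id|rewrite preimage_id].
Qed.

Lemma tst_line (phi : R4 -> R) : test4 phi -> exists n : nat, forall i z,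
  tst (- n%:R) n%:R (fun t => phi (swl i (z, t))) (fun t => pderiv (shift4 i) phi (swl i (z, t))).
Proof.
move=> tp; have [n [C [C0 H]]] := test4_supp tp; exists n => i z.
have [cp [_ dp]] := tp; have [d1 d2] := dp i; split.
  apply: C1_line d1 d2.
    by case: z => [[a b] c] s t; case: i => [[|[|[|[|m]]]] im] //; rewrite shift4E.
  case: z => [[a b] c]; case: i => [[|[|[|[|m]]]] im] //; rewrite /swl /sw1 /sw2 /sw3 /=.
  - apply: cont_pair; [apply: cont_pair; [apply: cont_pair|]|]; try exact: cont_cst; by move=> ?; exact: cvg_id.
  - apply: cont_pair; [apply: cont_pair; [apply: cont_pair|]|]; try exact: cont_cst; by move=> ?; exact: cvg_id.
  - apply: cont_pair; [apply: cont_pair|]; try exact: cont_cst; by move=> ?; exact: cvg_id.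
  - exact: cont_pairr.
move=> t tn {d1 d2}.
have ib0 : ib4 n (swl i (z, t)) = 0.
  have bt : iB n t = 0 :> R by rewrite /iB (negbTE tn).
  by case: z => [[a b] c]; case: i => [[|[|[|[|m]]]] im] //;
    rewrite /swl /sw1 /sw2 /sw3 /ib4 /ib3 /= bt ?(mul0r, mulr0).
have [e1 _ /(_ i)[e2 _]] := H (swl i (z, t)).
by split; [rewrite -e1|rewrite -e2]; rewrite ib0 mulr0.
Qed.

(** On each line in direction [i] the integrand is the derivative of a C^1 function of compact
    support, so its integral over the line vanishes. *)
Lemma ibp4 i (u du : R4 -> R) (phi : R4 -> R) : test4 phi ->
  (forall z, C1 (fun t => u (swl i (z, t))) (fun t => du (swl i (z, t)))) ->
  li L4 (fun p => u p * pderiv (shift4 i) phi p) -> li L4 (fun p => du p * phi p) ->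
  \int[L4]_p (u p * pderiv (shift4 i) phi p + du p * phi p) = 0.
Proof.
move=> tp Cu l1 l2; have [n H] := tst_line tp.
have l := liD l1 l2; have pS := mpres_swl i.
rewrite (Rint_mpres pS); last exact: li_meas l.
rewrite (Rint_fubini1 (m1 := L3) (m2 := mu) (li_mpres pS l)).
rewrite -[RHS](@Rint_eq0 _ _ _ L3 (fun=> 0) (fun=> erefl)); apply: eq_Rintegral => z _.
have [Cp p0] := H i z.
apply: (@int_tst_deriv _ (- n%:R) n%:R (fun t => u (swl i (z, t)) * phi (swl i (z, t)))).
split; first exact: C1M (Cu z) Cp.
by move=> t /p0[-> ->]; rewrite !mulr0 addr0.
Qed.

Lemma test3_meas (phi : R3 -> R) : test3 phi -> measurable_fun setT phi /\
  forall i, measurable_fun setT (pderiv (shift3 i) phi).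
Proof. by move=> [cp [_ dp]]; split=> [|i]; apply: cont3_meas => //; exact: (dp i).2. Qed.

Lemma test4_meas (phi : R4 -> R) : test4 phi -> measurable_fun setT phi /\
  forall i, measurable_fun setT (pderiv (shift4 i) phi).
Proof. by move=> [cp [_ dp]]; split=> [|i]; apply: cont4_meas => //; exact: (dp i).2. Qed.
End tests.

(** * Sobolev spaces, the product-tested class and the lift from R^3 *)

Section spaces.
Variable R : realType.
Local Notation mu := (L1 R).
Local Notation L4 := (L4 R).
Local Notation L3 := (L3 R).
Local Notation R3 := (R3 R).
Local Notation R4 := (R3R R).
Local Notation J f := (\int[L4]_p (f p * iT p.2)).

Lemma measurable_FD : measurable (@FD R).
Proof.
rewrite (_ : @FD R = setT `*` `[0, (2 * pi)[%classic); first exact: measurableX.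
by apply/seteqP; split=> -[x y]; rewrite /FD /= in_itv/= => // -[].
Qed.

(** The cells of [FD] and of [iT] differ only by the null slice y = 0. *)
Lemma intTE (f : R4 -> R) : measurable_fun setT f ->
  intT f = (\int[L4]_p (f p * iT p.2)%:E)%E.
Proof.
move=> mf; rewrite /intT int4E integral_mkcond.
have mfi : measurable_fun setT (fun p : R4 => f p * iT p.2).
  by apply: measurable_funM => //; exact: m_iT2.
apply: ae_eq_integral => //.
- apply: (iffLR (measurable_restrictT _ measurable_FD)).
  by apply/measurable_EFinP; exact: measurable_funTS.
- exact/measurable_EFinP.
exists (setT `*` [set 0]); split.
- exact: measurableX.
- transitivity (L3 setT * mu [set (0 : R)%R])%E; last by rewrite L1_set1 mule0.
  exact: (prodmE L3 mu measurableT (measurable_set1 0)).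
move=> [x y] /= h; split => //; apply/eqP; apply: contra_notT h => y0 _.
rewrite patchE /= /iT.
case: (boolP (0 <= y < 2 * pi)) => h.
  rewrite mem_set//; have -> : 0 < y < 2 * pi.
    by move: h => /andP[h1 ->]; rewrite lt_neqAle eq_sym y0 h1.
  by rewrite /bR mulr1.
rewrite memNset; last by apply/negP.
have -> : (0 < y < 2 * pi) = false.
  by apply: contraNF h => /andP[/ltW -> ->].
by rewrite /bR mulr0.
Qed.

Lemma intT_li (f : R4 -> R) : measurable_fun setT f -> (forall p, 0 <= f p) ->
  (intT f < +oo)%E <-> li L4 (fun p => f p * iT p.2).
Proof.
move=> mf f0; rewrite intTE//; apply: iff_sym; apply: li_ge0P.
  by apply: measurable_funM => //; exact: m_iT2.
by move=> p; rewrite mulr_ge0 ?iT_ge0.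
Qed.

Lemma intT_J (f : R4 -> R) : measurable_fun setT f -> li L4 (fun p => f p * iT p.2) ->
  intT f = (J f)%:E.
Proof. by move=> mf fi; rewrite intTE// RintE. Qed.

Lemma H1T_li u g : H1T u g -> [/\ measurable_fun setT u, forall i, measurable_fun setT (g i),
  li L4 (fun p => u p ^+ 2 * iT p.2) & forall i, li L4 (fun p => g i p ^+ 2 * iT p.2)].
Proof.
move=> [mu' [_ [u2 [w g2]]]]; split=> // [i||i].
- by have [] := w i.
- by apply/intT_li => //; [exact: measurable_funX|move=> p; exact: sqr_ge0].
- apply/intT_li => //; last by move=> p; exact: sqr_ge0.
  by apply: measurable_funX; have [] := w i.
Qed.

Lemma H1R3_li u g : H1R3 u g -> [/\ measurable_fun setT u, forall i, measurable_fun setT (g i),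
  li L3 (fun p => u p ^+ 2) & forall i, li L3 (fun p => g i p ^+ 2)].
Proof.
move=> [mu' [u2 [w g2]]]; split=> // [i||i].
- by have [] := w i.
- apply/li_ge0P => //; [exact: measurable_funX|by move=> p; exact: sqr_ge0|].
  by move: u2; rewrite /int3 int3E.
- apply/li_ge0P => //; last by move: (g2 i); rewrite /int3 int3E.
    by apply: measurable_funX; have [] := w i.
  by move=> p; exact: sqr_ge0.
Qed.

(** Turns the weak identity, an equation between extended integrals, into the vanishing of one real
    integral, to which Fubini and linearity apply. *)
Lemma wg_iff (d : measure_display) (T : measurableType d) (m : {measure set T -> \bar R})
  (a b : T -> R) : li m a -> li m b ->
  ((\int[m]_x (a x)%:E = - \int[m]_x (b x)%:E)%E <-> \int[m]_x (a x + b x) = 0).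
Proof.
move=> ai bi; rewrite !RintE// RintegralD// -EFinN; split.
  by move=> [->]; rewrite addNr.
by move/eqP; rewrite addr_eq0 => /eqP ->.
Qed.

Lemma li_box_mul n (u h : R4 -> R) C : measurable_fun setT u ->
  li L4 (fun p => u p ^+ 2 * iT p.2) -> measurable_fun setT h ->
  (forall p, h p * ibox n p = h p) -> (forall p, `|h p| <= C) -> li L4 (fun p => u p * h p).
Proof.
move=> mu' u2 mh hb hC.
have := @li_supp R _ _ L4 (fun p => u p * iT p.2) h (ibox n) C.
have -> : (fun p => u p * iT p.2 * h p) = (fun p => u p * h p).
  by apply/funext => p; rewrite -(hb p) -(ibox_iT n p); have := bR_sq R (0 < p.2 < 2 * pi); rewrite -/(iT _) => e; rewrite -[in RHS]e; ring.
apply=> //.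
- by apply: measurable_funM => //; exact: m_iT2.
- move: u2; congr (li L4 _); apply/funext => p.
  by rewrite exprMn (expr2 (iT _)) bR_sq.
- exact: li_ibox.
- exact: ibox01.
Qed.

Lemma tprod_ibox n (f1 f2 f3 f4 : R -> R) : (forall t, iB n t * f1 t = f1 t) ->
  (forall t, iB n t * f2 t = f2 t) -> (forall t, iB n t * f3 t = f3 t) ->
  (forall t, iT t * f4 t = f4 t) -> forall p, tprod f1 f2 f3 f4 p * ibox n p = tprod f1 f2 f3 f4 p.
Proof.
move=> h1 h2 h3 h4 p; rewrite /ibox /tprod.
rewrite -[in RHS]h1 -[in RHS]h2 -[in RHS]h3 -[in RHS]h4; ring.
Qed.

Lemma tprod_bound (f1 f2 f3 f4 : R -> R) C : (forall t, `|f1 t| <= C) -> (forall t, `|f2 t| <= C) ->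
  (forall t, `|f3 t| <= C) -> (forall t, `|f4 t| <= C) -> forall p, `|tprod f1 f2 f3 f4 p| <= C * C * C * C.
Proof.
move=> h1 h2 h3 h4 p; rewrite /tprod !normrM.
by apply: ler_pM => //; apply: ler_pM => //; exact: ler_pM.
Qed.

Lemma dprod_facts (i : 'I_4) n (f1 f1' f2 f2' f3 f3' f4 f4' : R -> R) :
  tst (- n%:R) n%:R f1 f1' -> tst (- n%:R) n%:R f2 f2' ->
  tst (- n%:R) n%:R f3 f3' -> tst 0 (2 * pi) f4 f4' ->
  (exists C, forall p, `|tprod f1 f2 f3 f4 p| <= C /\ `|dprod i f1 f1' f2 f2' f3 f3' f4 f4' p| <= C) /\
  [/\ measurable_fun setT (tprod f1 f2 f3 f4), measurable_fun setT (dprod i f1 f1' f2 f2' f3 f3' f4 f4'),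
      forall p, tprod f1 f2 f3 f4 p * ibox n p = tprod f1 f2 f3 f4 p &
      forall p, dprod i f1 f1' f2 f2' f3 f3' f4 f4' p * ibox n p = dprod i f1 f1' f2 f2' f3 f3' f4 f4' p].
Proof.
move=> t1 t2 t3 t4.
have [C1 c10 b1] := tst_bdd t1; have [C2 c20 b2] := tst_bdd t2.
have [C3 c30 b3] := tst_bdd t3; have [C4 c40 b4] := tst_bdd t4.
have [m1 m1'] := tst_meas t1; have [m2 m2'] := tst_meas t2.
have [m3 m3'] := tst_meas t3; have [m4 m4'] := tst_meas t4.
pose C := C1 + C2 + C3 + C4.
have e1 t : `|f1 t| <= C /\ `|f1' t| <= C by have [] := b1 t; rewrite /C => *; split; lra.
have e2 t : `|f2 t| <= C /\ `|f2' t| <= C by have [] := b2 t; rewrite /C => *; split; lra.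
have e3 t : `|f3 t| <= C /\ `|f3' t| <= C by have [] := b3 t; rewrite /C => *; split; lra.
have e4 t : `|f4 t| <= C /\ `|f4' t| <= C by have [] := b4 t; rewrite /C => *; split; lra.
have g1 := iB_fam t1; have g2 := iB_fam t2; have g3 := iB_fam t3; have g4 := iT_fam t4.
split.
  exists (C * C * C * C) => p; split.
    exact: (tprod_bound (fun t => (e1 t).1) (fun t => (e2 t).1) (fun t => (e3 t).1) (fun t => (e4 t).1)).
  rewrite /dprod; case: ifP => _; first exact: (tprod_bound (fun t => (e1 t).2) (fun t => (e2 t).1) (fun t => (e3 t).1) (fun t => (e4 t).1)).
  case: ifP => _; first exact: (tprod_bound (fun t => (e1 t).1) (fun t => (e2 t).2) (fun t => (e3 t).1) (fun t => (e4 t).1)).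
  case: ifP => _; first exact: (tprod_bound (fun t => (e1 t).1) (fun t => (e2 t).1) (fun t => (e3 t).2) (fun t => (e4 t).1)).
  exact: (tprod_bound (fun t => (e1 t).1) (fun t => (e2 t).1) (fun t => (e3 t).1) (fun t => (e4 t).2)).
split.
- exact: measurable_tprod.
- by rewrite /dprod; do 3 (case: ifP => _; first exact: measurable_tprod); exact: measurable_tprod.
- exact: (tprod_ibox (fun t => (g1 t).1) (fun t => (g2 t).1) (fun t => (g3 t).1) (fun t => (g4 t).1)).
- rewrite /dprod; case: ifP => _; first exact: (tprod_ibox (fun t => (g1 t).2) (fun t => (g2 t).1) (fun t => (g3 t).1) (fun t => (g4 t).1)).
  case: ifP => _; first exact: (tprod_ibox (fun t => (g1 t).1) (fun t => (g2 t).2) (fun t => (g3 t).1) (fun t => (g4 t).1)).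
  case: ifP => _; first exact: (tprod_ibox (fun t => (g1 t).1) (fun t => (g2 t).1) (fun t => (g3 t).2) (fun t => (g4 t).1)).
  exact: (tprod_ibox (fun t => (g1 t).1) (fun t => (g2 t).1) (fun t => (g3 t).1) (fun t => (g4 t).2)).
Qed.

Lemma tprod_test a1 b1 a2 b2 a3 b3 a4 b4 (f1 f1' f2 f2' f3 f3' f4 f4' : R -> R) :
  tst a1 b1 f1 f1' -> tst a2 b2 f2 f2' -> tst a3 b3 f3 f3' -> tst a4 b4 f4 f4' ->
  test4 (tprod f1 f2 f3 f4) /\
  forall i : 'I_4, pderiv (shift4 i) (tprod f1 f2 f3 f4) = dprod i f1 f1' f2 f2' f3 f3' f4 f4'.
Proof.
move=> t1 t2 t3 t4; have [p3 d3] := prod_test3 t1 t2 t3.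
have [p4 d4] := tens_test p3 t4; split => // i.
rewrite -[tprod f1 f2 f3 f4]/(fun p : R4 => f1 p.1.1.1 * f2 p.1.1.2 * f3 p.1.2 * f4 p.2) d4 d3.
by case: i => [[|[|[|[|m]]]] im] //=; rewrite /dprod /= ?inordK.
Qed.

Lemma H1T_PW (u : R4 -> R) g : H1T u g -> PW u g.
Proof.
move=> H; have [mu' mg u2 g2] := H1T_li H.
have [_ [_ [_ [w _]]]] := H.
split=> // i n f1 f1' f2 f2' f3 f3' f4 f4' t1 t2 t3 t4.
have [tp dp] := tprod_test t1 t2 t3 t4.
have [[C HC] [mt md bt bd]] := dprod_facts i t1 t2 t3 t4.
have [_ /(_ _ tp)] := w i; rewrite !int4E dp => E.
apply/wg_iff => //.
- exact: (li_box_mul mu' u2 md bd (fun p => (HC p).2)).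
- exact: (li_box_mul (mg i) (g2 i) mt bt (fun p => (HC p).1)).
Qed.

Lemma li_sqrB (d : measure_display) (T : measurableType d) (m : {measure set T -> \bar R})
  (f g w : T -> R) : measurable_fun setT f -> measurable_fun setT g -> measurable_fun setT w ->
  (forall x, 0 <= w x) -> li m (fun x => f x ^+ 2 * w x) -> li m (fun x => g x ^+ 2 * w x) ->
  li m (fun x => (f x - g x) ^+ 2 * w x).
Proof.
move=> mf mg mw w0 fi gi; apply: (li_le (g := fun x => 2 * (f x ^+ 2 * w x) + 2 * (g x ^+ 2 * w x))).
- by apply: measurable_funM => //; apply: measurable_funX; exact: measurable_funB.
- move=> x; rewrite (ger0_norm (mulr_ge0 (sqr_ge0 _) (w0 x))) !mulrA -mulrDl ler_wpM2r//.
  have := sqr_ge0 (f x + g x); rewrite sqrrD sqrrB; lra.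
- by apply: liD; exact: liZ.
Qed.

(** The fluctuation is a difference of two functions of the space, and the inequalities along lines
    only ask for the product-tested class, in which differences are immediate. *)
Lemma PW_sub (u v : R4 -> R) g h : PW u g -> PW v h -> PW (fun p => u p - v p) (fun i p => g i p - h i p).
Proof.
move=> [mu' mg u2 g2 wu] [mv mh v2 h2 wv]; have mi := @m_iT2 R.
split=> [|i||i|i n f1 f1' f2 f2' f3 f3' f4 f4' t1 t2 t3 t4].
- exact: measurable_funB.
- exact: measurable_funB.
- by apply: li_sqrB => // p; exact: iT_ge0.
- by apply: li_sqrB => // p; exact: iT_ge0.
have [[C HC] [mt md bt bd]] := dprod_facts i t1 t2 t3 t4.
have a1 := li_box_mul mu' u2 md bd (fun p => (HC p).2).
have a2 := li_box_mul (mg i) (g2 i) mt bt (fun p => (HC p).1).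
have a3 := li_box_mul mv v2 md bd (fun p => (HC p).2).
have a4 := li_box_mul (mh i) (h2 i) mt bt (fun p => (HC p).1).
have := wu i n _ _ _ _ _ _ _ _ t1 t2 t3 t4; have := wv i n _ _ _ _ _ _ _ _ t1 t2 t3 t4.
move=> e1 e2; rewrite -[RHS](subrr 0) -{1}e2 -e1 -RintegralB//; [|exact: liD|exact: liD].
by apply: eq_Rintegral => p _; ring.
Qed.

Definition lft (g : 'I_3 -> R3 -> R) (i : 'I_4) : R4 -> R :=
  if (i < 3)%N then (fun p => g (inord i) p.1) else (fun=> 0).

Lemma measurable_lft g : (forall i, measurable_fun setT (g i)) ->
  forall i, measurable_fun setT (lft g i).
Proof.
move=> mg i; rewrite /lft; case: ifP => // _.
exact: measurableT_comp (mg (inord i)) measurable_fst.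
Qed.

Lemma li_lift (f : R3 -> R) : li L3 f -> li L4 (fun p => f p.1 * iT p.2) /\
  J (fun p => f p.1) = 2 * pi * \int[L3]_x f x.
Proof.
move=> fi; split; first exact: prod_li fi (li_bitv 0 (2 * pi)).
rewrite (Rint_prod fi (li_bitv 0 (2 * pi))) mulrC; congr (_ * _).
by rewrite int_bitv ?subr0// ltW// pi2_gt0.
Qed.

Lemma li_test3 u g (phi : R3 -> R) i : H1R3 u g -> test3 phi ->
  li L3 (fun x => u x * pderiv (shift3 i) phi x) /\ li L3 (fun x => g i x * phi x).
Proof.
move=> H tp; have [mu' mg u2 g2] := H1R3_li H.
have [n [C [_ HC]]] := test3_supp tp; have [mp md] := test3_meas tp.
split.
  apply: (li_supp (C := C) mu' (md i) u2 (li_ib3 R n) (@ib3_01 R n)) => x.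
    by have [_ _ /(_ i)[]] := HC x.
  by have [_ _ /(_ i)[]] := HC x.
apply: (li_supp (C := C) (mg i) mp (g2 i) (li_ib3 R n) (@ib3_01 R n)) => x; by have [] := HC x.
Qed.

Lemma H1R3_weak u g (phi : R3 -> R) i : H1R3 u g -> test3 phi ->
  \int[L3]_x (u x * pderiv (shift3 i) phi x + g i x * phi x) = 0.
Proof.
move=> H tp; have [l1 l2] := li_test3 i H tp.
apply/wg_iff => //; have [_ [_ [w _]]] := H.
by have [_ /(_ _ tp)] := w i; rewrite !int3E.
Qed.

Lemma li_lift_test n (u : R3 -> R) (h : R4 -> R) C : measurable_fun setT u ->
  li L3 (fun x => u x ^+ 2) -> measurable_fun setT h ->
  (forall p, h p * ib4 n p = h p) -> (forall p, `|h p| <= C) -> li L4 (fun p => u p.1 * h p).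
Proof.
move=> mu' u2 mh hb hC.
have mB : measurable_fun setT (fun p : R4 => iB n p.2).
  exact: measurableT_comp (measurable_bitv _ _) measurable_snd.
have := @li_supp R _ _ L4 (fun p => u p.1 * iB n p.2) h (ib4 n) C.
have -> : (fun p => u p.1 * iB n p.2 * h p) = (fun p => u p.1 * h p).
  apply/funext => p; rewrite -(hb p) /ib4.
  have := bR_sq R (- n%:R < p.2 < n%:R); rewrite -/(iB n _) => e; rewrite -[in RHS]e; ring.
apply=> //.
- by apply: measurable_funM => //; exact: measurableT_comp mu' measurable_fst.
- have := prod_li u2 (li_bitv (- n%:R : R) n%:R); congr (li L4 _); apply/funext => p.
  by rewrite exprMn (expr2 (iB _ _)) bR_sq.
- exact: li_ib4.
- exact: ib4_01.
Qed.

(** For an x-derivative the test function is sliced at fixed y and the weak identity on R^3 is used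
    on every slice. For the y-derivative the lift is constant along y-lines, so [ibp4] applies with
    derivative zero. *)
Lemma H1R3_lift u g : H1R3 u g -> H1T (fun p => u p.1) (lft g).
Proof.
move=> H; have [mu' mg u2 g2] := H1R3_li H.
have mU : measurable_fun setT (fun p : R4 => u p.1) := measurableT_comp mu' measurable_fst.
have mG := measurable_lft mg.
split=> //; split=> //; split; [|split].
- apply/intT_li => [|p|]; [exact: measurable_funX|exact: sqr_ge0|].
  exact: (li_lift u2).1.
- move=> i; split=> // phi tp; rewrite !int4E.
  have [n [C [_ HC]]] := test4_supp tp; have [mp md] := test4_meas tp.
  have l1 : li L4 (fun p => u p.1 * pderiv (shift4 i) phi p).
    apply: (li_lift_test mu' u2 (md i) (n := n) (C := C)) => p; by have [_ _ /(_ i)[]] := HC p.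
  have l2 : li L4 (fun p => lft g i p * phi p).
    rewrite /lft; case: ifP => _.
      apply: (li_lift_test (mg _) (g2 _) mp (n := n) (C := C)) => p; by have [] := HC p.
    by rewrite (_ : (fun p => _) = fun=> 0); [exact: li0|apply/funext => p; rewrite mul0r].
  apply/wg_iff => //; case: (boolP (i < 3)%N) => i3.
    rewrite (Rint_fubini2 (m1 := L3) (m2 := mu) (liD l1 l2)).
    rewrite -[RHS](@Rint_eq0 _ _ _ mu (fun=> 0) (fun=> erefl)); apply: eq_Rintegral => y _.
    have [ty ey] := slice_test y tp.
    rewrite -(H1R3_weak (inord i) H ty); apply: eq_Rintegral => x _.
    by rewrite ey// /lft i3.
  have iE : i = iy by apply/val_inj; case: i i3 {l1 l2} => [[|[|[|[|m]]]] im].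
  have lE : lft g i = fun=> 0 by apply/funext => p; rewrite /lft (negbTE i3).
  rewrite lE; apply: ibp4 => //; last by move: l2; rewrite lE.
  by rewrite iE /swl /= => z; split=> t; [exact: cvg_cst|exact: is_derive_cst].
- move=> i; apply/intT_li => [|p|]; [by apply: measurable_funX|exact: sqr_ge0|].
  rewrite /lft; case: ifP => _; first exact: (li_lift (g2 _)).1.
  by rewrite (_ : (fun p => _) = fun=> 0); [exact: li0|apply/funext => p; rewrite expr0n mul0r].
Qed.
End spaces.

(** * The y-average *)

Section average.
Variable R : realType.
Local Notation mu := (L1 R).
Local Notation L4 := (L4 R).
Local Notation L3 := (L3 R).
Local Notation R3 := (R3 R).
Local Notation R4 := (R3R R).
Local Notation J f := (\int[L4]_p (f p * iT p.2)).

Definition avg (f : R4 -> R) (x : R3) : R := (2 * pi)^-1 * \int[mu]_y (f (x, y) * iT y).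

Lemma measurable_avg (f : R4 -> R) : measurable_fun setT f -> measurable_fun setT (avg f).
Proof.
move=> mf; have mfi : measurable_fun setT (fun p : R4 => (f p * iT p.2)%:E).
  by apply/measurable_EFinP; apply: measurable_funM => //; exact: m_iT2.
apply: measurable_funM => //; rewrite /Rintegral; apply: measurableT_comp => //.
have -> : (fun x => \int[mu]_y (f (x, y) * iT y)%:E)%E =
    (fun x => \int[mu]_y (fun p : R4 => (f p * iT p.2)%:E)^\+ (x, y) -
              \int[mu]_y (fun p : R4 => (f p * iT p.2)%:E)^\- (x, y))%E.
  by apply/funext => x; rewrite integralE; congr (_ - _)%E; apply: eq_integral => y _;
    rewrite ?funeposE ?funenegE.
apply: emeasurable_funB.
- by apply: (@measurable_int1 _ _ _ R3 _ mu); [exact: measurable_funepos|move=> p; exact: funepos_ge0].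
- by apply: (@measurable_int1 _ _ _ R3 _ mu); [exact: measurable_funeneg|move=> p; exact: funeneg_ge0].
Qed.

Lemma avg_cst (f : R3 -> R) : avg (fun p => f p.1) = f.
Proof.
apply/funext => x; rewrite /avg /= RintegralZl//; last exact: li_bitv.
rewrite int_bitv ?subr0 ?ltW ?pi2_gt0// mulrCA mulVf ?mulr1// gt_eqF// pi2_gt0//.
Qed.

Lemma li_ae (d : measure_display) (T : measurableType d) (m : {measure set T -> \bar R})
  (f g : T -> R) : measurable_fun setT f -> li m g -> {ae m, forall x, f x = g x} -> li m f.
Proof.
move=> mf gi fg; have mg := li_meas gi.
apply/(li_absP m mf); have := (li_absP m mg).1 gi.
congr (_ < _)%E; apply: ae_eq_integral => //.
- by apply/measurable_EFinP; exact: measurableT_comp.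
- by apply/measurable_EFinP; exact: measurableT_comp.
- by move: fg; apply: filterS => x ->.
Qed.

(** Fubini, a factor depending on x alone coming out of the average. *)
Lemma avg_mul (f : R4 -> R) (h : R3 -> R) : measurable_fun setT f -> measurable_fun setT h ->
  li L4 (fun p => f p * h p.1 * iT p.2) ->
  li L3 (fun x => avg f x * h x) /\
  J (fun p => f p * h p.1) = 2 * pi * \int[L3]_x (avg f x * h x).
Proof.
move=> mf mh fi; have p0 := pi2_gt0 R.
have ma : measurable_fun setT (fun x => avg f x * h x).
  by apply: measurable_funM => //; exact: measurable_avg.
have li1 := li_int1 (m1 := L3) (m2 := mu) fi.
have E : {ae L3, forall x, avg f x * h x = (2 * pi)^-1 * \int[mu]_y (f (x, y) * h x * iT y)}.
  have := ae_int1 (m1 := L3) (m2 := mu) fi; apply: filterS => x hx.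
  rewrite /avg -mulrA; congr (_ * _).
  (* Where [h x] vanishes, the slice of [f] may fail to be integrable, but both sides are zero;
     elsewhere, dividing by [h x] recovers integrability. *)
  have [h0|h0] := eqVneq (h x) 0.
    by rewrite h0 mulr0 Rint_eq0// => y; rewrite mulr0 mul0r.
  have fx : li mu (fun y => f (x, y) * iT y).
    have := liZ (h x)^-1 hx; congr (li mu _); apply/funext => y /=.
    by field.
  rewrite -RintegralZr//; apply: eq_Rintegral => y _; by rewrite mulrAC.
have li2 := liZ (2 * pi)^-1 li1.
split; first exact: li_ae ma li2 E.
rewrite (Rint_ae ma (li_meas li2) E) RintegralZl// mulrA mulfV ?gt_eqF// mul1r.
exact: (Rint_fubini1 (m1 := L3) (m2 := mu) fi).
Qed.

Lemma le_mul_sqrD (a b : R) : `|a * b| <= a ^+ 2 + b ^+ 2.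
Proof.
rewrite normrM -(real_normK (num_real a)) -(real_normK (num_real b)).
move: (`|a|) (`|b|) (normr_ge0 a) (normr_ge0 b) => x y x0 y0; nra.
Qed.

(** Cauchy-Schwarz on the period cell against the constant one. *)
Lemma avg_sqr (f : R4 -> R) : measurable_fun setT f -> li L4 (fun p => f p ^+ 2 * iT p.2) ->
  {ae L3, forall x, avg f x ^+ 2 <= avg (fun p => f p ^+ 2) x}.
Proof.
move=> mf f2; have h := ae_int1 (m1 := L3) (m2 := mu) f2.
have p0 := pi2_gt0 R; have miT := @measurable_iT R.
move: h; apply: filterS => x hx.
have sl : measurable_fun setT (fun t : R => (x, t)) by exact: measurable_fun_pair.
have mfx := measurableT_comp mf sl.
have [I IE [I0 I2]] : exists2 I, (\int[mu]_y (`|f (x, y) * iT y * iT y|)%:E = I%:E)%E &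
    0 <= I /\ I ^+ 2 <= (\int[mu]_y (f (x, y) ^+ 2 * iT y)) * (2 * pi).
  apply: cauchy_schwarz => //; first exact: measurable_funM.
    rewrite -RintE//; apply: eq_integral => t _; congr EFin.
    by rewrite exprMn (expr2 (iT _)) bR_sq.
  rewrite -[2 * pi]subr0 -(int_bitv (ltW p0)) -RintE; last exact: li_bitv.
  by apply: eq_integral => t _; rewrite expr2 bR_sq.
have IE' : (\int[mu]_y (`|f (x, y) * iT y|)%:E = I%:E)%E.
  by rewrite -IE; apply: eq_integral => y _; rewrite -mulrA bR_sq.
have fi : li mu (fun y => f (x, y) * iT y).
  by apply/li_absP; [exact: measurable_funM|rewrite IE' ltry].
have h1 : `|\int[mu]_y (f (x, y) * iT y)| <= I.
  apply: le_trans (le_normr_Rintegral measurableT fi) _.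
  by rewrite /Rintegral IE'.
rewrite /avg exprMn -(real_normK (num_real (\int[mu]_y _))).
have h2 : `|\int[mu]_y (f (x, y) * iT y)| ^+ 2 <= (\int[mu]_y (f (x, y) ^+ 2 * iT y)) * (2 * pi).
  by apply: le_trans I2; rewrite lerXn2r ?nnegrE.
rewrite expr2 -mulrA ler_wpM2l ?invr_ge0 ?(ltW p0)//.
by rewrite ler_pdivrMl// mulrC.
Qed.

Lemma avg_li (f : R4 -> R) : measurable_fun setT f -> li L4 (fun p => f p * iT p.2) ->
  li L3 (avg f) /\ J f = 2 * pi * \int[L3]_x avg f x.
Proof.
move=> mf fi; have := @avg_mul f (fun=> 1) mf (measurable_cst _).
have -> : (fun p : R4 => f p * 1 * iT p.2) = (fun p => f p * iT p.2) by apply/funext => p; rewrite mulr1.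
have -> : (fun x => avg f x * 1) = avg f by apply/funext => x; rewrite mulr1.
by apply.
Qed.

Lemma avg_sqr_li (f : R4 -> R) : measurable_fun setT f -> li L4 (fun p => f p ^+ 2 * iT p.2) ->
  li L3 (fun x => avg f x ^+ 2).
Proof.
move=> mf f2; have [a2 _] := avg_li (measurable_funX 2 mf) f2; have h := avg_sqr mf f2; have ma := measurable_avg mf.
have m2 := measurable_funX 2 ma.
(* The bound on the square holds only almost everywhere, whereas domination is required everywhere:
   the square is first replaced by its minimum with the bound. *)
apply: (@li_ae _ _ L3 _ (fun x => Num.min (avg f x ^+ 2) `|avg (fun p => f p ^+ 2) x|)) => //.
- apply: (li_le (g := fun x => `|avg (fun p => f p ^+ 2) x|)); last exact: li_abs.
  + apply: measurable_minr => //; apply: measurableT_comp => //; exact: li_meas a2.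
  + by move=> x; rewrite ger0_norm ?ge_min ?lexx ?orbT// le_min sqr_ge0 normr_ge0.
- move: h; apply: filterS => x h; by rewrite min_l// (le_trans h)// ler_norm.
Qed.

(** Pythagoras: averaging in y is the orthogonal projection onto functions of x alone. *)
Lemma avg_orth (f : R4 -> R) : measurable_fun setT f -> li L4 (fun p => f p ^+ 2 * iT p.2) ->
  [/\ li L4 (fun p => avg f p.1 ^+ 2 * iT p.2),
      li L4 (fun p => (f p - avg f p.1) ^+ 2 * iT p.2) &
      J (fun p => f p ^+ 2) = J (fun p => avg f p.1 ^+ 2) + J (fun p => (f p - avg f p.1) ^+ 2)].
Proof.
move=> mf f2; have ma := measurable_avg mf; have a2 := avg_sqr_li mf f2.
have mA : measurable_fun setT (fun p : R4 => avg f p.1) := measurableT_comp ma measurable_fst.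
have [l1 e1] := li_lift a2.
have mi := @m_iT2 R.
have l2 : li L4 (fun p => (f p - avg f p.1) ^+ 2 * iT p.2).
  by apply: li_sqrB => // p; exact: iT_ge0.
have l3 : li L4 (fun p => f p * avg f p.1 * iT p.2).
  apply: (li_le (g := fun p => f p ^+ 2 * iT p.2 + avg f p.1 ^+ 2 * iT p.2)); last exact: liD.
    by apply: measurable_funM => //; exact: measurable_funM.
  move=> p; rewrite normrM (ger0_norm (iT_ge0 _)) -mulrDl ler_wpM2r ?iT_ge0//.
  exact: le_mul_sqrD.
have [l4 e4] := avg_mul mf ma l3.
split => //.
have -> : J (fun p => (f p - avg f p.1) ^+ 2) =
    J (fun p => f p ^+ 2) - 2 * J (fun p => f p * avg f p.1) + J (fun p => avg f p.1 ^+ 2).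
  rewrite -RintegralZl// -RintegralB//; last exact: liZ.
  rewrite -RintegralD//; last by apply: liB => //; exact: liZ.
  by apply: eq_Rintegral => p _; ring.
have E : J (fun p => f p * avg f p.1) = J (fun p => avg f p.1 ^+ 2).
  rewrite e4 e1; congr (_ * _); apply: eq_Rintegral => x _; by rewrite expr2.
rewrite E; ring.
Qed.

Lemma avg_fluct0 (f : R4 -> R) : measurable_fun setT f -> li L4 (fun p => f p ^+ 2 * iT p.2) ->
  {ae L3, forall x, li mu (fun y => f (x, y) * iT y) /\
    \int[mu]_y ((f (x, y) - avg f x) * iT y) = 0}.
Proof.
move=> mf f2; have h := ae_int1 (m1 := L3) (m2 := mu) f2.
have p0 := pi2_gt0 R; have miT := @measurable_iT R.
move: h; apply: filterS => x hx.
have sl : measurable_fun setT (fun t : R => (x, t)) by exact: measurable_fun_pair.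
have mfx := measurableT_comp mf sl.
have bi : li mu (@iT R) by exact: li_bitv.
have fi : li mu (fun y => f (x, y) * iT y).
  apply: (li_le (g := fun y => f (x, y) ^+ 2 * iT y + iT y)); last exact: liD.
    exact: measurable_funM.
  move=> t; rewrite normrM (ger0_norm (iT_ge0 t)) -[X in _ + X]mul1r -mulrDl ler_wpM2r ?iT_ge0//.
  rewrite -(real_normK (num_real (f (x, t)))); move: (`|f (x, t)|) (normr_ge0 (f (x, t))) => z z0; nra.
split => //.
have -> : \int[mu]_y ((f (x, y) - avg f x) * iT y) = \int[mu]_y (f (x, y) * iT y - avg f x * iT y).
  by apply: eq_Rintegral => y _; rewrite mulrBl.
rewrite RintegralB//; last exact: liZ.
rewrite RintegralZl// int_bitv ?subr0 ?(ltW p0)// /avg mulrAC mulVf ?gt_eqF// mul1r subrr//.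
Qed.

Definition avg3 (g : 'I_4 -> R4 -> R) (i : 'I_3) : R3 -> R := avg (g (widen_ord (leqnSn 3) i)).

(** A test function on R^3, extended constantly in y, has no compact support on R^3 x R. It is
    multiplied by the cutoffs [sig 0 (2 * pi) m], on which x-derivatives do not act, and [m] tends
    to infinity by dominated convergence; [avg_mul] then turns the limit identity on the cell into
    one on R^3. *)
Lemma H1T_avg u g : H1T u g -> H1R3 (avg u) (avg3 g).
Proof.
move=> H; have [mu' mg u2 g2] := H1T_li H.
have fin (f : R4 -> R) : measurable_fun setT f -> li L4 (fun p => f p ^+ 2 * iT p.2) ->
    (int3 (fun x => (avg f x ^+ 2)%R) < +oo)%E.
  move=> mf f2; rewrite /int3 int3E; apply/li_ge0P; last exact: avg_sqr_li.
    by apply: measurable_funX; exact: measurable_avg.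
  by move=> x; exact: sqr_ge0.
split; first exact: measurable_avg.
split; first exact: fin.
split; last by move=> i; exact: fin.
move=> i; split; first exact: measurable_avg.
move=> phi tp; rewrite !int3E.
set j := widen_ord (leqnSn 3) i.
have ji : inord j = i by exact: inord_val.
have j3 : (j < 3)%N by exact: (ltn_ord i).
have [n [C [_ HC]]] := test3_supp tp; have [mp md] := test3_meas tp.
have mi := @m_iT2 R.
have ibi : li L4 (fun p => ib3 n p.1 * iT p.2) := (li_lift (li_ib3 R n)).1.
have ib01 (p : R4) : 0 <= ib3 n p.1 * iT p.2 <= 1.
  have /andP[b0 b1] := ib3_01 n p.1; have /andP[t0 t1] := bR01 R (0 < p.2 < 2 * pi).
  by rewrite mulr_ge0//= -[leRHS]mulr1 ler_pM.
have key (f : R4 -> R) (h : R3 -> R) : measurable_fun setT f -> li L4 (fun p => f p ^+ 2 * iT p.2) ->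
    measurable_fun setT h -> (forall x, h x * ib3 n x = h x) -> (forall x, `|h x| <= C) ->
    li L4 (fun p => f p * h p.1 * iT p.2).
  move=> mf f2 mh hb hC.
  have := @li_supp R _ _ L4 (fun p => f p * iT p.2) (fun p => h p.1 * iT p.2) (fun p => ib3 n p.1 * iT p.2) C.
  have -> : (fun p : R4 => f p * iT p.2 * (h p.1 * iT p.2)) = (fun p => f p * h p.1 * iT p.2).
    by apply/funext => p; rewrite mulrACA bR_sq.
  apply=> //.
  - exact: measurable_funM.
  - by apply: measurable_funM => //; exact: measurableT_comp mh measurable_fst.
  - by move: f2; congr (li L4 _); apply/funext => p; rewrite exprMn (expr2 (iT _)) bR_sq.
  - by move=> p; rewrite mulrACA hb bR_sq.
  - move=> p; have /andP[t0 t1] := bR01 R (0 < p.2 < 2 * pi).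
    by rewrite normrM (ger0_norm t0) -[leRHS]mulr1 ler_pM.
have l1 : li L4 (fun p => u p * pderiv (shift3 i) phi p.1 * iT p.2).
  apply: key => // x; by have [_ _ /(_ i)[]] := HC x.
have l2 : li L4 (fun p => g j p * phi p.1 * iT p.2) by apply: key => // x; have [] := HC x.
have [a1 e1] := avg_mul mu' (md i) l1; have [a2 e2] := avg_mul (mg j) mp l2.
apply/wg_iff => //.
have p0 := pi2_gt0 R.
suff E : \int[L4]_p (u p * pderiv (shift3 i) phi p.1 * iT p.2 + g j p * phi p.1 * iT p.2) = 0.
  apply: (mulfI (lt0r_neq0 p0)); rewrite mulr0 RintegralD// mulrDr -e1 -e2 -RintegralD//.
have lF := liD l1 l2.
pose F m (p : R4) := u p * pderiv (shift3 i) phi p.1 * sig 0 (2 * pi) m p.2 + g j p * phi p.1 * sig 0 (2 * pi) m p.2.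
have si m (p : R4) : sig 0 (2 * pi) m p.2 = iT p.2 * sig 0 (2 * pi) m p.2.
  by have [->] := iT_fam (tst_sig 0 (2 * pi) m) p.2.
have ms m : measurable_fun setT (fun p : R4 => sig 0 (2 * pi) m p.2).
  by have [h _] := tst_meas (tst_sig 0 (2 * pi : R) m); exact: measurableT_comp h measurable_snd.
have s1 m (p : R4) : `|sig 0 (2 * pi) m p.2| <= 1 by exact: sig_norm.
have l1m m : li L4 (fun p => u p * pderiv (shift3 i) phi p.1 * sig 0 (2 * pi) m p.2).
  have := li_bdd l1 (ms m) (s1 m); congr (li L4 _); apply/funext => p.
  by rewrite [in RHS]si mulrA.
have l2m m : li L4 (fun p => g j p * phi p.1 * sig 0 (2 * pi) m p.2).
  have := li_bdd l2 (ms m) (s1 m); congr (li L4 _); apply/funext => p.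
  by rewrite [in RHS]si mulrA.
have F0 m : (\int[L4]_p (F m p)%:E = 0)%E.
  rewrite RintE; last by exact: liD.
  congr EFin.
  have [t4 d4] := tens_test tp (tst_sig 0 (2 * pi) m).
  have [_ [_ [_ [w _]]]] := H; have [_ /(_ _ t4)] := w j; rewrite !int4E d4 j3 ji.
  have e1' : (fun p : R4 => u p * (pderiv (shift3 i) phi p.1 * sig 0 (2 * pi) m p.2)) =
     (fun p => u p * pderiv (shift3 i) phi p.1 * sig 0 (2 * pi) m p.2) by apply/funext => p; rewrite mulrA.
  have e2' : (fun p : R4 => g j p * (phi p.1 * sig 0 (2 * pi) m p.2)) =
     (fun p => g j p * phi p.1 * sig 0 (2 * pi) m p.2) by apply/funext => p; rewrite mulrA.
  move=> h; apply/(wg_iff (l1m m) (l2m m)).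
  transitivity (\int[L4]_x (u x * (pderiv (shift3 i) phi x.1 * sig 0 (2 * pi) m x.2))%:E)%E.
    by apply: eq_integral => p _; rewrite mulrA.
  by rewrite h; congr (- _)%E; apply: eq_integral => p _; rewrite mulrA.
pose G (p : R4) := u p * pderiv (shift3 i) phi p.1 * iT p.2 + g j p * phi p.1 * iT p.2.
pose D (p : R4) := `|u p * pderiv (shift3 i) phi p.1 * iT p.2| + `|g j p * phi p.1 * iT p.2|.
have cv : (\int[L4]_p (F m p)%:E)%E @[m --> \oo] --> (\int[L4]_p (G p)%:E)%E.
  apply: (@dominated_cvg _ _ _ L4 setT measurableT (fun m p => (F m p)%:E) (fun p => (G p)%:E) (fun p => (D p)%:E)).
  - by move=> m; apply/measurable_EFinP; exact: li_meas (liD (l1m m) (l2m m)).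
  - move=> p _; apply/cvg_EFin; first by near=> m.
    by apply: cvgD; apply: cvgM; (try exact: cvg_cst); exact: sig_cvg.
  - by move=> p _.
  - by apply: liD; exact: li_abs.
  - move=> m p _; rewrite lee_fin /F /D (le_trans (ler_normD _ _))//.
    by apply: lerD; rewrite si mulrA [leLHS]normrM ler_piMr// sig_norm.
have : (\int[L4]_p (G p)%:E)%E = 0%E.
  have z : (\int[L4]_p (F m p)%:E)%E @[m --> \oo] --> 0%E.
    by rewrite (_ : (fun m => _) = fun=> 0%E); [exact: cvg_cst|apply/funext => m; exact: F0].
  exact: (cvg_unique _ cv z).
by rewrite RintE// => -[].
Unshelve. all: by end_near.
Qed.
End average.

(** * Scaling and explicit functions *)

Section scl.
Context (R : realType) (d1 d2 d3 : measure_display).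
Context (X : measurableType d1) (Y : measurableType d2) (Z : measurableType d3).

(** Change of variables with constant Jacobian factor, stated for nonnegative integrands so that it
    composes and passes to products. *)
Definition scl (k : R) (m : {measure set X -> \bar R}) (m' : {measure set Y -> \bar R})
    (phi : X -> Y) :=
  measurable_fun setT phi /\ forall f : Y -> \bar R, measurable_fun setT f ->
    (forall y, 0 <= f y)%E -> (\int[m]_x f (phi x) = k%:E * \int[m']_y f y)%E.
End scl.

Section scl_theory.
Context (R : realType) (d1 d2 d3 : measure_display).
Context (X : measurableType d1) (Y : measurableType d2) (Z : measurableType d3).

Lemma scl_comp k k' (m1 : {measure set X -> \bar R}) (m2 : {measure set Y -> \bar R})
  (m3 : {measure set Z -> \bar R}) f g : scl k m1 m2 f -> scl k' m2 m3 g ->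
  scl (k * k') m1 m3 (g \o f).
Proof.
move=> [mf Hf] [mg Hg]; split; first exact: measurableT_comp.
move=> h mh h0; rewrite /= (Hf (fun y => h (g y)))//; last exact: measurableT_comp mh mg.
by rewrite Hg// EFinM muleA.
Qed.

Lemma scl_map1 k (m1 : {sigma_finite_measure set X -> \bar R})
  (m2 : {sigma_finite_measure set Y -> \bar R}) (m3 : {sigma_finite_measure set Z -> \bar R})
  (f : X -> Y) : 0 <= k -> scl k m1 m2 f ->
  scl k (prodm m1 m3) (prodm m2 m3) (fun p => (f p.1, p.2)).
Proof.
move=> k0 [mf Hf].
have mg : measurable_fun setT (fun p : X * Z => (f p.1, p.2)).
  by apply: measurable_fun_pair => //; exact: measurableT_comp.
split=> // h mh h0.
rewrite (@tonelli2 _ _ _ _ _ m1 m3 (fun p => h (f p.1, p.2)))//; last exact: measurableT_comp mh mg.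
rewrite (@tonelli2 _ _ _ _ _ m2 m3 h)// -ge0_integralZl//.
- apply: eq_integral => z _; apply: (Hf (fun y => h (y, z))) => //.
  by apply: measurableT_comp mh _; exact: measurable_fun_pair.
- exact: measurable_int2.
- by move=> z _; apply: integral_ge0.
Qed.

Lemma scl_map2 k (m1 : {sigma_finite_measure set X -> \bar R})
  (m2 : {sigma_finite_measure set Y -> \bar R}) (m3 : {sigma_finite_measure set Z -> \bar R})
  (f : X -> Y) : 0 <= k -> scl k m1 m2 f ->
  scl k (prodm m3 m1) (prodm m3 m2) (fun p => (p.1, f p.2)).
Proof.
move=> k0 [mf Hf].
have mg : measurable_fun setT (fun p : Z * X => (p.1, f p.2)).
  by apply: measurable_fun_pair => //; exact: measurableT_comp.
split=> // h mh h0.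
rewrite (@tonelli1 _ _ _ _ _ m3 m1 (fun p => h (p.1, f p.2)))//; last exact: measurableT_comp mh mg.
rewrite (@tonelli1 _ _ _ _ _ m3 m2 h)// -ge0_integralZl//.
- apply: eq_integral => z _; apply: (Hf (fun y => h (z, y))) => //.
  by apply: measurableT_comp mh _; exact: measurable_fun_pair.
- exact: measurable_int1.
- by move=> z _; apply: integral_ge0.
Qed.

End scl_theory.

(** The signed version holds for every measurable integrand, infinite integrals included, by cases
    on the two parts; weak identities can thus be transported under a dilation before integrability
    is discussed. *)
Lemma scl_int (R : realType) (d1 d2 : measure_display) (X : measurableType d1)
  (Y : measurableType d2) (k c : R) (m : {measure set X -> \bar R})
  (m' : {measure set Y -> \bar R}) (f : X -> Y) (F : Y -> R) :
  0 < k -> 0 < c -> scl k m m' f -> measurable_fun setT F ->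
  (\int[m]_x (c * F (f x))%:E = (c * k)%:E * \int[m']_y (F y)%:E)%E.
Proof.
move=> k0 c0 [mf Hf] mF; have mE : measurable_fun setT (EFin \o F) by exact/measurable_EFinP.
have ck : 0 < c * k by exact: mulr_gt0.
rewrite integralE [in RHS]integralE.
have E1 : (\int[m]_x ((fun x => (c * F (f x))%:E)^\+ x) = (c * k)%:E * \int[m']_y (EFin \o F)^\+ y)%E.
  rewrite EFinM -muleA -(Hf _ (measurable_funepos mE) (funepos_ge0 _)) -ge0_integralZl//.
  - apply: eq_integral => x _; rewrite !funeposE /= EFinM maxe_pMr ?ltW// ?mule0//.
  - exact: measurableT_comp (measurable_funepos mE) mf.
  - by rewrite lee_fin ltW.
have E2 : (\int[m]_x ((fun x => (c * F (f x))%:E)^\- x) = (c * k)%:E * \int[m']_y (EFin \o F)^\- y)%E.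
  rewrite EFinM -muleA -(Hf _ (measurable_funeneg mE) (funeneg_ge0 _)) -ge0_integralZl//.
  - apply: eq_integral => x _; rewrite !funenegE /= -mulrN EFinM maxe_pMr ?ltW// ?mule0//.
  - exact: measurableT_comp (measurable_funeneg mE) mf.
  - by rewrite lee_fin ltW.
rewrite E1 E2.
have : (0 <= \int[m']_y (EFin \o F)^\+ y)%E by exact: integral_ge0.
have : (0 <= \int[m']_y (EFin \o F)^\- y)%E by exact: integral_ge0.
case: (\int[m']_y (EFin \o F)^\- y)%E => [a| |] //= ha; case: (\int[m']_y (EFin \o F)^\+ y)%E => [b| |] //= hb.
- by rewrite -[LHS]/((c * k * b - c * k * a)%:E) -[RHS]/((c * k * (b - a))%:E) mulrBr.
- by rewrite gt0_muley ?lte_fin// addye// addye// gt0_muley ?lte_fin.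
- by rewrite addeNy gt0_muleNy ?lte_fin// gt0_muley ?lte_fin.
- by rewrite !gt0_muley ?lte_fin//= gt0_muleNy ?lte_fin.
Qed.

Section scaling.
Variable R : realType.
Local Notation mu := (L1 R).
Local Notation L4 := (L4 R).
Local Notation R3 := (R3 R).
Local Notation R4 := (R3R R).
Local Notation J f := (\int[L4]_p (f p * iT p.2)).

Definition dil (s : R) (p : R4) : R4 := (((s * p.1.1.1, s * p.1.1.2), s * p.1.2), p.2).
(* The factor by which [dil s] multiplies the i-th partial derivative. *)
Definition dilk (s : R) (i : 'I_4) : R := if (i < 3)%N then s else 1.

Lemma scl_dil s : 0 < s -> scl (s ^- 3) L4 L4 (dil s).
Proof.
move=> s0; have si : 0 <= s^-1 by rewrite invr_ge0 ltW.
have h1 : scl s^-1 mu mu ( *%R s).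
  split; first exact: measurable_funM.
  move=> f mf f0; rewrite -(@ge0_int_affine _ s 0)//.
  by apply: eq_integral => x _; rewrite addr0.
have a1 := scl_map1 mu si (scl_map1 mu si (scl_map1 mu si h1)).
have a2 := scl_map1 mu si (scl_map1 mu si (scl_map2 mu si h1)).
have a3 := scl_map1 mu si (scl_map2 (L2 R) si h1).
have := scl_comp (scl_comp a1 a2) a3.
rewrite -exprVn (_ : s^-1 * s^-1 * s^-1 = s^-1 ^+ 3)//; ring.
Qed.

Lemma dilK s : s != 0 -> forall p, dil s^-1 (dil s p) = p.
Proof. by move=> s0 [[[a b] c] e]; rewrite /dil /= !mulKf. Qed.

Lemma dil_cont s : continuous (dil s).
Proof.
have cs : continuous (fun t : R => s * t).
  by move=> t; apply: cvgM; [exact: cvg_cst|exact: cvg_id].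
have c1 : continuous (fun x : R4 => x.1.1) := cont_compT (@fst_cont R3 R) (@fst_cont (R * R)%type R).
have c11 : continuous (fun x : R4 => x.1.1.1) := cont_compT c1 (@fst_cont R R).
have c12 : continuous (fun x : R4 => x.1.1.2) := cont_compT c1 (@snd_cont R R).
have c13 : continuous (fun x : R4 => x.1.2) := cont_compT (@fst_cont R3 R) (@snd_cont (R * R)%type R).
have := cont_pair (cont_pair (cont_pair (cont_compT c11 cs) (cont_compT c12 cs)) (cont_compT c13 cs)) (@snd_cont R3 R).
exact.
Qed.

Lemma dil_shift s i t p : dil s (shift4 i t p) = shift4 i (dilk s i * t) (dil s p).
Proof.
case: p => [[[a b] c] e]; rewrite /dil /dilk; case: i => [[|[|[|[|m]]]] im] //;
  by rewrite !shift4E /= ?mulrDr ?mul1r.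
Qed.

Lemma test4_dil s (phi : R4 -> R) : s != 0 -> test4 phi -> test4 (fun p => phi (dil s p)) /\
  forall i p, pderiv (shift4 i) (fun p => phi (dil s p)) p = dilk s i * pderiv (shift4 i) phi (dil s p).
Proof.
move=> s0 [cp [[K [cK K0]] dp]].
have D i p : is_derive (0 : R) (1 : R) (fun t => phi (dil s (shift4 i t p)))
    (dilk s i * pderiv (shift4 i) phi (dil s p)).
  have [_ /(_ 0) h1] := C1_affine (dilk s i) 0.
  have h2 := is_derive_pderiv ((dp i).1 (dil s p)).
  rewrite -[X in is_derive X _ _ _](_ : dilk s i * 0 + 0 = 0) in h2; last by rewrite mulr0 addr0.
  have := @is_derive1_comp _ (fun t => phi (shift4 i t (dil s p))) (fun x => dilk s i * x + 0) 0 _ _ h2 h1.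
  rewrite mulrC.
  congr (is_derive _ _ _ _); apply/funext => t /=; by rewrite addr0 dil_shift.
have E i : pderiv (shift4 i) (fun p => phi (dil s p)) = fun p => dilk s i * pderiv (shift4 i) phi (dil s p).
  by apply/funext => p; exact: pderivE (D i p).
split; last by move=> i p; rewrite E.
split; [exact: cont_compT (@dil_cont s) cp|split].
  exists (dil s^-1 @` K); split.
    by apply: continuous_compact => //; apply: continuous_subspaceT; exact: dil_cont.
  move=> p h; apply: K0 => Kp; apply: h; exists (dil s p) => //.
  exact: dilK.
move=> i; split; first by move=> p; case: (D i p).
rewrite E; apply: contM; first exact: cont_cst.
exact: cont_compT (@dil_cont s) (dp i).2.
Qed.

Lemma dilk_gt0 s i : 0 < s -> 0 < dilk s i.
Proof. by rewrite /dilk; case: ifP. Qed.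

Lemma J_dil s (f : R4 -> R) c : 0 < s -> 0 < c -> measurable_fun setT f ->
  li L4 (fun p => f p * iT p.2) ->
  li L4 (fun p => c * f (dil s p) * iT p.2) /\
  J (fun p => c * f (dil s p)) = c * s ^- 3 * J f.
Proof.
move=> s0 c0 mf fi; have S := scl_dil s0; have s3 : 0 < s ^- 3 by rewrite invr_gt0 exprn_gt0.
have mfi := li_meas fi.
have E : (\int[L4]_p (c * f (dil s p) * iT p.2)%:E = (c * s ^- 3 * J f)%:E)%E.
  rewrite EFinM -RintE// -(scl_int s3 c0 S mfi).
  by apply: eq_integral => p _; rewrite mulrA.
split; last by rewrite /Rintegral E.
have mfa : measurable_fun setT (fun p => `|f p * iT p.2|) by exact: measurableT_comp.
apply/li_absP.
  rewrite (_ : (fun p => _) = fun p => c * (f (dil s p) * iT (dil s p).2)); last first.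
    by apply/funext => p; rewrite mulrA.
  by apply: measurable_funM => //; exact: measurableT_comp mfi S.1.
have := scl_int s3 c0 S mfa.
rewrite (RintE (li_abs fi)) -EFinM => h.
rewrite (_ : (\int[L4]_x _)%E = (\int[L4]_x (c * `|f (dil s x) * iT (dil s x).2|)%:E)%E).
  by rewrite h ltry.
by apply: eq_integral => p _; rewrite -mulrA (normrM c) (gtr0_norm c0).
Qed.

Lemma H1T_dil u g s c : 0 < s -> 0 < c -> H1T u g ->
  H1T (fun p => c * u (dil s p)) (fun i p => c * dilk s i * g i (dil s p)).
Proof.
move=> s0 c0 H; have [mu' mg u2 g2] := H1T_li H; have S := scl_dil s0.
have [_ [per [_ [w _]]]] := H.
have s3 : 0 < s ^- 3 by rewrite invr_gt0 exprn_gt0.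
have sn : s != 0 by rewrite gt_eqF.
have mU : measurable_fun setT (fun p => c * u (dil s p)).
  by apply: measurable_funM => //; exact: measurableT_comp mu' S.1.
have mG i : measurable_fun setT (fun p => c * dilk s i * g i (dil s p)).
  by apply: measurable_funM => //; exact: measurableT_comp (mg i) S.1.
split=> //; split; first by move=> x y; rewrite /dil /= per.
split.
  apply/intT_li => [|p|]; [exact: measurable_funX|exact: sqr_ge0|].
  have [h _] := J_dil s0 (exprn_gt0 2 c0) (measurable_funX 2 mu') u2.
  by move: h; congr (li L4 _); apply/funext => p; rewrite exprMn.
split; last first.
  move=> i; apply/intT_li => [|p|]; [exact: measurable_funX|exact: sqr_ge0|].
  have ck : 0 < c * dilk s i by rewrite mulr_gt0// dilk_gt0.
  have [h _] := J_dil s0 (exprn_gt0 2 ck) (measurable_funX 2 (mg i)) (g2 i).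
  by move: h; congr (li L4 _); apply/funext => p; rewrite [in RHS]exprMn.
move=> i; split=> // phi tp; rewrite !int4E.
have sV : s^-1 != 0 by rewrite invr_eq0.
have [tq _] := test4_dil sV tp.
(* The dilation is moved onto the test function: [phi] is [psi] composed with [dil s], and the weak
   identity of [u] is applied to [psi]. *)
pose psi p := phi (dil s^-1 p).
have [_ dq] := test4_dil sn tq.
have phiE p : phi p = psi (dil s p) by rewrite /psi dilK.
have phiF : (fun p => psi (dil s p)) = phi by apply/funext => p; rewrite phiE.
have [mp md] := test4_meas tq.
have [_ /(_ _ tq)] := w i; rewrite !int4E => E.
have ck : 0 < c * dilk s i by rewrite mulr_gt0// dilk_gt0.
transitivity ((c * dilk s i * s ^- 3)%:E * \int[L4]_p (u p * pderiv (shift4 i) psi p)%:E)%E.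
  rewrite -(scl_int s3 ck S (measurable_funM mu' (md i))).
  apply: eq_integral => p _; rewrite -[in LHS]phiF dq; congr EFin; rewrite /psi /=; ring.
rewrite E muleN -(scl_int s3 ck S (measurable_funM (mg i) mp)); congr (- _)%E.
apply: eq_integral => p _; rewrite [in RHS]phiE; congr EFin; rewrite /psi /=; ring.
Qed.
End scaling.

(** * Explicit product functions and spikes in y *)

Section explicit.
Variable R : realType.
Local Notation mu := (L1 R).
Local Notation L4 := (L4 R).
Local Notation R3 := (R3 R).
Local Notation R4 := (R3R R).
Local Notation J f := (\int[L4]_p (f p * iT p.2)).

Lemma li_cont_box n (f : R4 -> R) : continuous f -> (forall p, f p * ib4 n p = f p) -> li L4 f.
Proof.
move=> cf fb; pose I := `[(- n%:R : R), n%:R]%classic.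
have cK : compact ((I `*` I) `*` I `*` I : set R4).
  by repeat apply: compact_setX; exact: segment_compact.
have f0 p : ~ ((I `*` I) `*` I `*` I) p -> f p = 0.
  move=> h; rewrite -fb; suff -> : ib4 n p = 0 by rewrite mulr0.
  apply/eqP; apply: contra_notT h; rewrite /ib4 /ib3 !mulf_eq0 !negb_or => /andP[/andP[/andP[h1 h2] h3] h4].
  have H (t : R) : iB n t != 0 -> I t.
    rewrite /iB /I /= in_itv/=; case: (boolP (- n%:R < t < n%:R)) => [/andP[/ltW -> /ltW ->]//|_].
    by rewrite /bR eqxx.
  by split; [split; [split|]|]; exact: H.
have [C C0 HC] := compact_bdd0 cK cf f0.
apply: (li_le (g := fun p => C * ib4 n p)); first exact: cont4_meas.
  move=> p; rewrite -fb normrM; have /andP[b0 _] := ib4_01 n p.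
  by rewrite (ger0_norm b0) ler_wpM2r.
by apply: liZ; exact: li_ib4.
Qed.

Lemma C1_mulr (f f' : R -> R) k : C1 f f' -> C1 (fun t => f t * k) (fun t => f' t * k).
Proof.
move=> [cf' df]; split=> t; last exact: is_derive_mulr.
by apply: cvgM; [exact: cf'|exact: cvg_cst].
Qed.

Lemma tprod_cont (f1 f2 f3 f4 : R -> R) : continuous f1 -> continuous f2 -> continuous f3 ->
  continuous f4 -> continuous (tprod f1 f2 f3 f4).
Proof.
move=> h1 h2 h3 h4.
have c1 : continuous (fun x : R4 => x.1.1) := cont_compT (@fst_cont R3 R) (@fst_cont (R * R)%type R).
have c11 : continuous (fun x : R4 => x.1.1.1) := cont_compT c1 (@fst_cont R R).
have c12 : continuous (fun x : R4 => x.1.1.2) := cont_compT c1 (@snd_cont R R).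
have c13 : continuous (fun x : R4 => x.1.2) := cont_compT (@fst_cont R3 R) (@snd_cont (R * R)%type R).
exact: contM (contM (contM (cont_compT c11 h1) (cont_compT c12 h2)) (cont_compT c13 h3)) (cont_compT (@snd_cont R3 R) h4).
Qed.

Lemma dprod_cont i (f1 f1' f2 f2' f3 f3' f4 f4' : R -> R) : C1 f1 f1' -> C1 f2 f2' -> C1 f3 f3' ->
  C1 f4 f4' -> continuous (dprod i f1 f1' f2 f2' f3 f3' f4 f4').
Proof.
move=> h1 h2 h3 h4; have c1 := C1_cont h1; have c2 := C1_cont h2; have c3 := C1_cont h3.
have c4 := C1_cont h4; have [d1 _] := h1; have [d2 _] := h2; have [d3 _] := h3; have [d4 _] := h4.
by rewrite /dprod; do 3 (case: ifP => _; first exact: tprod_cont); exact: tprod_cont.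
Qed.

Lemma li_itv_cont (f : R -> R) k : continuous f -> li mu (fun t => f t ^+ k * iT t).
Proof.
move=> cf; have [C C0 HC] := compact_bdd (@segment_compact R 0 (2 * pi)) cf.
have mf := continuous_measurable_fun cf.
apply: (@li_bdd_itv _ 0 (2 * pi) _ (C ^+ k)).
- by apply: measurable_funM; [exact: measurable_funX|exact: measurable_iT].
- move=> t; case: (boolP (0 < t < 2 * pi)) => h; last first.
    by rewrite /iT (negbTE h) /bR mulr0 normr0 exprn_ge0.
  rewrite /iT h /bR mulr1 normrX lerXn2r ?nnegrE//; apply: HC; rewrite /= in_itv/=.
  by move: h => /andP[/ltW -> /ltW ->].
- by move=> t h; rewrite /iT (negbTE h) /bR mulr0.
Qed.

Lemma li_tst_pow a b (f f' : R -> R) k : tst a b f f' ->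
  li mu (fun t => f t ^+ k.+1) /\ li mu (fun t => f' t ^+ k.+1).
Proof.
move=> tf; have [C C0 HC] := tst_bdd tf; have [m1 m2] := tst_meas tf.
split; apply: (@li_bdd_itv _ a b _ (C ^+ k.+1)).
- exact: measurable_funX.
- by move=> t; rewrite normrX lerXn2r ?nnegrE//; have [] := HC t.
- by move=> t h; rewrite (tf.2 _ h).1 expr0n.
- exact: measurable_funX.
- by move=> t; rewrite normrX lerXn2r ?nnegrE//; have [] := HC t.
- by move=> t h; rewrite (tf.2 _ h).2 expr0n.
Qed.

Lemma Rint_tprod (f1 f2 f3 f4 : R -> R) : li mu f1 -> li mu f2 -> li mu f3 -> li mu f4 ->
  \int[L4]_p tprod f1 f2 f3 f4 p =
  (\int[mu]_t f1 t) * (\int[mu]_t f2 t) * (\int[mu]_t f3 t) * (\int[mu]_t f4 t).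
Proof.
move=> h1 h2 h3 h4.
rewrite (Rint_prod (prod_li (prod_li h1 h2) h3) h4); congr (_ * _).
rewrite (Rint_prod (prod_li h1 h2) h3); congr (_ * _).
exact: Rint_prod.
Qed.

Lemma tprodX (f1 f2 f3 f4 : R -> R) k p : tprod f1 f2 f3 f4 p ^+ k * iT p.2 =
  tprod (fun t => f1 t ^+ k) (fun t => f2 t ^+ k) (fun t => f3 t ^+ k) (fun t => f4 t ^+ k * iT t) p.
Proof. by rewrite /tprod !exprMn !mulrA. Qed.

Lemma J_tprod (f1 f2 f3 f4 : R -> R) k : li mu (fun t => f1 t ^+ k) -> li mu (fun t => f2 t ^+ k) ->
  li mu (fun t => f3 t ^+ k) -> li mu (fun t => f4 t ^+ k * iT t) ->
  li L4 (fun p => tprod f1 f2 f3 f4 p ^+ k * iT p.2) /\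
  J (fun p => tprod f1 f2 f3 f4 p ^+ k) = (\int[mu]_t f1 t ^+ k) * (\int[mu]_t f2 t ^+ k) *
    (\int[mu]_t f3 t ^+ k) * (\int[mu]_t (f4 t ^+ k * iT t)).
Proof.
move=> h1 h2 h3 h4; split.
  rewrite (_ : (fun p => _) = tprod (fun t => f1 t ^+ k) (fun t => f2 t ^+ k) (fun t => f3 t ^+ k)
    (fun t => f4 t ^+ k * iT t)); first exact: li_tprod.
  by apply/funext => p; rewrite tprodX.
rewrite -Rint_tprod//; apply: eq_Rintegral => p _; exact: tprodX.
Qed.

Definition gexp (b b' e e' : R -> R) (i : 'I_4) : R4 -> R := dprod i b b' b b' b b' e e'.

(** Classical derivatives are weak ones by [ibp4]. The factor [e] only has to be periodic, since the
    test function supplies the compact support in y. *)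
Lemma H1T_explicit (b b' e e' : R -> R) : tst (-1) 1 b b' -> C1 e e' ->
  (forall y, e (y + 2 * pi) = e y) -> H1T (tprod b b b e) (gexp b b' e e').
Proof.
move=> tb Ce per; have Cb := tb.1.
have [cb cb'] : continuous b /\ continuous b' by split; [exact: C1_cont Cb|exact: Cb.1].
have [ce ce'] : continuous e /\ continuous e' by split; [exact: C1_cont Ce|exact: Ce.1].
have cu := tprod_cont cb cb cb ce.
have cg i : continuous (gexp b b' e e' i) by exact: dprod_cont.
have mu' := cont4_meas cu; have mg i := cont4_meas (cg i).
have [lb lb'] := li_tst_pow 1 tb; have le := li_itv_cont 2 ce; have le' := li_itv_cont 2 ce'.
split=> //; split; first by move=> x y; rewrite /tprod /= per.
split.
  apply/intT_li => [|p|]; [exact: measurable_funX|exact: sqr_ge0|].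
  by have [] := J_tprod lb lb lb le.
split; last first.
  move=> i; apply/intT_li => [|p|]; [exact: measurable_funX|exact: sqr_ge0|].
  rewrite /gexp /dprod; case: ifP => _; first by have [] := J_tprod lb' lb lb le.
  case: ifP => _; first by have [] := J_tprod lb lb' lb le.
  case: ifP => _; first by have [] := J_tprod lb lb lb' le.
  by have [] := J_tprod lb lb lb le'.
move=> i; split=> // phi tp; rewrite !int4E.
have [n [C [_ HC]]] := test4_supp tp; have [cp [_ dp]] := tp.
have l1 : li L4 (fun p => tprod b b b e p * pderiv (shift4 i) phi p).
  apply: (@li_cont_box n); first exact: contM cu (dp i).2.
  by move=> p; rewrite -mulrA; have [_ _ /(_ i)[-> _]] := HC p.
have l2 : li L4 (fun p => gexp b b' e e' i p * phi p).
  apply: (@li_cont_box n); first exact: contM (cg i) cp.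
  by move=> p; rewrite -mulrA; have [-> _ _] := HC p.
apply/wg_iff => //; apply: ibp4 => //.
move=> [[x y] z]; case: i {l1 l2} => [[|[|[|[|m]]]] im] //; rewrite /swl /gexp /dprod /tprod /=.
- have := C1_mulr (b y * b z * e x) Cb; congr C1; apply/funext => t; ring.
- have := C1_mulr (b x * b z * e y) Cb; congr C1; apply/funext => t; ring.
- have := C1_mulr (b x * b y * e z) Cb; congr C1; apply/funext => t; ring.
- have := C1_mulr (b x * b y * b z) Ce; congr C1; apply/funext => t; ring.
Qed.

Lemma C1_cos : C1 (@cos R) (fun t => - sin t).
Proof.
split=> t; last exact: is_derive_cos.
by apply: cvgN; exact: continuous_sin.
Qed.

(* A 2pi-periodic C^1 bump concentrating at [y = 0] as [c] tends to 1. *)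
Definition spk (c t : R) : R := pos (cos t - c) ^+ 2.
Definition dspk (c t : R) : R := 2 * pos (cos t - c) * - sin t.

Lemma C1_spk c : C1 (spk c) (dspk c).
Proof.
have h := C1_comp (C1_affine 1 (- c)) C1_cos; have := C1_comp (@C1_pos2 R) h.
congr C1; apply/funext => t; rewrite /spk /dspk !mul1r//.
Qed.

Lemma spk_per c y : spk c (y + 2 * pi) = spk c y.
Proof. by rewrite /spk (_ : 2 * pi = pi *+ 2) ?cosD2pi// mulr2n mulrDl !mul1r. Qed.

Lemma cos_lt1 (t : R) : 0 < t < 2 * pi -> cos t < 1.
Proof.
move=> /andP[t0 t1].
have s0 : 0 < sin (t / 2) by apply: sin_gt0_pi; apply/andP; split; lra.
have -> : t = (t / 2) *+ 2 by rewrite mulr2n -splitr.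
rewrite cos_mulr2n; have := cos2Dsin2 (t / 2).
have : 0 < sin (t / 2) ^+ 2 by rewrite exprn_gt0.
rewrite mulr2n; lra.
Qed.

(** Inside the period the cosine is below 1, so the sets where it exceeds [1 - 1/(n+1)] shrink to a
    null set, and their measures tend to zero. *)
Lemma spk_supp (eps : R) : 0 < eps -> exists2 c : R, c < 1 &
  \int[mu]_t (bR R (c < cos t) * iT t) <= eps.
Proof.
move=> e0; pose c (n : nat) : R := 1 - n.+1%:R^-1.
have mb n : measurable_fun setT (fun t : R => bR R (c n < cos t)).
  apply: measurable_natb; apply: measurable_fun_ltr => //.
  exact: continuous_measurable_fun (@continuous_cos R).
have li_n n : li mu (fun t => bR R (c n < cos t) * iT t).
  have := li_bdd (li_bitv (0 : R) (2 * pi)) (mb n) (fun t => ind_le1 _ _).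
  by congr (li mu _); apply/funext => t; rewrite mulrC.
have cv : (\int[mu]_t (bR R (c n < cos t) * iT t)%:E)%E @[n --> \oo] --> (\int[mu]_t (0 : R)%:E)%E.
  apply: (@dominated_cvg _ _ _ mu setT measurableT (fun n t => (bR R (c n < cos t) * iT t)%:E)
    (fun=> (0 : R)%:E) (fun t => (iT t)%:E)).
  - by move=> n; apply/measurable_EFinP; exact: li_meas (li_n n).
  - move=> t _; apply/cvg_EFin; first by near=> n.
    case: (boolP (0 < t < 2 * pi)) => ht; last first.
      rewrite (_ : (fun n => _) = fun=> 0); first exact: cvg_cst.
      by apply/funext => n /=; rewrite /iT (negbTE ht) /bR mulr0.
    have ct := cos_lt1 ht.
    have hn : \forall n \near \oo, `|n.+1%:R^-1 : R| < 1 - cos t.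
      have : (n.+1%:R^-1 : R) @[n --> \oo] --> (0 : R) by exact: cvg_harmonic.
      by move=> /cvgr0Pnorm_lt /(_ (1 - cos t)); rewrite subr_gt0 => /(_ ct).
    apply: cvg_near_cst; near=> n.
    have : `|n.+1%:R^-1 : R| < 1 - cos t by near: n; exact: hn.
    rewrite ger0_norm ?invr_ge0// => h /=.
    by rewrite (_ : (c n < cos t) = false) /bR ?mul0r//; apply/negbTE; rewrite -leNgt /c lerBrDr -lerBrDl ltW.
  - by move=> t _.
  - exact: li_bitv.
  - move=> n t _; rewrite lee_fin normrM (ger0_norm (iT_ge0 t)) ler_piMl ?iT_ge0//; exact: ind_le1.
move: cv; rewrite integral0 => cv.
have cvR : (\int[mu]_t (bR R (c n < cos t) * iT t)) @[n --> \oo] --> (0 : R) by exact: (fine_cvg cv).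
move: cvR => /cvgr_lt /(_ _ e0) [n _ /(_ n (leqnn n)) /= h]; exists (c n).
  by rewrite /c ltrBlDr ltrDl invr_gt0.
exact: ltW.
Unshelve. all: by end_near.
Qed.
End explicit.

(** * Admissible pairs *)

Section pairs.
Variable R : realType.
Local Notation L4 := (L4 R).
Local Notation L3 := (L3 R).
Local Notation R3 := (R3 R).
Local Notation R4 := (R3R R).
Local Notation J f := (\int[L4]_p (f p * iT p.2)).
Local Notation K f := (2 * pi * \int[L3]_x (f x)).

Definition o40 : 'I_4 := @Ordinal 4 0 isT.
Definition o41 : 'I_4 := @Ordinal 4 1 isT.
Definition o42 : 'I_4 := @Ordinal 4 2 isT.
Definition o30 : 'I_3 := @Ordinal 3 0 isT.
Definition o31 : 'I_3 := @Ordinal 3 1 isT.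
Definition o32 : 'I_3 := @Ordinal 3 2 isT.

Definition A3 (g : 'I_4 -> R4 -> R) : R :=
  J (fun p => g o40 p ^+ 2) + J (fun p => g o41 p ^+ 2) + J (fun p => g o42 p ^+ 2).
Definition By (g : 'I_4 -> R4 -> R) : R := J (fun p => g iy p ^+ 2).
Definition A3f (g : 'I_3 -> R3 -> R) : R :=
  K (fun p => g o30 p ^+ 2) + K (fun p => g o31 p ^+ 2) + K (fun p => g o32 p ^+ 2).

(* a, a' are the squared masses, A and B the x- and y-parts of the Dirichlet energy, and N the
   quartic term of the pair (u, v). *)
Definition PD u v gu gv (a a' A B N : R) :=
  [/\ H1T u gu, H1T v gv, J (fun p => u p ^+ 2) = a, J (fun p => v p ^+ 2) = a' &
      li L4 (fun p => quartic (u p) (v p) * iT p.2)] /\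
  [/\ A3 gu + A3 gv = A, By gu + By gv = B & J (fun p => quartic (u p) (v p)) = N].

(** Integrals over R^3 carry the factor [2 pi], the length of the circle, so that a pair on R^3 and
    its y-independent lift have the same data. *)
Definition PF u v gu gv (a a' A N : R) :=
  [/\ H1R3 u gu, H1R3 v gv, K (fun p => u p ^+ 2) = a, K (fun p => v p ^+ 2) = a' &
      li L3 (fun p => quartic (u p) (v p))] /\
  [/\ A3f gu + A3f gv = A & K (fun p => quartic (u p) (v p)) = N].

Lemma measurable_quartic (d : measure_display) (T : measurableType d) (u v : T -> R) :
  measurable_fun setT u -> measurable_fun setT v ->
  measurable_fun setT (fun p => quartic (u p) (v p)).
Proof.
move=> mu' mv; rewrite /quartic; apply: measurable_funD; last exact: measurable_funX.
apply: measurable_funD; first exact: measurable_funX.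
apply: measurable_funM; last exact: measurable_funX.
by apply: measurable_funM => //; exact: measurable_funX.
Qed.

Lemma quarticE (a b : R) : quartic a b = (a ^+ 2 + b ^+ 2) ^+ 2.
Proof. by rewrite /quartic; ring. Qed.

Lemma quartic_ge0 (a b : R) : 0 <= quartic a b.
Proof. by rewrite quarticE sqr_ge0. Qed.

Lemma J_ge0 (f : R4 -> R) : (forall p, 0 <= f p) -> 0 <= J f.
Proof. by move=> f0; apply: Rintegral_ge0 => p _; rewrite mulr_ge0 ?iT_ge0. Qed.

Lemma A3_ge0 g : 0 <= A3 g.
Proof. by apply: addr_ge0; [apply: addr_ge0|]; apply: J_ge0 => p; exact: sqr_ge0. Qed.

Lemma By_ge0 g : 0 <= By g. Proof. by apply: J_ge0 => p; exact: sqr_ge0. Qed.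

Lemma J_sqr_dil s c (f : R4 -> R) : 0 < s -> 0 < c -> measurable_fun setT f ->
  li L4 (fun p => f p ^+ 2 * iT p.2) ->
  J (fun p => (c * f (dil s p)) ^+ 2) = c ^+ 2 * s ^- 3 * J (fun p => f p ^+ 2).
Proof.
move=> s0 c0 mf f2; have [_ <-] := J_dil s0 (exprn_gt0 2 c0) (measurable_funX 2 mf) f2.
by apply: eq_Rintegral => p _; rewrite exprMn.
Qed.

Lemma PD_dil u v gu gv a a' A B N s c : 0 < s -> 0 < c -> PD u v gu gv a a' A B N ->
  PD (fun p => c * u (dil s p)) (fun p => c * v (dil s p))
     (fun i p => c * dilk s i * gu i (dil s p)) (fun i p => c * dilk s i * gv i (dil s p))
     (c ^+ 2 * s ^- 3 * a) (c ^+ 2 * s ^- 3 * a') ((c * s) ^+ 2 * s ^- 3 * A)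
     (c ^+ 2 * s ^- 3 * B) (c ^+ 4 * s ^- 3 * N).
Proof.
move=> s0 c0 [[Hu Hv ua va qi] [AE BE NE]].
have [mu' mgu u2 gu2] := H1T_li Hu; have [mv mgv v2 gv2] := H1T_li Hv.
have cs : 0 < c * s by exact: mulr_gt0.
have [q1 q2] := J_dil s0 (exprn_gt0 4 c0) (measurable_quartic mu' mv) qi.
have qE (p : R4) : quartic (c * u (dil s p)) (c * v (dil s p)) =
    c ^+ 4 * quartic (u (dil s p)) (v (dil s p)) by rewrite /quartic; ring.
have X (g : 'I_4 -> R4 -> R) : (forall i, measurable_fun setT (g i)) -> (forall i, li L4 (fun p => g i p ^+ 2 * iT p.2)) ->
    A3 (fun i p => c * dilk s i * g i (dil s p)) = (c * s) ^+ 2 * s ^- 3 * A3 g.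
  by move=> mg g2; rewrite /A3 /dilk /= !J_sqr_dil// -!mulrDr.
have Y (g : 'I_4 -> R4 -> R) : (forall i, measurable_fun setT (g i)) -> (forall i, li L4 (fun p => g i p ^+ 2 * iT p.2)) ->
    By (fun i p => c * dilk s i * g i (dil s p)) = c ^+ 2 * s ^- 3 * By g.
  by move=> mg g2; rewrite /By /dilk /= mulr1 J_sqr_dil.
split; split.
- exact: H1T_dil.
- exact: H1T_dil.
- by rewrite J_sqr_dil// ua.
- by rewrite J_sqr_dil// va.
- by move: q1; congr (li L4 _); apply/funext => p; rewrite qE.
- by rewrite !X// -mulrDr AE.
- by rewrite !Y// -mulrDr BE.
- by rewrite -NE -q2; apply: eq_Rintegral => p _; rewrite qE.
Qed.

Lemma inord_o : (inord o40 = o30 :> 'I_3) * (inord o41 = o31 :> 'I_3) * (inord o42 = o32 :> 'I_3).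
Proof. by split; [split|]; apply/val_inj; rewrite /= inordK. Qed.

Lemma A3_lft g : (forall i, li L3 (fun x => g i x ^+ 2)) -> A3 (lft g) = A3f g.
Proof.
move=> g2; rewrite /A3 /A3f /lft /= !inord_o.
by rewrite -(li_lift (g2 o30)).2 -(li_lift (g2 o31)).2 -(li_lift (g2 o32)).2.
Qed.

Lemma By_lft g : By (lft g) = 0.
Proof. by rewrite /By /lft /= Rint_eq0// => p; rewrite expr0n mul0r. Qed.

Lemma PF_PD u v gu gv a a' A N : PF u v gu gv a a' A N ->
  PD (fun p => u p.1) (fun p => v p.1) (lft gu) (lft gv) a a' A 0 N.
Proof.
move=> [[Hu Hv ua va qi] [AE NE]].
have [mu' mgu u2 gu2] := H1R3_li Hu; have [mv mgv v2 gv2] := H1R3_li Hv.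
have [q1 q2] := li_lift qi.
split; split => //.
- exact: H1R3_lift.
- exact: H1R3_lift.
- by rewrite -ua -(li_lift u2).2.
- by rewrite -va -(li_lift v2).2.
- by rewrite !A3_lft.
- by rewrite !By_lft addr0.
- by rewrite -NE -q2.
Qed.

Lemma avg3_lft (g : 'I_3 -> R3 -> R) : avg3 (lft g) = g.
Proof.
apply/funext => i; rewrite /avg3 /lft /=.
by rewrite (ltn_ord i) avg_cst (_ : inord _ = i)//; exact: inord_val.
Qed.

(** Averaging in y inverts the lift, for functions and for gradients. In this way [PF_dil] is
    deduced from the dilation on R^3 x R instead of being proved again. *)
Lemma PD_PF u v gu gv a a' A B N :
  PD (fun p => u p.1) (fun p => v p.1) (lft gu) (lft gv) a a' A B N -> PF u v gu gv a a' A N.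
Proof.
move=> [[Hu Hv ua va qi] [AE BE NE]].
have Hu' : H1R3 u gu by have := H1T_avg Hu; rewrite avg_cst avg3_lft.
have Hv' : H1R3 v gv by have := H1T_avg Hv; rewrite avg_cst avg3_lft.
have [mu' mgu u2 gu2] := H1R3_li Hu'; have [mv mgv v2 gv2] := H1R3_li Hv'.
have mq := measurable_quartic mu' mv.
have qi' : li L3 (fun p => quartic (u p) (v p)).
  have := (avg_li (measurableT_comp mq measurable_fst) qi).1.
  by rewrite (avg_cst (fun x => quartic (u x) (v x))).
split; split => //.
- by rewrite -ua -(li_lift u2).2.
- by rewrite -va -(li_lift v2).2.
- by rewrite -AE !A3_lft.
- by rewrite -NE -(li_lift qi').2.
Qed.

Definition dil3 (s : R) (x : R3) : R3 := ((s * x.1.1, s * x.1.2), s * x.2).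

Lemma PF_dil u v gu gv a a' A N s c : 0 < s -> 0 < c -> PF u v gu gv a a' A N ->
  PF (fun x => c * u (dil3 s x)) (fun x => c * v (dil3 s x))
     (fun i x => c * s * gu i (dil3 s x)) (fun i x => c * s * gv i (dil3 s x))
     (c ^+ 2 * s ^- 3 * a) (c ^+ 2 * s ^- 3 * a') ((c * s) ^+ 2 * s ^- 3 * A) (c ^+ 4 * s ^- 3 * N).
Proof.
move=> s0 c0 /PF_PD /(PD_dil s0 c0) H; apply: PD_PF.
have E g : (fun i p => c * dilk s i * lft g i (dil s p)) = lft (fun i x => c * s * g i (dil3 s x)).
  apply/funext => i; apply/funext => p; rewrite /lft /dilk; case: ifP => _ //.
  by rewrite mulr0.
by move: H; rewrite !E; apply.
Qed.

(** The dilation [s] and the amplitude [c] are the solution of two equations: new mass equal to 1,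
    and new quartic term equal to 4/3 of the new energy. The resulting energy is 16/9 times the
    quantity [A^3 a / N^2], which is invariant under both scalings. *)
Lemma resc_alg (a A N : R) : 0 < a -> 0 < A -> 0 < N ->
  let s := 4 / 3 * (A * a / N) in let c := Num.sqrt (s ^+ 3 / a) in
  let A' := 16 / 9 * (A ^+ 3 * a / N ^+ 2) in
  [/\ 0 < s, 0 < c, c ^+ 2 * s ^- 3 = a^-1, (c * s) ^+ 2 * s ^- 3 * A = A' &
      c ^+ 4 * s ^- 3 * N = 4 / 3 * A'].
Proof.
move=> a0 A0 N0 s c A'.
have s0 : 0 < s by rewrite mulr_gt0// divr_gt0// mulr_gt0.
have h0 : 0 < s ^+ 3 / a by rewrite divr_gt0// exprn_gt0.
have c2 : c ^+ 2 = s ^+ 3 / a by rewrite sqr_sqrtr// ltW.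
have sn : s != 0 by rewrite gt_eqF.
have an : a != 0 by rewrite gt_eqF.
have Nn : N != 0 by rewrite gt_eqF.
have c4 : c ^+ 4 = (s ^+ 3 / a) ^+ 2 by rewrite -c2 -exprM.
split => //.
- by rewrite sqrtr_gt0.
- by rewrite c2; field; rewrite sn an.
- rewrite exprMn c2 /A'; transitivity (s ^+ 2 * A / a); first by field; rewrite sn an.
  by rewrite /s; field; rewrite Nn an.
- rewrite c4 /A'; transitivity (s ^+ 3 * N / a ^+ 2); first by field; rewrite sn an.
  by rewrite /s; field; rewrite Nn an.
Qed.

(** Any pair of equal positive masses, positive x-energy and positive quartic term is moved onto the
    constraint, so that explicit pairs never have to satisfy it from the outset. *)
Lemma PD_resc u v gu gv a A B N : 0 < a -> 0 < A -> 0 < N -> PD u v gu gv a a A B N ->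
  exists u' v' gu' gv', let A' := 16 / 9 * (A ^+ 3 * a / N ^+ 2) in
    PD u' v' gu' gv' 1 1 A' (B / a) (4 / 3 * A').
Proof.
move=> a0 A0 N0 H; have [s0 c0 e3 e2 e4] := resc_alg a0 A0 N0.
have e1 := mulVf (lt0r_neq0 a0).
have := PD_dil s0 c0 H; rewrite e2 e4 e3 e1 (mulrC a^-1 B) => H'.
by eexists; eexists; eexists; eexists; exact: H'.
Qed.

Lemma PF_resc u v gu gv a A N : 0 < a -> 0 < A -> 0 < N -> PF u v gu gv a a A N ->
  exists u' v' gu' gv', let A' := 16 / 9 * (A ^+ 3 * a / N ^+ 2) in
    PF u' v' gu' gv' 1 1 A' (4 / 3 * A').
Proof.
move=> a0 A0 N0 H; have [s0 c0 e3 e2 e4] := resc_alg a0 A0 N0.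
have e1 := mulVf (lt0r_neq0 a0).
have := PF_dil s0 c0 H; rewrite e2 e4 e3 e1 => H'.
by eexists; eexists; eexists; eexists; exact: H'.
Qed.

(* On the constraint the quartic term is 4A/3, so the energy is A/6 + B/2. *)
Definition Eset (th A B : R) := exists u v gu gv, PD u v gu gv (th ^+ 2) (th ^+ 2) A B (4 / 3 * A).
Definition E0set (th A : R) := exists u v gu gv, PF u v gu gv (th ^+ 2) (th ^+ 2) A (4 / 3 * A).

(** Dilation and amplitude have the same factor [s]: this keeps the ratio of the quartic term to the
    x-energy, hence the constraint, and multiplies the squared mass by [1 / s = k^2]. *)
Lemma scale_alg (k : R) : 0 < k -> let s := k ^- 2 in
  [/\ 0 < s, s ^+ 2 * s ^- 3 = k ^+ 2, (s * s) ^+ 2 * s ^- 3 = k ^- 2 & s ^+ 4 * s ^- 3 = k ^- 2].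
Proof.
move=> k0 s; have s0 : 0 < s by rewrite invr_gt0 exprn_gt0.
have sn : s != 0 by rewrite gt_eqF.
have kE : k ^+ 2 = s^-1 by rewrite /s invrK.
split => //; first by rewrite kE; field.
  by rewrite -/s; field.
by rewrite -/s; field.
Qed.

Lemma Eset_scale k th A B : 0 < k -> Eset th A B -> Eset (k * th) (k ^- 2 * A) (k ^+ 2 * B).
Proof.
move=> k0 [u [v [gu [gv H]]]]; have [s0 e1 e2 e3] := scale_alg k0.
have := PD_dil s0 s0 H; rewrite e1 e2 e3 (mulrCA (k ^- 2) (4 / 3) A) -exprMn => H'.
by eexists; eexists; eexists; eexists; exact: H'.
Qed.

Lemma E0set_scale k th A : 0 < k -> E0set th A -> E0set (k * th) (k ^- 2 * A).
Proof.
move=> k0 [u [v [gu [gv H]]]]; have [s0 e1 e2 e3] := scale_alg k0.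
have := PF_dil s0 s0 H; rewrite e1 e2 e3 (mulrCA (k ^- 2) (4 / 3) A) -exprMn => H'.
by eexists; eexists; eexists; eexists; exact: H'.
Qed.

Lemma E0set_Eset th A : E0set th A -> Eset th A 0.
Proof. by move=> [u [v [gu [gv /PF_PD H]]]]; eexists; eexists; eexists; eexists; exact: H. Qed.
End pairs.

(** * Real inequalities behind the lower bounds *)

Section real_algebra.
Variable R : realType.

(** The constraint bounds the quartic term below linearly in [A], and Gagliardo-Nirenberg bounds its
    square above by a multiple of [A^3 (1 + B)]. Together they give [A^2 <= 9 C A^3 (1 + B)], which
    is divided by [A^2]. *)
Lemma alg_lower (A B Au Av Bu Bv nu nv C : R) : 0 < C -> 0 <= nu -> 0 <= nv ->
  0 <= Au -> 0 <= Av -> 0 <= Bu -> 0 <= Bv -> Au + Av = A -> Bu + Bv = B ->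
  4 / 3 * A <= 2 * (nu + nv) -> nu ^+ 2 <= C * (Au ^+ 3 * (1 + Bu)) ->
  nv ^+ 2 <= C * (Av ^+ 3 * (1 + Bv)) -> 0 < A -> 1 <= 9 * C * (A * (1 + B)).
Proof.
move=> C0 u0 v0 Au0 Av0 Bu0 Bv0 AE BE hN hu hv A0.
have B0 : 0 <= B by rewrite -BE addr_ge0.
have T a b : 0 <= a -> 0 <= b -> a <= A -> b <= B -> C * (a ^+ 3 * (1 + b)) <= C * (A ^+ 3 * (1 + B)).
  move=> a0 b0 aA bB; rewrite ler_pM2l//; apply: ler_pM; [exact: exprn_ge0|by rewrite addr_ge0| |by rewrite lerD2l].
  by rewrite lerXn2r// nnegrE ltW.
have hu' := le_trans hu (T _ _ Au0 Bu0 ltac:(lra) ltac:(lra)).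
have hv' := le_trans hv (T _ _ Av0 Bv0 ltac:(lra) ltac:(lra)).
set X := C * (A ^+ 3 * (1 + B)) in hu' hv'.
have hX : (4 / 3 * A) ^+ 2 <= 16 * X.
  apply: (@le_trans _ _ ((2 * (nu + nv)) ^+ 2)).
    by rewrite lerXn2r ?nnegrE//; [apply: mulr_ge0; lra|lra].
  have := sqr_ge0 (nu - nv); rewrite !expr2 in hu' hv' *; lra.
rewrite -(ler_pM2r (exprn_gt0 2 A0)) mul1r.
have -> : 9 * C * (A * (1 + B)) * A ^+ 2 = 9 * X by rewrite /X; ring.
have : (4 / 3 * A) ^+ 2 = 16 / 9 * A ^+ 2 by rewrite exprMn; field.
move=> e; rewrite e in hX; lra.
Qed.

Lemma ler_X2 (x y : R) : 0 <= y -> x ^+ 2 <= y ^+ 2 -> x <= y.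
Proof.
move=> y0 h; rewrite leNgt; apply/negP => yx.
by move: h; rewrite leNgt => /negP; apply; rewrite ltrXn2r// nnegrE// (le_trans y0)// ltW.
Qed.

Lemma ler_X4 (x y : R) : 0 <= y -> x ^+ 4 <= y ^+ 4 -> x <= y.
Proof.
move=> y0 h; rewrite leNgt; apply/negP => yx.
by move: h; rewrite leNgt => /negP; apply; rewrite ltrXn2r// nnegrE// (le_trans y0)// ltW.
Qed.

(** Concavity of the power 3/4: both [p] and [q] are compared with their mean [m] through the
    tangent of [t^(3/4)] at 1. The factor 2 in the conclusion is [2^4 / 2^3]. *)
Lemma pow34_alg (x y p q K : R) : 0 <= x -> 0 <= y -> 0 <= p -> 0 <= q -> 0 <= K ->
  x ^+ 4 <= K * p ^+ 3 -> y ^+ 4 <= K * q ^+ 3 -> (x + y) ^+ 4 <= 2 * K * (p + q) ^+ 3.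
Proof.
move=> x0 y0 p0 q0 K0 hx hy.
pose m := (p + q) / 2.
have m0 : 0 <= m by rewrite divr_ge0// addr_ge0.
have [mz|mn] := eqVneq m 0.
  have pz : p = 0 by move: mz; rewrite /m; lra.
  have qz : q = 0 by move: mz; rewrite /m; lra.
  move: hx hy; rewrite pz qz expr0n/= mulr0 => hx hy.
  have xz : x <= 0 by apply: ler_X4; rewrite ?expr0n.
  have yz : y <= 0 by apply: ler_X4; rewrite ?expr0n.
  have -> : x + y = 0 by lra.
  by rewrite addr0 !expr0n/= mulr0.
have mp : 0 < m by rewrite lt_neqAle eq_sym mn.
have Km : 0 <= K * m ^+ 3 by rewrite mulr_ge0// exprn_ge0.
pose L := Num.sqrt (Num.sqrt (K * m ^+ 3)).
have L0 : 0 <= L by exact: sqrtr_ge0.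
have L4 : L ^+ 4 = K * m ^+ 3.
  by rewrite (exprM L 2 2) sqr_sqrtr ?sqrtr_ge0// sqr_sqrtr.
have T z r : 0 <= r -> z ^+ 4 <= K * r ^+ 3 -> z <= L * ((1 + 3 * (r / m)) / 4).
  move=> r0 h; have t0 : 0 <= r / m by rewrite divr_ge0.
  apply: ler_X4; first by rewrite mulr_ge0// divr_ge0// addr_ge0// mulr_ge0.
  apply: le_trans h _; rewrite exprMn L4.
  have -> : K * r ^+ 3 = K * m ^+ 3 * (r / m) ^+ 3.
    by rewrite -mulrA; congr (_ * _); rewrite -exprMn mulrCA mulfV// mulr1.
  rewrite ler_wpM2l//; move: (r / m) t0 => t t0.
  (* The tangent inequality [t^3 <= ((1 + 3 t) / 4)^4], with the double root at t = 1 factored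
     out. *)
  have : 0 <= (t - 1) ^+ 2 * (81 * t ^+ 2 + 14 * t + 1).
    by rewrite mulr_ge0 ?sqr_ge0// addr_ge0// addr_ge0// mulr_ge0// sqr_ge0.
  have -> : (t - 1) ^+ 2 * (81 * t ^+ 2 + 14 * t + 1) = (1 + 3 * t) ^+ 4 - 256 * t ^+ 3 by ring.
  have -> : ((1 + 3 * t) / 4) ^+ 4 = (1 + 3 * t) ^+ 4 / 256 by field.
  by rewrite subr_ge0 ler_pdivlMr// mulrC.
have hx' := T x p p0 hx; have hy' := T y q q0 hy.
have hs : x + y <= 2 * L.
  apply: le_trans (lerD hx' hy') _; rewrite -mulrDr mulrC ler_wpM2r//.
  have : p / m + q / m = 2 by rewrite -mulrDl (_ : p + q = 2 * m) ?mulfK// /m; field.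
  lra.
apply: (@le_trans _ _ ((2 * L) ^+ 4)).
  by rewrite lerXn2r ?nnegrE ?addr_ge0// mulr_ge0.
rewrite exprMn L4 (_ : p + q = 2 * m); last by rewrite /m; field.
by rewrite le_eqVlt; apply/orP; left; apply/eqP; ring.
Qed.

(** Here [s] and [h] are the x-energies of the average and of the fluctuation, [Nb] is the quartic
    term of the average, and [I] and [Y] are the mixed and the pure fluctuation terms. When
    [s + h < al], the last two are absorbed into a small part of [h] and a multiple of [B]; what is
    left compares the sharp bound on [Nb] with the constraint. *)
Lemma penalized_alg (al C C2 : R) : 0 < al -> 0 < C -> 0 <= C2 -> exists2 lam : R, 0 < lam &
  forall s h B Nb I Y : R, 0 <= s -> 0 <= h -> 0 <= B -> 0 <= Nb -> 0 <= I -> 0 <= Y ->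
    Nb ^+ 2 <= 16 / 9 / al * s ^+ 3 -> I ^+ 2 <= Nb * Y -> Y ^+ 2 <= C2 * (h ^+ 3 * B) ->
    4 / 3 * (s + h) <= Nb + 8 * I + 3 * Y -> 1 <= 9 * C * ((s + h) * (1 + B)) ->
    al <= s + h + 3 * lam * B.
Proof.
move=> a0 C0 C20.
pose M := 16 / 9 * al ^+ 2 * C2.
have M0 : 0 <= M by rewrite mulr_ge0// mulr_ge0 ?sqr_ge0//; lra.
(* Chosen so that [(3 Y)^2 <= 4 (h/6) (k1 B)] and [(8 I)^4 <= 4 (h/6)^3 (k2 B)] as long as [s] and
   [h] stay below [al]; the right-hand sides are dominated by the square of [h/6 + k1 B] and by the
   fourth power of [h/6 + k2 B]. *)
pose k1 := 27 / 2 * C2 * al ^+ 2; pose k2 := 54 * 8 ^+ 4 * M; pose C4 := k1 + k2.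
have k10 : 0 <= k1 by rewrite mulr_ge0 ?sqr_ge0// mulr_ge0//; lra.
have k20 : 0 <= k2 by apply: mulr_ge0 => //; apply: mulr_ge0 => //; exact: exprn_ge0.
have C40 : 0 <= C4 by exact: addr_ge0.
have CC : 0 <= C * C4 by rewrite mulr_ge0// ltW.
(* The first summand serves averages with [s >= al / 2], the second the remaining ones. *)
exists (C4 + al * (54 * (C * C4) + 1)).
  by rewrite ltr_wpDl// mulr_gt0// ltr_wpDl// mulr_ge0.
move=> s h B Nb I Y s0 h0 B0 Nb0 I0 Y0 hNb hI hY hN hC.
have lamB : 3 * (C4 + al * (54 * (C * C4) + 1)) * B =
   3 * (C4 * B) + 3 * (al * ((54 * (C * C4) + 1) * B)) by ring.
rewrite lamB.
have C4B : 0 <= C4 * B by exact: mulr_ge0.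
have aB : 0 <= al * ((54 * (C * C4) + 1) * B).
  by apply: mulr_ge0; [exact: ltW|apply: mulr_ge0 => //; lra].
case: (leP al (s + h)) => Aa; first by lra.
have sa : s < al by lra.
have ha : h < al by lra.
have hB : 0 <= h * B by exact: mulr_ge0.
have h3B : 0 <= h ^+ 3 * B by rewrite mulr_ge0// exprn_ge0.
have Yb : 3 * Y <= h / 6 + k1 * B.
  apply: ler_X2; first by rewrite addr_ge0// ?divr_ge0// mulr_ge0.
  have e1 : h ^+ 3 * B <= al ^+ 2 * (h * B).
    rewrite exprSr -mulrA ler_wpM2r// lerXn2r ?nnegrE// ltW//.
  have e2 : (3 * Y) ^+ 2 <= 9 * C2 * al ^+ 2 * (h * B).
    rewrite exprMn; have := ler_wpM2l C20 e1.
    move: hY; set X := C2 * (h ^+ 3 * B); set Z := h * B => hY.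
    have -> : 9 * C2 * al ^+ 2 * Z = 9 * (C2 * (al ^+ 2 * Z)) by ring.
    have -> : 3 ^+ 2 = 9 :> R by ring.
    lra.
  apply: le_trans e2 _.
  have -> : (h / 6 + k1 * B) ^+ 2 = (h / 6 - k1 * B) ^+ 2 + 9 * C2 * al ^+ 2 * (h * B).
    by rewrite /k1; field.
  by rewrite lerDr sqr_ge0.
have Ib : 8 * I <= h / 6 + k2 * B.
  apply: ler_X4; first by rewrite addr_ge0// ?divr_ge0// mulr_ge0.
  have i4 : I ^+ 4 <= M * (h ^+ 3 * B).
    rewrite (exprM I 2 2).
    apply: (@le_trans _ _ ((Nb * Y) ^+ 2)).
      by rewrite lerXn2r ?nnegrE ?sqr_ge0// mulr_ge0.
    rewrite exprMn.
    have n2 : Nb ^+ 2 <= 16 / 9 * al ^+ 2.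
      apply: le_trans hNb _.
      have -> : 16 / 9 * al ^+ 2 = 16 / 9 / al * al ^+ 3.
        by field; rewrite gt_eqF.
      rewrite ler_wpM2l//; first by rewrite divr_ge0// ?ltW//; lra.
      by rewrite lerXn2r ?nnegrE// ltW.
    have -> : M * (h ^+ 3 * B) = 16 / 9 * al ^+ 2 * (C2 * (h ^+ 3 * B)) by rewrite /M; ring.
    by apply: ler_pM; rewrite ?sqr_ge0.
  rewrite exprMn; apply: le_trans (ler_wpM2l (exprn_ge0 4 (ler0n R 8)) i4) _.
  have -> : 8 ^+ 4 * (M * (h ^+ 3 * B)) = 4 * (h / 6) ^+ 3 * (k2 * B).
    by rewrite /k2; move: (8 ^+ 4 : R) => c; field.
  have a1 : 0 <= h / 6 by rewrite divr_ge0.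
  have a2 : 0 <= k2 * B by rewrite mulr_ge0.
  move: (h / 6) (k2 * B) a1 a2 => a b a1 a2.
  have -> : (a + b) ^+ 4 = 4 * a ^+ 3 * b + (a ^+ 4 + 6 * (a ^+ 2 * b ^+ 2) + 4 * (a * b ^+ 3) + b ^+ 4) by ring.
  rewrite lerDl addr_ge0 ?exprn_ge0// addr_ge0//; last by rewrite mulr_ge0// mulr_ge0 ?exprn_ge0.
  by rewrite addr_ge0 ?exprn_ge0// mulr_ge0// mulr_ge0 ?exprn_ge0.
have C4E : C4 * B = k1 * B + k2 * B by rewrite /C4 mulrDl.
pose x := s / al.
have x0 : 0 <= x by rewrite divr_ge0// ltW.
have sE : s = x * al by rewrite /x mulfVK// gt_eqF.
(* The sharp bound reads [Nb <= 4/3 s sqrt x] with [x = s / al], and [sqrt x <= (1 + x) / 2]. *)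
have Nbb : Nb <= 2 / 3 * s * (1 + x).
  apply: ler_X2; first by rewrite mulr_ge0 ?addr_ge0// mulr_ge0//; lra.
  apply: le_trans hNb _.
  have -> : 16 / 9 / al * s ^+ 3 = 16 / 9 * s ^+ 2 * x by rewrite /x; field; rewrite gt_eqF.
  have -> : (2 / 3 * s * (1 + x)) ^+ 2 = 16 / 9 * s ^+ 2 * x + 4 / 9 * s ^+ 2 * (1 - x) ^+ 2 by field.
  by rewrite lerDl mulr_ge0 ?sqr_ge0// mulr_ge0 ?sqr_ge0//; lra.
(* With [x] at least 1/2, the deficit of [Nb] with respect to [4/3 s] is at least [(al - s) / 3];
   the constraint then bounds [al - s] by [3 C4 B]. *)
case: (leP (al / 2) s) => hs.
  have xh : 1 / 2 <= x by rewrite /x ler_pdivlMr//; lra.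
  have x1 : x < 1 by rewrite /x ltr_pdivrMr// mul1r.
  have : 1 / 3 * (al - s) <= 2 / 3 * s * (1 - x).
    have -> : 2 / 3 * s * (1 - x) = 2 / 3 * x * (al - s) by rewrite sE; ring.
    by rewrite ler_wpM2r; lra.
  have : 2 / 3 * s * (1 + x) = 4 / 3 * s - 2 / 3 * s * (1 - x) by field.
  lra.
have xh : x <= 1 / 2 by rewrite /x ler_pdivrMr//; lra.
have sx : s * x <= s * (1 / 2) by rewrite ler_wpM2l.
(* A small average makes [Nb <= s], so the constraint bounds the whole x-energy by [B]. Inserted in
   the lower bound on [(s + h) (1 + B)], this keeps [B] away from zero. *)
have A3 : s + h <= 3 * (C4 * B).
  have : 2 / 3 * s * (1 + x) = 2 / 3 * s + 2 / 3 * (s * x) by ring.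
  lra.
have hb : 1 <= 9 * C * (3 * (C4 * B) * (1 + B)).
  apply: le_trans hC _; rewrite ler_pM2l; last by rewrite mulr_gt0.
  by rewrite ler_wpM2r// addr_ge0.
have : 1 <= (54 * (C * C4) + 1) * B.
  case: (leP 1 B) => B1.
    have : 0 <= 54 * (C * C4) * B by rewrite mulr_ge0// mulr_ge0.
    by rewrite mulrDl mul1r; lra.
  have : 27 * (C * C4 * B) * (1 + B) <= 27 * (C * C4 * B) * 2.
    by rewrite ler_wpM2l ?mulr_ge0//; lra.
  have : 9 * C * (3 * (C4 * B) * (1 + B)) = 27 * (C * C4 * B) * (1 + B) by ring.
  have : (54 * (C * C4) + 1) * B = 27 * (C * C4 * B) * 2 + B by ring.
  lra.
move=> z1; have : al * 1 <= al * ((54 * (C * C4) + 1) * B) by rewrite ler_pM2l.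
rewrite mulr1; move: C4B s0 h0 aB; clear; move: (C4 * B) (al * _) => x y; lra.
Qed.
End real_algebra.

(** * The fluctuation estimate *)

Section key.
Variable R : realType.
Local Notation L4 := (L4 R).
Local Notation L3 := (L3 R).
Local Notation R4 := (R3R R).
Local Notation J f := (\int[L4]_p (f p * iT p.2)).
Local Notation K f := (2 * pi * \int[L3]_x (f x)).

(** The constant produced by [gagliardo_nirenberg], three factors 9 and one factor 18; only its
    finiteness and positivity matter later. *)
Definition gn_const : R := 9 ^+ 3 * 18.

Lemma gn_const_gt0 : 0 < gn_const. Proof. by rewrite mulr_gt0// exprn_gt0. Qed.

Lemma Rint_ge0_eq0 (d : measure_display) (T : measurableType d) (m : {measure set T -> \bar R})
  (f : T -> R) : li m f -> (forall x, 0 <= f x) -> \int[m]_x f x = 0 -> {ae m, forall x, f x = 0}.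
Proof.
move=> fi f0 I0.
have mE : measurable_fun setT (EFin \o f) by apply/measurable_EFinP; exact: li_meas fi.
have : ae_eq m setT (EFin \o f) (cst 0%E).
  apply/(ae_eq_integral_abs m measurableT mE).
  have := RintE fi; rewrite I0 => e; rewrite -[RHS]e.
  by apply: eq_integral => x _ /=; rewrite ger0_norm.
by apply: filterS => x /(_ I) /= [].
Qed.

Lemma gagliardo_nirenberg_A3 (u : R4 -> R) g : PW u g -> li L4 (fun p => u p ^+ 4 * iT p.2) ->
  (J (fun p => u p ^+ 4)) ^+ 2 <= gn_const * (A3 g ^+ 3 * (J (fun p => u p ^+ 2) + By g)).
Proof.
move=> H u4; apply: le_trans (gagliardo_nirenberg H u4) _.
rewrite -/gn_const ler_pM2l ?gn_const_gt0//.
have s0 i : 0 <= J (fun p => g i p ^+ 2) by apply: J_ge0 => p; exact: sqr_ge0.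
have a0 : 0 <= J (fun p => u p ^+ 2) by apply: J_ge0 => p; exact: sqr_ge0.
have b0 := By_ge0 g.
rewrite /A3; move: (s0 o40) (s0 o41) (s0 o42).
rewrite -/(By g).
move: (J (fun p => g o40 p ^+ 2)) (J (fun p => g o41 p ^+ 2)) (J (fun p => g o42 p ^+ 2)) => x y z x0 y0 z0.
apply: ler_wpM2r; first exact: addr_ge0.
rewrite !exprS expr0 mulr1 mulrA; apply: ler_pM => //; [exact: mulr_ge0| |lra].
by apply: ler_pM => //; lra.
Qed.

Lemma pow4_quartic (a b : R) : [/\ a ^+ 4 <= quartic a b, b ^+ 4 <= quartic a b,
  quartic a b <= 2 * (a ^+ 4 + b ^+ 4), 0 <= a ^+ 4 & 0 <= b ^+ 4].
Proof.
have ab : 0 <= 2 * a ^+ 2 * b ^+ 2 by rewrite mulr_ge0 ?sqr_ge0// mulr_ge0 ?sqr_ge0.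
have a4 : 0 <= a ^+ 4 by rewrite (exprM a 2 2) sqr_ge0.
have b4 : 0 <= b ^+ 4 by rewrite (exprM b 2 2) sqr_ge0.
rewrite /quartic; split => //; [lra|lra|].
have := sqr_ge0 (a ^+ 2 - b ^+ 2).
have -> : (a ^+ 2 - b ^+ 2) ^+ 2 = a ^+ 4 + b ^+ 4 - 2 * a ^+ 2 * b ^+ 2 by ring.
lra.
Qed.

Lemma quartic_li (u v : R4 -> R) : measurable_fun setT u -> measurable_fun setT v ->
  li L4 (fun p => quartic (u p) (v p) * iT p.2) ->
  [/\ li L4 (fun p => u p ^+ 4 * iT p.2), li L4 (fun p => v p ^+ 4 * iT p.2),
    J (fun p => u p ^+ 4) <= J (fun p => quartic (u p) (v p)) &
    J (fun p => quartic (u p) (v p)) <= 2 * (J (fun p => u p ^+ 4) + J (fun p => v p ^+ 4))].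
Proof.
move=> mu' mv qi; have mi := @m_iT2 R.
have lu : li L4 (fun p => u p ^+ 4 * iT p.2).
  apply: li_le qi => [|p]; first by apply: measurable_funM => //; exact: measurable_funX.
  have [h1 h2 h3 h4 h5] := pow4_quartic (u p) (v p).
  by rewrite (ger0_norm (mulr_ge0 h4 (iT_ge0 _))) ler_wpM2r ?iT_ge0.
have lv : li L4 (fun p => v p ^+ 4 * iT p.2).
  apply: li_le qi => [|p]; first by apply: measurable_funM => //; exact: measurable_funX.
  have [h1 h2 h3 h4 h5] := pow4_quartic (u p) (v p).
  by rewrite (ger0_norm (mulr_ge0 h5 (iT_ge0 _))) ler_wpM2r ?iT_ge0.
split => //.
  apply: Rint_le => // p; have [h1 _ _ _ _] := pow4_quartic (u p) (v p).
  by rewrite ler_wpM2r ?iT_ge0.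
rewrite -RintegralD// -RintegralZl//; last exact: liD.
apply: Rint_le => //; first by apply: liZ; exact: liD.
move=> p; have [_ _ h _ _] := pow4_quartic (u p) (v p).
by rewrite -mulrDl mulrA ler_wpM2r ?iT_ge0.
Qed.

Lemma quartic_li' (u v : R4 -> R) : measurable_fun setT u -> measurable_fun setT v ->
  li L4 (fun p => u p ^+ 4 * iT p.2) -> li L4 (fun p => v p ^+ 4 * iT p.2) ->
  li L4 (fun p => quartic (u p) (v p) * iT p.2).
Proof.
move=> mu' mv lu lv; have mi := @m_iT2 R.
apply: (li_le (g := fun p => 2 * (u p ^+ 4 * iT p.2 + v p ^+ 4 * iT p.2))).
- by apply: measurable_funM => //; exact: measurable_quartic.
- move=> p; rewrite (ger0_norm (mulr_ge0 (quartic_ge0 _ _) (iT_ge0 _))).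
  have [_ _ h _ _] := pow4_quartic (u p) (v p).
  by rewrite -mulrDl mulrA ler_wpM2r ?iT_ge0.
- by apply: liZ; exact: liD.
Qed.

Lemma PD_pos (u v : R4 -> R) gu gv (a a' A B N : R) : 0 < a -> PD u v gu gv a a' A B N -> 0 < N.
Proof.
move=> a0 [[Hu Hv ua va qi] [AE BE NE]].
have [mu' mgu u2 gu2] := H1T_li Hu; have [mv mgv v2 gv2] := H1T_li Hv.
have [lu lv h1 h2] := quartic_li mu' mv qi.
have u40 p : 0 <= u p ^+ 4 * iT p.2.
  by have [_ _ _ h _] := pow4_quartic (u p) (v p); rewrite mulr_ge0 ?iT_ge0.
have N0 : 0 <= N by rewrite -NE; apply: J_ge0 => p; exact: quartic_ge0.
rewrite lt_neqAle N0 andbT; apply/eqP => Nz.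
have Z : J (fun p => u p ^+ 4) = 0.
  by apply/eqP; rewrite eq_le; apply/andP; split; [rewrite Nz -NE|exact: Rintegral_ge0].
have E := Rint_ge0_eq0 lu u40 Z.
have : J (fun p => u p ^+ 2) = 0.
  rewrite -(@Rint_eq0 _ _ _ L4 (fun=> 0) (fun=> erefl)); apply: Rint_ae => //; first exact: li_meas u2.
  move: E; apply: filterS => p /eqP; rewrite mulf_eq0 expf_eq0 /= => /orP[/eqP ->|/eqP ->].
    by rewrite expr0n mul0r.
  by rewrite mulr0.
by rewrite ua => e; rewrite e ltxx in a0.
Qed.

(** Used twice: at B = 0 it makes [alpha] positive, and in general it supplies the crude bound
    needed by [penalized_alg] for averages of small energy. *)
Lemma PD_lower u v gu gv A B : PD u v gu gv 1 1 A B (4 / 3 * A) ->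
  0 < A /\ 1 <= 9 * gn_const * (A * (1 + B)).
Proof.
move=> H; have N0 := PD_pos ltr01 H.
have A0 : 0 < A by lra.
move: H => [[Hu Hv ua va qi] [AE BE NE]].
have [mu' mgu u2 gu2] := H1T_li Hu; have [mv mgv v2 gv2] := H1T_li Hv.
have [lu lv h1 h2] := quartic_li mu' mv qi.
have gu' := gagliardo_nirenberg_A3 (H1T_PW Hu) lu; have gv' := gagliardo_nirenberg_A3 (H1T_PW Hv) lv.
rewrite ua in gu'; rewrite va in gv'; rewrite NE in h2.
have p4 (w : R4 -> R) : 0 <= J (fun p => w p ^+ 4).
  by apply: J_ge0 => p; rewrite (exprM _ 2 2) sqr_ge0.
split => //.
exact: (alg_lower gn_const_gt0 (p4 u) (p4 v) (A3_ge0 gu) (A3_ge0 gv) (By_ge0 gu) (By_ge0 gv) AE BE h2 gu' gv' A0).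
Qed.

Lemma young34 (x y : R) : `|x * y ^+ 3| <= x ^+ 4 + y ^+ 4.
Proof.
rewrite normrM normrX -[x ^+ 4]ger0_norm ?(exprM x 2 2) ?sqr_ge0// -[X in _ <= _ + X]ger0_norm ?(exprM y 2 2) ?sqr_ge0//.
rewrite -!exprM !normrX; move: (`|x|) (`|y|) (normr_ge0 x) (normr_ge0 y) => a b a0 b0.
have a4 : 0 <= a ^+ 4 by exact: exprn_ge0.
have b4 : 0 <= b ^+ 4 by exact: exprn_ge0.
case: (leP a b) => ab.
  apply: (@le_trans _ _ (b * b ^+ 3)); first by rewrite ler_wpM2r// exprn_ge0.
  by rewrite -exprS lerDr.
apply: (@le_trans _ _ (a * a ^+ 3)); last by rewrite -exprS lerDl.
by rewrite ler_wpM2l// lerXn2r ?nnegrE// ltW.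
Qed.

(** Writing the quartic as the square of [S + 2 d + q], the terms beyond first order are estimated
    by [d^2 <= S q] and [4 d q <= 2 d^2 + 2 q^2]. The linear term [4 S d] is kept exact because its
    integral will vanish. *)
Lemma quartic_expand (W1 W2 w1 w2 : R) :
  quartic (W1 + w1) (W2 + w2) <= quartic W1 W2 +
    4 * ((W1 ^+ 2 + W2 ^+ 2) * W1 * w1 + (W1 ^+ 2 + W2 ^+ 2) * W2 * w2) +
    8 * ((W1 ^+ 2 + W2 ^+ 2) * (w1 ^+ 2 + w2 ^+ 2)) + 3 * quartic w1 w2.
Proof.
rewrite !quarticE.
set S := W1 ^+ 2 + W2 ^+ 2; set d := W1 * w1 + W2 * w2; set q := w1 ^+ 2 + w2 ^+ 2.
have S0 : 0 <= S by rewrite addr_ge0 ?sqr_ge0.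
have q0 : 0 <= q by rewrite addr_ge0 ?sqr_ge0.
have cs : d ^+ 2 <= S * q.
  have -> : S * q = d ^+ 2 + (W1 * w2 - W2 * w1) ^+ 2 by rewrite /S /d /q; ring.
  by rewrite lerDl sqr_ge0.
have -> : (W1 + w1) ^+ 2 + (W2 + w2) ^+ 2 = S + 2 * d + q by rewrite /S /d /q; ring.
have -> : S * W1 * w1 + S * W2 * w2 = S * d by rewrite /d; ring.
have h : 4 * (d * q) <= 2 * (S * q) + 2 * q ^+ 2.
  have e : 0 <= (d - q) ^+ 2 by exact: sqr_ge0.
  have -> : 4 * (d * q) = 2 * d ^+ 2 + 2 * q ^+ 2 - 2 * (d - q) ^+ 2 by ring.
  lra.
have -> : (S + 2 * d + q) ^+ 2 = S ^+ 2 + 4 * (S * d) + 2 * (S * q) + 4 * d ^+ 2 + 4 * (d * q) + q ^+ 2 by ring.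
lra.
Qed.

Lemma addr_ACAC (x x' y y' z z' : R) :
  (x + x') + (y + y') + (z + z') = (x + y + z) + (x' + y' + z').
Proof. by ring. Qed.

Section fluct.
Variables (u : R4 -> R) (g : 'I_4 -> R4 -> R).
Hypothesis H : H1T u g.
Hypothesis u4 : li L4 (fun p => u p ^+ 4 * iT p.2).

Let w p := u p - avg u p.1.

Let mu' : measurable_fun setT u. Proof. by have [] := H1T_li H. Qed.
Let ma : measurable_fun setT (fun p : R4 => avg u p.1).
Proof. exact: measurableT_comp (measurable_avg mu') measurable_fst. Qed.

(** Jensen twice: [avg u ^+ 4] is at most the square of the average of [u^2], which is integrable
    because [u^2] is square integrable on the cell. *)
Lemma avg4_li : li L3 (fun x => avg u x ^+ 4).
Proof.
have [_ _ u2 _] := H1T_li H.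
have m2 := measurable_funX 2 mu'.
have u22 : li L4 (fun p => (u p ^+ 2) ^+ 2 * iT p.2).
  by move: u4; congr (li L4 _); apply/funext => p; rewrite -exprM.
have l := avg_sqr_li m2 u22; have h := avg_sqr mu' u2.
have ma' := measurable_avg mu'.
have mm : measurable_fun setT (fun x => avg u x ^+ 4) by exact: measurable_funX.
apply: (@li_ae _ _ _ L3 _ (fun x => Num.min (avg u x ^+ 4) (avg (fun p => u p ^+ 2) x ^+ 2))) => //.
- apply: (li_le (g := fun x => avg (fun p => u p ^+ 2) x ^+ 2)) => //.
  + by apply: measurable_minr => //; exact: li_meas l.
  + move=> x; rewrite ger0_norm ?ge_min ?lexx ?orbT// le_min sqr_ge0 andbT.
    by rewrite (exprM _ 2 2) sqr_ge0.
- move: h; apply: filterS => x h; rewrite min_l//.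
  by rewrite (exprM _ 2 2) lerXn2r ?nnegrE ?sqr_ge0// (le_trans _ h)// sqr_ge0.
Qed.

Lemma fluct_PW : PW w (fun i p => g i p - lft (avg3 g) i p).
Proof. exact: PW_sub (H1T_PW H) (H1T_PW (H1R3_lift (H1T_avg H))). Qed.

Lemma lft_avg3 (i : 'I_4) : (i < 3)%N -> lft (avg3 g) i = fun p => avg (g i) p.1.
Proof.
move=> i3; rewrite /lft i3 /avg3; apply/funext => p; congr (avg (g _) _).
by apply/val_inj; rewrite /= inordK.
Qed.

Lemma fluct_energy : A3 g = A3f (avg3 g) + A3 (fun i p => g i p - lft (avg3 g) i p) /\
  By (fun i p => g i p - lft (avg3 g) i p) = By g.
Proof.
have [_ mg _ g2] := H1T_li H; have [_ mg' _ g2'] := H1R3_li (H1T_avg H).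
split.
  rewrite -A3_lft// /A3 !lft_avg3//.
  have [_ _ e0] := avg_orth (mg o40) (g2 o40); have [_ _ e1] := avg_orth (mg o41) (g2 o41).
  have [_ _ e2] := avg_orth (mg o42) (g2 o42).
  by rewrite e0 e1 e2; exact: addr_ACAC.
by apply: eq_Rintegral => p _; rewrite /lft /= subr0.
Qed.

Lemma fluct4_li : li L4 (fun p => w p ^+ 4 * iT p.2).
Proof.
have [la _] := li_lift avg4_li; have mi := @m_iT2 R.
apply: (li_le (g := fun p => 8 * (u p ^+ 4 * iT p.2 + avg u p.1 ^+ 4 * iT p.2))).
- by apply: measurable_funM => //; apply: measurable_funX; exact: measurable_funB.
- move=> p; have w4 : 0 <= w p ^+ 4 by rewrite (exprM _ 2 2) sqr_ge0.
  rewrite (ger0_norm (mulr_ge0 w4 (iT_ge0 _))) -mulrDl mulrA ler_wpM2r ?iT_ge0// /w.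
  move: (u p) (avg u p.1) => a b.
  have h1 : (a - b) ^+ 2 <= 2 * (a ^+ 2 + b ^+ 2).
    by have := sqr_ge0 (a + b); rewrite sqrrD sqrrB; lra.
  have h2 : ((a - b) ^+ 2) ^+ 2 <= (2 * (a ^+ 2 + b ^+ 2)) ^+ 2.
    by rewrite lerXn2r ?nnegrE ?sqr_ge0// mulr_ge0// addr_ge0 ?sqr_ge0.
  have := sqr_ge0 (a ^+ 2 - b ^+ 2).
  have -> : (a ^+ 2 - b ^+ 2) ^+ 2 = a ^+ 4 + b ^+ 4 - 2 * (a ^+ 2 * b ^+ 2) by ring.
  have e : (2 * (a ^+ 2 + b ^+ 2)) ^+ 2 = 4 * (a ^+ 4 + b ^+ 4) + 8 * (a ^+ 2 * b ^+ 2) by ring.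
  move: h2; rewrite e -exprM; lra.
- by apply: liZ; exact: liD.
Qed.

(** Gagliardo-Nirenberg for the fluctuation involves its mass plus its y-energy. Poincare bounds
    this mass by the y-energy, so the bound acquires the factor [By g] that the penalty can
    absorb. *)
Lemma fluct_gn : (J (fun p => w p ^+ 4)) ^+ 2 <= gn_const * (1 + (2 * pi) ^+ 2) *
  (A3 (fun i p => g i p - lft (avg3 g) i p) ^+ 3 * By g).
Proof.
have P := fluct_PW; have [eA eB] := fluct_energy; have [_ _ u2 _] := H1T_li H.
have h := gagliardo_nirenberg_A3 P fluct4_li; have z := avg_fluct0 mu' u2.
have pc : J (fun p => w p ^+ 2) <= (2 * pi) ^+ 2 * By g.
  rewrite -eB; apply: (poincare P).
  by move: z; apply: filterS => x [].
rewrite eB in h; apply: le_trans h _.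
rewrite -mulrA ler_pM2l ?gn_const_gt0// mulrCA; apply: ler_wpM2l; first by rewrite exprn_ge0// A3_ge0.
rewrite mulrDl mul1r; lra.
Qed.

Lemma avg_mass : K (fun x => avg u x ^+ 2) <= J (fun p => u p ^+ 2).
Proof.
have [_ _ u2 _] := H1T_li H; have [_ _ e] := avg_orth mu' u2.
have [_ <-] := li_lift (avg_sqr_li mu' u2).
rewrite e lerDl; apply: J_ge0 => p; exact: sqr_ge0.
Qed.

End fluct.

Lemma li_3_1 (f h : R4 -> R) (w : R4 -> R) : measurable_fun setT f -> measurable_fun setT h ->
  li L4 (fun p => f p ^+ 4 * iT p.2) -> li L4 (fun p => w p ^+ 4 * iT p.2) ->
  (forall p, `|h p| <= `|w p| ^+ 3) -> li L4 (fun p => f p * h p * iT p.2).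
Proof.
move=> mf mh f4 w4 hw; have mi := @m_iT2 R.
apply: (li_le (g := fun p => f p ^+ 4 * iT p.2 + w p ^+ 4 * iT p.2)); last exact: liD.
  by apply: measurable_funM => //; exact: measurable_funM.
move=> p; rewrite normrM (ger0_norm (iT_ge0 _)) -mulrDl ler_wpM2r ?iT_ge0//.
apply: le_trans (young34 (f p) (w p)); by rewrite (normrM (f p) (h p)) (normrM (f p)) normrX ler_wpM2l.
Qed.
End key.

(** * Sharp inequality for the average and the penalized lower bound *)

Section sharp.
Variable R : realType.
Local Notation L4 := (L4 R).
Local Notation L3 := (L3 R).
Local Notation R3 := (R3 R).
Local Notation R4 := (R3R R).
Local Notation J f := (\int[L4]_p (f p * iT p.2)).
Local Notation K f := (2 * pi * \int[L3]_x (f x)).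

(** The factor [1 + (2 pi)^2] is the effect of Poincare in [fluct_gn], and 16 is the cost of
    combining the two components in [fluct_const_alg]. *)
Definition fluct_const : R := 16 * (gn_const R * (1 + (2 * pi) ^+ 2)).

Lemma fluct_const_ge0 : 0 <= fluct_const.
Proof.
have := gn_const_gt0 R; have := sqr_ge0 (2 * pi : R) => h1 h2.
by rewrite mulr_ge0// mulr_ge0 ?(ltW h2)// addr_ge0.
Qed.

Lemma pow4_ge0 (x : R) : 0 <= x ^+ 4. Proof. by rewrite (exprM x 2 2) sqr_ge0. Qed.

Lemma avg_fluct_orth (u : R4 -> R) (h : R3 -> R) : measurable_fun setT u ->
  li L4 (fun p => u p ^+ 2 * iT p.2) -> measurable_fun setT h ->
  li L4 (fun p => (u p - avg u p.1) * h p.1 * iT p.2) ->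
  J (fun p => (u p - avg u p.1) * h p.1) = 0.
Proof.
move=> mu' u2 mh l.
have ma : measurable_fun setT (fun p : R4 => avg u p.1).
  exact: measurableT_comp (measurable_avg mu') measurable_fst.
have mw : measurable_fun setT (fun p => u p - avg u p.1) by exact: measurable_funB.
have [l' ->] := avg_mul mw mh l.
rewrite (_ : \int[L3]_x _ = 0) ?mulr0//.
rewrite -(@Rint_eq0 _ _ _ L3 (fun=> 0) (fun=> erefl)); apply: Rint_ae => //; first exact: li_meas l'.
have := avg_fluct0 mu' u2; apply: filterS => x [_ e].
by rewrite {1}/avg /= e mulr0 mul0r.
Qed.

Lemma li_quartic3 (U V : R3 -> R) : measurable_fun setT U -> measurable_fun setT V ->
  li L3 (fun x => U x ^+ 4) -> li L3 (fun x => V x ^+ 4) ->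
  li L3 (fun x => quartic (U x) (V x)).
Proof.
move=> mU mV lU lV; apply: (li_le (g := fun x => 2 * (U x ^+ 4 + V x ^+ 4))).
- exact: measurable_quartic.
- by move=> x; rewrite (ger0_norm (quartic_ge0 _ _)); have [] := pow4_quartic (U x) (V x).
- by apply: liZ; exact: liD.
Qed.

Lemma li3_quartic (U V : R3 -> R) : measurable_fun setT U -> measurable_fun setT V ->
  li L3 (fun x => quartic (U x) (V x)) -> li L3 (fun x => U x ^+ 4) /\ li L3 (fun x => V x ^+ 4).
Proof.
move=> mU mV q; split; apply: li_le q => [|x].
- exact: measurable_funX.
- by rewrite ger0_norm ?pow4_ge0//; have [] := pow4_quartic (U x) (V x).
- exact: measurable_funX.
- by rewrite ger0_norm ?pow4_ge0//; have [] := pow4_quartic (U x) (V x).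
Qed.

Lemma fluct_const_alg (x y hu hv bu bv c : R) : 0 <= c -> 0 <= hu -> 0 <= hv -> 0 <= bu -> 0 <= bv ->
  x ^+ 2 <= c * (hu ^+ 3 * bu) -> y ^+ 2 <= c * (hv ^+ 3 * bv) ->
  (2 * (x + y)) ^+ 2 <= 16 * c * ((hu + hv) ^+ 3 * (bu + bv)).
Proof.
move=> c0 hu0 hv0 bu0 bv0 hx hy.
have T a b : 0 <= a -> 0 <= b -> a <= hu + hv -> b <= bu + bv ->
    c * (a ^+ 3 * b) <= c * ((hu + hv) ^+ 3 * (bu + bv)).
  move=> a0 b0 ah bh; apply: ler_wpM2l => //; apply: ler_pM => //; first exact: exprn_ge0.
  by rewrite lerXn2r// nnegrE addr_ge0.
have hx' := le_trans hx (T _ _ hu0 bu0 ltac:(lra) ltac:(lra)).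
have hy' := le_trans hy (T _ _ hv0 bv0 ltac:(lra) ltac:(lra)).
rewrite -(mulrA 16); move: hx' hy'; move: (c * _) => X hx' hy'.
have := sqr_ge0 (x - y); rewrite !expr2 in hx' hy' *; lra.
Qed.

(* The term of [quartic_expand] that is linear in the fluctuation has zero y-mean, so the
   fluctuation contributes only the quadratic term [I] and the quartic term [Y]. *)
Lemma quartic_fluct_bound (u v : R4 -> R) gu gv (a a' A B N : R) : PD u v gu gv a a' A B N ->
  exists ab ab' s h Nb I Y,
  [/\ PF (avg u) (avg v) (avg3 gu) (avg3 gv) ab ab' s Nb, ab <= a, ab' <= a' & A = s + h] /\
  [/\ 0 <= s, 0 <= h, 0 <= I & 0 <= Y] /\
  [/\ 0 <= Nb, I ^+ 2 <= Nb * Y, Y ^+ 2 <= fluct_const * (h ^+ 3 * B) & N <= Nb + 8 * I + 3 * Y].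
Proof.
move=> [[Hu Hv ua va qi] [AE BE NE]].
have [mu' mgu u2 gu2] := H1T_li Hu; have [mv mgv v2 gv2] := H1T_li Hv.
have [lu lv _ _] := quartic_li mu' mv qi.
have au4 := avg4_li Hu lu; have av4 := avg4_li Hv lv.
have mau := measurable_avg mu'; have mav := measurable_avg mv.
have q3 := li_quartic3 mau mav au4 av4.
have [q4 eq4] := li_lift q3.
have [eAu eBu] := fluct_energy Hu; have [eAv eBv] := fluct_energy Hv.
have wu4 := fluct4_li Hu lu; have wv4 := fluct4_li Hv lv.
have gnu := fluct_gn Hu lu; have gnv := fluct_gn Hv lv.
set hu := A3 (fun i p => gu i p - lft (avg3 gu) i p) in eAu gnu.
set hv := A3 (fun i p => gv i p - lft (avg3 gv) i p) in eAv gnv.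
have hu0 : 0 <= hu by exact: A3_ge0.
have hv0 : 0 <= hv by exact: A3_ge0.
have mAu : measurable_fun setT (fun p : R4 => avg u p.1) := measurableT_comp mau measurable_fst.
have mAv : measurable_fun setT (fun p : R4 => avg v p.1) := measurableT_comp mav measurable_fst.
pose w1 p := u p - avg u p.1; pose w2 p := v p - avg v p.1.
have mw1 : measurable_fun setT w1 by exact: measurable_funB.
have mw2 : measurable_fun setT w2 by exact: measurable_funB.
have mi := @m_iT2 R.
have qw := quartic_li' mw1 mw2 wu4 wv4.
have [_ _ _ qwY] := quartic_li mw1 mw2 qw.
set Y := 2 * _ in qwY.
have Y0 : 0 <= Y by rewrite mulr_ge0// addr_ge0//; apply: J_ge0 => p; exact: pow4_ge0.
pose S (x : R3) := avg u x ^+ 2 + avg v x ^+ 2.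
have mS : measurable_fun setT S by apply: measurable_funD; exact: measurable_funX.
have S0 x : 0 <= S x by rewrite addr_ge0 ?sqr_ge0.
pose q p := w1 p ^+ 2 + w2 p ^+ 2.
have mq : measurable_fun setT q by apply: measurable_funD; exact: measurable_funX.
have q0 p : 0 <= q p by rewrite addr_ge0 ?sqr_ge0.
pose Nb := K (fun x => quartic (avg u x) (avg v x)).
have NbJ : J (fun p => quartic (avg u p.1) (avg v p.1)) = Nb by exact: eq4.
have Nb0 : 0 <= Nb by rewrite -NbJ; apply: J_ge0 => p; exact: quartic_ge0.
(* The mixed term is the integral of [S q]; the squares of [S] and [q] are the quartic densities of
   the average and of the fluctuation. *)
have [I IE [I0 I2]] : exists2 I, (\int[L4]_p (`|S p.1 * iT p.2 * (q p * iT p.2)|)%:E = I%:E)%E &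
    0 <= I /\ I ^+ 2 <= Nb * J (fun p => quartic (w1 p) (w2 p)).
  apply: cauchy_schwarz.
  - by apply: measurable_funM => //; exact: measurableT_comp mS measurable_fst.
  - exact: measurable_funM.
  - rewrite -NbJ -RintE//; apply: eq_integral => p _; congr EFin.
    by rewrite quarticE exprMn (expr2 (iT _)) bR_sq.
  - rewrite -RintE//; apply: eq_integral => p _; congr EFin.
    by rewrite quarticE exprMn (expr2 (iT _)) bR_sq.
have IE' : (\int[L4]_p (S p.1 * q p * iT p.2)%:E = I%:E)%E.
  rewrite -IE; apply: eq_integral => p _; congr EFin.
  by rewrite mulrACA bR_sq ger0_norm// mulr_ge0 ?iT_ge0// mulr_ge0.
have mSq : measurable_fun setT (fun p : R4 => S p.1 * q p * iT p.2).
  apply: measurable_funM => //; apply: measurable_funM => //.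
  exact: measurableT_comp mS measurable_fst.
have Sq : li L4 (fun p => S p.1 * q p * iT p.2).
  apply/li_ge0P => //; last by rewrite IE' ltry.
  by move=> p; rewrite mulr_ge0 ?iT_ge0// mulr_ge0.
have JSq : J (fun p => S p.1 * q p) = I by rewrite /Rintegral IE'.
(* A scalar function whose fourth power is the quartic density of the average. It dominates the
   cubic factors by [|W|^3], which makes the linear terms integrable. *)
pose W (p : R4) := Num.sqrt (S p.1).
have W4 : li L4 (fun p => W p ^+ 4 * iT p.2).
  move: q4; congr (li L4 _); apply/funext => p.
  by rewrite /W (exprM _ 2 2) sqr_sqrtr// quarticE.
have Wb (x : R3) (b : R) : b ^+ 2 <= S x -> `|S x * b| <= `|Num.sqrt (S x)| ^+ 3.
  move=> h; rewrite normrM (ger0_norm (S0 x)) (ger0_norm (sqrtr_ge0 _)) exprSr sqr_sqrtr//.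
  by apply: ler_wpM2l => //; rewrite -sqrtr_sqr ler_sqrt.
have mh1 : measurable_fun setT (fun x => S x * avg u x) by exact: measurable_funM.
have mh2 : measurable_fun setT (fun x => S x * avg v x) by exact: measurable_funM.
have l1 : li L4 (fun p => w1 p * (S p.1 * avg u p.1) * iT p.2).
  apply: (li_3_1 mw1 _ wu4 W4); first exact: measurableT_comp mh1 measurable_fst.
  by move=> p; apply: Wb; rewrite /S lerDl sqr_ge0.
have l2 : li L4 (fun p => w2 p * (S p.1 * avg v p.1) * iT p.2).
  apply: (li_3_1 mw2 _ wv4 W4); first exact: measurableT_comp mh2 measurable_fst.
  by move=> p; apply: Wb; rewrite /S lerDr sqr_ge0.
have z1 := avg_fluct_orth mu' u2 mh1 l1; have z2 := avg_fluct_orth mv v2 mh2 l2.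
have l12 := liD l1 l2.
have key : N <= Nb + 8 * I + 3 * J (fun p => quartic (w1 p) (w2 p)).
  have -> : Nb + 8 * I + 3 * J (fun p => quartic (w1 p) (w2 p)) =
     Nb + 4 * \int[L4]_p (w1 p * (S p.1 * avg u p.1) * iT p.2 + w2 p * (S p.1 * avg v p.1) * iT p.2) +
     8 * I + 3 * J (fun p => quartic (w1 p) (w2 p)).
    by rewrite RintegralD// z1 z2 !addr0 mulr0 addr0.
  rewrite -NbJ -JSq -NE -!RintegralZl// -!RintegralD//;
    try (by repeat first [exact: liZ | apply: liD => //]).
  apply: Rint_le => //; first by repeat first [exact: liZ | apply: liD => //].
  move=> p.
  have := quartic_expand (avg u p.1) (avg v p.1) (w1 p) (w2 p).
  rewrite (_ : avg u p.1 + w1 p = u p); last by rewrite /w1 addrC subrK.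
  rewrite (_ : avg v p.1 + w2 p = v p); last by rewrite /w2 addrC subrK.
  move=> h; apply: le_trans (ler_wpM2r (iT_ge0 p.2) h) _.
  by rewrite /S /q le_eqVlt; apply/orP; left; apply/eqP; ring.
have pf : PF (avg u) (avg v) (avg3 gu) (avg3 gv) (K (fun x => avg u x ^+ 2))
    (K (fun x => avg v x ^+ 2)) (A3f (avg3 gu) + A3f (avg3 gv)) Nb.
  by split; split => //; exact: H1T_avg.
exists (K (fun x => avg u x ^+ 2)), (K (fun x => avg v x ^+ 2)),
  (A3f (avg3 gu) + A3f (avg3 gv)), (hu + hv), Nb, I, Y.
have A3f0 (g : 'I_3 -> R3 -> R) : 0 <= A3f g.
  by apply: addr_ge0; [apply: addr_ge0|]; apply: mulr_ge0; rewrite ?(ltW (pi2_gt0 R))//;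
    apply: Rintegral_ge0 => x _; exact: sqr_ge0.
split; [split => //|split; split => //].
- by rewrite -ua; exact: (avg_mass Hu).
- by rewrite -va; exact: (avg_mass Hv).
- by rewrite -AE eAu eAv addrACA.
- exact: addr_ge0 (A3f0 _) (A3f0 _).
- exact: addr_ge0 hu0 hv0.
- by apply: le_trans I2 _; rewrite ler_wpM2l.
- rewrite -BE; have c0 : 0 <= gn_const R * (1 + (2 * pi) ^+ 2).
    by rewrite mulr_ge0 ?(ltW (gn_const_gt0 R))// addr_ge0// sqr_ge0.
  exact: (fluct_const_alg c0 hu0 hv0 (By_ge0 gu) (By_ge0 gv) gnu gnv).
- by apply: le_trans key _; rewrite lerD2l ler_pM2l.
Qed.

Lemma PF_diag U g : H1R3 U g -> li L3 (fun x => U x ^+ 4) ->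
  PF U U g g (K (fun x => U x ^+ 2)) (K (fun x => U x ^+ 2)) (2 * A3f g) (4 * K (fun x => U x ^+ 4)).
Proof.
move=> H U4; have [mU mg U2 g2] := H1R3_li H.
split; split => //.
- exact: li_quartic3.
- by rewrite mulr_natl mulr2n.
- transitivity (2 * pi * (4 * \int[L3]_x U x ^+ 4)); last by rewrite mulrCA.
  rewrite -[X in _ = _ * X]RintegralZl//; congr (_ * _); apply: eq_Rintegral => x _.
  by rewrite /quartic; ring.
Qed.

Section flat.
Variable al : R.
Hypothesis al0 : 0 < al.
Hypothesis alP : forall A, @E0set R 1 A -> al <= A.

Lemma A3f_ge0 (g : 'I_3 -> R3 -> R) : 0 <= A3f g.
Proof.
by apply: addr_ge0; [apply: addr_ge0|]; apply: mulr_ge0; rewrite ?(ltW (pi2_gt0 R))//;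
    apply: Rintegral_ge0 => x _; exact: sqr_ge0.
Qed.

(* Rescale the diagonal pair (U, U) onto the constraint and use minimality of [al]. *)
Lemma sharp_gn_flat U g : H1R3 U g -> li L3 (fun x => U x ^+ 4) -> K (fun x => U x ^+ 2) <= 1 ->
  (K (fun x => U x ^+ 4)) ^+ 2 <= 8 / 9 / al * A3f g ^+ 3.
Proof.
move=> H U4 U1; have [mU mg U2 g2] := H1R3_li H.
have [l4 e4] := li_lift U4; have [l2 e2] := li_lift U2.
have G := gagliardo_nirenberg_A3 (H1T_PW (H1R3_lift H)) l4.
rewrite e4 e2 A3_lft// By_lft addr0 in G.
have p0 := A3f_ge0 g.
have a0 : 0 <= K (fun x => U x ^+ 2).
  by rewrite -e2; apply: J_ge0 => p; exact: sqr_ge0.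
have n0 : 0 <= K (fun x => U x ^+ 4).
  by rewrite -e4; apply: J_ge0 => p; exact: pow4_ge0.
have pf := PF_diag H U4.
move: G U1 a0 n0 p0 pf.
move: (K (fun x => U x ^+ 2)) (K (fun x => U x ^+ 4)) (A3f g) => a n p G a1 a0 n0 p0 pf.
have R0 : 0 <= 8 / 9 / al * p ^+ 3 by rewrite mulr_ge0 ?exprn_ge0// divr_ge0 ?(ltW al0)//; lra.
have [nz|nn] := eqVneq n 0; first by rewrite nz expr0n.
have np : 0 < n by rewrite lt_neqAle eq_sym nn.
(* A positive quartic term forces energy and mass to be positive, as the rescaling requires. *)
have Gp : 0 < gn_const R * (p ^+ 3 * a) by apply: lt_le_trans G; rewrite exprn_gt0.
have pp : 0 < p.
  rewrite lt_neqAle p0 andbT; apply: contraTneq Gp => <-.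
  by rewrite expr0n/= mul0r mulr0 ltxx.
have ap : 0 < a.
  rewrite lt_neqAle a0 andbT; apply: contraTneq Gp => <-.
  by rewrite !mulr0 ltxx.
have p2 : 0 < 2 * p by rewrite mulr_gt0.
have n4 : 0 < 4 * n by rewrite mulr_gt0.
have [u' [v' [gu' [gv' pf']]]] := PF_resc ap p2 n4 pf.
have hE : al <= 16 / 9 * ((2 * p) ^+ 3 * a / (4 * n) ^+ 2).
  by apply: alP; exists u', v', gu', gv'; rewrite expr1n.
have e : 16 / 9 * ((2 * p) ^+ 3 * a / (4 * n) ^+ 2) = 8 / 9 * p ^+ 3 * a / n ^+ 2 by field.
rewrite e ler_pdivlMr ?exprn_gt0// in hE.
have -> : 8 / 9 / al * p ^+ 3 = 8 / 9 * p ^+ 3 / al by rewrite mulrAC.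
rewrite ler_pdivlMr// mulrC; apply: le_trans hE _.
rewrite ler_piMr// mulr_ge0 ?exprn_ge0//; lra.
Qed.

(** The two averages may have different masses, both at most one, so the pair as such cannot be
    rescaled to the constraint. Each component is estimated on its own by [sharp_gn_flat].
    Cauchy-Schwarz bounds the mixed term, and [pow34_alg] adds the two estimates, doubling 8/9 to
    16/9, the constant that pairs on the constraint with energy [al] attain. *)
Lemma sharp_gn_flat_pair U V gU gV ab ab' s Nb : PF U V gU gV ab ab' s Nb -> ab <= 1 -> ab' <= 1 ->
  Nb ^+ 2 <= 16 / 9 / al * s ^+ 3.
Proof.
move=> [[HU HV Ua Va qi] [AE NE]] a1 a1'.
have [mU mgU U2 gU2] := H1R3_li HU; have [mV mgV V2 gV2] := H1R3_li HV.
have [U4 V4] := li3_quartic mU mV qi.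
have hU := sharp_gn_flat HU U4 ltac:(by rewrite Ua); have hV := sharp_gn_flat HV V4 ltac:(by rewrite Va).
have p0 := pi2_gt0 R.
have [I IE [I0 I2]] : exists2 I, (\int[L3]_x (`|U x ^+ 2 * V x ^+ 2|)%:E = I%:E)%E &
    0 <= I /\ I ^+ 2 <= (\int[L3]_x U x ^+ 4) * (\int[L3]_x V x ^+ 4).
  apply: cauchy_schwarz; [exact: measurable_funX|exact: measurable_funX| |].
  - by rewrite -RintE//; apply: eq_integral => x _; rewrite -exprM.
  - by rewrite -RintE//; apply: eq_integral => x _; rewrite -exprM.
have UV : li L3 (fun x => U x ^+ 2 * V x ^+ 2).
  apply/li_absP; last by rewrite IE ltry.
  by apply: measurable_funM; exact: measurable_funX.
have UVI : \int[L3]_x (U x ^+ 2 * V x ^+ 2) = I.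
  rewrite /Rintegral -[RHS]/(fine I%:E) -IE; congr fine; apply: eq_integral => x _.
  by rewrite ger0_norm// mulr_ge0 ?sqr_ge0.
have NbE : Nb = K (fun x => U x ^+ 4) + K (fun x => V x ^+ 4) + 2 * (2 * pi * I).
  rewrite -NE -UVI.
  transitivity (2 * pi * (\int[L3]_x U x ^+ 4 + \int[L3]_x V x ^+ 4 + 2 * \int[L3]_x (U x ^+ 2 * V x ^+ 2))); last first.
    move: (\int[L3]_x U x ^+ 4) (\int[L3]_x V x ^+ 4) (\int[L3]_x (U x ^+ 2 * V x ^+ 2)) => *; ring.
  congr (_ * _); rewrite -RintegralZl// -RintegralD// -RintegralD//.
  - by apply: eq_Rintegral => x _; rewrite /quartic; ring.
  - exact: liD.
  - exact: liZ.
have n0 (f : R3 -> R) : 0 <= K (fun x => f x ^+ 4).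
  by rewrite mulr_ge0 ?(ltW p0)//; apply: Rintegral_ge0 => x _; exact: pow4_ge0.
pose x := Num.sqrt (K (fun x => U x ^+ 4)); pose y := Num.sqrt (K (fun x => V x ^+ 4)).
have x2 : x ^+ 2 = K (fun x => U x ^+ 4) by rewrite sqr_sqrtr.
have y2 : y ^+ 2 = K (fun x => V x ^+ 4) by rewrite sqr_sqrtr.
have x0 : 0 <= x by exact: sqrtr_ge0.
have y0 : 0 <= y by exact: sqrtr_ge0.
have Ixy : 2 * pi * I <= x * y.
  apply: ler_X2; first exact: mulr_ge0.
  rewrite (exprMn _ x) x2 y2 (exprMn _ (2 * pi)).
  apply: (@le_trans _ _ ((2 * pi) ^+ 2 * ((\int[L3]_x U x ^+ 4) * (\int[L3]_x V x ^+ 4)))).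
    by rewrite ler_pM2l// exprn_gt0.
  rewrite le_eqVlt; apply/orP; left; apply/eqP.
  move: (\int[L3]_z U z ^+ 4) (\int[L3]_z V z ^+ 4) => *; ring.
have Nb0 : 0 <= Nb by rewrite -NE mulr_ge0 ?(ltW p0)//; apply: Rintegral_ge0 => z _; exact: quartic_ge0.
have NbS : Nb <= (x + y) ^+ 2.
  have -> : (x + y) ^+ 2 = x ^+ 2 + y ^+ 2 + 2 * (x * y) by ring.
  by rewrite NbE -x2 -y2 lerD2l ler_pM2l.
apply: (@le_trans _ _ ((x + y) ^+ 4)).
  by rewrite (exprM _ 2 2) lerXn2r ?nnegrE// sqr_ge0.
have K0 : 0 <= 8 / 9 / al by rewrite divr_ge0 ?(ltW al0)//; lra.
have := pow34_alg x0 y0 (A3f_ge0 gU) (A3f_ge0 gV) K0.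
rewrite (exprM x 2 2) x2 (exprM y 2 2) y2 AE => /(_ hU hV) /le_trans; apply.
rewrite le_eqVlt; apply/orP; left; apply/eqP; congr (_ * _).
by field; rewrite gt_eqF.
Qed.

Lemma Eset_penalized_lower : exists2 lam : R, 0 < lam & forall A B, Eset 1 A B -> al <= A + 3 * lam * B.
Proof.
have [lam l0 H] := penalized_alg al0 (gn_const_gt0 R) fluct_const_ge0.
exists lam => // A B [u [v [gu [gv]]]]; rewrite expr1n => pd.
have [A0 lo] := PD_lower pd.
have B0 : 0 <= B by have [_ [_ <- _]] := pd; rewrite addr_ge0// By_ge0.
have [ab [ab' [s [h [Nb [I [Y [[pf a1 a1' AE] [[s0 h0 I0 Y0] [Nb0 I2 Y2 N8]]]]]]]]]] := quartic_fluct_bound pd.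
rewrite AE in N8 lo *.
exact: (H s h B Nb I Y s0 h0 B0 Nb0 I0 Y0 (sharp_gn_flat_pair pf a1 a1') I2 Y2 N8 lo).
Qed.
End flat.
End sharp.

(** * Existence of admissible pairs *)

Section witnesses.
Variable R : realType.
Local Notation mu := (L1 R).
Local Notation L4 := (L4 R).
Local Notation L3 := (L3 R).
Local Notation R3 := (R3 R).
Local Notation R4 := (R3R R).
Local Notation J f := (\int[L4]_p (f p * iT p.2)).
Local Notation K f := (2 * pi * \int[L3]_x (f x)).

Lemma Rint_gt0_itv (f : R -> R) (a b : R) : a < b -> li mu f -> (forall t, 0 <= f t) ->
  (forall t, a < t < b -> 0 < f t) -> 0 < \int[mu]_t f t.
Proof.
move=> ab fi f0 fp; rewrite lt_neqAle; apply/andP; split; last exact: Rintegral_ge0.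
apply/eqP => I0; have [N [mN N0 NP]] := Rint_ge0_eq0 fi f0 (esym I0).
have sub : `]a, b[%classic `<=` N.
  move=> t; rewrite /= in_itv/= => h; apply: NP => /= e.
  by have := fp t h; rewrite e ltxx.
have h : (mu `]a, b[%classic <= mu N)%E.
  by apply: le_measure => //; rewrite inE//; exact: measurable_itv.
move: h; rewrite N0 (@L1_itv R a b false true (ltW ab)).
by rewrite lee_fin subr_le0 leNgt ab.
Qed.

Lemma A3_gexp (b b' e e' : R -> R) : tst (-1) 1 b b' -> C1 e e' ->
  A3 (gexp b b' e e') = 3 * ((\int[mu]_t b' t ^+ 2) * (\int[mu]_t b t ^+ 2) ^+ 2 *
    \int[mu]_t (e t ^+ 2 * iT t)).
Proof.
move=> tb Ce; have [lb lb'] := li_tst_pow 1 tb; have le := li_itv_cont 2 (C1_cont Ce).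
have [_ e0] := J_tprod lb' lb lb le; have [_ e1] := J_tprod lb lb' lb le.
have [_ e2] := J_tprod lb lb lb' le.
rewrite /A3 /gexp /dprod /= e0 e1 e2.
move: (\int[mu]_t b' t ^+ 2) (\int[mu]_t b t ^+ 2) (\int[mu]_t (e t ^+ 2 * iT t)) => *; ring.
Qed.

Lemma PD_diag (u : R4 -> R) g : H1T u g -> li L4 (fun p => u p ^+ 4 * iT p.2) ->
  PD u u g g (J (fun p => u p ^+ 2)) (J (fun p => u p ^+ 2)) (2 * A3 g) (2 * By g)
     (4 * J (fun p => u p ^+ 4)).
Proof.
move=> H u4; have [mu' mg u2 g2] := H1T_li H.
split; split => //.
- exact: quartic_li'.
- by rewrite mulr_natl mulr2n.
- by rewrite mulr_natl mulr2n.
- rewrite -RintegralZl//; apply: eq_Rintegral => p _; by rewrite /quartic; ring.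
Qed.

(** Positive mass gives a positive quartic term, and Gagliardo-Nirenberg then rules out zero
    x-energy. *)
Lemma A3_gt0 (u : R4 -> R) g : H1T u g -> li L4 (fun p => u p ^+ 4 * iT p.2) ->
  0 < J (fun p => u p ^+ 2) -> 0 < A3 g /\ 0 < J (fun p => u p ^+ 4).
Proof.
move=> H u4 a0; have N0 := PD_pos a0 (PD_diag H u4).
have n0 : 0 < J (fun p => u p ^+ 4) by rewrite pmulr_rgt0 in N0.
split => //; have G := gagliardo_nirenberg_A3 (H1T_PW H) u4.
rewrite lt_neqAle A3_ge0 andbT; apply: contraTneq G => <-.
by rewrite expr0n/= mul0r mulr0 -ltNge exprn_gt0.
Qed.

Let b := bmp (-1 : R) 1.
Let b' := dbmp (-1 : R) 1.

Let tb : tst (-1) 1 b b'.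
Proof. by split; [exact: C1_bmp|move=> t; exact: bmp_out]. Qed.

Let bpos k : 0 < \int[mu]_t b t ^+ k.+1.
Proof.
have [lb _] := li_tst_pow k tb.
have h : -1 < 1 :> R by lra.
apply: (Rint_gt0_itv h lb).
- by move=> t; rewrite exprn_ge0// bmp_ge0.
- by move=> t ht; rewrite exprn_gt0// bmp_gt0.
Qed.

(** A product of three bumps, constant in y, is placed on R^3 x T; its average supplies the function
    on R^3 together with a weak gradient, and the diagonal pair is rescaled to the constraint. *)
Lemma E0set_nonempty : exists A, @E0set R 1 A.
Proof.
pose e (t : R) : R := 1.
have Ce : C1 e (fun=> 0) by split=> t; [exact: cvg_cst|exact: is_derive_cst].
have H : H1T (tprod b b b e) (gexp b b' e (fun=> 0)) by exact: H1T_explicit.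
have [lb _] := li_tst_pow 1 tb; have [lb4 _] := li_tst_pow 3 tb.
have le k := li_itv_cont k (C1_cont Ce).
have [l4 _] := J_tprod lb4 lb4 lb4 (le 4).
have [_ e2] := J_tprod lb lb lb (le 2).
pose f (x : R3) := b x.1.1 * b x.1.2 * b x.2 * 1.
have H3 : H1R3 f (avg3 (gexp b b' e (fun=> 0))).
  by have := H1T_avg H; rewrite (avg_cst f : avg (tprod b b b e) = f).
have f4 : li L3 (fun x => f x ^+ 4).
  by have := avg4_li H l4; rewrite (avg_cst f : avg (tprod b b b e) = f).
have [mf mg f2 g2] := H1R3_li H3.
have a0 : 0 < K (fun x => f x ^+ 2).
  have [_ <-] := li_lift f2.
  rewrite -[X in 0 < X]/(J (fun p => tprod b b b e p ^+ 2)) e2.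
  apply: mulr_gt0; first by rewrite !mulr_gt0// bpos.
  apply: (Rint_gt0_itv (pi2_gt0 R) (le 2%N)).
  - by move=> t; rewrite expr1n mul1r iT_ge0.
  - by move=> t h; rewrite expr1n mul1r (iT1 h).
have pd := PF_PD (PF_diag H3 f4).
have N0 := PD_pos a0 pd.
have [[HL _ _ _ _] _] := pd.
have [l4' e4'] := li_lift f4; have [_ e2'] := li_lift f2.
have [A0 _] := A3_gt0 HL l4' ltac:(by rewrite e2').
rewrite A3_lft// in A0.
have A20 : 0 < 2 * A3f (avg3 (gexp b b' e (fun=> 0))) by rewrite mulr_gt0.
have [u' [v' [gu' [gv' h]]]] := PF_resc a0 A20 N0 (PF_diag H3 f4).
by eexists; exists u', v', gu', gv'; rewrite expr1n; exact: h.
Qed.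

(** Cauchy-Schwarz against the indicator of the support of the spike: the ratio on the left is at
    most the measure of that support, which [spk_supp] makes small. *)
Lemma spk_conc (delta : R) : 0 < delta -> exists2 c : R,
  0 < \int[mu]_t (spk c t ^+ 2 * iT t) &
  (\int[mu]_t (spk c t ^+ 2 * iT t)) ^+ 2 <= delta * \int[mu]_t (spk c t ^+ 4 * iT t).
Proof.
move=> d0; have [c c1 hc] := spk_supp d0; exists c.
  have : \forall t \near (0 : R), c < cos t.
    by have /cvgr_gt/(_ c) := @continuous_cos R 0; rewrite cos0 => /(_ c1).
  move=> /nbhs_ballP[r /= r0 hr].
  apply: (@Rint_gt0_itv _ 0 (Num.min r (2 * pi))).
  - by rewrite lt_min r0 pi2_gt0.
  - exact: li_itv_cont (C1_cont (C1_spk c)).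
  - by move=> t; rewrite mulr_ge0 ?iT_ge0// sqr_ge0.
  - move=> t /andP[t0]; rewrite lt_min => /andP[tr tp].
    have ct : c < cos t by apply: hr; rewrite /ball /= sub0r normrN gtr0_norm.
    have tT : 0 < t < 2 * pi by rewrite t0.
    rewrite (iT1 tT) mulr1 /spk exprn_gt0// exprn_gt0// pos_id ?subr_ge0 ?(ltW ct)// subr_gt0//.
have ms : measurable_fun setT (spk c) := continuous_measurable_fun (C1_cont (C1_spk c)).
have mi := @measurable_iT R.
have mb : measurable_fun setT (fun t : R => bR R (c < cos t)).
  apply: measurable_natb; apply: measurable_fun_ltr => //.
  exact: continuous_measurable_fun (@continuous_cos R).
have lb : li mu (fun t => bR R (c < cos t) * iT t).
  have := li_bdd (li_bitv (0 : R) (2 * pi)) mb (fun t => ind_le1 _ _).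
  by congr (li mu _); apply/funext => t; rewrite mulrC.
have l2 := li_itv_cont 2 (C1_cont (C1_spk c)); have l4 := li_itv_cont 4 (C1_cont (C1_spk c)).
have [I IE [I0 I2]] : exists2 I, (\int[mu]_t (`|bR R (c < cos t) * iT t * (spk c t ^+ 2 * iT t)|)%:E = I%:E)%E &
    0 <= I /\ I ^+ 2 <= (\int[mu]_t (bR R (c < cos t) * iT t)) * \int[mu]_t (spk c t ^+ 4 * iT t).
  apply: cauchy_schwarz.
  - exact: measurable_funM.
  - by apply: measurable_funM => //; exact: measurable_funX.
  - by rewrite -RintE//; apply: eq_integral => t _; rewrite expr2 mulrACA !bR_sq.
  - by rewrite -RintE//; apply: eq_integral => t _; rewrite exprMn -exprM (expr2 (iT _)) bR_sq.
have <- : I = \int[mu]_t (spk c t ^+ 2 * iT t).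
  rewrite /Rintegral -[LHS]/(fine I%:E) -IE; congr fine; apply: eq_integral => t _; congr EFin.
  rewrite mulrACA bR_sq ger0_norm; last first.
    rewrite mulr_ge0 ?iT_ge0// mulr_ge0 ?sqr_ge0//; by have /andP[] := bR01 R (c < cos t).
  case: (ltP c (cos t)) => h; first by rewrite /bR mul1r.
  by rewrite /spk pos_0 ?subr_le0// !expr0n/= mulr0.
apply: le_trans I2 _; apply: ler_wpM2r => //.
apply: Rintegral_ge0 => t _; by rewrite mulr_ge0 ?iT_ge0// (exprM _ 2 2) sqr_ge0.
Qed.

(** The invariant [A^3 a / N^2] of the diagonal pair depends on the profile in y only through
    [(H2^2 / H4)^2], since [A] and [a] are proportional to [H2] and [N] to [H4]. *)
Lemma concentration_alg (b1 b2 b4 H2 H4 delta eps : R) : 0 <= b1 -> 0 < b2 -> 0 < b4 -> 0 < H2 -> 0 < H4 ->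
  0 < delta -> delta <= 1 -> H2 ^+ 2 <= delta * H4 ->
  24 * (b1 ^+ 3 * b2 ^+ 9 / b4 ^+ 6) * delta < eps ->
  16 / 9 * ((2 * (3 * (b1 * b2 ^+ 2 * H2))) ^+ 3 * (b2 * b2 * b2 * H2) /
    (4 * (b4 * b4 * b4 * H4)) ^+ 2) < eps.
Proof.
move=> b10 b20 b40 H20 H40 d0 d1 hH he; apply: le_lt_trans he.
have -> : 16 / 9 * ((2 * (3 * (b1 * b2 ^+ 2 * H2))) ^+ 3 * (b2 * b2 * b2 * H2) /
    (4 * (b4 * b4 * b4 * H4)) ^+ 2) = 24 * (b1 ^+ 3 * b2 ^+ 9 / b4 ^+ 6) * (H2 ^+ 2 / H4) ^+ 2.
  by field; rewrite !gt_eqF.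
apply: ler_wpM2l.
  by rewrite mulr_ge0// divr_ge0 ?exprn_ge0 ?(ltW b40)// mulr_ge0// exprn_ge0// ltW.
have h : H2 ^+ 2 / H4 <= delta by rewrite ler_pdivrMr.
have h0 : 0 <= H2 ^+ 2 / H4 by rewrite divr_ge0 ?sqr_ge0// ltW.
apply: (@le_trans _ _ (delta ^+ 2)); first by rewrite lerXn2r// nnegrE ltW.
by rewrite expr2 ler_piMl// ltW.
Qed.

Lemma Eset_small_A (eps : R) : 0 < eps -> exists A B, [/\ @Eset R 1 A B, A < eps & 0 <= B].
Proof.
move=> e0.
pose b1 := \int[mu]_t b' t ^+ 2; pose b2 := \int[mu]_t b t ^+ 2; pose b4 := \int[mu]_t b t ^+ 4.
have b10 : 0 <= b1 by apply: Rintegral_ge0 => t _; exact: sqr_ge0.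
have b20 : 0 < b2 := bpos 1.
have b40 : 0 < b4 := bpos 3.
pose k := 24 * (b1 ^+ 3 * b2 ^+ 9 / b4 ^+ 6).
have k0 : 0 <= k.
  by rewrite mulr_ge0// divr_ge0 ?exprn_ge0 ?(ltW b40)// mulr_ge0// exprn_ge0// ltW.
(* The cap at 1 allows [delta^2 <= delta]; the shift [k + 1] keeps the denominator positive and the
   final inequality strict. *)
pose delta := Num.min 1 (eps / (k + 1)).
have d0 : 0 < delta by rewrite lt_min ltr01 divr_gt0// ltr_wpDl.
have d1 : delta <= 1 by rewrite ge_min lexx.
have kd : k * delta < eps.
  apply: (@le_lt_trans _ _ (k * (eps / (k + 1)))); first by rewrite ler_wpM2l// ge_min lexx orbT.
  by rewrite mulrA ltr_pdivrMr ?ltr_wpDl// mulrC ltr_pM2l// ltrDl.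
have [c H20 hH] := spk_conc d0.
have Ce := C1_spk c.
have H : H1T (tprod b b b (spk c)) (gexp b b' (spk c) (dspk c)).
  by apply: H1T_explicit => // y; exact: spk_per.
have [lb _] := li_tst_pow 1 tb; have [lb4 _] := li_tst_pow 3 tb.
have le j := li_itv_cont j (C1_cont Ce).
have [l4 e4] := J_tprod lb4 lb4 lb4 (le 4).
have [_ e2] := J_tprod lb lb lb (le 2).
have a0 : 0 < J (fun p => tprod b b b (spk c) p ^+ 2) by rewrite e2 !mulr_gt0.
have [A0 n0] := A3_gt0 H l4 a0.
have A20 : 0 < 2 * A3 (gexp b b' (spk c) (dspk c)) by rewrite mulr_gt0.
have n40 : 0 < 4 * J (fun p => tprod b b b (spk c) p ^+ 4) by rewrite mulr_gt0.
have H40 : 0 < \int[mu]_t (spk c t ^+ 4 * iT t).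
  by move: n0; rewrite e4 pmulr_rgt0// !mulr_gt0.
have [u' [v' [gu' [gv' h]]]] := PD_resc a0 A20 n40 (PD_diag H l4).
eexists; eexists; split.
- by exists u', v', gu', gv'; rewrite expr1n; exact: h.
- rewrite A3_gexp// e2 e4 -/b1 -/b2 -/b4.
  exact: (concentration_alg b10 b20 b40 H20 H40 d0 d1 hH kd).
- by rewrite divr_ge0 ?(ltW a0)// mulr_ge0// By_ge0.
Qed.
End witnesses.

(** * Vanishing y-energy *)

Section flatness.
Variable R : realType.
Local Notation mu := (L1 R).
Local Notation L4 := (L4 R).
Local Notation L3 := (L3 R).
Local Notation R3 := (R3 R).
Local Notation R4 := (R3R R).
Local Notation J f := (\int[L4]_p (f p * iT p.2)).

(** The value zero excludes an infinite positive or negative part, as no difference with an infinite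
    term is zero in the extended reals. Integrability can thus be read off from a weak identity. *)
Lemma int0_li (d : measure_display) (T : measurableType d) (m : {measure set T -> \bar R})
  (f : T -> R) : measurable_fun setT f -> (\int[m]_x (f x)%:E = 0)%E -> li m f.
Proof.
move=> mf; have mE : measurable_fun setT (EFin \o f) by exact/measurable_EFinP.
rewrite integralE.
have : (0 <= \int[m]_x (EFin \o f)^\+ x)%E by exact: integral_ge0.
have : (0 <= \int[m]_x (EFin \o f)^\- x)%E by exact: integral_ge0.
case E2 : (\int[m]_x (EFin \o f)^\- x)%E => [a| |] //= _;
  case E1 : (\int[m]_x (EFin \o f)^\+ x)%E => [c| |] //= _ h.
apply/integrableP; split => //.
have -> : (\int[m]_x `|(EFin \o f) x| = \int[m]_x ((EFin \o f)^\+ x + (EFin \o f)^\- x))%E.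
  by apply: eq_integral => x _; rewrite -[LHS]/((abse \o (EFin \o f)) x) fune_abse.
rewrite ge0_integralD//.
- by rewrite E1 E2 ltry.
- exact: measurable_funepos.
- exact: measurable_funeneg.
Qed.

Lemma mpres_trans (c : R) : mpres L4 L4 (fun p => (p.1, p.2 + c)).
Proof.
have h : mpres mu mu (fun y : R => y + c).
  apply: mpres_ge0; first by apply: measurable_funD => //; exact: measurable_cst.
  move=> f mf f0; have := ge0_int_affine c ltr01 mf f0; rewrite invr1 mul1e => <-.
  by apply: eq_integral => x _; rewrite mul1r.
exact: (mpres_map2 L3 h).
Qed.

Lemma periodic_int (u : R4 -> R) (k : int) x y : periodic_y u -> u (x, y + k%:~R * (2 * pi)) = u (x, y).
Proof.
move=> per.
have N (n : nat) z : u (x, z + n%:R * (2 * pi)) = u (x, z).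
  elim: n z => [|n IH] z; first by rewrite mul0r addr0.
  by rewrite -[RHS]IH -[RHS]per; congr (u (x, _)); rewrite -natr1; ring.
case: k => n; first exact: N.
rewrite NegzE -[LHS](N n.+1); congr (u (x, _)).
by rewrite mulrNz -pmulrn -addrA -mulrDl addNr mul0r addr0.
Qed.

(** Translates of the null set by whole periods are null, and so is the countable union of the
    slices at multiples of the period, which no translate of the open cell covers. *)
Lemma ae_periodic (u : R4 -> R) (f : R3 -> R) : periodic_y u ->
  {ae L4, forall p, 0 < p.2 < 2 * pi -> u p = f p.1} -> {ae L4, forall p, u p = f p.1}.
Proof.
move=> per H; have p0 := pi2_gt0 R.
have H1 : {ae L4, forall p, forall k : int, 0 < p.2 + k%:~R * (2 * pi) < 2 * pi -> u p = f p.1}.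
  apply: ae_countable => k; have := ae_mpres (mpres_trans (k%:~R * (2 * pi))) H.
  by apply: filterS => -[x y] /= h /h; rewrite periodic_int.
have H2 : {ae L4, forall p, forall k : int, p.2 <> - (k%:~R * (2 * pi))}.
  apply: ae_countable => k; pose c : R := - (k%:~R * (2 * pi)); exists (setT `*` [set c]); split.
  - exact: measurableX.
  - transitivity (L3 setT * mu [set c])%E; last by rewrite L1_set1 mule0.
    exact: (prodmE L3 mu measurableT (measurable_set1 _)).
  - by move=> [x y] /= h; split => //; exact: contrapT.
apply: filterS2 H1 H2 => -[x y] /= h1 h2.
(* The number of periods that brings [y] back into the cell. *)
pose k := - Num.floor (y / (2 * pi)).
apply: (h1 k); have /andP[f1 f2] := floor_itv (y / (2 * pi)).
have kE : k%:~R = - (Num.floor (y / (2 * pi)))%:~R :> R by rewrite /k mulrNz.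
have := h2 k; rewrite kE; move: f1 f2.
rewrite intrD; move: ((Num.floor _)%:~R : R) => z f1 f2 h3.
rewrite ler_pdivlMr// in f1; rewrite ltr_pdivrMr// mulrDl mul1r in f2.
apply/andP; split; last by rewrite mulNr; lra.
rewrite mulNr subr_gt0 lt_neqAle f1 andbT; apply/eqP => e.
by apply: h3; rewrite mulNr opprK.
Qed.

Lemma tstM a b (f f' g g' : R -> R) : tst a b f f' -> tst a b g g' ->
  tst a b (fun t => f t * g t) (fun t => f t * g' t + f' t * g t).
Proof.
move=> [Cf f0] [Cg g0]; split; first exact: C1M.
by move=> t h; have [-> ->] := f0 t h; rewrite !mul0r addr0.
Qed.

(** The conclusion concerns all of R^3 x R, whereas [By g] sees only one period cell and periodicity
    is imposed on [u], not on [g]. Poincare gives [u = avg u] in the cell, and periodicity of [u]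
    extends this to all y; the weak identity then annihilates [g iy] against all products, and
    separation concludes. *)
Lemma By0_gy_ae0 (u : R4 -> R) g : H1T u g -> By g = 0 -> {ae L4, forall p, g iy p = 0}.
Proof.
move=> H B0; have [mu' mg u2 g2] := H1T_li H.
have [_ [per [_ [w _]]]] := H.
have H3 := H1T_avg H; have [ma _ a2 _] := H1R3_li H3.
have P := fluct_PW H; have [_ eB] := fluct_energy H.
have z := avg_fluct0 mu' u2.
have ufl : {ae L4, forall p, 0 < p.2 < 2 * pi -> u p = avg u p.1}.
  have pc : J (fun p => (u p - avg u p.1) ^+ 2) <= 0.
    rewrite -[leRHS](mulr0 ((2 * pi) ^+ 2)) -[X in _ * X]B0 -eB; apply: (poincare P).
    by move: z; apply: filterS => x [].
  have [_ _ l _ _] := P.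
  have l0 (p : R4) : 0 <= (u p - avg u p.1) ^+ 2 * iT p.2 by rewrite mulr_ge0 ?iT_ge0 ?sqr_ge0.
  have e : J (fun p => (u p - avg u p.1) ^+ 2) = 0.
    by apply/eqP; rewrite eq_le pc; apply: Rintegral_ge0 => p _.
  have := Rint_ge0_eq0 l l0 e; apply: filterS => p + h.
  by rewrite (iT1 h) mulr1 => /eqP; rewrite sqrf_eq0 subr_eq0 => /eqP.
have uE := ae_periodic per ufl.
have key a b (f1 f1' f2 f2' f3 f3' f4 f4' : R -> R) : tst a b f1 f1' -> tst a b f2 f2' ->
    tst a b f3 f3' -> tst a b f4 f4' ->
    li L4 (fun p => g iy p * tprod f1 f2 f3 f4 p) /\ \int[L4]_p (g iy p * tprod f1 f2 f3 f4 p) = 0.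
  move=> t1 t2 t3 t4; have [tp dp] := tprod_test t1 t2 t3 t4.
  have [tq _] := prod_test3 t1 t2 t3.
  have [mp md] := test4_meas tp.
  have [_ l2] := tst_li t4.
  have [n [C [_ HC]]] := test3_supp tq; have [mq _] := test3_meas tq.
  have l1 : li L3 (fun x => avg u x * (f1 x.1.1 * f2 x.1.2 * f3 x.2)).
    apply: (li_supp (C := C) ma mq a2 (li_ib3 R n) (@ib3_01 R n)) => x; by have [] := HC x.
  have [_ /(_ _ tp)] := w iy; rewrite !int4E => E.
  (* With [u] replaced by its average, the y-integral acts on [f4'] alone and vanishes. *)
  have Z : (\int[L4]_p (u p * pderiv (shift4 iy) (tprod f1 f2 f3 f4) p)%:E = 0)%E.
    have -> : (\int[L4]_p (u p * pderiv (shift4 iy) (tprod f1 f2 f3 f4) p)%:E =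
       \int[L4]_p (avg u p.1 * (f1 p.1.1.1 * f2 p.1.1.2 * f3 p.1.2) * f4' p.2)%:E)%E.
      apply: ae_eq_integral => //.
      - by apply/measurable_EFinP; apply: measurable_funM => //; exact: md.
      - by apply/measurable_EFinP; exact: li_meas (prod_li l1 l2).
      - by move: uE; apply: filterS => p -> _; rewrite dp /dprod /= /tprod !mulrA.
    rewrite RintE; last exact: prod_li l1 l2.
    by rewrite (Rint_prod l1 l2) (int_tst_deriv t4) mulr0.
  rewrite Z in E; have E0 : (\int[L4]_p (g iy p * tprod f1 f2 f3 f4 p)%:E = 0)%E.
    by apply/eqP; rewrite -oppe_eq0 -E.
  have l : li L4 (fun p => g iy p * tprod f1 f2 f3 f4 p).
    by apply: int0_li => //; apply: measurable_funM => //; exact: mg.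
  by split => //; rewrite /Rintegral E0.
have box (n : nat) : {ae L4, forall p,
    ((`](- n.+1%:R), n.+1%:R[%classic `*` `](- n.+1%:R), n.+1%:R[%classic `*`
      `](- n.+1%:R), n.+1%:R[%classic) `*` `](- n.+1%:R), n.+1%:R[%classic) p -> g iy p = 0}.
  pose a : R := - n.+1%:R; pose b : R := n.+1%:R.
  have ab : a < b by rewrite /a /b gtrN// ltr0n.
  have tb : tst a b (bmp a b) (dbmp a b).
    by split; [exact: C1_bmp|move=> t; exact: bmp_out].
  have [_ _ S] := sep_prod (sep_box ab ab ab) (sep1 ab).
  (* Separation needs an integrable function, and [g iy] on the box is not known to be one. It is
     applied to [g iy] times a product of bumps positive in the box; the bumps are absorbed into the
     test functions by [tstM]. *)
  have [l _] := key a b _ _ _ _ _ _ _ _ tb tb tb tb.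
  apply: (filterS _ (S _ l _)); first last.
    move=> i.
    have [_ e] := key a b _ _ _ _ _ _ _ _ (tstM tb (tst_fam a b i.1.1.1)) (tstM tb (tst_fam a b i.1.1.2))
      (tstM tb (tst_fam a b i.1.2)) (tstM tb (tst_fam a b i.2)).
    rewrite -[RHS]e; apply: eq_Rintegral => p _; rewrite /tprod; ring.
  move=> -[[[x1 x2] x3] y] h hp; have := h hp.
  move: hp; rewrite /= !in_itv/= => -[[[h1 h2] h3] h4] /eqP.
  rewrite mulf_eq0 => /orP[/eqP //|/eqP e]; exfalso; move: e; rewrite /tprod /=.
  apply/eqP; rewrite gt_eqF//.
  exact: mulr_gt0 (mulr_gt0 (mulr_gt0 (bmp_gt0 h1) (bmp_gt0 h2)) (bmp_gt0 h3)) (bmp_gt0 h4).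
have : {ae L4, forall p, forall n : nat,
    ((`](- n.+1%:R), n.+1%:R[%classic `*` `](- n.+1%:R), n.+1%:R[%classic `*`
      `](- n.+1%:R), n.+1%:R[%classic) `*` `](- n.+1%:R), n.+1%:R[%classic) p -> g iy p = 0}.
  exact: ae_countable.
apply: filterS => -[[[x1 x2] x3] y] h.
have [n1 hn1] := nat_gt_norm3 x1 x2 x3; have [n2 hn2] := nat_gt_norm3 y y y.
pose n := maxn n1 n2.
have [_ g1 g2' g3] := hn1 n.+1 (leqW (leq_maxl _ _)); have [_ g4 _ _] := hn2 n.+1 (leqW (leq_maxr _ _)).
by apply: (h n); rewrite /= !in_itv/=.
Qed.
End flatness.

(** * The variational problems and the threshold *)

Section variational.
Variable R : realType.
Local Notation L4 := (L4 R).
Local Notation L3 := (L3 R).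
Local Notation R3 := (R3 R).
Local Notation R4 := (R3R R).
Local Notation J f := (\int[L4]_p (f p * iT p.2)).
Local Notation K f := (2 * pi * \int[L3]_x (f x)).

Lemma sum4E (F : 'I_4 -> R) : \sum_(i < 4) F i = F o40 + F o41 + F o42 + F iy.
Proof.
rewrite !big_ord_recl big_ord0 addr0 !addrA.
by congr (F _ + F _ + F _ + F _); apply/val_inj.
Qed.

Lemma sum43E (F : 'I_4 -> R) : \sum_(i < 4 | (i < 3)%N) F i = F o40 + F o41 + F o42.
Proof. by rewrite big_mkcond sum4E /= addr0. Qed.

Lemma sum3E (F : 'I_3 -> R) : \sum_(i < 3) F i = F o30 + F o31 + F o32.
Proof.
rewrite !big_ord_recl big_ord0 addr0 !addrA.
by congr (F _ + F _ + F _); apply/val_inj.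
Qed.

Lemma J_add (f h : R4 -> R) : li L4 (fun p => f p * iT p.2) -> li L4 (fun p => h p * iT p.2) ->
  li L4 (fun p => (f p + h p) * iT p.2) /\ J (fun p => f p + h p) = J f + J h.
Proof.
move=> lf lh.
have E : (fun p => (f p + h p) * iT p.2) = (fun p => f p * iT p.2 + h p * iT p.2).
  by apply/funext => p; rewrite mulrDl.
by rewrite E; split; [exact: liD|rewrite RintegralD].
Qed.

Lemma intT_energy (u v : R4 -> R) gu gv : H1T u gu -> H1T v gv ->
  intT (fun p => \sum_(i < 4 | (i < 3)%N) (gu i p ^+ 2 + gv i p ^+ 2)) = (A3 gu + A3 gv)%:E /\
  intT (fun p => \sum_(i < 4) (gu i p ^+ 2 + gv i p ^+ 2)) = (A3 gu + A3 gv + (By gu + By gv))%:E.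
Proof.
move=> Hu Hv; have [_ mu' _ u2] := H1T_li Hu; have [_ mv _ v2] := H1T_li Hv.
have m i : measurable_fun setT (fun p => gu i p ^+ 2 + gv i p ^+ 2).
  by apply: measurable_funD; exact: measurable_funX.
have [l0 e0] := J_add (u2 o40) (v2 o40); have [l1 e1] := J_add (u2 o41) (v2 o41).
have [l2 e2] := J_add (u2 o42) (v2 o42); have [l3 e3] := J_add (u2 iy) (v2 iy).
have [l01 e01] := J_add l0 l1; have [l012 e012] := J_add l01 l2; have [l0123 e0123] := J_add l012 l3.
have m01 := measurable_funD (m o40) (m o41); have m012 := measurable_funD m01 (m o42).
have m0123 := measurable_funD m012 (m iy).
have E : (A3 gu + A3 gv) = J (fun p => gu o40 p ^+ 2 + gv o40 p ^+ 2 + (gu o41 p ^+ 2 + gv o41 p ^+ 2) +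
    (gu o42 p ^+ 2 + gv o42 p ^+ 2)).
  by rewrite e012 e01 e0 e1 e2 -addr_ACAC.
split.
  have -> : (fun p => \sum_(i < 4 | (i < 3)%N) (gu i p ^+ 2 + gv i p ^+ 2)) =
     (fun p => gu o40 p ^+ 2 + gv o40 p ^+ 2 + (gu o41 p ^+ 2 + gv o41 p ^+ 2) + (gu o42 p ^+ 2 + gv o42 p ^+ 2)).
    by apply/funext => p; rewrite (sum43E (fun i => gu i p ^+ 2 + gv i p ^+ 2)).
  by rewrite (intT_J m012 l012) E.
have -> : (fun p => \sum_(i < 4) (gu i p ^+ 2 + gv i p ^+ 2)) =
     (fun p => gu o40 p ^+ 2 + gv o40 p ^+ 2 + (gu o41 p ^+ 2 + gv o41 p ^+ 2) + (gu o42 p ^+ 2 + gv o42 p ^+ 2) +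
       (gu iy p ^+ 2 + gv iy p ^+ 2)).
  by apply/funext => p; rewrite (sum4E (fun i => gu i p ^+ 2 + gv i p ^+ 2)).
by rewrite (intT_J m0123 l0123) e0123 e3 E.
Qed.

Lemma PD_I (u v : R4 -> R) gu gv a a' A B N : PD u v gu gv a a' A B N ->
  Q_T u v gu gv = (A - 3 / 4 * N)%:E /\ I_T u v gu gv = (2^-1 * (A + B) - 4^-1 * N)%:E.
Proof.
move=> [[Hu Hv ua va qi] [AE BE NE]].
have [mu' _ _ _] := H1T_li Hu; have [mv _ _ _] := H1T_li Hv.
have [e3 e4] := intT_energy Hu Hv; have mq := measurable_quartic mu' mv.
by rewrite /Q_T /I_T e3 e4 (intT_J mq qi) AE BE NE.
Qed.

Lemma PD_in_V Th (u v : R4 -> R) gu gv A B : PD u v gu gv (Th ^+ 2) (Th ^+ 2) A B (4 / 3 * A) ->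
  in_V Th u v gu gv /\ I_T u v gu gv = (A / 6 + B / 2)%:E.
Proof.
move=> pd; have [q i] := PD_I pd; have [[Hu Hv ua va qi] _] := pd.
have [mu' _ u2 _] := H1T_li Hu; have [mv _ v2 _] := H1T_li Hv.
split; last by rewrite i; congr EFin; field.
split => //; split => //; split.
  by rewrite (intT_J (measurable_funX 2 mu') u2) ua.
split; first by rewrite (intT_J (measurable_funX 2 mv) v2) va.
by rewrite q; congr EFin; field.
Qed.

Lemma in_V_PD Th (u v : R4 -> R) gu gv : in_V Th u v gu gv -> exists A B,
  PD u v gu gv (Th ^+ 2) (Th ^+ 2) A B (4 / 3 * A) /\ I_T u v gu gv = (A / 6 + B / 2)%:E.
Proof.
move=> [Hu [Hv [ua [va Q0]]]].
have [mu' _ u2 _] := H1T_li Hu; have [mv _ v2 _] := H1T_li Hv.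
have mq := measurable_quartic mu' mv.
have [e3 e4] := intT_energy Hu Hv.
(* Finiteness of the quartic term comes from the constraint: the gradient part is finite, so an
   infinite quartic term would make [Q_T] infinite instead of zero. *)
have qi : li L4 (fun p => quartic (u p) (v p) * iT p.2).
  apply/intT_li => [//|p|]; first exact: quartic_ge0.
  by rewrite ltey; apply/eqP => qy; move: Q0; rewrite /Q_T e3 qy gt0_muley.
have uaR : J (fun p => u p ^+ 2) = Th ^+ 2.
  by move: ua; rewrite (intT_J (measurable_funX 2 mu') u2) => -[].
have vaR : J (fun p => v p ^+ 2) = Th ^+ 2.
  by move: va; rewrite (intT_J (measurable_funX 2 mv) v2) => -[].
pose A := A3 gu + A3 gv; pose B := By gu + By gv.
have pd0 : PD u v gu gv (Th ^+ 2) (Th ^+ 2) A B (J (fun p => quartic (u p) (v p))) by split; split.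
have [q _] := PD_I pd0.
have NE : J (fun p => quartic (u p) (v p)) = 4 / 3 * A.
  by move: Q0; rewrite q => -[] => h; move: h; move: (\int[L4]_p _) => N; lra.
exists A, B; rewrite NE in pd0; split => //.
by have [_ ->] := PD_in_V pd0.
Qed.

Lemma int3_K (f : R3 -> R) (a : R) : li L3 f -> (int3 f = (a / (2 * pi))%:E <-> K f = a).
Proof.
move=> fi; rewrite /int3 int3E RintE//; have p0 := pi2_gt0 R; split.
  by move=> [->]; rewrite mulrC mulfVK// gt_eqF.
by move=> <-; rewrite mulrAC mulfV ?mul1r// gt_eqF.
Qed.

Lemma int3_energy (u v : R3 -> R) gu gv : H1R3 u gu -> H1R3 v gv ->
  int3 (fun p => \sum_(i < 3) (gu i p ^+ 2 + gv i p ^+ 2)) = ((A3f gu + A3f gv) / (2 * pi))%:E.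
Proof.
move=> Hu Hv; have [_ mu' _ u2] := H1R3_li Hu; have [_ mv _ v2] := H1R3_li Hv.
have l i := liD (u2 i) (v2 i).
have -> : (fun p => \sum_(i < 3) (gu i p ^+ 2 + gv i p ^+ 2)) =
     (fun p => gu o30 p ^+ 2 + gv o30 p ^+ 2 + (gu o31 p ^+ 2 + gv o31 p ^+ 2) + (gu o32 p ^+ 2 + gv o32 p ^+ 2)).
  by apply/funext => p; rewrite (sum3E (fun i => gu i p ^+ 2 + gv i p ^+ 2)).
have l2 := liD (l o30) (l o31); have l3 := liD l2 (l o32).
apply/(int3_K _ l3); rewrite RintegralD// RintegralD// !RintegralD// /A3f.
rewrite !mulrDr; exact: addr_ACAC.
Qed.

Lemma PF_I (u v : R3 -> R) gu gv a a' A N : PF u v gu gv a a' A N ->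
  Q_R3 u v gu gv = ((A - 3 / 4 * N) / (2 * pi))%:E /\
  I_R3 u v gu gv = ((2^-1 * A - 4^-1 * N) / (2 * pi))%:E.
Proof.
move=> [[Hu Hv ua va qi] [AE NE]].
have qE := (int3_K N qi).2 NE.
rewrite /Q_R3 /I_R3 (int3_energy Hu Hv) qE AE; split;
  by rewrite -!EFinM -EFinB mulrBl !mulrA.
Qed.

Lemma rho2 (Th : R) : (Th / Num.sqrt (2 * pi)) ^+ 2 = Th ^+ 2 / (2 * pi).
Proof. by rewrite exprMn exprVn sqr_sqrtr// ltW// pi2_gt0. Qed.

Definition hatset (rho : R) : set (\bar R) := [set r | exists u v gu gv,
    H1R3 u gu /\ H1R3 v gv /\
    int3 (fun p => (u p ^+ 2)%R) = (rho ^+ 2)%:E /\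
    int3 (fun p => (v p ^+ 2)%R) = (rho ^+ 2)%:E /\
    Q_R3 u v gu gv = 0%E /\ r = I_R3 u v gu gv].

(** Mass [Th / sqrt(2 pi)] on R^3 is mass [Th] for the lift to R^3 x T. The remaining factor [2 pi]
    is the ratio of the two energies. *)
Lemma hatset_E0 (Th : R) (r : \bar R) : hatset (Th / Num.sqrt (2 * pi)) r <->
  exists2 A, E0set Th A & r = (A / 6 / (2 * pi))%:E.
Proof.
have p0 := pi2_gt0 R; have pn : 2 * pi != 0 :> R by rewrite gt_eqF.
split.
  move=> [u [v [gu [gv [Hu [Hv [ua [va [Q0 ->]]]]]]]]].
  have [mu' mgu u2 gu2] := H1R3_li Hu; have [mv mgv v2 gv2] := H1R3_li Hv.
  have mq := measurable_quartic mu' mv.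
  rewrite rho2 in ua va; move/(int3_K _ u2) in ua; move/(int3_K _ v2) in va.
  have qi : li L3 (fun p => quartic (u p) (v p)).
    apply/li_ge0P => [//|p|]; first exact: quartic_ge0.
    rewrite -int3E -/(int3 _) ltey; apply/eqP => qy; move: Q0.
    by rewrite /Q_R3 (int3_energy Hu Hv) qy gt0_muley.
  pose A := A3f gu + A3f gv.
  have pf0 : PF u v gu gv (Th ^+ 2) (Th ^+ 2) A (K (fun p => quartic (u p) (v p))) by split; split.
  have [q _] := PF_I pf0.
  have NE : K (fun p => quartic (u p) (v p)) = 4 / 3 * A.
    move: Q0; rewrite q => -[] /eqP; rewrite mulf_eq0 invr_eq0 (negbTE pn) orbF => /eqP.
    by move: (_ * \int[L3]_x _) => N; lra.
  rewrite NE in pf0; exists A; first by exists u, v, gu, gv.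
  by have [_ ->] := PF_I pf0; congr EFin; congr (_ / _); field.
move=> [A [u [v [gu [gv pf]]]] ->]; exists u, v, gu, gv.
have [q i] := PF_I pf; have [[Hu Hv ua va qi] _] := pf.
have [mu' mgu u2 gu2] := H1R3_li Hu; have [mv mgv v2 gv2] := H1R3_li Hv.
split => //; split => //; rewrite rho2; split; first exact/(int3_K _ u2).
split; first exact/(int3_K _ v2).
split; first by rewrite q; have -> : A - 3 / 4 * (4 / 3 * A) = 0 by [field]; rewrite mul0r.
by rewrite i; congr EFin; congr (_ / _); field.
Qed.

Lemma Eset_B (A B : R) : Eset 1 A B -> 0 <= B.
Proof. by move=> [u [v [gu [gv [_ [_ <- _]]]]]]; rewrite addr_ge0// By_ge0. Qed.

Lemma Eset_to1 (Th A B : R) : 0 < Th -> Eset Th A B -> Eset 1 (Th ^+ 2 * A) (Th ^- 2 * B).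
Proof.
move=> T0 H; have Ti : 0 < Th^-1 by rewrite invr_gt0.
have := Eset_scale Ti H; rewrite mulVf ?gt_eqF// exprVn invrK.
by [].
Qed.

Lemma Eset_of1 (Th A B : R) : 0 < Th -> Eset 1 A B -> Eset Th (Th ^- 2 * A) (Th ^+ 2 * B).
Proof. by move=> T0 H; have := Eset_scale T0 H; rewrite mulr1. Qed.

Definition alpha : R := inf [set A | @E0set R 1 A].

Let lowb : lbound [set A | @E0set R 1 A] (9 * gn_const R)^-1.
Proof.
move=> A /E0set_Eset[u [v [gu [gv]]]]; rewrite expr1n => /PD_lower[_].
have C0 : 0 < 9 * gn_const R by rewrite mulr_gt0// gn_const_gt0.
by rewrite addr0 mulr1 -ler_pdivrMl// mulr1.
Qed.

Let hasinf : has_inf [set A | @E0set R 1 A].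
Proof. by split; [exact: E0set_nonempty|exists (9 * gn_const R)^-1; exact: lowb]. Qed.

Lemma alpha_gt0 : 0 < alpha.
Proof.
have C0 : 0 < (9 * gn_const R)^-1 by rewrite invr_gt0 mulr_gt0// gn_const_gt0.
by apply: lt_le_trans C0 _; apply: lb_le_inf; [exact: E0set_nonempty|exact: lowb].
Qed.

Lemma alpha_le A : @E0set R 1 A -> alpha <= A.
Proof. by move=> h; apply: ge_inf => //; exists (9 * gn_const R)^-1; exact: lowb. Qed.

Lemma alpha_approx (e : R) : 0 < e -> exists2 A, @E0set R 1 A & A < alpha + e.
Proof. by move=> e0; have [A h1 h2] := inf_adherent e0 hasinf; exists A. Qed.

Lemma mhatE (Th : R) : 0 < Th ->
  ((2 * pi)%:E * mhat (Th / Num.sqrt (2 * pi)) = (alpha / (6 * Th ^+ 2))%:E)%E.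
Proof.
move=> T0; have p0 := pi2_gt0 R.
have Tn : Th != 0 by rewrite gt_eqF.
have T2 : 0 < Th ^+ 2 by rewrite exprn_gt0.
suff -> : mhat (Th / Num.sqrt (2 * pi)) = (alpha / (6 * Th ^+ 2) / (2 * pi))%:E.
  by rewrite -EFinM; congr EFin; rewrite mulrC divfK// gt_eqF.
rewrite /mhat -/(hatset _); apply/eqP; rewrite eq_le; apply/andP; split.
  apply/lee_addgt0Pr => e; move: (e : R) => {}e e0.
  have e'0 : 0 < e * (6 * (2 * pi)) * Th ^+ 2 by rewrite !mulr_gt0 ?pi_gt0.
  have [A1 hA1 hlt] := alpha_approx e'0.
  have h := E0set_scale T0 hA1; rewrite mulr1 in h.
  apply: (@le_trans _ _ (Th ^- 2 * A1 / 6 / (2 * pi))%:E).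
    by apply: ereal_inf_lbound; apply/hatset_E0; exists (Th ^- 2 * A1).
  rewrite -EFinD lee_fin.
  have -> : alpha / (6 * Th ^+ 2) / (2 * pi) + e =
     (alpha + e * (6 * (2 * pi)) * Th ^+ 2) / (6 * Th ^+ 2 * (2 * pi)) by move: (2 * pi) (lt0r_neq0 p0) => q qn; field; rewrite ?Tn ?qn.
  have -> : Th ^- 2 * A1 / 6 / (2 * pi) = A1 / (6 * Th ^+ 2 * (2 * pi)) by move: (2 * pi) (lt0r_neq0 p0) => q qn; field; rewrite ?Tn ?qn.
  by rewrite ler_pM2r ?ltW// invr_gt0 !mulr_gt0 ?pi_gt0.
apply: le_ereal_inf_tmp => r /hatset_E0[A hA ->]; rewrite lee_fin.
have Ti : 0 < Th^-1 by rewrite invr_gt0.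
have := E0set_scale Ti hA; rewrite mulVf// exprVn invrK => /alpha_le h.
rewrite ler_pM2r ?invr_gt0// ler_pdivrMr ?mulr_gt0//.
have -> : A / 6 * (6 * Th ^+ 2) = Th ^+ 2 * A by field.
exact: h.
Qed.

Lemma mT_lb (Th : R) : 0 < Th -> (forall A B, Eset 1 A B -> alpha <= A + 3 * Th ^+ 4 * B) ->
  ((alpha / (6 * Th ^+ 2))%:E <= m_T Th)%E.
Proof.
move=> T0 H; have Tn : Th != 0 by rewrite gt_eqF.
have T2 : 0 < Th ^+ 2 by rewrite exprn_gt0.
apply: le_ereal_inf_tmp => r [u [v [gu [gv [/in_V_PD[A [B [pd rE]]] ->]]]]]; rewrite rE.
have hE : Eset Th A B by exists u, v, gu, gv.
have := H _ _ (Eset_to1 T0 hE).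
have -> : 3 * Th ^+ 4 * (Th ^- 2 * B) = 3 * (Th ^+ 2 * B) by field.
rewrite lee_fin ler_pdivrMr ?mulr_gt0// => h; apply: le_trans h _.
by rewrite le_eqVlt; apply/orP; left; apply/eqP; field.
Qed.

Lemma mT_ub (Th A B : R) : 0 < Th -> Eset 1 A B ->
  (m_T Th <= ((A + 3 * Th ^+ 4 * B) / (6 * Th ^+ 2))%:E)%E.
Proof.
move=> T0 /(Eset_of1 T0)[u [v [gu [gv pd]]]]; have [iv ie] := PD_in_V pd.
have Tn : Th != 0 by rewrite gt_eqF.
have -> : (A + 3 * Th ^+ 4 * B) / (6 * Th ^+ 2) = Th ^- 2 * A / 6 + Th ^+ 2 * B / 2 by field.
by apply: ereal_inf_lbound; exists u, v, gu, gv; rewrite ie.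
Qed.

Lemma mT_ub_flat (Th : R) : 0 < Th -> (m_T Th <= (alpha / (6 * Th ^+ 2))%:E)%E.
Proof.
move=> T0; have T2 : 0 < 6 * Th ^+ 2 by rewrite mulr_gt0// exprn_gt0.
apply/lee_addgt0Pr => e; move: (e : R) => {}e e0.
have [A h1 h2] := alpha_approx (mulr_gt0 e0 T2).
apply: le_trans (mT_ub T0 (E0set_Eset h1)) _; rewrite mulr0 addr0 -EFinD lee_fin.
have -> : alpha / (6 * Th ^+ 2) + e = (alpha + e * (6 * Th ^+ 2)) / (6 * Th ^+ 2).
  by field; rewrite gt_eqF.
by rewrite ler_pM2r ?ltW// invr_gt0.
Qed.

Lemma gy_ae0_By0 (g : 'I_4 -> R4 -> R) : measurable_fun setT (g iy) ->
  {ae L4, forall p, g iy p = 0} -> By g = 0.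
Proof.
move=> mg h; rewrite -(@Rint_eq0 _ _ _ L4 (fun=> 0) (fun=> erefl)); apply: Rint_ae => //.
  by apply: measurable_funM; [exact: measurable_funX|exact: m_iT2].
by move: h; apply: filterS => p ->; rewrite expr0n mul0r.
Qed.

Lemma threshold : exists2 Lam : R, 0 < Lam &
  (forall lam, lam < Lam -> 0 < lam -> exists A B, Eset 1 A B /\ A + 3 * lam * B < alpha) /\
  (forall lam, Lam < lam -> forall A B, Eset 1 A B -> alpha <= A + 3 * lam * B).
Proof.
have a0 := alpha_gt0; have [lam0 l0 H0] := Eset_penalized_lower a0 alpha_le.
pose L := [set lam : R | exists A B, Eset 1 A B /\ A + 3 * lam * B < alpha].
have ubL : ubound L lam0.
  move=> lam [A [B [hE hlt]]]; rewrite leNgt; apply/negP => hl.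
  have := H0 A B hE; rewrite leNgt => /negP; apply; apply: le_lt_trans hlt.
  by rewrite lerD2l ler_wpM2r ?(Eset_B hE)// ler_pM2l// ltW.
have [A1 [B1 [hE1 hA1 hB1]]] := Eset_small_A (divr_gt0 a0 (ltr0n R 2)).
(* Small enough that [3 l1 B1 < alpha / 2], while [A1] is already below [alpha / 2]. *)
pose l1 := alpha / 2 / (3 * B1 + 1).
have d1 : 0 < 3 * B1 + 1 by rewrite ltr_wpDl// mulr_ge0.
have l10 : 0 < l1 by rewrite !divr_gt0.
have Ll1 : L l1.
  exists A1, B1; split => //.
  have e : l1 * (3 * B1 + 1) = alpha / 2 by rewrite /l1 mulfVK// gt_eqF.
  have -> : 3 * l1 * B1 = l1 * (3 * B1 + 1) - l1 by ring.
  rewrite e; lra.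
have hs : has_sup L by split; [exists l1|exists lam0].
exists (sup L); first by apply: lt_le_trans l10 _; exact: ub_le_sup (ex_intro _ lam0 ubL) _ Ll1.
split.
  move=> lam hlt lp; have hp : 0 < sup L - lam by rewrite subr_gt0.
  have [l2 [A [B [hE hl2]]] h] := sup_adherent hp hs.
  exists A, B; split => //; apply: le_lt_trans hl2.
  rewrite lerD2l ler_wpM2r ?(Eset_B hE)// ler_pM2l//; rewrite opprB addrC subrK in h; exact: ltW.
move=> lam hlt A B hE; rewrite leNgt; apply/negP => h.
have : lam <= sup L by apply: (ub_le_sup (ex_intro _ lam0 ubL)); exists A, B.
by rewrite leNgt hlt.
Qed.
End variational.

Theorem theorem1p2 (R : realType) :
  exists Th0 : R, 0 < Th0 /\
  (forall Th : R, 0 < Th < Th0 ->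
     (m_T Th < (2 * pi)%:E * mhat (Th / Num.sqrt (2 * pi)))%E /\
     forall u v gu gv, minimizer Th u v gu gv ->
       ~ ({ae (@leb4 R), forall p, gu iy p = 0} /\
          {ae (@leb4 R), forall p, gv iy p = 0})) /\
  (forall Th : R, Th0 < Th ->
     m_T Th = ((2 * pi)%:E * mhat (Th / Num.sqrt (2 * pi)))%E /\
     forall u v gu gv, minimizer Th u v gu gv ->
       {ae (@leb4 R), forall p, gu iy p = 0} /\
       {ae (@leb4 R), forall p, gv iy p = 0}).
Proof.
have [Lam L0 [H1 H2]] := threshold R; have a0 := alpha_gt0 R.
have [lam0 l0 H0] := Eset_penalized_lower a0 (@alpha_le R).
pose Th0 : R := Num.sqrt (Num.sqrt Lam).
have T40 : Th0 ^+ 4 = Lam.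
  by rewrite (exprM _ 2 2) sqr_sqrtr ?sqrtr_ge0// sqr_sqrtr// ltW.
have T00 : 0 < Th0 by rewrite !sqrtr_gt0.
exists Th0; split => //; split.
  move=> Th /andP[T0 TT0].
  have TL : Th ^+ 4 < Lam by rewrite -T40 ltr_pXn2r// nnegrE ltW.
  have T2 : 0 < 6 * Th ^+ 2 by rewrite mulr_gt0// exprn_gt0.
  have lt : (m_T Th < (alpha R / (6 * Th ^+ 2))%:E)%E.
    have [A [B [hE hlt]]] := H1 _ TL (exprn_gt0 4 T0).
    by apply: le_lt_trans (mT_ub T0 hE) _; rewrite lte_fin ltr_pM2r// invr_gt0.
  rewrite mhatE//; split => // u v gu gv [iv im] [/ae4E gu0 /ae4E gv0].
  have [A [B [pd ie]]] := in_V_PD iv.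
  have [[Hu Hv _ _ _] [_ BE _]] := pd.
  have [_ mgu _ _] := H1T_li Hu; have [_ mgv _ _] := H1T_li Hv.
  have B0 : B = 0 by rewrite -BE (gy_ae0_By0 (mgu iy) gu0) (gy_ae0_By0 (mgv iy) gv0) addr0.
  have hE : Eset Th A B by exists u, v, gu, gv.
  (* At B = 0 the penalized bound says that the x-energy rescaled to mass one is at least [alpha].
     The pair itself need not be identified with one on R^3. *)
  have := H0 _ _ (Eset_to1 T0 hE); rewrite B0 !mulr0 addr0 => h.
  move: lt; rewrite -im ie B0 mul0r addr0 lte_fin ltNge => /negP; apply.
  rewrite ler_pdivrMr//; apply: le_trans h _.
  by rewrite le_eqVlt; apply/orP; left; apply/eqP; field.
move=> Th TT0; have T0 := lt_trans T00 TT0.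
have Tn : Th != 0 by rewrite gt_eqF.
have TL : Lam < Th ^+ 4 by rewrite -T40 ltr_pXn2r// nnegrE ltW.
have T2 : 0 < Th ^+ 2 by rewrite exprn_gt0.
have mE : m_T Th = (alpha R / (6 * Th ^+ 2))%:E.
  by apply/eqP; rewrite eq_le mT_ub_flat//= mT_lb//; exact: H2.
rewrite mhatE//; split => // u v gu gv [iv im].
have [A [B [pd ie]]] := in_V_PD iv.
have [[Hu Hv _ _ _] [_ BE _]] := pd.
have hE : Eset Th A B by exists u, v, gu, gv.
have hE1 := Eset_to1 T0 hE.
(* The lower bound [alpha] still holds at this smaller parameter, while the minimizer attains
   [alpha] at [Th ^+ 4]; comparing the two leaves no room for a positive y-energy. *)
pose lam := (Th ^+ 4 + Lam) / 2.
have lL : Lam < lam by rewrite /lam; lra.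
have lT : lam < Th ^+ 4 by rewrite /lam; lra.
have h := H2 lam lL _ _ hE1; have B10 := Eset_B hE1.
have e : alpha R = Th ^+ 2 * A + 3 * Th ^+ 4 * (Th ^- 2 * B).
  move: im; rewrite ie mE => -[] /(congr1 (fun z => z * (6 * Th ^+ 2))).
  rewrite divfK; last by rewrite gt_eqF// mulr_gt0.
  by move=> <-; field.
have B1 : Th ^- 2 * B = 0.
  rewrite e lerD2l in h; apply/eqP; rewrite eq_le B10 andbT leNgt; apply/negP => bp.
  by move: h; rewrite ler_pM2r// ler_pM2l// leNgt lT.
have B0 : B = 0 by move/eqP: B1; rewrite mulf_eq0 invr_eq0 expf_eq0/= (negbTE Tn) => /eqP.
have := By_ge0 gu; have := By_ge0 gv; rewrite B0 in BE => b1 b2.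
split; apply/ae4E; [apply: (By0_gy_ae0 Hu)|apply: (By0_gy_ae0 Hv)]; lra.
Qed.
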